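(* Let $\Omega\subset\mathbb{R}^n$ be a domain, $0<T<\infty$, $1<p<p_S$, $\alpha=1/(p-1)$. Let $f:[0,\infty)\to[0,\infty)$ be of class $C^1$ with $\lim_{s\to\infty}s^{-p}f(s)=1$ and $|f'(s)|\le C(1+s^{p-1})$ for all $s\ge 0$ and some constant $C>0$. Let $V:\overline\Omega\to[0,\infty)$ be Hölder continuous. Let $\omega\subset\subset D\subset\subset\Omega$ and assume that $V(x)\ge c_0$ in $D$ for some $c_0>0$. Let $u$ be a nonnegative classical solution of $$u_t=\Delta u+V(x)f(u),\qquad 0<t<T,\ x\in\Omega,$$ such that $$u(t,x)\le M(T-t)^{-\alpha}\quad\text{in }(T/4,T)\times D$$ for some $M>0$. Then for each $\varepsilon>0$ there exists a constant $C_\varepsilon>0$ such that $$|u_t-V(x)f(u)|\le\varepsilon u^p+C_\varepsilon\quad\text{in }[T/2,T)\times\omega.$$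
   Context: $p_S=(n+2)/(n-2)_+$, i.e. $p_S=\infty$ if $n\le 2$ and $p_S=(n+2)/(n-2)$ if $n\ge3$. For open sets, $A\subset\subset B$ means that $\overline A$ is compact and contained in $B$. A classical solution is a function that is $C^1$ in $t$ and $C^2$ in $x$ on $(0,T)\times\Omega$ and satisfies the equation pointwise; no boundary conditions are imposed. *)

(* Defs.v *)
From HB Require Import structures.
From mathcomp Require Import all_boot all_order all_algebra.
From mathcomp Require Import all_classical all_reals all_analysis.
Set Implicit Arguments.
Unset Strict Implicit.
Unset Printing Implicit Defensive.
Import Order.TTheory GRing.Theory Num.Theory.
Import numFieldNormedType.Exports.
Local Open Scope classical_set_scope.
Local Open Scope ring_scope.

(* The subtraction n - 2 in nat is only used for n >= 3. *)
Definition sobolev_exponent (R : realType) (n : nat) : \bar R :=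
  if (n <= 2)%N then +oo%E else ((n + 2)%:R / (n - 2)%:R)%:E.

Definition domain (R : realType) (n : nat) (Omega : set 'rV[R]_n) : Prop :=
  [/\ open Omega, connected Omega & Omega !=set0].

Definition compactly_included (T : topologicalType) (A B : set T) : Prop :=
  compact (closure A) /\ closure A `<=` B.

(* Difference quotients are restricted to arguments in [0, +oo[, so this is
   the usual derivative at s > 0 and the right derivative at s = 0. *)
Definition diff_quotient_nneg (R : realType) (f : R -> R) (s h : R) : R :=
  h^-1 * (f (s + h) - f s).

Definition derivable_nneg (R : realType) (f : R -> R) (s : R) : Prop :=
  cvg (diff_quotient_nneg f s h @[h --> within [set h | 0 <= s + h] 0^']).

Definition derive_nneg (R : realType) (f : R -> R) (s : R) : R :=
  lim (diff_quotient_nneg f s h @[h --> within [set h | 0 <= s + h] 0^']).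

Definition C1_nneg (R : realType) (f : R -> R) : Prop :=
  (forall s, 0 <= s -> derivable_nneg f s) /\
  {within `[0, +oo[, continuous (derive_nneg f)}.

(* `|x - y| is the sup norm on 'rV[R]_n; replacing it by the Euclidean norm
   only changes the constant L. *)
Definition hoelder_continuous_on (R : realType) (n : nat)
    (A : set 'rV[R]_n) (V : 'rV[R]_n -> R) : Prop :=
  exists gamma L : R, [/\ 0 < gamma, gamma <= 1, 0 <= L &
    forall x y, A x -> A y -> `|V x - V y| <= L * `|x - y| `^ gamma].

Definition evec (R : realType) (n : nat) (i : 'I_n) : 'rV[R]_n :=
  delta_mx ord0 i.

Definition partial (R : realType) (n : nat) (i : 'I_n) (w : 'rV[R]_n -> R) :
  'rV[R]_n -> R := fun x => 'D_(evec R i) w x.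

Definition laplacian (R : realType) (n : nat) (w : 'rV[R]_n -> R)
    (x : 'rV[R]_n) : R :=
  \sum_(i < n) partial i (partial i w) x.

Definition time_derivative (R : realType) (n : nat) (u : R -> 'rV[R]_n -> R)
    (t : R) (x : 'rV[R]_n) : R :=
  derive1 (fun s => u s x) t.

Definition continuous_on_cylinder (R : realType) (n : nat) (T : R)
    (Omega : set 'rV[R]_n) (w : R -> 'rV[R]_n -> R) : Prop :=
  forall z : R * 'rV[R]_n, (`]0, T[ `*` Omega) z ->
    {for z, continuous (fun z : R * 'rV[R]_n => w z.1 z.2)}.

(* The space C^{1,2}: the derivatives u_t, D_x u, D_x^2 u exist and are jointly
   continuous in (t, x). *)
Definition C12_on_cylinder (R : realType) (n : nat) (T : R)
    (Omega : set 'rV[R]_n) (u : R -> 'rV[R]_n -> R) : Prop :=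
  [/\ forall t x, 0 < t < T -> Omega x ->
        [/\ derivable (fun s => u s x) t 1,
            forall i, derivable (u t) x (evec R i) &
            forall i j, derivable (partial i (u t)) x (evec R j)],
      continuous_on_cylinder T Omega u,
      continuous_on_cylinder T Omega (time_derivative u),
      forall i, continuous_on_cylinder T Omega (fun t => partial i (u t)) &
      forall i j,
        continuous_on_cylinder T Omega (fun t => partial j (partial i (u t)))].

Definition classical_solution (R : realType) (n : nat) (T : R)
    (Omega : set 'rV[R]_n) (V : 'rV[R]_n -> R) (f : R -> R)
    (u : R -> 'rV[R]_n -> R) : Prop :=
  C12_on_cylinder T Omega u /\
  forall t x, 0 < t < T -> Omega x ->
    time_derivative u t x = laplacian (u t) x + V x * f (u t x).

(* Main.v *)
Require Import Defs.
From HB Require Import structures.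
From mathcomp Require Import all_boot all_order all_algebra.
From mathcomp Require Import all_classical all_reals all_analysis.
From mathcomp Require Import ring lra.
Set Implicit Arguments.
Unset Strict Implicit.
Unset Printing Implicit Defensive.
Import Order.TTheory GRing.Theory Num.Theory.
Import numFieldNormedType.Exports.
Local Open Scope classical_set_scope.
Local Open Scope ring_scope.

(* By contradiction and rescaling: with mu_j = max(u, j^(1/p)) at bad points, the rescaled solutions
   converge to an ancient solution U of U_t = Laplace U + U^p with a type I bound.  For the Gaussian
   mean, the monotone self-similar energy and Pohozaev's identity show that U flattens as t -> -oo.
   The maximum principle for tr (S D^2 U) + B U^p, at a nearly maximal |t| in a parabolic cone, then
   makes U(t, .) constant.  Barriers carry the bounds on u_j up to the bad time, so that D^2 u_j -> 0
   there, against |Laplace u| > eps u^p + j. *)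

(* [lra] is slow in large contexts: clear all propositions except [l] and the section hypotheses [S]. *)
Ltac lra_in S := repeat match goal with H : ?T |- _ => lazymatch type of T with
  Prop => lazymatch S with context [H] => fail | _ => clear H end end end; lra.
Tactic Notation "sra" hyp_list(l) := revert l; lra_in tt.

(** Integrals against the heat kernel are replaced by one positive functional, a limit of random
    walks along a fixed ultrafilter. Stein's identity for it suffices: Duhamel's formula weighted by
    Hermite polynomials of degree 0, 1, 2 gives the strong maximum principle, interior gradient
    bounds and Schauder-type Hessian bounds, hence compactness. The same ultrafilter serves for all
    limits, so no subsequence is extracted. In S = s^T s + A I the rank one part singles out a
    direction; the multiple of the identity produces in the equation for tr (S D^2 U) a positive
    multiple of A U^(p-2) |grad U|^2, which absorbs the negative gradient term created by B U^p. For
    A = 1/(2n), nonnegativity for all unit s still makes a function bounded above constant, by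
    comparison with |x - a|^(1/2). The obstacle at the end is that the rescaled time tau_j from the
    bad time to the final time may tend to 0: the type I bound then degenerates at the bad time, and
    compactness covers earlier times only. Hence the barriers, used both in the final contradiction
    and in the proof that U(t, .) is constant. *)

Section NormBounds.
Context {R : numDomainType} {W : normedZmodType R}.
Implicit Types (x y : W) (e : R).

Lemma le_normD x y e : `|x| + `|y| <= e -> `|x + y| <= e.
Proof. exact: le_trans (ler_normD x y). Qed.

Lemma lt_normD x y e : `|x| + `|y| < e -> `|x + y| < e.
Proof. exact: le_lt_trans (ler_normD x y). Qed.

Lemma le_normB x y e : `|x| + `|y| <= e -> `|x - y| <= e.
Proof. exact: le_trans (ler_normB x y). Qed.

Lemma le_norm_sum (I : Type) (r : seq I) (F : I -> W) e :
  \sum_(i <- r) `|F i| <= e -> `|\sum_(i <- r) F i| <= e.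
Proof. exact: le_trans (ler_norm_sum _ _ _). Qed.

End NormBounds.

Lemma powRDp (R : realType) (a : R) (a0 : 0 < a) (q r : R) : a `^ (q + r) = a `^ q * a `^ r.
Proof. by rewrite powRD // (gt_eqF a0) implybT. Qed.

(** * Limits of sequences along a free ultrafilter *)

Section UltraLimit.

Lemma uf_exists : exists G : set_system nat, UltraFilter G /\ \oo `<=` G.
Proof. exact: ultraFilterLemma. Qed.

(** Every bounded sequence converges along this ultrafilter, so it replaces extraction of
    subsequences and diagonal arguments: all limits below are taken along the same [uf], and
    finitely many conditions are intersected by [evI]. *)
Definition uf : set_system nat := sval (cid uf_exists).

Lemma uf_ultra : UltraFilter uf.
Proof. by rewrite /uf; case: (cid uf_exists) => G /= []. Qed.

Lemma uf_oo : \oo `<=` uf.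
Proof. by rewrite /uf; case: (cid uf_exists) => G /= []. Qed.

Definition ev (P : nat -> Prop) : Prop := uf [set k | P k].

Lemma evS (P Q : nat -> Prop) : (forall k, P k -> Q k) -> ev P -> ev Q.
Proof. by move=> PQ; apply: (@filterS _ uf (@ultra_proper _ _ uf_ultra)). Qed.

Lemma evI (P Q : nat -> Prop) : ev P -> ev Q -> ev (fun k => P k /\ Q k).
Proof. by move=> p q; apply: (@filterI _ uf (@ultra_proper _ _ uf_ultra)). Qed.

Lemma evE (P : nat -> Prop) : (forall k, P k) -> ev P.
Proof.
by move=> p; apply: (evS (fun k _ => p k));
  exact: (@filterT _ uf (@ultra_proper _ _ uf_ultra)).
Qed.

Lemma ev_ex (P : nat -> Prop) : ev P -> exists k, P k.
Proof. by move=> p; apply: (@filter_ex _ uf (@ultra_proper _ _ uf_ultra)). Qed.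

(** Maximality of the ultrafilter. Compactness proofs by contradiction and the alternative between
    large and small values of a sequence rest on this. *)
Lemma ev_not (P : nat -> Prop) : ~ ev P -> ev (fun k => ~ P k).
Proof.
by move=> nP; case: (in_ultra_setVsetC [set k | P k] uf_ultra).
Qed.

Lemma ev_ge (N : nat) : ev (fun k => (N <= k)%N).
Proof. by apply: uf_oo; exists N. Qed.

Lemma ev2 (P Q S : nat -> Prop) :
  (forall k, P k -> Q k -> S k) -> ev P -> ev Q -> ev S.
Proof. by move=> h p q; apply: evS (evI p q) => k []; exact: h. Qed.

Lemma ev_fin (I : finType) (P : I -> nat -> Prop) :
  (forall i, ev (P i)) -> ev (fun k => forall i, P i k).
Proof.
move=> h.
suff: ev (fun k => forall i, i \in enum I -> P i k).
  by apply: evS => k hk i; apply: hk; rewrite mem_enum.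
elim: (enum I) => [|a s ih]; first exact: evE.
apply: ev2 (h a) ih => k pa ps i; rewrite inE => /orP[/eqP->//|]; exact: ps.
Qed.

Context {R : realType}.
Implicit Types (u v : nat -> R) (l m : R).

Definition ucv u l := forall e, 0 < e -> ev (fun k => `|u k - l| < e).

(** The image ultrafilter on the compact segment [-C, C] has a cluster point. It is a limit, since
    otherwise the complement of some ball around it would belong to the ultrafilter and miss that
    ball. *)
Lemma ucv_ex u (C : R) : ev (fun k => `|u k| <= C) -> exists l, ucv u l.
Proof.
move=> hb.
have puf := @ultra_proper _ _ uf_ultra.
have [|l [_ hl]] := @segment_compact R (- C) C (u @ uf) (fmap_proper_filter u puf).
  by apply: evS hb => k /=; rewrite in_itv /= ler_norml.
exists l => e e0; case: (pselect (ev (fun k => `|u k - l| < e))) => // /ev_not hn.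
have [|r [/= h1 h2]] := hl [set r | ~ `|r - l| < e] (ball l e) _ (nbhsx_ballx l e e0).
  exact: hn.
by case: h1; move: h2; rewrite /ball /= distrC.
Qed.

Lemma ucv_cst l : ucv (fun=> l) l.
Proof. by move=> e e0; apply: evE => k; rewrite subrr normr0. Qed.

Lemma ucv_ext u v l : ev (fun k => u k = v k) -> ucv u l -> ucv v l.
Proof. by move=> h hu e e0; apply: ev2 h (hu e e0) => k ->. Qed.

Lemma ucv_le u v l m : ucv u l -> ucv v m -> ev (fun k => u k <= v k) -> l <= m.
Proof.
move=> hu hv huv; rewrite leNgt; apply/negP => ml.
have e0 : 0 < (l - m) / 2 by lra.
have [k [[h1 h2] h3]] := ev_ex (evI (evI (hu _ e0) (hv _ e0)) huv).
by move: h1 h2; rewrite !ltr_norml => /andP[? ?] /andP[? ?]; lra.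
Qed.

Lemma ucv_lel u l m : ucv u l -> ev (fun k => u k <= m) -> l <= m.
Proof. by move=> hu; apply: ucv_le hu (ucv_cst m). Qed.

Lemma ucv_ler u l m : ucv u l -> ev (fun k => m <= u k) -> m <= l.
Proof. by move=> hu; apply: ucv_le (ucv_cst m) hu. Qed.

Lemma ucv_uniq u l m : ucv u l -> ucv u m -> l = m.
Proof.
move=> h1 h2; apply/eqP; rewrite eq_le; apply/andP; split.
- by apply: ucv_le h1 h2 _; apply: evE.
- by apply: ucv_le h2 h1 _; apply: evE.
Qed.

Lemma ucvD u v l m : ucv u l -> ucv v m -> ucv (fun k => u k + v k) (l + m).
Proof.
move=> hu hv e e0; have e2 : 0 < e / 2 by lra.
apply: ev2 (hu _ e2) (hv _ e2) => k.
by rewrite !ltr_norml => /andP[? ?] /andP[? ?]; apply/andP; split; lra.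
Qed.

Definition ctsat (f : R -> R) (x : R) :=
  forall e, 0 < e -> exists2 d, 0 < d & forall y, `|y - x| < d -> `|f y - f x| < e.

Lemma ucvZ u l (c : R) : ucv u l -> ucv (fun k => c * u k) (c * l).
Proof.
move=> hu e e0.
apply: evS (hu (e / (`|c| + 1)) _) => [k|]; last exact: divr_gt0.
rewrite ltr_pdivlMr // => h; rewrite -mulrBr normrM.
have := normr_ge0 (u k - l); nra.
Qed.

Lemma ucvN u l : ucv u l -> ucv (fun k => - u k) (- l).
Proof.
by move=> hu e e0; apply: evS (hu e e0) => k; rewrite -opprD normrN.
Qed.

Lemma ucvB u v l m : ucv u l -> ucv v m -> ucv (fun k => u k - v k) (l - m).
Proof. by move=> hu hv; exact: ucvD hu (ucvN hv). Qed.

Lemma ucv_norm u l : ucv u l -> ucv (fun k => `|u k|) `|l|.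
Proof.
move=> hu e e0; apply: evS (hu e e0) => k h.
exact: le_lt_trans (ler_dist_dist _ _) h.
Qed.

Lemma ucv_sum (I : finType) (u : I -> nat -> R) (l : I -> R) :
  (forall i, ucv (u i) (l i)) -> ucv (fun k => \sum_i u i k) (\sum_i l i).
Proof.
move=> h; rewrite /index_enum.
elim: (Finite.enum I) => [|a s ih].
  by rewrite big_nil; apply: ucv_ext (ucv_cst 0); apply: evE => k; rewrite big_nil.
rewrite big_cons; apply: ucv_ext (ucvD (h a) ih).
by apply: evE => k; rewrite big_cons.
Qed.

Lemma ucv_inv : ucv (fun k => k.+1%:R^-1) 0.
Proof.
move=> e e0; apply: evS (ev_ge (Num.truncn e^-1)) => k hk.
rewrite subr0 ger0_norm ?invr_ge0 // invf_plt ?posrE //.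
have /andP[_ h] := truncn_itv (ltW (etrans (invr_gt0 e) e0)).
by apply: lt_le_trans h _; rewrite ler_nat.
Qed.

(** The default 0 is returned only when there is no limit; [ulimP] asks for existence first. *)
Definition ulim u : R := xget 0 [set l | ucv u l].

Lemma ulimP u : (exists l, ucv u l) -> ucv u (ulim u).
Proof. by move=> [l hl]; rewrite /ulim; case: xgetP => [x _ //|/(_ l)]. Qed.

Lemma ulimE u l : ucv u l -> ulim u = l.
Proof. by move=> h; exact: ucv_uniq (ulimP (ex_intro _ l h)) h. Qed.

End UltraLimit.

(** * Sup norm and limits of row vectors *)

Section RowVectors.
Context {R : realType} {n : nat}.
Implicit Types (x : 'rV[R]_n).

Lemma normVE x i : `|x ord0 i| <= `|x|.
Proof.
rewrite [leRHS]/Num.norm /= mx_normrE.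
exact: (@le_bigmax _ _ _ 0 (fun ij : 'I_1 * 'I_n => `|x ij.1 ij.2|) (ord0, i)).
Qed.

Lemma normV_le x (e : R) : 0 <= e -> (forall i, `|x ord0 i| <= e) -> `|x| <= e.
Proof.
move=> e0 h; rewrite /Num.norm /= mx_normrE; apply/bigmax_leP; split => //.
by move=> [i j] _ /=; rewrite (ord1 i).
Qed.

Lemma normV_lt x (e : R) : 0 < e -> (forall i, `|x ord0 i| < e) -> `|x| < e.
Proof.
move=> e0 h; rewrite /Num.norm /= mx_normrE; apply/bigmax_ltP; split => //.
by move=> [i j] _ /=; rewrite (ord1 i).
Qed.

Lemma ucvV_ex (x : nat -> 'rV[R]_n) (C : R) : ev (fun k => `|x k| <= C) ->
  exists l, forall e, 0 < e -> ev (fun k => `|x k - l| < e).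
Proof.
move=> h.
have hi i : exists l, ucv (fun k => x k ord0 i) l.
  by apply: (@ucv_ex R _ C); apply: evS h => k; apply: le_trans (normVE _ _).
exists (\row_i ulim (fun k => x k ord0 i)) => e e0.
have : ev (fun k => forall i, `|x k ord0 i - ulim (fun k => x k ord0 i)| < e).
  by apply: ev_fin => i; exact: (ulimP (hi i)).
by apply: evS => k hk; apply: normV_lt => // i; rewrite !mxE.
Qed.

End RowVectors.

Lemma addrBC (W : zmodType) (x y : W) : x + (y - x) = y.
Proof. by rewrite addrC subrK. Qed.

Lemma addrCK (W : zmodType) (x y : W) : x + y - x = y.
Proof. by rewrite addrC addKr. Qed.

(** * One-variable calculus *)

Section OneDim.
Context {R : realType}.
Implicit Types (f g df : R -> R) (a b c l x e d h : R).

(** The o(h) form of differentiability. It includes h = 0 and involves no quotient, so derivatives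
    can be handled by plain epsilon-delta estimates. *)
Lemma derP f x l : is_derive x 1 f l <->
  forall e, 0 < e -> exists2 d, 0 < d &
    forall h, `|h| < d -> `|f (x + h) - f x - l * h| <= e * `|h|.
Proof.
split=> [[hd hl] e e0|H].
  have hc : h^-1 *: (f (h *: 1 + x) - f x) @[h --> 0^'] --> l by rewrite -hl.
  move/cvgrPdist_le : hc => /(_ e e0); rewrite near_withinE => -[d /= d0 hdd].
  exists d => // h hh; have [->|h0] := eqVneq h 0.
    by rewrite addr0 subrr mulr0 subr0 !normr0 mulr0.
  have := hdd h; rewrite /ball_ /= sub0r normrN => /(_ hh h0).
  rewrite !scaler1 /GRing.scale /= => h1.
  have -> : f (x + h) - f x - l * h = - (h * (l - h^-1 * (f (h + x) - f x))).
    rewrite mulrBr mulrA mulfV // mul1r (addrC h x); ring.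
  rewrite normrN normrM mulrC; exact: ler_wpM2r.
have hc : h^-1 *: (f (h *: 1 + x) - f x) @[h --> 0^'] --> l.
  apply/cvgrPdist_le => e e0; rewrite near_withinE.
  have [d d0 hd] := H e e0; exists d => //= h; rewrite /ball_ /= sub0r normrN => hh h0.
  rewrite !scaler1 /GRing.scale /=.
  have -> : l - h^-1 * (f (h + x) - f x) = - (h^-1 * (f (x + h) - f x - l * h)).
    by rewrite (addrC h x); field.
  rewrite normrN normrM normfV mulrC ler_pdivrMr ?normr_gt0 //; exact: hd.
by split; [apply/cvg_ex; exists l|exact: cvg_lim].
Qed.

Lemma der_ext f g x l : (exists2 d, 0 < d & forall h, `|h| < d -> f (x + h) = g (x + h)) ->
  is_derive x 1 f l -> is_derive x 1 g l.
Proof.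
move=> [d d0 hd] /derP hf; apply/derP => e e0.
have [d' d0' hd'] := hf e e0; exists (Num.min d d'); first by rewrite lt_min d0.
move=> h; rewrite lt_min => /andP[h1 h2]; rewrite -(hd h) //.
have := hd 0; rewrite addr0 normr0 => <- //; exact: hd'.
Qed.

Lemma der_cts f x l : is_derive x 1 f l -> ctsat f x.
Proof.
move=> /derP h e e0; have [d d0 hd] := h 1 ltr01.
exists (Num.min d (e / (`|l| + 2))); first by rewrite lt_min d0 divr_gt0.
move=> y; rewrite lt_min => /andP[h1]; rewrite ltr_pdivlMr // => h2.
have := hd (y - x) h1; rewrite addrBC mul1r => h3.
have : `|f y - f x| <= `|f y - f x - l * (y - x)| + `|l * (y - x)|.
  by have := ler_normD (f y - f x - l * (y - x)) (l * (y - x)); rewrite subrK.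
rewrite normrM; have := normr_ge0 (y - x); nra.
Qed.

Lemma mvt f df a b : a < b -> (forall x, a <= x <= b -> is_derive x 1 f (df x)) ->
  exists2 c, a < c < b & f b - f a = df c * (b - a).
Proof.
move=> ab h.
have [| |c] := @MVT R f df a b ab.
- by move=> x; rewrite in_itv /= => /andP[? ?]; apply: h; rewrite !ltW.
- apply: derivable_within_continuous => x; rewrite in_itv /= => hx.
  by case: (h x hx).
by rewrite in_itv /= => hc e; exists c.
Qed.

(** The two-sided form avoids distinguishing the order of a and b. The price is that c is located
    only up to its distance from a. *)
Lemma mvt_sym f df a b : (forall x, `|x - a| <= `|b - a| -> is_derive x 1 f (df x)) ->
  exists2 c, `|c - a| <= `|b - a| & f b - f a = df c * (b - a).
Proof.
move=> h; have [ab|ba|->] := ltgtP a b.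
- have [|c /andP[c1 c2] e] := @mvt f df a b ab.
    by move=> x /andP[x1 x2]; apply: h; rewrite !ger0_norm; lra.
  by exists c => //; rewrite !ger0_norm; lra.
- have [|c /andP[c1 c2] e] := @mvt f df b a ba.
    by move=> x /andP[x1 x2]; apply: h; rewrite !ler0_norm; lra.
  exists c; first by rewrite !ler0_norm; lra.
  by rewrite -(opprB (f a)) e; ring.
- by exists b; rewrite ?subrr ?mulr0.
Qed.

Lemma derive_mono f df a b : a <= b -> (forall x, a <= x <= b -> is_derive x 1 f (df x)) ->
  (forall x, a <= x <= b -> 0 <= df x) -> f a <= f b.
Proof.
rewrite le_eqVlt => /orP[/eqP-> //|ab] h1 h2.
have [c /andP[c1 c2] e] := mvt ab h1.
have := h2 c; rewrite (ltW c1) (ltW c2) => /(_ isT) h3.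
by rewrite -subr_ge0 e mulr_ge0 // subr_ge0 ltW.
Qed.

Lemma derive_bound f df a b K : (forall x, `|x - a| <= `|b - a| -> is_derive x 1 f (df x)) ->
  (forall x, `|x - a| <= `|b - a| -> `|df x| <= K) -> `|f b - f a| <= K * `|b - a|.
Proof.
move=> h1 h2; have [c hc ->] := mvt_sym h1.
by rewrite normrM ler_wpM2r // h2.
Qed.

Lemma derive_left_min f x l (d : R) : is_derive x 1 f l -> 0 < d ->
  (forall h, 0 < h < d -> f x <= f (x - h)) -> l <= 0.
Proof.
move=> /derP H d0 hm; rewrite leNgt; apply/negP => l0.
have [|d' d0' hd] := H (l / 2); first lra.
pose h := Num.min d d' / 2.
have h0 : 0 < Num.min d d' by rewrite lt_min d0.
have h1 : h < d by have : Num.min d d' <= d by [rewrite ge_min lexx]; rewrite /h; lra.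
have h2 : h < d' by have : Num.min d d' <= d' by [rewrite ge_min lexx orbT]; rewrite /h; lra.
have h3 : 0 < h by rewrite /h; lra.
have := hd (- h); rewrite normrN gtr0_norm // => /(_ h2).
have := hm h; rewrite h3 h1 => /(_ isT).
rewrite ler_norml => h4 /andP[h5 h6]; nra.
Qed.

Lemma derive_min0 f x l (d : R) : is_derive x 1 f l -> 0 < d ->
  (forall h, `|h| < d -> f x <= f (x + h)) -> l = 0.
Proof.
move=> /derP H d0 hm; apply/eqP; rewrite -normr_eq0 eq_le normr_ge0 andbT.
rewrite leNgt; apply/negP => l0.
have [|d' d0' hd] := H (`|l| / 2); first lra.
pose h := Num.min d d' / 2.
have h0 : 0 < Num.min d d' by rewrite lt_min d0.
have h1 : h < d by have : Num.min d d' <= d by [rewrite ge_min lexx]; rewrite /h; lra.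
have h2 : h < d' by have : Num.min d d' <= d' by [rewrite ge_min lexx orbT]; rewrite /h; sra d0'.
have h3 : 0 < h by rewrite /h; sra h0.
have a1 := hm h; have a2 := hm (- h); have b1 := hd h; have b2 := hd (- h).
move: a1 a2 b1 b2; rewrite !normrN !(gtr0_norm h3) => /(_ h1) a1 /(_ h1) a2 /(_ h2) b1 /(_ h2) b2.
move: b1 b2; rewrite !ler_norml => /andP[? ?] /andP[? ?].
case: (lerP 0 l) => sg.
  by have : `|l| * h = l * h by [rewrite ger0_norm]; nra.
by have : `|l| * h = - l * h by [rewrite ltr0_norm]; nra.
Qed.

(** The first derivative vanishes at the minimum; if the second one were negative, [f1] would be
    negative just to the right of x and f would drop below f x. *)
Lemma derive2_min f f1 x l (d : R) : 0 < d ->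
  (forall h, `|h| < d -> is_derive (x + h) 1 f (f1 (x + h))) -> is_derive x 1 f1 l ->
  (forall h, `|h| < d -> f x <= f (x + h)) -> 0 <= l.
Proof.
move=> d0 hf hf1 hm.
have f10 : f1 x = 0.
  by apply: (@derive_min0 f x _ d) => //; have := hf 0; rewrite addr0 normr0; apply.
rewrite leNgt; apply/negP => l0.
move/derP : hf1 => H; have [|d' d0' hd] := H (- l / 2); first lra.
pose h := Num.min d d' / 2.
have h0 : 0 < Num.min d d' by rewrite lt_min d0.
have h1 : h < d by have : Num.min d d' <= d by [rewrite ge_min lexx]; rewrite /h; lra.
have h2 : h < d' by have : Num.min d d' <= d' by [rewrite ge_min lexx orbT]; rewrite /h; sra d0'.
have h3 : 0 < h by rewrite /h; lra.
have [||c /andP[c1 c2] e] := @mvt f f1 x (x + h).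
- by lra.
- move=> y /andP[y1 y2]; have := hf (y - x); rewrite addrBC; apply.
  by rewrite ger0_norm; sra h1 y1 y2.
have := hd (c - x); rewrite addrBC gtr0_norm ?subr_gt0 // => /(_ ltac:(sra c2 h2)).
rewrite f10 subr0 ler_norml => /andP[_ h5].
have := hm h; rewrite gtr0_norm // => /(_ h1) h6.
have h7 : f1 c < 0 by nra.
have h8 : f1 c * h < 0 by rewrite pmulr_llt0.
have e' : f (x + h) - f x = f1 c * h by rewrite e; ring.
sra e h6 h8.
Qed.

End OneDim.

(** * Joint continuity and directional derivatives *)

Section SpaceTime.
Context {R : realType} {n : nat}.
Local Notation V := 'rV[R]_n.
Implicit Types (f g : R -> V -> R) (t s e d h : R) (x y v : V).

Definition jc f t x := forall e, 0 < e -> exists2 d, 0 < d &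
  forall s y, `|s - t| < d -> `|y - x| < d -> `|f s y - f t x| < e.


Definition pd v (f : V -> R) x (l : R) := is_derive (0 : R) 1 (fun s : R => f (x + s *: v)) l.

Lemma pd_shift v (f : V -> R) x (s l : R) : pd v f (x + s *: v) l ->
  is_derive s 1 (fun s => f (x + s *: v)) l.
Proof.
rewrite /pd => /derP H; apply/derP => e e0.
have [d d0 hd] := H e e0; exists d => // h hh; have := hd h hh.
by rewrite add0r scale0r addr0 (scalerDl _ s h) addrA.
Qed.

Lemma pd_ext v (f g : V -> R) x l : (exists2 d, 0 < d & forall y, `|y - x| < d -> f y = g y) ->
  pd v f x l -> pd v g x l.
Proof.
move=> [d d0 hd]; apply: der_ext; exists (d / (`|v| + 1)).
  by apply: divr_gt0 => //; have := normr_ge0 v; lra.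
move=> h hh; apply: hd; rewrite add0r addrC addKr normrZ.
have h1 : `|h| * (`|v| + 1) < d by rewrite -ltr_pdivlMr //; have := normr_ge0 v; lra.
have := normr_ge0 h; nra.
Qed.

Lemma evecE (i j : 'I_n) : (evec R i) ord0 j = (i == j)%:R.
Proof. by rewrite /evec mxE eqxx eq_sym. Qed.

Lemma norm_evec (i : 'I_n) : `|evec R i| = 1.
Proof.
apply/eqP; rewrite eq_le; apply/andP; split.
  by apply: normV_le => // j; rewrite evecE; case: (i == j); rewrite ?normr1 ?normr0.
by have := normVE (evec R i) i; rewrite evecE eqxx normr1.
Qed.

Lemma jcD f g t x : jc f t x -> jc g t x -> jc (fun s y => f s y + g s y) t x.
Proof.
move=> hf hg e e0; have e2 : 0 < e / 2 by lra.
have [d1 d10 h1] := hf _ e2; have [d2 d20 h2] := hg _ e2.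
exists (Num.min d1 d2); first by rewrite lt_min d10.
move=> s y; rewrite !lt_min => /andP[a1 a2] /andP[b1 b2].
have := h1 s y a1 b1; have := h2 s y a2 b2; rewrite !ltr_norml.
by move=> /andP[? ?] /andP[? ?]; apply/andP; split; lra.
Qed.

Lemma jc_cst (c : R) t x : jc (fun _ _ => c) t x.
Proof. by move=> e e0; exists 1 => // s y _ _; rewrite subrr normr0. Qed.

Lemma jc_comp (phi : R -> R) f t x : ctsat phi (f t x) -> jc f t x -> jc (fun s y => phi (f s y)) t x.
Proof.
move=> hp hf e e0; have [d d0 hd] := hp e e0; have [d' d0' hd'] := hf d d0.
by exists d' => // s y hs hy; apply: hd; exact: hd'.
Qed.

Lemma jcZ (c : R) f t x : jc f t x -> jc (fun s y => c * f s y) t x.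
Proof.
move=> hf; apply: (@jc_comp (fun r => c * r)) => // e e0.
exists (e / (`|c| + 1)); first by apply: divr_gt0 => //; have := normr_ge0 c; lra.
move=> y; rewrite ltr_pdivlMr; last by have := normr_ge0 c; lra.
by rewrite -mulrBr normrM; have := normr_ge0 (y - f t x); nra.
Qed.

Lemma jcN f t x : jc f t x -> jc (fun s y => - f s y) t x.
Proof.
by move=> hf e e0; have [d d0 hd] := hf e e0; exists d => // s y hs hy;
  rewrite -opprD normrN; exact: hd.
Qed.

Lemma jc_bnd f t x : jc f t x -> exists2 d, 0 < d &
  forall s y, `|s - t| < d -> `|y - x| < d -> `|f s y| <= `|f t x| + 1.
Proof.
move=> hf; have [d d0 hd] := hf 1 ltr01; exists d => // s y hs hy.
have := hd s y hs hy; have := ler_normD (f s y - f t x) (f t x); rewrite subrK; lra.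
Qed.

Lemma jcM f g t x : jc f t x -> jc g t x -> jc (fun s y => f s y * g s y) t x.
Proof.
move=> hf hg e e0; have [d0 d00 hb] := jc_bnd hg.
pose C := `|f t x| + `|g t x| + 2.
have C0 : 0 < C by rewrite /C; have := normr_ge0 (f t x); have := normr_ge0 (g t x); lra.
have e2 : 0 < e / C by exact: divr_gt0.
have [d1 d10 h1] := hf _ e2; have [d2 d20 h2] := hg _ e2.
exists (Num.min d0 (Num.min d1 d2)); first by rewrite !lt_min d00 d10.
move=> s y; rewrite !lt_min => /and3P[a0 a1 a2] /and3P[b0 b1 b2].
have := h1 s y a1 b1; have := h2 s y a2 b2; have := hb s y a0 b0.
rewrite !ltr_pdivlMr // => u1 u2 u3.
have -> : f s y * g s y - f t x * g t x =
  (f s y - f t x) * g s y + f t x * (g s y - g t x) by ring.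
apply: lt_normD; rewrite !normrM.
have := normr_ge0 (f s y - f t x); have := normr_ge0 (g s y - g t x).
have := normr_ge0 (f t x); have := normr_ge0 (g t x).
have := normr_ge0 (g s y).
move: u1 u2 u3; rewrite /C.
set A := `|f s y - f t x|; set B := `|g s y - g t x|; set F := `|f t x|.
set G := `|g t x|; set G' := `|g s y|; nra.
Qed.

Lemma jc_sum (I : Type) (r : seq I) (F : I -> R -> V -> R) t x :
  (forall i, jc (F i) t x) -> jc (fun s y => \sum_(i <- r) F i s y) t x.
Proof.
move=> h; elim: r => [|a r ih].
  by move=> e e0; exists 1 => // s y _ _; rewrite !big_nil subrr normr0.
move=> e e0; have [d d0 hd] := jcD (h a) ih e0; exists d => // s y hs hy.
by rewrite !big_cons; exact: hd.
Qed.

Lemma jc_coord i t x : jc (fun _ y => y ord0 i) t x.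
Proof.
move=> e e0; exists e => // s y _ hy; apply: le_lt_trans hy.
by have := normVE (y - x) i; rewrite !mxE.
Qed.

Lemma jc_time t x : jc (fun s _ => s) t x.
Proof. by move=> e e0; exists e. Qed.

Lemma jc_ext f g t x : (exists2 d, 0 < d & forall s y, `|s - t| < d -> `|y - x| < d -> f s y = g s y) ->
  jc f t x -> jc g t x.
Proof.
move=> [d d0 hd] hf e e0; have [d' d0' hd'] := hf e e0.
exists (Num.min d d'); first by rewrite lt_min d0.
move=> s y; rewrite !lt_min => /andP[a0 a1] /andP[b0 b1].
by rewrite -!hd ?subrr ?normr0 //; exact: hd'.
Qed.

(* C^1 functions are differentiable: move one coordinate at a time *)
Lemma increment (f : V -> R) (fi : 'I_n -> V -> R) x (d : R) (e : R) :
  0 < d -> 0 < e ->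
  (forall i y, `|y - x| < d -> pd (evec R i) f y (fi i y)) ->
  (forall i y, `|y - x| < d -> `|fi i y - fi i x| <= e) ->
  forall v, `|v| < d -> `|f (x + v) - f x - \sum_i v ord0 i * fi i x| <= n%:R * e * `|v|.
Proof.
move=> d0 e0 hf hfi v hv.
(* The path from 0 to v through partial vectors: [w k] keeps the first k coordinates of v, so
   consecutive points differ in one coordinate and the one-variable mean value theorem applies. *)
pose w (k : nat) : V := \row_i (if (i < k)%N then v ord0 i else 0).
have w0 : w 0%N = 0 by apply/rowP => i; rewrite !mxE.
have wn : w n = v by apply/rowP => i; rewrite !mxE ltn_ord.
have nw k (c : R) (i : 'I_n) : `|c| <= `|v ord0 i| -> i = k :> nat -> `|w k + c *: evec R i| <= `|v|.
  move=> hc ik; apply: normV_le => // j; rewrite !mxE eqxx /= -ik.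
  have [->|ji] := eqVneq j i; first by rewrite ltnn add0r mulr1 (le_trans hc) ?normVE.
  rewrite mulr0 addr0; case: ifP => _; rewrite ?normr0 ?normr_ge0 //; exact: normVE.
have step (i : 'I_n) : `|f (x + w i.+1) - f (x + w i) - v ord0 i * fi i x| <= e * `|v|.
  have e1 : w i.+1 = w i + v ord0 i *: evec R i.
    apply/rowP => j; rewrite !mxE eqxx /= ltnS leq_eqVlt.
    have [->|ji] := eqVneq j i; first by rewrite eqxx ltnn add0r mulr1.
    by rewrite mulr0 addr0 (negbTE (_ : (val j != val i))).
  have hin c : `|c| <= `|v ord0 i| -> `|x + w i + c *: evec R i - x| < d.
    by move=> hc; rewrite -(addrA x (w i)) addrCK; apply: le_lt_trans hv; exact: nw.
  have [|c hc] := @mvt_sym R (fun s => f (x + w i + s *: evec R i))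
      (fun s => fi i (x + w i + s *: evec R i)) 0 (v ord0 i).
    move=> s; rewrite !subr0 => hs; apply: pd_shift; apply: hf; exact: hin.
  rewrite scale0r addr0 !subr0 in hc * => e2.
  rewrite e1 addrA e2 [v _ _ * _]mulrC -mulrBl normrM.
  by apply: ler_pM => //; [apply: hfi; exact: hin|exact: normVE].
have tel : f (x + v) - f x = \sum_(i < n) (f (x + w i.+1) - f (x + w i)).
  rewrite -(big_mkord xpredT (fun i => f (x + w i.+1) - f (x + w i))).
  by rewrite (telescope_sumr (fun i => f (x + w i))) // w0 wn addr0.
rewrite tel -sumrB; apply: le_norm_sum.
apply: le_trans (ler_sum _ (fun i _ => step i)) _.
by rewrite sumr_const card_ord -[leLHS]mulr_natl mulrA.
Qed.

End SpaceTime.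

Lemma fin_min (R : realType) (I : finType) (dd : I -> R) : (forall i, 0 < dd i) ->
  exists2 d, 0 < d & forall i, d <= dd i.
Proof.
move=> h; exists (\big[Num.min/1]_i dd i); first by elim/big_ind : _ => // a b a0 b0; rewrite lt_min a0.
by move=> i; rewrite (bigD1 i) //= ge_min lexx.
Qed.

(** * Differentiation rules on the line *)

Section Rules.
Context {R : realType}.
Implicit Types (f g : R -> R) (a b c x e d h : R).

Lemma dD f g x a b : is_derive x 1 f a -> is_derive x 1 g b ->
  is_derive x 1 (fun s => f s + g s) (a + b).
Proof. by move=> hf hg; exact: is_deriveD. Qed.

Lemma dM f g x a b : is_derive x 1 f a -> is_derive x 1 g b ->
  is_derive x 1 (fun s => f s * g s) (f x * b + g x * a).
Proof. by move=> hf hg; exact: is_deriveM. Qed.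

Lemma dcst c x : is_derive x 1 (fun=> c) 0.
Proof. exact: is_derive_cst. Qed.

Lemma did x : is_derive x 1 (fun s : R => s) 1.
Proof. exact: is_derive_id. Qed.

Lemma dZ f c x a : is_derive x 1 f a -> is_derive x 1 (fun s => c * f s) (c * a).
Proof.
by move=> hf; have := dM (dcst c x) hf; rewrite mulr0 addr0.
Qed.

Lemma dN f x a : is_derive x 1 f a -> is_derive x 1 (fun s => - f s) (- a).
Proof. by move=> hf; exact: is_deriveN. Qed.

Lemma dB f g x a b : is_derive x 1 f a -> is_derive x 1 g b ->
  is_derive x 1 (fun s => f s - g s) (a - b).
Proof. by move=> hf hg; exact: is_deriveB. Qed.

Lemma dcomp f g x a b : is_derive (g x) 1 f a -> is_derive x 1 g b ->
  is_derive x 1 (fun s => f (g s)) (a * b).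
Proof. by move=> hf hg; exact: (is_derive1_comp hf hg). Qed.

Lemma dsum (I : Type) (r : seq I) (F : I -> R -> R) (l : I -> R) x :
  (forall i, is_derive x 1 (F i) (l i)) ->
  is_derive x 1 (fun s => \sum_(i <- r) F i s) (\sum_(i <- r) l i).
Proof.
move=> h; elim: r => [|i r ih].
  rewrite big_nil; apply: der_ext (dcst 0 x); exists 1 => // s _.
  by rewrite big_nil.
rewrite big_cons; apply: der_ext (dD (h i) ih); exists 1 => // s _.
by rewrite big_cons.
Qed.

Lemma dpow (q : R) x : 0 < x -> is_derive x 1 (fun r => r `^ q) (q * x `^ (q - 1)).
Proof. exact: is_derive1_powR. Qed.

Lemma powR_cts (q : R) x : 0 < x -> ctsat (fun r => r `^ q) x.
Proof. by move=> x0; exact: der_cts (dpow q x0). Qed.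

End Rules.

(** * Jets: functions bundled with their parabolic derivatives *)

Section Jets.
Context {R : realType} {n : nat}.
Local Notation V := 'rV[R]_n.
Implicit Types (f g : R -> V -> R) (t s e d h c : R) (x y v : V).

Lemma increment2 f ft (fi : 'I_n -> R -> V -> R) t x :
  (exists2 d, 0 < d & forall s y, `|s - t| < d -> `|y - x| < d ->
     is_derive s 1 (f ^~ y) (ft s y) /\ forall i, pd (evec R i) (f s) y (fi i s y)) ->
  jc ft t x -> (forall i, jc (fi i) t x) ->
  forall e, 0 < e -> exists2 d, 0 < d & forall s y, `|s - t| < d -> `|y - x| < d ->
    `|f s y - f t x - (s - t) * ft t x - \sum_i (y - x) ord0 i * fi i t x|
      <= e * (`|s - t| + `|y - x|).
Proof.
move=> [d0 d00 hd0] cft cfi e e0.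
pose e' := e / (n%:R + 1).
have e'0 : 0 < e' by apply: divr_gt0.
have ne' : n%:R * e' <= e.
  by rewrite /e' mulrA ler_pdivrMr // mulrC ler_wpM2l ?ltW // ltrDl.
have ee' : e' <= e by rewrite /e' ler_pdivrMr //; have : (0 : R) <= n%:R by []; nra.
have [d1 d10 hd1] := cft _ e'0.
have [d2 d20 hd2] : exists2 d, 0 < d & forall i s y, `|s - t| < d -> `|y - x| < d ->
    `|fi i s y - fi i t x| < e'.
  have := fun i => cfi i _ e'0.
  move=> /(_ _)/cid2-/all_sig2[dd dd0 hdd].
  have [dm dm0 hdm] := fin_min dd0; exists dm => // i s y h1 h2.
  by apply: hdd; [exact: lt_le_trans h1 _|exact: lt_le_trans h2 _].
pose d := Num.min d0 (Num.min d1 d2).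
have d_gt0 : 0 < d by rewrite !lt_min d00 d10.
exists d => // s y; rewrite !lt_min => /and3P[s0 s1 s2] /and3P[y0 y1 y2].
have h1 : `|f t (x + (y - x)) - f t x - \sum_i (y - x) ord0 i * fi i t x| <= n%:R * e' * `|y - x|.
  apply: (@increment R n (f t) (fi^~ t) x (Num.min d0 d2)) => //.
  - by rewrite lt_min d00.
  - move=> i z; rewrite lt_min => /andP[z0 _].
    by have [|_] := hd0 t z _ z0; [rewrite subrr normr0|apply].
  - move=> i z; rewrite lt_min => /andP[_ z0]; apply/ltW.
    by apply: hd2 => //; rewrite subrr normr0.
  - by rewrite lt_min y0.
rewrite addrBC in h1.
have [c hc e1] : exists2 c, `|c - t| <= `|s - t| & f s y - f t y = ft c y * (s - t).
  apply: (@mvt_sym R (f^~ y) (ft^~ y)) => c hc.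
  by have [] := hd0 c y (le_lt_trans hc s0) y0.
have h2 : `|(s - t) * (ft c y - ft t x)| <= e' * `|s - t|.
  rewrite normrM mulrC ler_wpM2r //; apply/ltW; apply: hd1 => //.
  exact: le_lt_trans hc s1.
have -> : f s y - f t x - (s - t) * ft t x - \sum_i (y - x) ord0 i * fi i t x =
  (s - t) * (ft c y - ft t x) + (f t y - f t x - \sum_i (y - x) ord0 i * fi i t x).
  have -> : f s y = f t y + ft c y * (s - t) by rewrite -e1; ring.
  ring.
apply: le_normD; rewrite [leRHS]mulrDr; apply: lerD.
  by apply: le_trans h2 _; rewrite ler_wpM2r.
by apply: le_trans h1 _; rewrite ler_wpM2r.
Qed.

Lemma chain f ft (fi : 'I_n -> R -> V -> R) (a : R -> R) (b : R -> V) s (a' : R) (b' : V) :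
  (exists2 d, 0 < d & forall s' y, `|s' - a s| < d -> `|y - b s| < d ->
     is_derive s' 1 (f ^~ y) (ft s' y) /\ forall i, pd (evec R i) (f s') y (fi i s' y)) ->
  jc ft (a s) (b s) -> (forall i, jc (fi i) (a s) (b s)) ->
  is_derive s 1 a a' -> (forall i, is_derive s 1 (fun s => b s ord0 i) (b' ord0 i)) ->
  is_derive s 1 (fun s => f (a s) (b s))
    (ft (a s) (b s) * a' + \sum_i b' ord0 i * fi i (a s) (b s)).
Proof.
move=> hf cft cfi ha hb.
have hinc := increment2 hf cft cfi.
move/derP : ha => ha.
have {}hb : forall e, 0 < e -> exists2 d, 0 < d & forall h, `|h| < d ->
    `|b (s + h) - b s - h *: b'| <= e * `|h|.
  move=> e e0.
  have := fun i => (derP _ _ _).1 (hb i) e e0.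
  move=> /(_ _)/cid2-/all_sig2[dd dd0 hdd].
  have [dm dm0 hdm] := fin_min dd0; exists dm => // h hh.
  apply: normV_le => [|i]; first by rewrite mulr_ge0 // ltW.
  rewrite !mxE [h * _]mulrC; apply: hdd; exact: lt_le_trans hh _.
apply/derP => e e0.
pose K := `|a'| + `|b'| + 2.
have K0 : 0 < K by rewrite /K; have := normr_ge0 a'; have := normr_ge0 b'; sra.
pose F := `|ft (a s) (b s)| + \sum_i `|fi i (a s) (b s)| + 1.
have F0 : 0 < F.
  by rewrite /F ltr_wpDl // addr_ge0 // sumr_ge0.
have eK : 0 < e / (2 * K) by rewrite divr_gt0 // mulr_gt0.
have [d1 d10 h1] := hinc _ eK.
have eF : 0 < Num.min 1 (e / (2 * F)) by rewrite lt_min ltr01 divr_gt0 // mulr_gt0.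
have [d2 d20 h2] := ha _ eF; have [d3 d30 h3] := hb _ eF.
exists (Num.min (d1 / K) (Num.min d2 d3)); first by rewrite !lt_min d20 d30 divr_gt0.
move=> h; rewrite !lt_min => /and3P[hh1 hh2 hh3].
have {}h2 := h2 h hh2; have {}h3 := h3 h hh3.
have m1 : Num.min 1 (e / (2 * F)) <= 1 by rewrite ge_min lexx.
have m2 : Num.min 1 (e / (2 * F)) <= e / (2 * F) by rewrite ge_min lexx orbT.
have da : `|a (s + h) - a s| <= (`|a'| + 1) * `|h|.
  have -> : a (s + h) - a s = (a (s + h) - a s - a' * h) + a' * h by ring.
  apply: le_normD; rewrite normrM mulrDl addrC lerD2l mul1r.
  apply: le_trans h2 _; exact: ler_piMl.
have db : `|b (s + h) - b s| <= (`|b'| + 1) * `|h|.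
  have -> : b (s + h) - b s = (b (s + h) - b s - h *: b') + h *: b' by rewrite subrK.
  apply: le_normD; rewrite normrZ mulrDl addrC [`|h| * _]mulrC lerD2l mul1r.
  apply: le_trans h3 _; exact: ler_piMl.
have hK : `|h| * K < d1 by rewrite -ltr_pdivlMr.
have l1 : `|a (s + h) - a s| < d1.
  by apply: le_lt_trans da _; apply: le_lt_trans hK; rewrite mulrC ler_wpM2l // /K;
    have := normr_ge0 b'; sra.
have l2 : `|b (s + h) - b s| < d1.
  by apply: le_lt_trans db _; apply: le_lt_trans hK; rewrite mulrC ler_wpM2l // /K;
    have := normr_ge0 a'; sra.
have h4 := h1 _ _ l1 l2.
have h5 : `|(a (s + h) - a s - a' * h) * ft (a s) (b s) +
     \sum_i (b (s + h) - b s - h *: b') ord0 i * fi i (a s) (b s)| <= e / 2 * `|h|.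
  have : e / 2 * `|h| = e / (2 * F) * `|h| * F by field; rewrite gt_eqF.
  move=> ->; apply: le_normD.
  have b1 : `|(a (s + h) - a s - a' * h) * ft (a s) (b s)| <=
     e / (2 * F) * `|h| * `|ft (a s) (b s)|.
    rewrite normrM ler_wpM2r //; apply: le_trans h2 _; exact: ler_wpM2r.
  have b2 : `|\sum_i (b (s + h) - b s - h *: b') ord0 i * fi i (a s) (b s)| <=
     e / (2 * F) * `|h| * \sum_i `|fi i (a s) (b s)|.
    apply: le_norm_sum; rewrite mulr_sumr; apply: ler_sum => i _.
    rewrite normrM ler_wpM2r //; apply: le_trans (normVE _ _) _.
    apply: le_trans h3 _; exact: ler_wpM2r.
  apply: le_trans (lerD b1 b2) _; rewrite -mulrDr ler_wpM2l //.
    by rewrite mulr_ge0 // divr_ge0 // ltW // mulr_gt0.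
  by rewrite /F lerDl.
have -> : f (a (s + h)) (b (s + h)) - f (a s) (b s) -
   (ft (a s) (b s) * a' + \sum_i b' ord0 i * fi i (a s) (b s)) * h =
  (f (a (s + h)) (b (s + h)) - f (a s) (b s) - (a (s + h) - a s) * ft (a s) (b s) -
   \sum_i (b (s + h) - b s) ord0 i * fi i (a s) (b s)) +
  ((a (s + h) - a s - a' * h) * ft (a s) (b s) +
     \sum_i (b (s + h) - b s - h *: b') ord0 i * fi i (a s) (b s)).
  have -> : \sum_i (b (s + h) - b s - h *: b') ord0 i * fi i (a s) (b s) =
    \sum_i (b (s + h) - b s) ord0 i * fi i (a s) (b s) -
     h * \sum_i b' ord0 i * fi i (a s) (b s).
    rewrite mulr_sumr -sumrB; apply: eq_bigr => i _; rewrite !mxE; ring.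
  ring.
apply: le_normD.
have h6 : e / (2 * K) * (`|a (s + h) - a s| + `|b (s + h) - b s|) <= e / 2 * `|h|.
  have -> : e / 2 * `|h| = e / (2 * K) * (K * `|h|) by field; rewrite gt_eqF.
  rewrite ler_wpM2l //; first by rewrite divr_ge0 // ltW // mulr_gt0.
  apply: le_trans (lerD da db) _; rewrite /K; sra.
sra h4 h5 h6.
Qed.

(** The derivatives are stored as data, and [C12] asserts at a point that they are the derivatives.
    The rules for the heat operator ([heatM], [heat_comp], [heat_sum]) are thus algebraic identities
    without differentiability conditions. *)
Record jf := Jf { jv : R -> V -> R; jt : R -> V -> R; jd : 'I_n -> R -> V -> R;
  jdd : 'I_n -> 'I_n -> R -> V -> R }.
Implicit Types (j k : jf).

Record C12 j t x : Prop := C12At {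
  c_t : is_derive t 1 (fun s => jv j s x) (jt j t x);
  c_d : forall i, pd (evec R i) (jv j t) x (jd j i t x);
  c_dd : forall i l, pd (evec R l) (jd j i t) x (jdd j i l t x);
  c_v0 : jc (jv j) t x;
  c_t0 : jc (jt j) t x;
  c_d0 : forall i, jc (jd j i) t x;
  c_dd0 : forall i l, jc (jdd j i l) t x }.


Definition heat j t x := jt j t x - \sum_i jdd j i i t x.
Definition grad2 j k t x := \sum_i jd j i t x * jd k i t x.

Definition jcst c := Jf (fun _ _ => c) (fun _ _ => 0) (fun _ _ _ => 0) (fun _ _ _ _ => 0).
Definition jtime := Jf (fun t _ => t) (fun _ _ => 1) (fun _ _ _ => 0) (fun _ _ _ _ => 0).
Definition jlin (i : 'I_n) c := Jf (fun _ x => x ord0 i - c) (fun _ _ => 0)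
  (fun l _ _ => (l == i)%:R) (fun _ _ _ _ => 0).
Definition jadd j k := Jf (fun t x => jv j t x + jv k t x) (fun t x => jt j t x + jt k t x)
  (fun i t x => jd j i t x + jd k i t x) (fun i l t x => jdd j i l t x + jdd k i l t x).
Definition jmul j k := Jf (fun t x => jv j t x * jv k t x)
  (fun t x => jv j t x * jt k t x + jv k t x * jt j t x)
  (fun i t x => jv j t x * jd k i t x + jv k t x * jd j i t x)
  (fun i l t x => (jv j t x * jdd k i l t x + jd k i t x * jd j l t x) +
    (jv k t x * jdd j i l t x + jd j i t x * jd k l t x)).
Definition jcomp (p0 p1 p2 : R -> R) j := Jf (fun t x => p0 (jv j t x))
  (fun t x => p1 (jv j t x) * jt j t x) (fun i t x => p1 (jv j t x) * jd j i t x)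
  (fun i l t x => p1 (jv j t x) * jdd j i l t x + jd j i t x * (p2 (jv j t x) * jd j l t x)).
Definition jsum (I : finType) (F : I -> jf) := Jf (fun t x => \sum_a jv (F a) t x)
  (fun t x => \sum_a jt (F a) t x) (fun i t x => \sum_a jd (F a) i t x)
  (fun i l t x => \sum_a jdd (F a) i l t x).

Lemma pdD v (f g : V -> R) x (a b : R) : pd v f x a -> pd v g x b -> pd v (fun y => f y + g y) x (a + b).
Proof. exact: dD. Qed.

Lemma pdM v (f g : V -> R) x (a b : R) : pd v f x a -> pd v g x b ->
  pd v (fun y => f y * g y) x (f x * b + g x * a).
Proof. by move=> hf hg; have := dM hf hg; rewrite scale0r addr0. Qed.

Lemma pdcomp v (p : R -> R) (g : V -> R) x (a b : R) : is_derive (g x) 1 p a -> pd v g x b ->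
  pd v (fun y => p (g y)) x (a * b).
Proof.
move=> hp hg; apply: (@dcomp R p (fun s => g (x + s *: v))) => //.
by rewrite scale0r addr0.
Qed.

Lemma pdcst v c x : pd v (fun=> c) x 0.
Proof. exact: dcst. Qed.

Lemma pdsum v (I : Type) (r : seq I) (F : I -> V -> R) (l : I -> R) x :
  (forall i, pd v (F i) x (l i)) -> pd v (fun y => \sum_(i <- r) F i y) x (\sum_(i <- r) l i).
Proof. exact: dsum. Qed.

Lemma pd_lin v (i : 'I_n) c x : pd v (fun y => y ord0 i - c) x (v ord0 i).
Proof.
rewrite /pd; have h := dB (dD (dcst (x ord0 i) 0) (dM (did (0 : R)) (dcst (v ord0 i) 0))) (dcst c 0).
have := h; rewrite /= mulr0 add0r subr0 add0r mulr1.
by apply: der_ext; exists 1 => // s _; rewrite !mxE.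
Qed.

Lemma C12_cst c t x : C12 (jcst c) t x.
Proof. by split => *; [exact: dcst|exact: pdcst|exact: pdcst|exact: jc_cst..]. Qed.

Lemma C12_time t x : C12 jtime t x.
Proof.
by split => *; [exact: did|exact: pdcst|exact: pdcst|exact: jc_time|exact: jc_cst..].
Qed.

Lemma C12_lin (i : 'I_n) c t x : C12 (jlin i c) t x.
Proof.
split => *; [exact: dcst| |exact: pdcst| |exact: jc_cst..].
  by rewrite /= -evecE; exact: pd_lin.
by apply: jcD; [exact: jc_coord|exact: jc_cst].
Qed.

Lemma C12D j k t x : C12 j t x -> C12 k t x -> C12 (jadd j k) t x.
Proof.
move=> [a1 a2 a3 a4 a5 a6 a7] [b1 b2 b3 b4 b5 b6 b7].
split => [|i|i l|||i|i l]; [exact: dD|exact: pdD|exact: pdD|exact: jcD..].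
Qed.

Lemma C12M j k t x : C12 j t x -> C12 k t x -> C12 (jmul j k) t x.
Proof.
move=> [a1 a2 a3 a4 a5 a6 a7] [b1 b2 b3 b4 b5 b6 b7].
split => [|i|i l|||i|i l]; first exact: dM.
- exact: pdM.
- by apply: pdD; exact: pdM.
- exact: jcM.
- by apply: jcD; exact: jcM.
- by apply: jcD; exact: jcM.
- by apply: jcD; apply: jcD; exact: jcM.
Qed.

Lemma C12_comp (p0 p1 p2 : R -> R) j t x : C12 j t x ->
  is_derive (jv j t x) 1 p0 (p1 (jv j t x)) -> is_derive (jv j t x) 1 p1 (p2 (jv j t x)) ->
  ctsat p2 (jv j t x) -> C12 (jcomp p0 p1 p2 j) t x.
Proof.
move=> [a1 a2 a3 a4 a5 a6 a7] hp0 hp1 hp2.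
have c1 := der_cts hp1; have c0 := der_cts hp0.
split => [|i|i l|||i|i l].
- exact: (@dcomp R p0 (fun s => jv j s x)).
- exact: pdcomp.
- by apply: pdM => //; exact: pdcomp.
- exact: jc_comp.
- by apply: jcM => //; exact: jc_comp.
- by apply: jcM => //; exact: jc_comp.
- by apply: jcD; apply: jcM => //; [exact: jc_comp|apply: jcM => //; exact: jc_comp].
Qed.

Lemma C12_sum (I : finType) (F : I -> jf) t x : (forall a, C12 (F a) t x) -> C12 (jsum F) t x.
Proof.
move=> h; split => [|i|i l|||i|i l].
- by apply: dsum => a; case: (h a).
- by apply: pdsum => a; case: (h a).
- by apply: pdsum => a; case: (h a).
- by apply: jc_sum => a; case: (h a).
- by apply: jc_sum => a; case: (h a).
- by apply: jc_sum => a; case: (h a).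
- by apply: jc_sum => a; case: (h a).
Qed.

Lemma heatD j k t x : heat (jadd j k) t x = heat j t x + heat k t x.
Proof. by rewrite /heat /= big_split /=; ring. Qed.

Lemma heat_cst c t x : heat (jcst c) t x = 0.
Proof. by rewrite /heat /= sumr_const mul0rn subr0. Qed.

Lemma heat_time t x : heat jtime t x = 1.
Proof. by rewrite /heat /= sumr_const mul0rn subr0. Qed.

Lemma heatM j k t x : heat (jmul j k) t x =
  jv j t x * heat k t x + jv k t x * heat j t x - 2 * grad2 j k t x.
Proof.
rewrite /heat /grad2 /= !big_split /= !mulr_sumr.
rewrite !mulrBr !mulr_sumr.
have -> : \sum_i jd k i t x * jd j i t x = \sum_i jd j i t x * jd k i t x.
  by apply: eq_bigr => i _; rewrite mulrC.
rewrite -!mulr_sumr; ring.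
Qed.

Lemma heat_comp (p0 p1 p2 : R -> R) j t x : heat (jcomp p0 p1 p2 j) t x =
  p1 (jv j t x) * heat j t x - p2 (jv j t x) * grad2 j j t x.
Proof.
rewrite /heat /grad2 /= big_split /= mulrBr !mulr_sumr.
have -> : \sum_i jd j i t x * (p2 (jv j t x) * jd j i t x) =
  \sum_i p2 (jv j t x) * (jd j i t x * jd j i t x).
  by apply: eq_bigr => i _; ring.
ring.
Qed.

Lemma heat_sum (I : finType) (F : I -> jf) t x : heat (jsum F) t x = \sum_a heat (F a) t x.
Proof. by rewrite /heat /= exchange_big /= sumrB. Qed.

Definition jpow (q : R) := jcomp (fun r => r `^ q) (fun r => q * r `^ (q - 1))
  (fun r => q * ((q - 1) * r `^ (q - 1 - 1))).

Lemma C12_pow (q : R) j t x : C12 j t x -> 0 < jv j t x -> C12 (jpow q j) t x.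
Proof.
move=> hj j0; apply: C12_comp => //; first exact: dpow.
  by apply: dZ; exact: dpow.
apply: (@der_cts R _ _ (q * ((q - 1) * ((q - 1 - 1) * jv j t x `^ (q - 1 - 1 - 1))))).
by do 2 apply: dZ; exact: dpow.
Qed.

Definition jsq (a : V) := jsum (fun i : 'I_n => jmul (jlin i (a ord0 i)) (jlin i (a ord0 i))).

Lemma C12_sq (a : V) t x : C12 (jsq a) t x.
Proof. by apply: C12_sum => i; apply: C12M; exact: C12_lin. Qed.

(** The Euclidean square: barriers and cut-offs need a smooth function, while the norm of row
    vectors is the sup norm. [nsq_norm] and [nsq_le] compare the two, up to a factor n. *)
Definition nsq x : R := \sum_i x ord0 i * x ord0 i.

Lemma jsqE (a : V) t x : jv (jsq a) t x = nsq (x - a).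
Proof. by apply: eq_bigr => i _; rewrite !mxE. Qed.

Lemma jd_sq (a : V) i t x : jd (jsq a) i t x = 2 * (x - a) ord0 i.
Proof.
rewrite /= (bigD1 i) //= eqxx big1 ?addr0; first by rewrite !mxE /=; ring.
by move=> l li; rewrite eq_sym (negbTE li) !mulr0 addr0.
Qed.

Lemma heat_sq (a : V) t x : heat (jsq a) t x = - (2 * n%:R).
Proof.
rewrite heat_sum (eq_bigr (fun=> - 2)) => [|i _].
  by rewrite sumr_const card_ord -mulr_natr; ring.
rewrite heatM /heat /= big1 ?subr0 ?mulr0 ?addr0 ?add0r; last by [].
rewrite /grad2 /= (bigD1 i) //= eqxx big1 ?addr0; first by rewrite mulr1 mulr1.
by move=> l /negbTE ->; rewrite mulr0.
Qed.

Lemma grad2_sq (a : V) j t x : grad2 (jsq a) j t x = 2 * \sum_i (x - a) ord0 i * jd j i t x.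
Proof. by rewrite /grad2 mulr_sumr; apply: eq_bigr => i _; rewrite jd_sq mulrA. Qed.

Lemma nsq_ge0 x : 0 <= nsq x.
Proof. by apply: sumr_ge0 => i _; rewrite -expr2 sqr_ge0. Qed.

Lemma nsq_norm x : `|x| ^+ 2 <= nsq x.
Proof.
rewrite -(@ler_sqrt R) ?nsq_ge0 // sqrtr_sqr normr_id; apply: normV_le => [|i]; first exact: sqrtr_ge0.
rewrite -sqrtr_sqr ler_sqrt ?nsq_ge0 // /nsq (bigD1 i) //= expr2 lerDl.
by apply: sumr_ge0 => k _; rewrite -expr2 sqr_ge0.
Qed.

Lemma nsq_le x : nsq x <= n%:R * `|x| ^+ 2.
Proof.
have -> : n%:R * `|x| ^+ 2 = \sum_(i < n) `|x| ^+ 2 by rewrite sumr_const card_ord mulr_natl.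
apply: ler_sum => i _; rewrite -expr2 -(real_normK (num_real (x ord0 i))).
by apply: lerXn2r; rewrite ?nnegrE //; exact: normVE.
Qed.

End Jets.

(** * Uniform continuity and boundedness on compact cylinders *)

Section Compactness.
Context {R : realType} {n : nat}.
Local Notation V := 'rV[R]_n.
Implicit Types (F : R -> V -> R) (t s e d : R) (x y : V).

Lemma ucv_itv (a b : R) (t : nat -> R) : (forall k, a <= t k <= b) ->
  exists2 l, a <= l <= b & ucv t l.
Proof.
move=> h; have [|l hl] := @ucv_ex R t (`|a| + `|b|).
  apply: evE => k; have /andP[h1 h2] := h k.
  have := ler_norm a; have := ler_norm b; have := ler_norm (- a); have := ler_norm (- b).
  have := normr_ge0 a; have := normr_ge0 b; rewrite !normrN ler_norml => *; apply/andP; split; lra.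
exists l => //; apply/andP; split.
  by apply: ucv_ler hl _; apply: evE => k; have /andP[] := h k.
by apply: ucv_lel hl _; apply: evE => k; have /andP[] := h k.
Qed.

Lemma ucv_ball (x : nat -> V) (Y : R) : (forall k, `|x k| <= Y) ->
  exists2 l, `|l| <= Y & forall e, 0 < e -> ev (fun k => `|x k - l| < e).
Proof.
move=> h; have [|l hl] := @ucvV_ex R n x Y; first by apply: evE.
exists l => //; rewrite leNgt; apply/negP => hY.
have [|k hk] := ev_ex (hl (`|l| - Y) _); first by rewrite subr_gt0.
have := h k; have := ler_normD (l - x k) (x k); rewrite subrK distrC; lra.
Qed.

(** Only the base point (t, x) is confined to the compact cylinder; its neighbour (s, y) may leave
    it. This permits the degenerate interval a = b, where the result is uniformity in x of the joint
    continuity at one time. *)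
Lemma unif_cont2 F (a b Y : R) :
  (forall t x, a <= t <= b -> `|x| <= Y -> jc F t x) ->
  forall e, 0 < e -> exists2 d, 0 < d & forall t x s y, a <= t <= b -> `|x| <= Y ->
    `|s - t| < d -> `|y - x| < d -> `|F s y - F t x| < e.
Proof.
move=> hF e e0; apply: contrapT => hn.
have hk k : exists q : (R * V) * (R * V), [/\ a <= q.1.1 <= b, `|q.1.2| <= Y,
    `|q.2.1 - q.1.1| < k.+1%:R^-1, `|q.2.2 - q.1.2| < k.+1%:R^-1 &
    e <= `|F q.2.1 q.2.2 - F q.1.1 q.1.2|].
  apply: contrapT => hn2; apply: hn; exists (k.+1%:R^-1); first by rewrite invr_gt0.
  move=> t x s y h1 h2 h3 h4; rewrite ltNge; apply/negP => h5.
  by apply: hn2; exists ((t, x), (s, y)).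
have [q hq] := choice hk.
have [|t0 ht0 ct] := @ucv_itv a b (fun k => (q k).1.1); first by move=> k; have [] := hq k.
have [|x0 hx0 cx] := @ucv_ball (fun k => (q k).1.2) Y; first by move=> k; have [] := hq k.
have [d d0 hd] := hF t0 x0 ht0 hx0 _ (divr_gt0 e0 (ltr0Sn R 1)).
have d2 : 0 < d / 2 by sra d0.
have [k [[h1 h2] h3]] := ev_ex (evI (evI (ct _ d2) (cx _ d2)) (@ucv_inv R _ d2)).
have [_ _ h4 h5 h6] := hq k; move: h3; rewrite subr0 ger0_norm ?invr_ge0 //.
move: h4 h5; move: (k.+1%:R^-1) => w h4 h5 h3.
have a1 : `|F (q k).1.1 (q k).1.2 - F t0 x0| < e / 2 by apply: hd; sra d0 h1 h2.
have a2 : `|F (q k).2.1 (q k).2.2 - F t0 x0| < e / 2.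
  apply: hd.
    by have := ler_distD (q k).1.1 (q k).2.1 t0; sra h1 h3 h4.
  by have := ler_distD (q k).1.2 (q k).2.2 x0; sra h2 h3 h5.
have := ler_normB (F (q k).2.1 (q k).2.2 - F t0 x0) (F (q k).1.1 (q k).1.2 - F t0 x0).
have -> : F (q k).2.1 (q k).2.2 - F t0 x0 - (F (q k).1.1 (q k).1.2 - F t0 x0) =
  F (q k).2.1 (q k).2.2 - F (q k).1.1 (q k).1.2 by ring.
sra a1 a2 h6.
Qed.

Lemma bounded2 F (a b Y : R) :
  (forall t x, a <= t <= b -> `|x| <= Y -> jc F t x) ->
  exists C, forall t x, a <= t <= b -> `|x| <= Y -> `|F t x| <= C.
Proof.
move=> hF; apply: contrapT => hn.
have hk (k : nat) : exists q : R * V, [/\ a <= q.1 <= b, `|q.2| <= Y & k%:R < `|F q.1 q.2|].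
  apply: contrapT => hn2; apply: hn; exists k%:R => t x h1 h2.
  by rewrite leNgt; apply/negP => h5; apply: hn2; exists (t, x).
have [q hq] := choice hk.
have [|t0 ht0 ct] := @ucv_itv a b (fun k => (q k).1); first by move=> k; have [] := hq k.
have [|x0 hx0 cx] := @ucv_ball (fun k => (q k).2) Y; first by move=> k; have [] := hq k.
have [d d0 hd] := jc_bnd (hF t0 x0 ht0 hx0).
have [k [[h1 h2] h3]] := ev_ex (evI (evI (ct _ d0) (cx _ d0))
  (ev_ge (Num.truncn (`|F t0 x0| + 1)).+1)).
have [_ _] := hq k; have := hd _ _ h1 h2.
have /andP[_ h4] := truncn_itv (addr_ge0 (normr_ge0 (F t0 x0)) ler01).
move: h3; rewrite -(ler_nat R); sra h4.
Qed.

End Compactness.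

(** * The Gaussian mean as a limit of random walks *)

Section GaussianMean.
Context {R : realType} {n : nat}.
Local Notation V := 'rV[R]_n.
Implicit Types (phi psi : V -> R) (x y : V) (C c e d : R) (m : nat).

Definition cts phi x := forall e, 0 < e -> exists2 d, 0 < d &
  forall y, `|y - x| < d -> `|phi y - phi x| < e.

Lemma cts_jc phi x t : cts phi x -> jc (fun _ => phi) t x.
Proof. by move=> h e e0; have [d d0 hd] := h e e0; exists d => // s y _; exact: hd. Qed.

Lemma jc_cts (F : R -> V -> R) t x : jc F t x -> cts (F t) x.
Proof.
move=> h e e0; have [d d0 hd] := h e e0; exists d => // y; apply: hd.
by rewrite subrr normr0.
Qed.

Definition sgb (b : bool) : R := if b then 1 else -1.
(** Each coordinate of the walk is a sum of N + 1 independent signs; this step gives it variance 2,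
    as for the density proportional to exp(-y^2/4). *)
Definition stp (N : nat) : R := Num.sqrt (2 / N.+1%:R).
Definition walk N (w : {ffun 'I_n * 'I_N.+1 -> bool}) : V :=
  \row_i (stp N * \sum_j sgb (w (i, j))).
Definition walkE N phi : R :=
  (\sum_(w : {ffun 'I_n * 'I_N.+1 -> bool}) phi (walk w)) / (2 ^+ (n * N.+1)).

(* Mean of phi against the Gaussian density (4 pi)^(-n/2) exp(-|y|^2/4), obtained as a
   limit of random walks with time horizon 1 and generator the Laplacian *)
Definition gmean phi : R := ulim (fun N => walkE N phi).

(** Polynomial growth with explicit degree and constant. It serves as the domain of the mean:
    [walkE_bnd] bounds all walks uniformly in N on it, so the limit exists. *)
Definition pgr m C phi := forall y, `|phi y| <= C * (1 + `|y|) ^+ m.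
Definition PG phi := exists m C, pgr m C phi.

Lemma pgr_ge0 m C phi : pgr m C phi -> 0 <= C.
Proof.
move=> /(_ 0); rewrite normr0 addr0 expr1n mulr1; exact: le_trans.
Qed.

Lemma pgr_weak m m' C C' phi : (m <= m')%N -> C <= C' -> pgr m C phi -> pgr m' C' phi.
Proof.
move=> mm CC h y; apply: le_trans (h y) _; apply: ler_pM => //; first exact: pgr_ge0 h.
by apply: ler_weXn2l => //; rewrite lerDl.
Qed.

Lemma PGC c : PG (fun=> c).
Proof. by exists 0%N, `|c| => y; rewrite mulr1. Qed.

Lemma PG_coord i : PG (fun y => y ord0 i).
Proof.
exists 1%N, 1 => y; rewrite mul1r expr1; have := normVE y i; lra.
Qed.

Lemma PGD phi psi : PG phi -> PG psi -> PG (fun y => phi y + psi y).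
Proof.
move=> [m [C h]] [m' [C' h']]; exists (m + m')%N, (C + C') => y.
apply: le_normD; rewrite mulrDl; apply: lerD.
  exact: (pgr_weak (leq_addr _ _) (lexx _) h).
exact: (pgr_weak (leq_addl _ _) (lexx _) h').
Qed.

Lemma PGM phi psi : PG phi -> PG psi -> PG (fun y => phi y * psi y).
Proof.
move=> [m [C h]] [m' [C' h']]; exists (m + m')%N, (C * C') => y.
rewrite normrM exprD mulrACA; exact: ler_pM.
Qed.

Lemma PG_Z c phi : PG phi -> PG (fun y => c * phi y).
Proof. exact: PGM (PGC c). Qed.

Lemma PG_N phi : PG phi -> PG (fun y => - phi y).
Proof. by move=> [m [C h]]; exists m, C => y; rewrite normrN. Qed.

Lemma PG_B phi psi : PG phi -> PG psi -> PG (fun y => phi y - psi y).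
Proof. by move=> h1 h2; exact: PGD h1 (PG_N h2). Qed.

Lemma PG_sum (I : finType) (F : I -> V -> R) : (forall i, PG (F i)) -> PG (fun y => \sum_i F i y).
Proof.
move=> h; rewrite /index_enum; elim: (Finite.enum I) => [|a s [m [C ih]]].
  by exists 0%N, 0 => y; rewrite big_nil normr0 mul0r.
have [m' [C' h']] := PGD (h a) (ex_intro _ m (ex_intro _ C ih)).
by exists m', C' => y; rewrite big_cons; exact: h'.
Qed.

Lemma PG_bnd C phi : (forall y, `|phi y| <= C) -> PG phi.
Proof. by move=> h; exists 0%N, C => y; rewrite mulr1. Qed.

Section WalkE.
Variable N : nat.
Local Notation E := (walkE N).

Lemma walkE_D phi psi : E (fun y => phi y + psi y) = E phi + E psi.
Proof. by rewrite /walkE big_split mulrDl. Qed.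

Lemma walkE_Z c phi : E (fun y => c * phi y) = c * E phi.
Proof. by rewrite /walkE -mulr_sumr mulrA. Qed.

Lemma walkE_sum (I : finType) (F : I -> V -> R) : E (fun y => \sum_i F i y) = \sum_i E (F i).
Proof. by rewrite /walkE exchange_big /= mulr_suml. Qed.

Lemma walkE_le phi psi : (forall y, phi y <= psi y) -> E phi <= E psi.
Proof.
move=> h; rewrite /walkE ler_wpM2r //.
by apply: ler_sum.
Qed.

Lemma walkE_cst c : E (fun=> c) = c.
Proof.
rewrite /walkE sumr_const card_ffun card_bool card_prod !card_ord -[c *+ _]mulr_natr natrX.
by rewrite mulfK // expf_neq0.
Qed.

Lemma walkE_norm phi : `|E phi| <= E (fun y => `|phi y|).
Proof.
rewrite /walkE normrM [X in _ * X]ger0_norm ?invr_ge0 ?exprn_ge0 // ler_wpM2r //.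
exact: ler_norm_sum.
Qed.

Lemma stp_ge0 : 0 <= stp N. Proof. exact: sqrtr_ge0. Qed.

Lemma stp_sq : stp N ^+ 2 * N.+1%:R = 2.
Proof. by rewrite sqr_sqrtr ?divr_ge0 // divfK. Qed.

(** Exponential moments factorise by independence. The signs of the other coordinates contribute
    factors 1/2 + 1/2, and the sum over one sign is symmetric, so s = 1 and s = -1 give the same
    value. *)
Lemma walkE_exp (i : 'I_n) (s : R) : `|s| = 1 ->
  E (fun y => expR (s * y ord0 i)) = ((expR (stp N) + expR (- stp N)) / 2) ^+ N.+1.
Proof.
move=> s1.
have e1 (w : {ffun 'I_n * 'I_N.+1 -> bool}) : expR (s * walk w ord0 i) / 2 ^+ (n * N.+1) =
    \prod_(ij : 'I_n * 'I_N.+1) ((if ij.1 == i then expR (s * stp N * sgb (w ij)) else 1) / 2).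
  rewrite big_split /= prodr_const card_prod !card_ord exprVn; congr (_ * _).
  rewrite mxE mulrA mulr_sumr expR_sum.
  rewrite (eq_bigr (fun ij : 'I_n * 'I_N.+1 => (fun a b =>
    if a == i then expR (s * stp N * sgb (w (a, b))) else 1) ij.1 ij.2)); last by case.
  rewrite -(pair_bigA _ (fun a b =>
    if a == i then expR (s * stp N * sgb (w (a, b))) else 1)) /=.
  rewrite [RHS](bigD1 i) //= eqxx [X in _ = _ * X]big1 ?mulr1 // => a /negbTE ai.
  by rewrite big1 // => b _; rewrite ai.
rewrite /walkE mulr_suml (eq_bigr _ (fun w _ => e1 w)).
(* Independence as distributivity: the sum over all sign assignments of a product is the product of
   the two-term sums. *)
rewrite -(bigA_distr_bigA (fun (ij : 'I_n * 'I_N.+1) (b : bool) =>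
  (if ij.1 == i then expR (s * stp N * sgb b) else 1) / 2)) /=.
rewrite -(pair_bigA _ (fun a (_ : 'I_N.+1) =>
  \sum_(b : bool) (if a == i then expR (s * stp N * sgb b) else 1) / 2)) /=.
rewrite (bigD1 i) //= eqxx [X in _ * X]big1 ?mulr1 => [|a /negbTE ai].
  rewrite prodr_const card_ord; congr (_ ^+ _).
  rewrite big_bool /= mulr1 mulrN1 -mulrDl; congr (_ / _).
  have [s0|s0] := lerP 0 s.
    by move: s1; rewrite ger0_norm // => ->; rewrite mul1r.
  by move: s1; rewrite ltr0_norm // => /eqP; rewrite eqr_oppLR => /eqP ->;
    rewrite mulN1r opprK addrC.
rewrite big1 // => b _; rewrite big_bool /= ai -splitr //.
Qed.

End WalkE.

Lemma expR_taylor2 (h : R) : `|h| <= 2 -> expR h <= 1 + h + expR 2 * h ^+ 2.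
Proof.
move=> h2.
have [c hc e1] := @mvt_sym R expR expR 0 h (fun (r : R) _ => is_derive_expR r).
have [c' hc' e2] := @mvt_sym R expR expR 0 c (fun (r : R) _ => is_derive_expR r).
rewrite !subr0 expR0 in hc hc' e1 e2.
have -> : expR h = 1 + h + expR c' * (c * h).
  have -> : expR h = 1 + expR c * h by rewrite -e1; ring.
  have -> : expR c = 1 + expR c' * c by rewrite -e2; ring.
  ring.
rewrite lerD2l; apply: le_trans (ler_norm _) _; rewrite normrM ger0_norm ?expR_ge0 //.
apply: ler_pM; rewrite ?expR_ge0 //.
  by rewrite ler_expR; apply: le_trans (ler_norm _) _; exact: le_trans hc' (le_trans hc h2).
by rewrite normrM -(real_normK (num_real h)) expr2 ler_wpM2r.
Qed.

Lemma stp_le2 N : `|stp N| <= 2.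
Proof.
rewrite ger0_norm ?stp_ge0 // -[leRHS](@ger0_norm R) // -sqrtr_sqr ler_sqrt ?exprn_ge0 //.
rewrite ler_pdivrMr //; have : 1 <= N.+1%:R :> R by rewrite ler1n.
lra.
Qed.

Definition expK : R := expR (2 * expR 2).

(** In the average of exp(h) and exp(-h) the linear terms cancel, leaving at most 1 + exp(2) h^2 <=
    exp(exp(2) h^2); the power N + 1 turns h^2 into (N + 1) stp^2 = 2. Hence a bound uniform in
    N. *)
Lemma walkE_exp_le N (i : 'I_n) (s : R) : `|s| = 1 -> walkE N (fun y => expR (s * y ord0 i)) <= expK.
Proof.
move=> s1; rewrite walkE_exp //.
have h1 := expR_taylor2 (stp_le2 N); have h2 : `|- stp N| <= 2 by rewrite normrN stp_le2.
have {}h2 := expR_taylor2 h2.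
have h3 : (expR (stp N) + expR (- stp N)) / 2 <= expR (expR 2 * stp N ^+ 2).
  apply: le_trans (expR_ge1Dx _); move: h1 h2; rewrite sqrrN; lra.
apply: le_trans (_ : expR (expR 2 * stp N ^+ 2) ^+ N.+1 <= _).
  by apply: lerXn2r => //; rewrite nnegrE ?expR_ge0 // divr_ge0 // addr_ge0 // expR_ge0.
by rewrite -expRM_natl /expK ler_expR mulrCA [_ * stp N ^+ 2]mulrC stp_sq mulrC.
Qed.

Definition momK m : R := m`!%:R * expR 1 * (1 + n%:R * (2 * expK)).

(** The weight is at most m! exp(1 + |y|), and for the sup norm exp |y| is controlled by the
    exponentials of the coordinates and their opposites. The summand 1 makes the right side at least
    1, so that its logarithm can be compared with |y| coordinatewise. *)
Lemma wgt_le_exp m y : (1 + `|y|) ^+ m <=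
  m`!%:R * expR 1 * (1 + \sum_i (expR (1 * y ord0 i) + expR (-1 * y ord0 i))).
Proof.
have B1 : 1 <= 1 + \sum_i (expR (1 * y ord0 i) + expR (-1 * y ord0 i)).
  by rewrite lerDl; apply: sumr_ge0 => i _; rewrite addr_ge0 ?expR_ge0.
have h1 : expR `|y| <= 1 + \sum_i (expR (1 * y ord0 i) + expR (-1 * y ord0 i)).
  set B := 1 + _ in B1 *.
  have B0 : 0 < B by apply: lt_le_trans B1.
  rewrite -[leRHS](lnK B0) ler_expR; apply: normV_le; first exact: ln_ge0.
  move=> i; rewrite -ler_expR lnK //.
  have h : expR (1 * y ord0 i) + expR (-1 * y ord0 i) <= B.
    rewrite /B (bigD1 i) //= addrCA lerDl addr_ge0 //.
    by apply: sumr_ge0 => k _; rewrite addr_ge0 ?expR_ge0.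
  apply: le_trans h; rewrite mul1r mulN1r.
  by case: (ger0P (y ord0 i)) => _; rewrite ?lerDl ?lerDr expR_ge0.
have h2 : (1 + `|y|) ^+ m <= m`!%:R * expR (1 + `|y|).
  have y0 : 0 <= 1 + `|y| by rewrite addr_ge0.
  case: m => [|m]; first by rewrite mul1r expr0; apply: le_trans (expR_ge1Dx _); rewrite lerDl.
  have := expR_ge1Dxn m y0 => h.
  by rewrite mulrC -ler_pdivrMr //; apply: le_trans h; rewrite lerDr.
by apply: le_trans h2 _; rewrite expRD -mulrA ler_wpM2l // ler_wpM2l ?expR_ge0.
Qed.

Lemma walkE_wgt N m : walkE N (fun y => (1 + `|y|) ^+ m) <= momK m.
Proof.
apply: le_trans (walkE_le _ (wgt_le_exp m)) _.
rewrite walkE_Z walkE_D walkE_cst walkE_sum /momK ler_wpM2l ?mulr_ge0 ?expR_ge0 //.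
rewrite lerD2l; apply: le_trans (ler_sum _ (_ : forall i _, _ <= 2 * expK)) _.
  move=> i _; rewrite walkE_D mulr_natl mulr2n.
  by apply: lerD; apply: walkE_exp_le; rewrite ?normrN normr1.
by rewrite sumr_const card_ord [leRHS]mulr_natl.
Qed.

Lemma momK_ge0 m : 0 <= momK m.
Proof. by rewrite /momK !mulr_ge0 ?addr_ge0 ?expR_ge0 // !mulr_ge0 ?expR_ge0. Qed.

Lemma walkE_bnd N m C phi : pgr m C phi -> `|walkE N phi| <= C * momK m.
Proof.
move=> h; apply: le_trans (walkE_norm _ _) _; apply: le_trans (walkE_le _ h) _.
by rewrite walkE_Z ler_wpM2l ?walkE_wgt //; exact: pgr_ge0 h.
Qed.

Lemma gmeanP phi : PG phi -> ucv (fun N => walkE N phi) (gmean phi).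
Proof.
move=> [m [C h]]; apply: ulimP; apply: (@ucv_ex R _ (C * momK m)).
by apply: evE => N; exact: walkE_bnd.
Qed.

Lemma gmeanE phi psi : phi =1 psi -> gmean phi = gmean psi.
Proof. by move=> h; have -> : phi = psi by apply/funext. Qed.

Lemma gmeanD phi psi : PG phi -> PG psi -> gmean (fun y => phi y + psi y) = gmean phi + gmean psi.
Proof.
move=> h1 h2; apply: ulimE; apply: ucv_ext (ucvD (gmeanP h1) (gmeanP h2)).
by apply: evE => N; rewrite walkE_D.
Qed.

Lemma gmeanZ c phi : PG phi -> gmean (fun y => c * phi y) = c * gmean phi.
Proof.
move=> h1; apply: ulimE; apply: ucv_ext (ucvZ c (gmeanP h1)).
by apply: evE => N; rewrite walkE_Z.
Qed.

Lemma gmeanN phi : PG phi -> gmean (fun y => - phi y) = - gmean phi.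
Proof.
move=> h; rewrite -mulN1r -gmeanZ //; apply: gmeanE => y; by rewrite mulN1r.
Qed.

Lemma gmeanB phi psi : PG phi -> PG psi -> gmean (fun y => phi y - psi y) = gmean phi - gmean psi.
Proof. by move=> h1 h2; rewrite gmeanD ?gmeanN //; exact: PG_N. Qed.

Lemma gmean_sum (I : finType) (F : I -> V -> R) : (forall i, PG (F i)) ->
  gmean (fun y => \sum_i F i y) = \sum_i gmean (F i).
Proof.
move=> h; apply: ulimE; apply: ucv_ext (ucv_sum (fun i => gmeanP (h i))).
by apply: evE => N; rewrite walkE_sum.
Qed.

Lemma gmeanC c : gmean (fun=> c) = c.
Proof. by apply: ulimE; apply: ucv_ext (ucv_cst c); apply: evE => N; rewrite walkE_cst. Qed.

Lemma gmean_le phi psi : PG phi -> PG psi -> (forall y, phi y <= psi y) -> gmean phi <= gmean psi.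
Proof.
move=> h1 h2 h; apply: ucv_le (gmeanP h1) (gmeanP h2) _.
by apply: evE => N; exact: walkE_le.
Qed.

Lemma gmean_ge0 phi : PG phi -> (forall y, 0 <= phi y) -> 0 <= gmean phi.
Proof. by move=> h1 h; rewrite -(gmeanC 0); apply: gmean_le => //; exact: PGC. Qed.

Lemma gmean_bnd m C phi : pgr m C phi -> `|gmean phi| <= C * momK m.
Proof.
move=> h; apply: ucv_lel (ucv_norm (gmeanP (ex_intro _ m (ex_intro _ C h)))) _.
by apply: evE => N; exact: walkE_bnd.
Qed.

(** Outside the ball of radius Y one more power of the weight is inserted, through (1 + |y|)/(1 + Y)
    >= 1. In the mean, the tail therefore carries a factor 1/(1 + Y). *)
Lemma tail_wgt m C e (Y : R) phi : pgr m C phi -> 0 <= e -> 0 <= Y ->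
  (forall y, `|y| <= Y -> `|phi y| <= e) ->
  forall y, `|phi y| <= e + C / (1 + Y) * (1 + `|y|) ^+ m.+1.
Proof.
move=> h e0 Y0 hY y; have C0 := pgr_ge0 h; have Y1 : 0 < 1 + Y by lra.
have [/hY h1|h1] := lerP `|y| Y.
  by apply: le_trans h1 _; rewrite lerDl mulr_ge0 // divr_ge0 // ltW.
apply: le_trans (h y) _; apply: ler_wpDl => //.
rewrite exprS mulrA ler_wpM2r //.
rewrite -mulrA ler_peMr // mulrC ler_pdivlMr //; lra.
Qed.

Lemma walkE_tail N m C e (Y : R) phi : pgr m C phi -> 0 <= e -> 0 <= Y ->
  (forall y, `|y| <= Y -> `|phi y| <= e) -> `|walkE N phi| <= e + C / (1 + Y) * momK m.+1.
Proof.
move=> h e0 Y0 hY; apply: le_trans (walkE_norm _ _) _.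
apply: le_trans (walkE_le _ (tail_wgt h e0 Y0 hY)) _.
rewrite walkE_D walkE_cst walkE_Z lerD2l ler_wpM2l ?walkE_wgt //.
by rewrite divr_ge0 ?(pgr_ge0 h) // addr_ge0.
Qed.

Lemma gmean_tail m C e (Y : R) phi : pgr m C phi -> 0 <= e -> 0 <= Y ->
  (forall y, `|y| <= Y -> `|phi y| <= e) -> `|gmean phi| <= e + C / (1 + Y) * momK m.+1.
Proof.
move=> h e0 Y0 hY.
apply: ucv_lel (ucv_norm (gmeanP (ex_intro _ m (ex_intro _ C h)))) _.
by apply: evE => N; exact: walkE_tail.
Qed.

End GaussianMean.

(** * Stein's identity and faithfulness of the Gaussian mean *)

Section Stein.
Context {R : realType} {n : nat}.
Local Notation V := 'rV[R]_n.
Local Notation signs N := {ffun 'I_n * 'I_N -> bool}.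
Implicit Types (phi psi : V -> R) (x y : V) (C c e d : R) (m : nat).

Lemma unif_cont phi (Y : R) : (forall x, cts phi x) ->
  forall e, 0 < e -> exists2 d, 0 < d & forall x y, `|x| <= Y -> `|y - x| < d -> `|phi y - phi x| < e.
Proof.
move=> h e e0; have [|d d0 hd] := @unif_cont2 R n (fun _ => phi) 0 0 Y _ e e0.
  by move=> t x _ _; exact: cts_jc.
by exists d => // x y hx hy; apply: (hd 0 x 0 y) => //; rewrite ?lexx // subrr normr0.
Qed.

Definition flip (I : finType) (a : I) (w : {ffun I -> bool}) : {ffun I -> bool} :=
  [ffun b => if b == a then ~~ w b else w b].

Lemma flipK (I : finType) (a : I) : involutive (flip a).
Proof. by move=> w; apply/ffunP => b; rewrite !ffunE; case: eqP => // _; rewrite negbK. Qed.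

Lemma sgbN b : sgb (~~ b) = - sgb b :> R.
Proof. by case: b; rewrite /sgb ?opprK. Qed.

Lemma sgb_sq b : sgb b * sgb b = 1 :> R.
Proof. by case: b; rewrite /sgb ?mulrNN mulr1. Qed.

Lemma walk_flip N (i : 'I_n) (j : 'I_N.+1) w :
  walk (flip (i, j) w) = walk w - (2 * stp N * sgb (w (i, j))) *: evec R i.
Proof.
apply/rowP => k; rewrite !mxE eqxx /=.
have [->|ki] := eqVneq k i; last first.
  rewrite mulr0 subr0; congr (_ * _); apply: eq_bigr => l _.
  by rewrite ffunE xpair_eqE (negbTE ki).
rewrite mulr1 (bigD1 j) //= [in RHS](bigD1 j) //= ffunE eqxx sgbN.
have -> : \sum_(l < N.+1 | l != j) sgb (flip (i, j) w (i, l)) =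
    \sum_(l < N.+1 | l != j) sgb (w (i, l)) :> R.
  by apply: eq_bigr => l lj; rewrite ffunE xpair_eqE (negbTE lj) andbF.
ring.
Qed.

(** Discrete Stein identity. Flipping one sign is an involution of the sample space, so the mean of
    the sign times phi is half the mean of the sign times the difference of phi across the flip; by
    the mean value theorem this is stp times a nearby value of phi'. The N + 1 signs add up to the
    factor (N + 1) stp^2 = 2. The distance 4 stp is twice the flip length 2 stp, because [mvt_sym]
    locates its point only up to that length. *)
Lemma walkE_ibp N (i : 'I_n) phi (phi' : V -> R) :
  (forall y, pd (evec R i) phi y (phi' y)) ->
  forall w0 : V -> R, (forall y z, `|z - y| <= 4 * stp N -> `|phi' z - phi' y| <= w0 y) ->
  `|walkE N (fun y => y ord0 i * phi y) - 2 * walkE N phi'| <= 2 * walkE N w0.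
Proof.
move=> hphi w0 hw.
have s0 := @stp_ge0 R N.
pose D := 2 ^+ (n * N.+1) : R.
have e1 : walkE N (fun y => y ord0 i * phi y) =
    \sum_(j < N.+1) (\sum_(w : signs N.+1) stp N * (sgb (w (i, j)) * phi (walk w))) / D.
  rewrite /walkE -mulr_suml exchange_big /=; congr (_ / _); apply: eq_bigr => w _.
  by rewrite mxE -mulrA mulr_suml mulr_sumr.
have e2 (j : 'I_N.+1) : \sum_(w : signs N.+1) stp N * (sgb (w (i, j)) * phi (walk w)) =
    \sum_(w : signs N.+1) stp N / 2 * (sgb (w (i, j)) * (phi (walk w) - phi (walk (flip (i, j) w)))).
  have h : \sum_(w : signs N.+1) sgb (w (i, j)) * phi (walk w) =
      - \sum_(w : signs N.+1) sgb (w (i, j)) * phi (walk (flip (i, j) w)).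
    rewrite (reindex_inj (inv_inj (@flipK _ (i, j)))) -sumrN; apply: eq_bigr => w _.
    by rewrite ffunE eqxx sgbN mulNr.
  rewrite -!mulr_sumr (eq_bigr _ (fun w _ => mulrBr _ _ _)) sumrB.
  have -> : \sum_(w : signs N.+1) sgb (w (i, j)) * phi (walk (flip (i, j) w)) =
    - \sum_(w : signs N.+1) sgb (w (i, j)) * phi (walk w) by rewrite h opprK.
  by field.
have e3 (j : 'I_N.+1) (w : signs N.+1) : `|stp N / 2 * (sgb (w (i, j)) * (phi (walk w) - phi (walk (flip (i, j) w)))) -
    stp N ^+ 2 * phi' (walk w)| <= stp N ^+ 2 * w0 (walk w).
  rewrite walk_flip; set q := 2 * stp N * sgb (w (i, j)).
  have q2 : `|q| = 2 * stp N.
    have n1 b : `|sgb b : R| = 1 by case: b; rewrite /sgb ?normrN normr1.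
    by rewrite /q normrM n1 mulr1 ger0_norm // mulr_ge0.
  have [|c hc e] := @mvt_sym R (fun s => phi (walk w - q *: evec R i + s *: evec R i))
    (fun s => phi' (walk w - q *: evec R i + s *: evec R i)) 0 q.
    by move=> s _; apply: pd_shift.
  rewrite scale0r addr0 subrK !subr0 in hc e; rewrite e.
  have -> : stp N / 2 * (sgb (w (i, j)) * (phi' (walk w - q *: evec R i + c *: evec R i) * q)) =
      stp N ^+ 2 * phi' (walk w - q *: evec R i + c *: evec R i).
    rewrite /q; have := sgb_sq (w (i, j)); move: (sgb _ : R) => sg sg2.
    rewrite (_ : _ * (sg * _) = stp N ^+ 2 * phi' (walk w - (2 * stp N * sg) *: evec R i + c *: evec R i) * (sg * sg)).
      by rewrite sg2 mulr1.
    by field.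
  rewrite -mulrBr normrM ger0_norm ?sqr_ge0 // ler_wpM2l ?sqr_ge0 //; apply: hw.
  have -> : walk w - q *: evec R i + c *: evec R i - walk w = (c - q) *: evec R i.
    by apply/rowP => k; rewrite !mxE; ring.
  rewrite normrZ norm_evec mulr1; have := ler_normB c q; lra.
have DE psi : walkE N psi = (\sum_(w : signs N.+1) psi (walk w)) / D by [].
have s2 : stp N ^+ 2 * N.+1%:R = 2 :> R := @stp_sq R N.
have e4 psi : 2 * walkE N psi =
    \sum_(j < N.+1) (\sum_(w : signs N.+1) stp N ^+ 2 * psi (walk w)) / D.
  by rewrite sumr_const card_ord -mulr_sumr -mulrA -DE -[RHS]mulr_natr -s2; ring.
rewrite e1 e4 -sumrB (e4 w0); apply: le_norm_sum.
apply: ler_sum => j _; rewrite -mulrBl normrM [X in _ * X]ger0_norm; last first.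
  by rewrite invr_ge0 exprn_ge0.
rewrite ler_wpM2r ?invr_ge0 ?exprn_ge0 // e2 -sumrB.
by apply: le_norm_sum; apply: ler_sum.
Qed.

Lemma stp_small e : 0 < e -> ev (fun N => stp N < e).
Proof.
move=> e0; have e2 : 0 < e ^+ 2 / 2 by rewrite divr_gt0 // exprn_gt0.
apply: evS (@ucv_inv R _ e2) => N; rewrite subr0 ger0_norm ?invr_ge0 // => h.
rewrite -(@ger0_norm R e) ?ltW // -sqrtr_sqr ltr_sqrt ?exprn_gt0 //.
by move: h; move: (N.+1%:R^-1) => w h; lra.
Qed.

Lemma small_div (A e : R) : 0 <= A -> 0 < e -> exists2 Y : R, 0 <= Y & A / (1 + Y) <= e.
Proof.
move=> A0 e0; exists (A / e); first by rewrite divr_ge0 // ltW.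
have h : 0 <= A / e by rewrite divr_ge0 // ltW.
rewrite ler_pdivrMr; last lra.
by rewrite mulrDr mulrCA divff ?gt_eqF // mulr1; lra.
Qed.

Lemma pgr_shift m C phi : pgr m C phi -> forall y z, `|z - y| <= 8 ->
  `|phi z - phi y| <= C * (9 ^+ m + 1) * (1 + `|y|) ^+ m.
Proof.
move=> h y z hz; have C0 := pgr_ge0 h.
apply: le_normB; rewrite mulrDr mulr1 mulrDl; apply: lerD; last exact: h.
apply: le_trans (h z) _; rewrite -mulrA ler_wpM2l // -exprMn.
have y0 := normr_ge0 y; have z0 := normr_ge0 z.
apply: lerXn2r; rewrite ?nnegrE ?mulr_ge0 ?addr_ge0 //.
have := ler_normD (z - y) y; rewrite subrK; lra.
Qed.

(** Limit of [walkE_ibp]: in a large ball the oscillation of phi' over the vanishing step is small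
    by uniform continuity; outside, the polynomial growth is absorbed by one extra power of the
    weight. *)
Lemma gmean_ibp (i : 'I_n) phi (phi' : V -> R) : PG phi -> PG phi' ->
  (forall y, pd (evec R i) phi y (phi' y)) -> (forall y, cts phi' y) ->
  gmean (fun y => y ord0 i * phi y) = 2 * gmean phi'.
Proof.
move=> h1 [m [C h2]] hpd hc; have C0 := pgr_ge0 h2.
have h3 := PGM (PG_coord i) h1.
have h2' : PG phi' by exists m, C.
apply: (ucv_uniq (gmeanP h3)).
have : ucv (fun N => walkE N (fun y => y ord0 i * phi y) - 2 * walkE N phi') 0.
  move=> e e0; have e4 : 0 < e / 8 by lra.
  set C' := C * (9 ^+ m + 1).
  have C'0 : 0 <= C' by rewrite mulr_ge0 // addr_ge0 // exprn_ge0.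
  have [Y Y0 hY] := small_div (mulr_ge0 C'0 (@momK_ge0 R n m.+1)) e4.
  have [d d0 hd] := unif_cont Y hc e4.
  have d4 : 0 < d / 4 by lra.
  apply: evS (stp_small d4) => N hN; rewrite subr0.
  have s0 := @stp_ge0 R N.
  have hw y z : `|z - y| <= 4 * stp N -> `|phi' z - phi' y| <= e / 8 + C' / (1 + Y) * (1 + `|y|) ^+ m.+1.
    move=> hz; have z8 : `|z - y| <= 8.
      by apply: le_trans hz _; have := @stp_le2 R N; rewrite ger0_norm //; sra.
    have Y1 : 0 < 1 + Y by sra Y0.
    have [hy|hy] := lerP `|y| Y.
      apply: ler_wpDr; first by rewrite mulr_ge0 ?divr_ge0 ?exprn_ge0 ?addr_ge0.
      by apply/ltW/hd => //; sra hN hz.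
    apply: le_trans (pgr_shift h2 z8) _; apply: ler_wpDl; first sra e0.
    rewrite -/C' exprS mulrA ler_wpM2r ?exprn_ge0 ?addr_ge0 //.
    by rewrite -mulrA ler_peMr // mulrC ler_pdivlMr //; sra hy.
  apply: le_lt_trans (walkE_ibp hpd hw) _.
  have hb : walkE N (fun y => e / 8 + C' / (1 + Y) * (1 + `|y|) ^+ m.+1) <= e / 8 + e / 8.
    rewrite walkE_D walkE_cst walkE_Z lerD2l; apply: le_trans _ hY.
    by rewrite mulrAC ler_wpM2r ?invr_ge0 ?addr_ge0 // ler_wpM2l // walkE_wgt.
  by sra e0 hb.
move=> /(ucvD (ucvZ 2 (gmeanP h2'))); rewrite addr0; apply: ucv_ext.
by apply: evE => N; ring.
Qed.

(** Differentiation under the mean: in a ball the difference quotients converge uniformly by joint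
    continuity of [Fs] at time s0, and the common growth bound controls the rest. *)
Lemma gmean_deriv (F Fs : R -> V -> R) (s0 r : R) m C : 0 < r ->
  (forall s y, `|s - s0| < r -> is_derive s 1 (F ^~ y) (Fs s y)) ->
  (forall y, jc Fs s0 y) ->
  (forall s, `|s - s0| < r -> pgr m C (Fs s)) -> (forall s, `|s - s0| < r -> PG (F s)) ->
  is_derive s0 1 (fun s => gmean (F s)) (gmean (Fs s0)).
Proof.
move=> r0 hF hc hFs hPG; apply/derP => e e0.
have s00 : `|s0 - s0| < r by rewrite subrr normr0.
have C0 := pgr_ge0 (hFs _ s00).
have e2 : 0 < e / 2 by lra.
have C2 : 0 <= 2 * C * @momK R n m.+1 by apply: mulr_ge0; [rewrite mulr_ge0|exact: momK_ge0].
have [Y Y0 hY] := small_div C2 e2.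
have [|d d0 hd] := @unif_cont2 R n Fs s0 s0 Y _ _ e2.
  by move=> t x /andP[t1 t2] _; have -> : t = s0 by apply/eqP; rewrite eq_le t1 t2.
exists (Num.min d r); first by rewrite lt_min d0.
move=> h; rewrite lt_min => /andP[hd1 hr1].
have hs : `|s0 + h - s0| < r by rewrite addrC addKr.
have P0 : PG (Fs s0) by exists m, C; exact: hFs.
rewrite mulrC -gmeanZ // -gmeanB; [|exact: hPG..].
rewrite -gmeanB; [|apply: PG_B; exact: hPG|exact: PG_Z].
have key y : exists2 c, `|c - s0| <= `|h| &
    F (s0 + h) y - F s0 y - h * Fs s0 y = h * (Fs c y - Fs s0 y).
  have [|c hc' ec] := @mvt_sym R (F^~ y) (Fs^~ y) s0 (s0 + h).
    by move=> x hx; apply: hF; apply: le_lt_trans hx _; rewrite addrC addKr.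
  rewrite addrCK in hc' ec; exists c => //.
  by rewrite ec; ring.
have := @gmean_tail R n m (`|h| * (2 * C)) (`|h| * (e / 2)) Y
  (fun y => F (s0 + h) y - F s0 y - h * Fs s0 y).
have q1 : pgr m (`|h| * (2 * C)) (fun y => F (s0 + h) y - F s0 y - h * Fs s0 y).
  move=> y; have [c hc' ->] := key y; rewrite normrM -mulrA ler_wpM2l //.
  have := hFs c (le_lt_trans hc' hr1) y; have := hFs s0 s00 y.
  by have := ler_normB (Fs c y) (Fs s0 y); sra.
have q2 y : `|y| <= Y -> `|F (s0 + h) y - F s0 y - h * Fs s0 y| <= `|h| * (e / 2).
  move=> hy; have [c hc' ->] := key y; rewrite normrM ler_wpM2l //; apply/ltW.
  by apply: (hd s0 y c y) => //; rewrite ?lexx ?subrr ?normr0 //; exact: le_lt_trans hc' _.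
have q3 : 0 <= `|h| * (e / 2) by rewrite mulr_ge0 // ltW.
move=> /(_ q1 q3 Y0 q2) q4; apply: le_trans q4 _.
have -> : `|h| * (2 * C) / (1 + Y) * @momK R n m.+1 = `|h| * (2 * C * @momK R n m.+1 / (1 + Y)) by ring.
have -> : e * `|h| = `|h| * (e / 2) + `|h| * (e / 2) by field.
by rewrite lerD2l ler_wpM2l.
Qed.

Lemma dpos (k : nat) (x : R) :
  is_derive x 1 (fun q => Num.max 0 q ^+ k.+2) (k.+2%:R * Num.max 0 x ^+ k.+1).
Proof.
have [x0|x0|x0] := ltgtP x 0.
- rewrite ?(max_idPl (ltW x0)) expr0n mulr0; apply: der_ext (dcst 0 x).
  exists (- x); first lra.
  move=> h; rewrite ltr_norml => /andP[_ hh]; rewrite (max_idPl _) ?expr0n //; lra.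
- rewrite ?(max_idPr (ltW x0)).
  have := @is_deriveX R R (fun q => q) k.+2 x 1 1 (did x).
  rewrite /GRing.scale /= mulr1; apply: der_ext; exists x => // h.
  rewrite ltr_norml => /andP[hh _].
  have hx : 0 <= x + h by lra.
  by rewrite (max_idPr hx) fctE.
- rewrite x0 ?maxxx expr0n mulr0; apply/derP => e e0.
  exists (Num.min 1 e); first by rewrite lt_min ltr01.
  move=> h; rewrite lt_min => /andP[h1 h2].
  rewrite add0r maxxx expr0n mul0r !subr0 normrX.
  have h3 : `|Num.max 0 h| <= `|h|.
    by case: (lerP 0 h) => _; rewrite ?normr0.
  apply: le_trans (_ : `|h| ^+ k.+2 <= _); first by apply: lerXn2r; rewrite ?nnegrE.
  rewrite exprSr ler_wpM2r // exprS; apply: le_trans (_ : `|h| * 1 <= _); last by rewrite mulr1 ltW.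
  by rewrite ler_wpM2l // exprn_ile1 // ltW.
Qed.

Lemma pd_nsq (a : V) i y : pd (evec R i) (fun y => nsq (y - a)) y (2 * (y - a) ord0 i).
Proof.
rewrite -(jd_sq a i 0 y); have := c_d (C12_sq a 0 y) i.
by have -> : jv (jsq a) 0 = (fun y => nsq (y - a)) by apply/funext => z; exact: jsqE.
Qed.

Lemma cts_comp (p : R -> R) phi y : ctsat p (phi y) -> cts phi y -> cts (fun y => p (phi y)) y.
Proof. by move=> hp h e e0; have [d d0 hd] := hp e e0; have [d' d0' hd'] := h d d0; exists d' => // z hz; apply: hd; exact: hd'. Qed.

Lemma cts_pd phi (f' : 'I_n -> V -> R) y : (forall i y, pd (evec R i) phi y (f' i y)) ->
  (forall i, cts (f' i) y) -> cts phi y.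
Proof.
move=> h1 h2; have [|||d d0 hd] := @increment2 R n (fun _ => phi) (fun _ _ => 0) (fun i _ => f' i) 0 y _ _ _ 1 ltr01.
- by exists 1 => // s z _ _; split => [|i]; [exact: dcst|exact: h1].
- exact: jc_cst.
- by move=> i; apply: cts_jc; exact: h2.
pose K := 1 + \sum_i `|f' i y|.
have K0 : 0 < K by rewrite ltr_pwDl // sumr_ge0.
move=> e e0; exists (Num.min d (e / K)); first by rewrite lt_min d0 divr_gt0.
move=> z; rewrite lt_min => /andP[z1]; rewrite ltr_pdivlMr // => z2.
have := hd 0 z; rewrite subrr normr0 mul0r subr0 add0r mul1r => /(_ d0 z1) h3.
have h4 : `|\sum_i (z - y) ord0 i * f' i y| <= `|z - y| * \sum_i `|f' i y|.
  apply: le_norm_sum; rewrite mulr_sumr; apply: ler_sum => i _.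
  by rewrite normrM ler_wpM2r // normVE.
have := ler_normD (phi z - phi y - \sum_i (z - y) ord0 i * f' i y) (\sum_i (z - y) ord0 i * f' i y).
by rewrite subrK; move: z2; rewrite /K mulrDr mulr1; sra h3 h4.
Qed.


(** Squaring the positive part makes the bump C^1, as Stein's identity requires. *)
Definition bump (r : R) (v y : V) : R := Num.max 0 (r ^+ 2 - nsq (y - v)) ^+ 2.
Definition dbump (r : R) (v : V) (i : 'I_n) (y : V) : R :=
  2 * Num.max 0 (r ^+ 2 - nsq (y - v)) * - (2 * (y - v) ord0 i).

Lemma bump_ge0 r v y : 0 <= bump r v y.
Proof. by rewrite /bump sqr_ge0. Qed.

Lemma bump_supp r v y : 0 < r -> r <= `|y - v| -> Num.max 0 (r ^+ 2 - nsq (y - v)) = 0.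
Proof.
move=> r0 h; apply/max_idPl; rewrite subr_le0; apply: le_trans (nsq_norm _).
by apply: lerXn2r; rewrite ?nnegrE // ltW.
Qed.

Lemma max_le_r2 r v y : Num.max 0 (r ^+ 2 - nsq (y - v)) <= r ^+ 2.
Proof. by rewrite ge_max sqr_ge0 /= gerBl nsq_ge0. Qed.

Lemma bump_le r v y : bump r v y <= r ^+ 4.
Proof.
have -> : r ^+ 4 = (r ^+ 2) ^+ 2 by rewrite -exprM.
apply: lerXn2r; rewrite ?nnegrE ?sqr_ge0 ?le_max ?lexx //; exact: max_le_r2.
Qed.

Lemma pd_bump r v i y : pd (evec R i) (bump r v) y (dbump r v i y).
Proof.
apply: (@pdcomp R n (evec R i) (fun q => Num.max 0 q ^+ 2)
  (fun y => r ^+ 2 - nsq (y - v)) y); first by have := dpos 0 (r ^+ 2 - nsq (y - v)); rewrite expr1.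
have hn : pd (evec R i) (fun y => - nsq (y - v)) y (- (2 * (y - v) ord0 i)) by exact: dN (pd_nsq v i y).
have := pdD (pdcst (evec R i) (r ^+ 2) y) hn.
by rewrite add0r.
Qed.

Lemma cts_coord (v : V) i y : cts (fun y => (y - v) ord0 i) y.
Proof.
move=> e e0; exists e => // z hz; apply: le_lt_trans hz.
by have := normVE (z - y) i; rewrite !mxE; congr (`|_| <= _); ring.
Qed.

Lemma max_cts (x : R) : ctsat (fun q => Num.max 0 q) x.
Proof.
move=> e e0; exists e => // y hy; apply: le_lt_trans hy.
case: (lerP 0 x) => hx; case: (lerP 0 y) => hy //; rewrite ?subr0 ?sub0r ?normrN ?subrr ?normr0 //.
- by rewrite ger0_norm // ler0_norm; lra.
- by rewrite ger0_norm // ger0_norm; lra.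
Qed.

Lemma cts_jcN phi y : cts phi y <-> jc (fun _ => phi) 0 y.
Proof. by split => [|h]; [exact: cts_jc|exact: (jc_cts h)]. Qed.

Lemma cts_nsq (v : V) y : cts (fun y => nsq (y - v)) y.
Proof. by apply: cts_pd => [i z|i]; [exact: pd_nsq|]; apply/cts_jcN/jcZ/cts_jc/cts_coord. Qed.

Lemma cts_max r v y : cts (fun y => Num.max 0 (r ^+ 2 - nsq (y - v))) y.
Proof.
apply: (@cts_comp (fun q => Num.max 0 (r ^+ 2 - q)) (fun y => nsq (y - v))); last exact: cts_nsq.
move=> e e0; have [d d0 hd] := @max_cts (r ^+ 2 - nsq (y - v)) e e0; exists d => // z hz.
apply: hd; have -> : r ^+ 2 - z - (r ^+ 2 - nsq (y - v)) = - (z - nsq (y - v)) by ring.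
by rewrite normrN.
Qed.

Lemma cts_dbump r v i y : cts (dbump r v i) y.
Proof.
apply/cts_jcN/jcM; first by apply/jcZ/cts_jc/cts_max.
by apply/jcN/jcZ/cts_jc/cts_coord.
Qed.

Lemma PG_bump r v : PG (bump r v).
Proof. by apply: (@PG_bnd _ _ (r ^+ 4)) => y; rewrite ger0_norm ?bump_ge0 // bump_le. Qed.

Lemma dbump_le r v i y : 0 < r -> `|dbump r v i y| <= 4 * r ^+ 3.
Proof.
move=> r0; rewrite /dbump; have [h|h] := lerP r `|y - v|.
  by rewrite bump_supp // mulr0 mul0r normr0 mulr_ge0 // exprn_ge0 // ltW.
rewrite !normrM normrN normrM (@ger0_norm R 2) //.
have -> : 4 * r ^+ 3 = 2 * r ^+ 2 * (2 * r) by ring.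
apply: ler_pM; rewrite ?mulr_ge0 //.
  by rewrite ler_wpM2l // ger0_norm ?max_le_r2 // le_max lexx.
by rewrite ler_wpM2l //; apply: le_trans (normVE _ _) _; exact: ltW.
Qed.

Lemma PG_dbump r v i : 0 < r -> PG (dbump r v i).
Proof. by move=> r0; apply: (@PG_bnd _ _ (4 * r ^+ 3)) => y; exact: dbump_le. Qed.

Lemma gmean_bump_deriv r (v w : V) (l : R) : 0 < r ->
  is_derive l 1 (fun s => gmean (bump r (v + s *: w)))
    (gmean (fun y => - \sum_i w ord0 i * dbump r (v + l *: w) i y)).
Proof.
move=> r0.
pose Fs (s : R) (y : V) := - \sum_i w ord0 i * dbump r (v + s *: w) i y.
have B s y : `|Fs s y| <= \sum_i `|w ord0 i| * (4 * r ^+ 3).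
  rewrite normrN; apply: le_norm_sum; apply: ler_sum => i _.
  by rewrite normrM ler_wpM2l // dbump_le.
apply: (@gmean_deriv (fun s => bump r (v + s *: w)) Fs l 1 0%N (\sum_i `|w ord0 i| * (4 * r ^+ 3))) => //.
- move=> s y _.
  have -> : Fs s y = 2 * Num.max 0 (r ^+ 2 - nsq (y - (v + s *: w))) *
     (2 * \sum_i w ord0 i * (y - (v + s *: w)) ord0 i).
    rewrite /Fs -sumrN !mulr_sumr; apply: eq_bigr => i _; rewrite /dbump; ring.
  apply: (@dcomp R (fun q => Num.max 0 q ^+ 2) (fun s => r ^+ 2 - nsq (y - (v + s *: w)))).
    by have := dpos 0 (r ^+ 2 - nsq (y - (v + s *: w))); rewrite expr1.
  rewrite -[X in is_derive _ _ _ X]opprK; rewrite -[- - _]add0r.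
  apply: dB (dcst _ _) _.
  have -> : - (2 * \sum_i w ord0 i * (y - (v + s *: w)) ord0 i) =
     \sum_i ((y - (v + s *: w)) ord0 i * - w ord0 i + (y - (v + s *: w)) ord0 i * - w ord0 i).
    by rewrite mulr_sumr -sumrN; apply: eq_bigr => i _; ring.
  apply: dsum => i.
  have h : is_derive s 1 (fun s => (y - (v + s *: w)) ord0 i) (- w ord0 i).
    have := dB (dcst (y ord0 i - v ord0 i) s) (dM (did s) (dcst (w ord0 i) s)).
    rewrite mulr0 add0r mulr1 ?sub0r ?add0r; apply: der_ext; exists 1 => // q _.
    by rewrite !mxE; ring.
  exact: (dM h h).
- move=> y; apply/jcN/jc_sum => i; apply: jcZ.
  have : jc (fun (_ : R) z => dbump r 0 i z) 0 (y - (v + l *: w)).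
    by apply: cts_jc; exact: cts_dbump.
  move=> h e e0; have [d d0 hd] := h e e0.
  pose K := 1 + `|w|; have K0 : 0 < K by rewrite /K; have := normr_ge0 w; lra.
  exists (d / (2 * K)); first by rewrite divr_gt0 // mulr_gt0.
  move=> s z hs hz.
  have bE q (x : V) : dbump r q i x = dbump r 0 i (x - q) by rewrite /dbump subr0.
  rewrite (bE (v + s *: w)) (bE (v + l *: w)); apply: (hd 0); first by rewrite subrr normr0.
  have -> : z - (v + s *: w) - (y - (v + l *: w)) = (z - y) - (s - l) *: w.
    by rewrite scalerBl; apply/rowP => k; rewrite !mxE; ring.
  apply: le_lt_trans (ler_normB _ _) _; rewrite normrZ.
  move: hs hz; rewrite !ltr_pdivlMr ?mulr_gt0 // /K.
  by have := normr_ge0 w; have := normr_ge0 (s - l); have := normr_ge0 (z - y); nra.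
- by move=> s _ y; rewrite mulr1; exact: B.
- by move=> s _; exact: PG_bump.
Qed.

(** Gronwall's argument along the segment from v to v + w. Stein's identity turns the derivative of
    the mean J into means of y_i times the bump, and |y_i| <= |v| + |w| + r on its support; so |J'|
    <= K J and J stays 0. *)
Lemma gmean_bump0 r (v w : V) : 0 < r -> gmean (bump r v) = 0 -> gmean (bump r (v + w)) = 0.
Proof.
move=> r0 hv.
pose J (s : R) := gmean (bump r (v + s *: w)).
pose J' (l : R) := gmean (fun y => - \sum_i w ord0 i * dbump r (v + l *: w) i y).
have dJ (l : R) : is_derive l 1 J (J' l) by exact: gmean_bump_deriv.
have J0 s : 0 <= J s by apply: gmean_ge0; [exact: PG_bump|exact: bump_ge0].
pose K := \sum_i `|w ord0 i| * (`|v| + `|w| + r).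
have bJ (l : R) : 0 <= l <= 1 -> `|J' l| <= K * J l.
  move=> /andP[l0 l1].
  rewrite /J' gmeanN; last by apply: PG_sum => i; apply: PG_Z; exact: PG_dbump.
  rewrite gmean_sum; last by move=> i; apply: PG_Z; exact: PG_dbump.
  rewrite normrN /K mulr_suml; apply: le_norm_sum.
  apply: ler_sum => i _; rewrite gmeanZ; last exact: PG_dbump.
  rewrite normrM -mulrA ler_wpM2l //.
  have -> : gmean (dbump r (v + l *: w) i) = 2^-1 * gmean (fun y => y ord0 i * bump r (v + l *: w) y).
    rewrite (@gmean_ibp i _ (dbump r (v + l *: w) i)) ?mulKf //.
    - exact: PG_bump.
    - exact: PG_dbump.
    - by move=> y; exact: pd_bump.
    - by move=> y; exact: cts_dbump.
  have P1 : PG (fun y : V => y ord0 i * bump r (v + l *: w) y).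
    by apply: PGM; [exact: PG_coord|exact: PG_bump].
  have P2 : PG (fun y => (`|v| + `|w| + r) * bump r (v + l *: w) y) by apply: PG_Z; exact: PG_bump.
  have b y : `|y ord0 i * bump r (v + l *: w) y| <= (`|v| + `|w| + r) * bump r (v + l *: w) y.
    rewrite normrM (ger0_norm (bump_ge0 _ _ _)).
    have [h|h] := lerP r `|y - (v + l *: w)|.
      by rewrite /bump bump_supp // expr0n !mulr0.
    rewrite ler_wpM2r ?bump_ge0 //; apply: le_trans (normVE _ _) _.
    have := ler_normD (y - (v + l *: w)) (v + l *: w); rewrite subrK.
    have := ler_normD v (l *: w); rewrite normrZ (ger0_norm l0).
    by have := normr_ge0 w; nra.
  have Jr : 0 <= (`|v| + `|w| + r) * J l by rewrite mulr_ge0 // !addr_ge0 // ltW.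
  suff : `|gmean (fun y : V => y ord0 i * bump r (v + l *: w) y)| <= (`|v| + `|w| + r) * J l.
    by rewrite normrM ger0_norm ?invr_ge0 // => h; lra.
  rewrite -gmeanZ; last exact: PG_bump.
  rewrite ler_norml -gmeanN //; apply/andP; split; apply: gmean_le => //; first exact: PG_N.
    by move=> y; have := b y; rewrite ler_norml => /andP[].
  by move=> y; have := b y; rewrite ler_norml => /andP[].
have := @derive_mono R (fun s => - (expR (- K * s) * J s))
  (fun s => - (expR (- K * s) * J' s + J s * (expR (- K * s) * - K))) 0 1 ler01.
have h1 (x : R) : 0 <= x <= 1 -> is_derive x 1 (fun s => - (expR (- K * s) * J s))
   (- (expR (- K * x) * J' x + J x * (expR (- K * x) * - K))).
  move=> _; apply: dN; apply: dM => //.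
  have q2 : is_derive x 1 (fun s : R => - K * s) (- K) by have := dZ (- K) (did x); rewrite mulr1.
  exact: (dcomp (is_derive_expR (- K * x)) q2).
have h2 (x : R) : 0 <= x <= 1 -> 0 <= - (expR (- K * x) * J' x + J x * (expR (- K * x) * - K)).
  move=> hx; have -> : - (expR (- K * x) * J' x + J x * (expR (- K * x) * - K)) =
    expR (- K * x) * (K * J x - J' x) by ring.
  rewrite mulr_ge0 ?expR_ge0 // subr_ge0; apply: le_trans (ler_norm _) _; exact: bJ.
move=> /(_ h1 h2); rewrite /J scale0r addr0 hv mulr0 oppr0 scale1r oppr_ge0.
rewrite mulr1 pmulr_rle0 ?expR_gt0 // => h3.
by apply/eqP; rewrite eq_le h3; have := J0 1; rewrite /J scale1r.
Qed.

Lemma gmean_sq (i : 'I_n) : gmean (fun y : V => y ord0 i * y ord0 i) = 2.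
Proof.
rewrite (@gmean_ibp i (fun y => y ord0 i) (fun=> 1)).
- by rewrite gmeanC mulr1.
- exact: PG_coord.
- exact: PGC.
- move=> y; have := pd_lin (evec R i) i 0 y; rewrite evecE eqxx.
  by apply: pd_ext; exists 1 => // z _; rewrite subr0.
- by move=> y e e0; exists 1 => // z _; rewrite subrr normr0.
Qed.

(** If phi were positive somewhere, some bump would have mean 0, hence by [gmean_bump0] all its
    translates would. Finitely many of them cover a large cube, which would then carry no mass; but
    by Chebyshev's inequality the second moment 2 n leaves mass in the cube. *)
Lemma gmean_faithful phi : PG phi -> (forall y, cts phi y) -> (forall y, 0 <= phi y) ->
  gmean phi = 0 -> forall y, phi y = 0.
Proof.
move=> hP hc h0 hg y0; apply/eqP; rewrite eq_le h0 andbT leNgt; apply/negP => p0.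
have [r r0 hr] := hc y0 (phi y0 / 2) (divr_gt0 p0 (ltr0Sn R 1)).
have r4 : 0 < r ^+ 4 by rewrite exprn_gt0.
have B0 v : gmean (bump r v) = 0.
  have -> : v = y0 + (v - y0) by rewrite addrBC.
  apply: gmean_bump0 => //; apply/eqP; rewrite eq_le.
  rewrite (gmean_ge0 (PG_bump _ _) (bump_ge0 _ _)) andbT.
  have c0 : 0 < phi y0 / 2 / r ^+ 4 by rewrite !divr_gt0.
  rewrite -(pmulr_rle0 _ c0) -gmeanZ; last exact: PG_bump.
  rewrite -hg; apply: gmean_le => //; first by apply: PG_Z; exact: PG_bump.
  move=> y; have [h|h] := lerP r `|y - y0|; first by rewrite /bump bump_supp // expr0n mulr0.
  have := hr y h; rewrite ltr_norml => /andP[h1 _].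
  apply: le_trans (_ : phi y0 / 2 <= _); last lra.
  by rewrite mulrAC ler_pdivrMr // ler_wpM2l ?bump_le // divr_ge0 // ltW.
(* For |y| > Y the square exceeds 4 n + 4, so that 1 - |y|^2/(4 n + 4) is negative there, while its
   mean is 1 - 2 n/(4 n + 4) > 0. *)
pose Y : R := 2 * n%:R + 2.
(* Mesh of the grid of centres: n d^2 <= r^2/2 puts every point of the cube well inside some
   bump. *)
pose d : R := r / (2 * (n%:R + 1)).
have n0 : 0 <= n%:R :> R by [].
have d0 : 0 < d by rewrite divr_gt0 // mulr_gt0 //; lra.
pose M := (Num.truncn (2 * Y / d)).+1.
pose ctr (f : {ffun 'I_n -> 'I_M}) : V := \row_i ((f i)%:R * d - Y).
have cover y : `|y| <= Y -> exists f, r ^+ 4 / 4 <= bump r (ctr f) y.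
  move=> hy.
  have hi i : 0 <= (y ord0 i + Y) / d <= 2 * Y / d.
    have := le_trans (normVE y i) hy; rewrite ler_norml => /andP[h1 h2].
    apply/andP; split; first by apply: divr_ge0; [lra|exact: ltW].
    by rewrite ler_pM2r ?invr_gt0 //; lra.
  have hM i : (Num.truncn ((y ord0 i + Y) / d) < M)%N.
    by rewrite ltnS; apply: le_truncn; have /andP[] := hi i.
  exists [ffun i => Ordinal (hM i)].
  have hn : nsq (y - ctr [ffun i => Ordinal (hM i)]) <= r ^+ 2 / 2.
    apply: le_trans (nsq_le _) _.
    have : `|y - ctr [ffun i => Ordinal (hM i)]| <= d.
      apply: normV_le => [|i]; first exact: ltW.
      rewrite !mxE ffunE /=; have /andP[h1 _] := hi i.
      have /andP[h3 h4] := truncn_itv h1.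
      set k := Num.truncn _ in h3 h4 *.
      move: h3 h4; rewrite -[k.+1%:R]natr1 ler_pdivlMr // ltr_pdivrMr // mulrDl mul1r => h3 h4.
      by rewrite ler_norml; apply/andP; split; sra d0 h3 h4.
    move=> hd; apply: le_trans (_ : n%:R * d ^+ 2 <= _).
      by rewrite ler_wpM2l // lerXn2r ?nnegrE // ltW.
    have e1 : d * (2 * (n%:R + 1)) = r by rewrite /d divfK // gt_eqF // mulr_gt0 //; lra.
    have := sqr_ge0 d; rewrite -e1; nra.
  rewrite /bump (max_idPr _); last by have := sqr_ge0 r; lra.
  have -> : r ^+ 4 / 4 = (r ^+ 2 / 2) ^+ 2 by field.
  by apply: lerXn2r; rewrite ?nnegrE ?divr_ge0 ?sqr_ge0 //; have := sqr_ge0 r; lra.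
pose S (y : V) := \sum_f bump r (ctr f) y.
have PS : PG S by apply: PG_sum => f; exact: PG_bump.
have S0 : gmean S = 0.
  by rewrite /S gmean_sum ?big1 // => f; exact: PG_bump.
have h1 y : 1 - (4 * n%:R + 4)^-1 * nsq y <= 4 / r ^+ 4 * S y.
  have [hy|hy] := lerP `|y| Y; last first.
    apply: le_trans (_ : 0 <= _); last first.
      apply: mulr_ge0; first by rewrite divr_ge0 // ltW.
      by apply: sumr_ge0 => f _; exact: bump_ge0.
    rewrite subr_le0 mulrC ler_pdivlMr // mul1r; apply: le_trans (nsq_norm y).
    by have := normr_ge0 y; rewrite /Y in hy; nra.
  have [f hf] := cover y hy.
  apply: le_trans (_ : 1 <= _).
    by rewrite gerBl mulr_ge0 ?nsq_ge0 // invr_ge0 ltW.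
  have : r ^+ 4 / 4 <= S y.
    apply: le_trans hf _; rewrite /S (bigD1 f) //= lerDl.
    by apply: sumr_ge0 => g _; exact: bump_ge0.
  rewrite ler_pdivrMr // => h; rewrite mulrAC ler_pdivlMr // mul1r mulrC; lra.
have PN : PG (fun y : V => nsq y).
  by apply: PG_sum => i; apply: PGM; exact: PG_coord.
have := gmean_le (PG_B (PGC 1) (PG_Z (4 * n%:R + 4)^-1 PN)) (PG_Z (4 / r ^+ 4) PS) h1.
rewrite gmeanZ // S0 mulr0 gmeanB ?gmeanZ ?gmeanC //; [|exact: PGC|exact: PG_Z].
have -> : gmean (fun y : V => nsq y) = 2 * n%:R.
  rewrite gmean_sum; last by move=> i; apply: PGM; exact: PG_coord.
  by rewrite (eq_bigr _ (fun i _ => gmean_sq i)) sumr_const card_ord mulr_natr.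
rewrite subr_le0 mulrC ler_pdivlMr //; lra.
Qed.

End Stein.

Lemma dinv (R : realType) (x : R) : x != 0 -> is_derive x 1 (fun q => q^-1) (- x ^- 2).
Proof.
move=> x0; have := @is_deriveV R (fun q => q) x 1 1 x0 (did x).
by rewrite /GRing.scale /= mulr1.
Qed.

(** * Duhamel's formula with Hermite weights *)

Section Duhamel.
Context {R : realType} {n : nat}.
Local Notation V := 'rV[R]_n.
Implicit Types (phi psi : V -> R) (x y : V) (C c e d t s : R) (m : nat) (z : @jf R n).

Lemma pd_scale (w : V) (f : V -> R) x y s (l : R) : pd w f (x + s *: y) l ->
  pd w (fun y => f (x + s *: y)) y (s * l).
Proof.
move=> h; have h' : pd w f (x + s *: y + 0 *: w) l by rewrite scale0r addr0.
have h2 : is_derive (0 : R) 1 (fun q : R => s * q) s by have := dZ s (did (0 : R)); rewrite mulr1.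
have h3 : is_derive (s * 0) 1 (fun q : R => f (x + s *: y + q *: w)) l.
  by rewrite mulr0; exact: (pd_shift h').
have := dcomp h3 h2; rewrite mulrC; apply: der_ext; exists 1 => // q _.
by rewrite add0r scalerDr addrA scalerA.
Qed.

Lemma jc_param (f : R -> V -> R) t x s y : jc f (t - s ^+ 2) (x + s *: y) ->
  jc (fun s y => f (t - s ^+ 2) (x + s *: y)) s y.
Proof.
move=> hf e e0; have [d d0 hd] := hf e e0.
pose K := 2 * `|s| + `|y| + 2.
have K0 : 0 < K by rewrite /K; have := normr_ge0 s; have := normr_ge0 y; lra.
exists (Num.min 1 (d / (2 * K))); first by rewrite lt_min ltr01 divr_gt0 // mulr_gt0.
move=> s' y'; rewrite !lt_min !ltr_pdivlMr ?mulr_gt0 // => /andP[a1 a2] /andP[b1 b2].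
have ns := normr_ge0 s; have ny := normr_ge0 y.
have a0 := normr_ge0 (s' - s); have b0 := normr_ge0 (y' - y).
apply: hd.
  have -> : t - s' ^+ 2 - (t - s ^+ 2) = - (s' - s) * ((s' - s) + 2 * s) by ring.
  rewrite normrM normrN.
  have h : `|(s' - s) + 2 * s| <= 1 + 2 * `|s|.
    by have := ler_normD (s' - s) (2 * s); rewrite [`|2 * s|]normrM (@ger0_norm R 2) //; sra a1.
  by move: a2; rewrite /K; nra.
have -> : x + s' *: y' - (x + s *: y) = s' *: (y' - y) + (s' - s) *: y.
  by apply/rowP => k; rewrite !mxE; ring.
apply: lt_normD; rewrite !normrZ.
have h : `|s'| <= 1 + `|s| by have := ler_normD (s' - s) s; rewrite subrK; sra a1.
by move: a2 b2; rewrite /K; nra.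
Qed.

Lemma cts_scale phi x s y : cts phi (x + s *: y) -> cts (fun y => phi (x + s *: y)) y.
Proof.
move=> h; apply: (@jc_cts R n (fun s y => phi (x + s *: y)) s y).
by have := @jc_param (fun _ => phi) 0 x s y (cts_jc _ h).
Qed.

Lemma cts_jc1 phi t x : cts phi x <-> jc (fun _ => phi) t x.
Proof. by split=> [|h]; [exact: cts_jc|exact: (jc_cts h)]. Qed.

Lemma ctsM phi psi x : cts phi x -> cts psi x -> cts (fun y => phi y * psi y) x.
Proof. by rewrite !(cts_jc1 _ 0); exact: jcM. Qed.

Lemma ctsD phi psi x : cts phi x -> cts psi x -> cts (fun y => phi y + psi y) x.
Proof. by rewrite !(cts_jc1 _ 0); exact: jcD. Qed.

Lemma ctsC c x : cts (fun=> c) x.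
Proof. by rewrite (cts_jc1 _ 0); exact: jc_cst. Qed.

Lemma cts_sum (I : finType) (F : I -> V -> R) x : (forall i, cts (F i) x) -> cts (fun y => \sum_i F i y) x.
Proof. by move=> h; rewrite (cts_jc1 _ 0); apply: jc_sum => i; apply: cts_jc. Qed.

Lemma cts_co (i : 'I_n) x : cts (fun y => y ord0 i) x.
Proof. by rewrite (cts_jc1 _ 0); exact: jc_coord. Qed.

Lemma pd_co (i k : 'I_n) x : pd (evec R k) (fun y => y ord0 i) x (k == i)%:R.
Proof.
have := pd_lin (evec R k) i 0 x; rewrite evecE; apply: pd_ext.
by exists 1 => // z _; rewrite subr0.
Qed.

(** The backward Gaussian of scale s concentrates at (t, x) as s tends to 0: continuity handles a
    ball, the bound on f the tail. *)
Lemma gmean_shrink (f : R -> V -> R) t x (B r : R) : 0 < r ->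
  (forall s y, t - r ^+ 2 <= s <= t -> `|f s y| <= B) -> jc f t x ->
  forall e, 0 < e -> exists2 d, 0 < d & forall s, 0 < s -> s < d ->
    `|gmean (fun y => f (t - s ^+ 2) (x + s *: y)) - f t x| <= e.
Proof.
move=> r0 hB hf e e0; have e2 : 0 < e / 2 by lra.
have B0 : 0 <= B.
  have := hB t x; rewrite lexx andbT gerBl sqr_ge0 => /(_ isT); exact: le_trans.
have K0 : 0 <= 2 * B * @momK R n 1 by apply: mulr_ge0; [rewrite mulr_ge0|exact: momK_ge0].
have [Y Y0 hY] := small_div K0 e2.
have [d d0 hd] := hf _ e2.
exists (Num.min (Num.min 1 r) (Num.min d (d / (1 + Y)))).
  by rewrite !lt_min d0 r0 ltr01 divr_gt0 //; lra.
move=> s s0; rewrite !lt_min => /andP[/andP[s1 sr] /andP[sd]]; rewrite ltr_pdivlMr; last sra Y0.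
move=> sY.
have hs2 : s ^+ 2 <= s by rewrite expr2 ler_piMl // ltW.
have hsr : s ^+ 2 <= r ^+ 2 by rewrite lerXn2r ?nnegrE ?ltW.
have hin : t - r ^+ 2 <= t - s ^+ 2 <= t by rewrite lerD2l lerN2 hsr gerBl sqr_ge0.
have P1 : PG (fun y => f (t - s ^+ 2) (x + s *: y)) by apply: (@PG_bnd _ _ B) => y; exact: hB.
rewrite -[X in _ - X](@gmeanC R n) -gmeanB //; last exact: PGC.
have := @gmean_tail R n 0 (2 * B) (e / 2) Y (fun y => f (t - s ^+ 2) (x + s *: y) - f t x).
have q1 : pgr 0 (2 * B) (fun y => f (t - s ^+ 2) (x + s *: y) - f t x).
  move=> y; rewrite expr0 mulr1; apply: le_normB.
  have := hB (t - s ^+ 2) (x + s *: y) hin; have := hB t x.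
  by rewrite lexx andbT gerBl sqr_ge0 => /(_ isT); sra.
have q2 y : `|y| <= Y -> `|f (t - s ^+ 2) (x + s *: y) - f t x| <= e / 2.
  move=> hy; apply/ltW; apply: hd.
    by rewrite addrCK normrN ger0_norm ?sqr_ge0 //; sra hs2 sd.
  rewrite addrCK normrZ (gtr0_norm s0); have := normr_ge0 y; nra.
move=> /(_ q1 (ltW e2) Y0 q2) h; apply: le_trans h _.
have -> : 2 * B / (1 + Y) * @momK R n 1 = 2 * B * @momK R n 1 / (1 + Y) by ring.
by sra hY.
Qed.

Section Hermite.
Variables (z : @jf R n) (t r B : R) (x : V).
Local Notation bk f s y := (f (t - s ^+ 2) (x + s *: y)).
Hypotheses (r0 : 0 < r) (zC : forall s y, t - r ^+ 2 <= s <= t -> C12 z s y)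
  (zB : forall s y, t - r ^+ 2 <= s <= t ->
  [/\ `|jv z s y| <= B, `|jt z s y| <= B, (forall i, `|jd z i s y| <= B) &
      forall i k, `|jdd z i k s y| <= B]).

Lemma zin (s : R) : 0 < s < r -> t - r ^+ 2 <= t - s ^+ 2 <= t.
Proof.
move=> /andP[s0 sr]; rewrite lerD2l lerN2 gerBl sqr_ge0 andbT.
by rewrite lerXn2r ?nnegrE ?ltW.
Qed.

Lemma B_ge0 : 0 <= B.
Proof. have hin : t - r ^+ 2 <= t <= t by rewrite lexx andbT gerBl sqr_ge0.
by have [h _ _ _] := zB x hin; exact: le_trans h. Qed.

Variables (H : V -> R) (Hi Hii : 'I_n -> V -> R) (d : nat).
Hypotheses (HP : PG H) (HiP : forall i, PG (Hi i)) (HiiP : forall i, PG (Hii i)) (Hc : forall y, cts H y)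
  (Hic : forall i y, cts (Hi i) y) (Hiic : forall i y, cts (Hii i) y) (Hd : forall i y, pd (evec R i) H y (Hi i y))
  (Hdd : forall i y, pd (evec R i) (Hi i) y (Hii i y))
  (Heig : forall y, \sum_i (y ord0 i * Hi i y - 2 * Hii i y) = d%:R * H y).
Local Tactic Notation "sra2" hyp_list(l) := revert l; lra_in (r0, zC, zB, HP, HiP, HiiP, Hc, Hic, Hiic, Hd, Hdd, Heig).

(** The hypothesis [Heig] says that H is an eigenfunction of the Ornstein-Uhlenbeck operator, that
    is, a Hermite polynomial of degree d. The mean is taken over the slice at time t - s^2 with
    space scale s, as in the heat semigroup. *)
Definition hM (s : R) := gmean (fun y => H y * bk (jv z) s y).
Definition hG (s : R) := gmean (fun y => H y * bk (heat z) s y).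

Let PGz (f : R -> V -> R) s : 0 < s < r -> (forall s y, t - r ^+ 2 <= s <= t -> `|f s y| <= B) ->
  PG (fun y => f (t - s ^+ 2) (x + s *: y)).
Proof. by move=> hs hf; apply: (@PG_bnd _ _ B) => y; apply: hf; exact: zin. Qed.

Lemma hM_deriv0 s : 0 < s < r -> is_derive s 1 hM
  (gmean (fun y => H y * (- (2 * s) * bk (jt z) s y +
     \sum_i y ord0 i * bk (jd z i) s y))).
Proof.
move=> /andP[s0 sr]; have [m [C hH]] := HP; have B0 := B_ge0.
pose rho := Num.min s (r - s).
have rho0 : 0 < rho by rewrite lt_min s0 subr_gt0.
have hin q : `|q - s| < rho -> 0 < q < r.
  rewrite lt_min => /andP[]; rewrite !ltr_norml => /andP[? ?] /andP[? ?].
  by apply/andP; split; lra.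
pose Fs (s : R) (y : V) := H y * (- (2 * s) * bk (jt z) s y +
     \sum_i y ord0 i * bk (jd z i) s y).
apply: (@gmean_deriv R n (fun s y => H y * bk (jv z) s y) Fs s rho (m + 1)
  (C * ((2 * r + n%:R) * B))) => //.
- move=> q y /hin hq; apply: dZ.
  have hq' := zin hq; have /andP[q0 qr] := hq.
  rewrite [- (2 * q) * _]mulrC.
  apply: (@chain R n (jv z) (jt z) (jd z) (fun s => t - s ^+ 2) (fun s => x + s *: y) q (- (2 * q)) y).
  + exists (Num.min (q ^+ 2) (r ^+ 2 - q ^+ 2)).
      by rewrite lt_min exprn_gt0 // subr_gt0 ltrXn2r ?nnegrE ?ltW.
    move=> s' y'; rewrite lt_min !ltr_norml => /andP[/andP[? ?] /andP[? ?]] _.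
    have hs' : t - r ^+ 2 <= s' <= t by apply/andP; split; lra.
    by have hc := zC y' hs'; split; [exact: (c_t hc)|exact: (c_d hc)].
  + exact: (c_t0 (zC _ hq')).
  + by move=> i; exact: (c_d0 (zC _ hq')).
  + have := dB (dcst t q) (dM (did q) (did q)); rewrite !mulr1 sub0r.
    have -> : - (q + q) = - (2 * q) by ring.
    by apply: der_ext; exists 1 => // h _; rewrite expr2.
  + move=> i; have := dD (dcst (x ord0 i) q) (dM (did q) (dcst (y ord0 i) q)).
    rewrite mulr0 !add0r mulr1; apply: der_ext; exists 1 => // h _.
    by rewrite !mxE.
- move=> y; have hs := zin (hin s _); rewrite subrr normr0 in hs; have {}hs := hs rho0.
  apply: jcM; first exact: cts_jc.
  apply: jcD.
    by apply: jcM; [apply/jcN/jcZ/jc_time|apply: jc_param; exact: (c_t0 (zC _ hs))].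
  apply: jc_sum => i; apply: jcM; first exact: jc_coord.
  by apply: jc_param; exact: (c_d0 (zC _ hs)).
- move=> q /hin hq y; have [_ h2 h3 _] := zB (x + q *: y) (zin hq).
  rewrite normrM exprD expr1 mulrACA; apply: ler_pM => //.
  apply: le_normD; rewrite normrM normrN (@ger0_norm _ (2 * q)); last first.
    by have /andP[? ?] := hq; sra2 hq.
  have h4 : `|\sum_i y ord0 i * bk (jd z i) q y| <= n%:R * B * `|y|.
    apply: le_norm_sum.
    apply: le_trans (ler_sum _ (_ : forall i _, _ <= `|y| * B)) _.
      by move=> i _; rewrite normrM; apply: ler_pM => //; exact: normVE.
    by rewrite sumr_const card_ord -[leLHS]mulr_natl; lra.
  have /andP[q0 qr] := hq; have ny := normr_ge0 y.
  have h5 : 2 * q * `|bk (jt z) q y| <= 2 * r * B.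
    by apply: ler_pM => //; sra2 hq.
  have h6 : 0 <= n%:R * B by rewrite mulr_ge0.
  have h7 : 0 <= r * B * `|y| by rewrite !mulr_ge0 // ltW.
  by nra.
- move=> q /hin hq; apply: PGM => //; apply: PGz => // s' y hs'.
  by have [] := zB y hs'.
Qed.

(** Stein's identity for H z_i produces 2 s H z_ii, which joins the time derivative to form the heat
    operator. Applied once more, to H_i z, and combined with the eigenvalue equation, it turns the
    remaining first order term into d/s times [hM]. *)
Lemma hM_deriv s : 0 < s < r -> is_derive s 1 hM (d%:R / s * hM s - 2 * s * hG s).
Proof.
move=> hs; have /andP[s0 sr] := hs; have h := hM_deriv0 hs.
suff -> : d%:R / s * hM s - 2 * s * hG s = gmean (fun y => H y * (- (2 * s) * bk (jt z) s y +
     \sum_i y ord0 i * bk (jd z i) s y)) by [].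
have hz y := zC y (zin hs); have bz y := zB y (zin hs).
have cc (f : R -> V -> R) y : (forall y, jc f (t - s ^+ 2) y) ->
    cts (fun y => f (t - s ^+ 2) (x + s *: y)) y.
  by move=> hf; apply: cts_scale; apply: (@jc_cts R n f).
have Pv : PG (fun y => bk (jv z) s y) by apply: PGz => // s' y hs'; have [? _ _ _] := zB y hs'.
have Pt : PG (fun y => bk (jt z) s y) by apply: PGz => // s' y hs'; have [_ ? _ _] := zB y hs'.
have Pd i : PG (fun y => bk (jd z i) s y).
  by apply: PGz => // s' y hs'; have [_ _ ? _] := zB y hs'.
have Pdd i k : PG (fun y => bk (jdd z i k) s y).
  by apply: PGz => // s' y hs'; have [_ _ _ ?] := zB y hs'.
have P1 i : PG (fun y => Hi i y * bk (jd z i) s y) by exact: PGM.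
have P2 i : PG (fun y => H y * bk (jdd z i i) s y) by exact: PGM.
have P3 i : PG (fun y => H y * bk (jd z i) s y) by exact: PGM.
have P4 i : PG (fun y => Hi i y * bk (jv z) s y) by exact: PGM.
have P5 i : PG (fun y => Hii i y * bk (jv z) s y) by exact: PGM.
have P6 i : PG (fun y => y ord0 i * (H y * bk (jd z i) s y)).
  by apply: PGM => //; exact: PG_coord.
have P7 i : PG (fun y => y ord0 i * (Hi i y * bk (jv z) s y)).
  by apply: PGM => //; exact: PG_coord.
have ibp1 i : gmean (fun y => y ord0 i * (H y * bk (jd z i) s y)) =
    2 * (s * gmean (fun y => H y * bk (jdd z i i) s y) +
         gmean (fun y => Hi i y * bk (jd z i) s y)).
  rewrite -gmeanZ // -gmeanD //; last exact: PG_Z.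
  rewrite (@gmean_ibp R n i _ (fun y => s * (H y * bk (jdd z i i) s y) +
      Hi i y * bk (jd z i) s y)) //.
  - by apply: PGD => //; exact: PG_Z.
  - move=> y; have := pdM (Hd i y) (pd_scale (c_dd (hz (x + s *: y)) i i)).
    by congr (pd _ _ _ _); ring.
  - move=> y; apply: ctsD; first apply: ctsM (ctsC _ _) _; apply: ctsM => //; apply: cc => y'.
      exact: (c_dd0 (hz y')).
    exact: (c_d0 (hz y')).
have ibp2 i : gmean (fun y => y ord0 i * (Hi i y * bk (jv z) s y)) =
    2 * (s * gmean (fun y => Hi i y * bk (jd z i) s y) +
         gmean (fun y => Hii i y * bk (jv z) s y)).
  rewrite -gmeanZ // -gmeanD //; last exact: PG_Z.
  rewrite (@gmean_ibp R n i _ (fun y => s * (Hi i y * bk (jd z i) s y) +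
      Hii i y * bk (jv z) s y)) //.
  - by apply: PGD => //; exact: PG_Z.
  - move=> y; have := pdM (Hdd i y) (pd_scale (c_d (hz (x + s *: y)) i)).
    by congr (pd _ _ _ _); ring.
  - move=> y; apply: ctsD; first apply: ctsM (ctsC _ _) _; apply: ctsM => //; apply: cc => y'.
      exact: (c_d0 (hz y')).
    exact: (c_v0 (hz y')).
have e1 : gmean (fun y => H y * (- (2 * s) * bk (jt z) s y +
     \sum_i y ord0 i * bk (jd z i) s y)) =
   - (2 * s) * gmean (fun y => H y * bk (jt z) s y) +
   \sum_i gmean (fun y => y ord0 i * (H y * bk (jd z i) s y)).
  rewrite -gmean_sum // -gmeanZ; last exact: PGM.
  rewrite -gmeanD; [|by apply: PG_Z; exact: PGM|by apply: PG_sum].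
  apply: gmeanE => y; rewrite mulrDr mulr_sumr; congr (_ + _); first by ring.
  by apply: eq_bigr => i _; ring.
have e2 : hG s = gmean (fun y => H y * bk (jt z) s y) -
    \sum_i gmean (fun y => H y * bk (jdd z i i) s y).
  rewrite -gmean_sum // -gmeanB; [|exact: PGM|by apply: PG_sum].
  by apply: gmeanE => y; rewrite /heat mulrBr mulr_sumr.
have e3 : d%:R * hM s = 2 * s * \sum_i gmean (fun y => Hi i y * bk (jd z i) s y).
  rewrite /hM -gmeanZ; last exact: PGM.
  have -> : gmean (fun y => d%:R * (H y * bk (jv z) s y)) =
    \sum_i (gmean (fun y => y ord0 i * (Hi i y * bk (jv z) s y)) -
            2 * gmean (fun y => Hii i y * bk (jv z) s y)).
    rewrite -[RHS](@eq_bigr _ _ _ _ _ _ (fun i => gmean (fun y => y ord0 i * (Hi i y * bk (jv z) s y) -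
            2 * (Hii i y * bk (jv z) s y)))); last first.
      by move=> i _; rewrite gmeanB ?gmeanZ //; exact: PG_Z.
    rewrite -gmean_sum; last by move=> i; apply: PG_B => //; exact: PG_Z.
    apply: gmeanE => y; rewrite mulrA -Heig mulr_suml; apply: eq_bigr => i _; ring.
  by rewrite mulr_sumr; apply: eq_bigr => i _; rewrite ibp2; ring.
rewrite e1 (eq_bigr _ (fun i _ => ibp1 i)) -mulr_sumr big_split /= -mulr_sumr.
have -> : d%:R / s * hM s = 2 * \sum_i gmean (fun y => Hi i y * bk (jd z i) s y).
  rewrite mulrAC e3; field; sra2 hs.
rewrite e2; ring.
Qed.

(** Division by s^d removes the homogeneous term d/s from the differential equation, so only the
    heat operator remains in the derivative. *)
Definition hN (s : R) := hM s / s ^+ d.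

Lemma hN_deriv s : 0 < s < r -> is_derive s 1 hN (- (2 * s * hG s / s ^+ d)).
Proof.
move=> hs; have /andP[s0 sr] := hs.
have h1 : is_derive s 1 (fun q : R => (q ^+ d)^-1) (- (s ^+ d) ^- 2 * (d%:R * s ^+ d.-1)).
  apply: (@dcomp R (fun q => q^-1) (fun q => q ^+ d)).
    by apply: dinv; rewrite expf_neq0 // gt_eqF.
  have := @is_deriveX R R (fun q => q) d s 1 1 (did s).
  rewrite /GRing.scale /= mulr1; apply: der_ext; exists 1 => // q _.
  by rewrite fctE.
have := dM (hM_deriv hs) h1; rewrite /hN.
congr (is_derive _ _ _ _).
have s0' : s != 0 by rewrite gt_eqF.
have -> : d%:R * s ^+ d.-1 = d%:R * s ^+ d / s.
  by case: (d) => [|d']; [rewrite !mul0r|rewrite /= exprS; field].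
have : s ^+ d != 0 by rewrite expf_neq0.
by move: (s ^+ d) => P P0; field; rewrite P0.
Qed.

(** The derivative of [hN] is at most 2 K q^(g - 1), integrable at 0 with integral 2 K s^g / g. The
    integration is done through monotonicity of 2 K q^g / g plus or minus [hN]. *)
Lemma hN_bound (K g : R) (s : R) : 0 < s < r -> 0 < g ->
  (forall q, 0 < q <= s -> `|hG q| <= K * q `^ (g + d%:R - 2)) ->
  forall s', 0 < s' <= s -> `|hN s - hN s'| <= 2 * K / g * s `^ g.
Proof.
move=> /andP[s0 sr] g0 hK s' /andP[s'0 s's].
have K0 : 0 <= K.
  have := hK s; rewrite s0 lexx => /(_ isT) h; have := le_trans (normr_ge0 _) h.
  by rewrite pmulr_lge0 // powR_gt0.
have hq q : s' <= q <= s -> 0 < q < r by move=> /andP[? ?]; apply/andP; split; lra.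
have dg q : s' <= q <= s -> is_derive q 1 (fun q => 2 * K / g * q `^ g) (2 * K * q `^ (g - 1)).
  move=> h; have /andP[q0 _] := hq q h.
  have := dZ (2 * K / g) (dpow g q0); congr (is_derive _ _ _ _); field; lra.
have bd q : s' <= q <= s -> `|- (2 * q * hG q / q ^+ d)| <= 2 * K * q `^ (g - 1).
  move=> h; have /andP[q0 _] := hq q h; have /andP[h1 h2] := h.
  have q0' := ltW q0; have qd0 : 0 <= q ^+ d by rewrite exprn_ge0.
  rewrite normrN !normrM normfV (ger0_norm q0') (@ger0_norm _ 2) // (ger0_norm qd0).
  have h3 := hK q; rewrite q0 h2 in h3; have {}h3 := h3 isT.
  have -> : q `^ (g - 1) = q * q `^ (g + d%:R - 2) / q ^+ d.
    rewrite -(powR_mulrn _ q0') -{2}(powRr1 q0') -powRN -!powRD ?(gt_eqF q0) ?implybT //.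
    by congr (_ `^ _); ring.
  rewrite ler_pdivrMr ?exprn_gt0 //.
  have -> : 2 * K * (q * q `^ (g + d%:R - 2) / q ^+ d) * q ^+ d = 2 * q * (K * q `^ (g + d%:R - 2)).
    by field; rewrite gt_eqF // exprn_gt0.
  by rewrite ler_wpM2l // mulr_ge0 // ltW.
have p' : 0 <= 2 * K / g * s' `^ g by rewrite mulr_ge0 ?powR_ge0 // divr_ge0 ?mulr_ge0 // ltW.
have m1 := @derive_mono R (fun q => 2 * K / g * q `^ g - hN q) _ s' s s's
   (fun q h => dB (dg q h) (hN_deriv (hq q h))).
have m2 := @derive_mono R (fun q => 2 * K / g * q `^ g + hN q) _ s' s s's
   (fun q h => dD (dg q h) (hN_deriv (hq q h))).
have {}m1 : 2 * K / g * s' `^ g - hN s' <= 2 * K / g * s `^ g - hN s.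
  by apply: m1 => q h; have := bd q h; rewrite ler_norml => /andP[? ?]; lra.
have {}m2 : 2 * K / g * s' `^ g + hN s' <= 2 * K / g * s `^ g + hN s.
  by apply: m2 => q h; have := bd q h; rewrite ler_norml => /andP[? ?]; lra.
by rewrite ler_norml; apply/andP; split; sra2 m1 m2 p'.
Qed.

End Hermite.

End Duhamel.

(** * Localisation by a polynomial cut-off *)

Section Cutoff.
Context {R : realType} {n : nat}.
Local Notation V := 'rV[R]_n.
Implicit Types (x y v : V) (C c e d t s : R) (u : @jf R n).

Definition bmp (v : V) : R := Num.max 0 (1 - nsq v).

(** The cube makes the truncated quadratic C^2 across the sphere where it vanishes. The derivatives
    are written out by hand; [C12_chi] identifies them with those of a composition. *)
Definition jchi x : @jf R n := Jf (fun _ y => bmp (y - x) ^+ 3) (fun _ _ => 0)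
  (fun i _ y => - (6 * bmp (y - x) ^+ 2 * (y - x) ord0 i))
  (fun i k _ y => - (6 * bmp (y - x) ^+ 2 * (i == k)%:R) +
     24 * bmp (y - x) * (y - x) ord0 i * (y - x) ord0 k).

Lemma bmp_ge0 v : 0 <= bmp v. Proof. by rewrite le_max lexx. Qed.
Lemma bmp_le1 v : bmp v <= 1. Proof. by rewrite ge_max ler01 gerBl nsq_ge0. Qed.

Lemma bmp_out v : 1 <= `|v| -> bmp v = 0.
Proof.
move=> h; apply/max_idPl; rewrite subr_le0; apply: le_trans (nsq_norm _).
by rewrite exprn_ege1.
Qed.

Lemma bmp_nsq v : bmp v * nsq v <= 1.
Proof.
rewrite /bmp; case: (lerP 0 (1 - nsq v)) => h1; last by rewrite mul0r.
by have := bmp_le1 v; nra.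
Qed.

Lemma bmp0 : bmp 0 = 1.
Proof.
rewrite /bmp (_ : nsq 0 = 0) ?subr0; first by apply/max_idPr.
by rewrite /nsq big1 // => i _; rewrite mxE mulr0.
Qed.

Lemma bmp_lip v : 0 <= 1 - bmp v <= nsq v.
Proof.
have := bmp_le1 v; rewrite subr_ge0 => -> /=.
have : 1 - nsq v <= bmp v by rewrite le_max lexx orbT.
lra.
Qed.

Lemma C12_chi x t y : C12 (jchi x) t y.
Proof.
pose inner := jadd (jcst 1) (jmul (jcst (-1)) (jsq x)).
have E : jchi x = jcomp (fun q => Num.max 0 q ^+ 3) (fun q => 3 * Num.max 0 q ^+ 2)
    (fun q => 6 * Num.max 0 q) inner.
  have iv s w : jv inner s w = 1 - nsq (w - x) by rewrite -(jsqE x s w) /= mulN1r.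
  have id0 i s w : jd inner i s w = - (2 * (w - x) ord0 i).
    by rewrite -(jd_sq x i s w) /= mulr0 addr0 add0r mulN1r.
  have idd i k s w : jdd inner i k s w = - (2 * (i == k)%:R).
    rewrite /= !mulr0 !mul0r !addr0 mulN1r add0r; congr (- _).
    rewrite (bigD1 i) //= eqxx big1 ?addr0.
      by rewrite !mulr0 !add0r (_ : true%:R = 1) // mul1r eq_sym; ring.
    by move=> l /negbTE li; rewrite !mulr0 eq_sym li !mul0r !addr0.
  have it s w : jt inner s w = 0.
    by rewrite /= big1 ?mulr0 ?addr0 // => i _; rewrite !mulr0 addr0.
  rewrite /jchi /jcomp; congr Jf; apply/funext => a.
  - by apply/funext => w; rewrite iv.
  - by apply/funext => w; rewrite it mulr0.
  - by apply/funext => s; apply/funext => w; rewrite iv id0 -/(bmp _); ring.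
  - apply/funext => k; apply/funext => s; apply/funext => w.
    by rewrite iv !id0 idd -/(bmp _); ring.
rewrite E; apply: C12_comp.
- by apply: C12D; [exact: C12_cst|apply: C12M; [exact: C12_cst|exact: C12_sq]].
- exact: (dpos 1).
- have := dZ 3 (dpos 0 (jv inner t y)); rewrite expr1.
  by have -> : 3 * (2 * Num.max 0 (jv inner t y)) = 6 * Num.max 0 (jv inner t y) by ring.
- move=> e e0; have [d d0 hd] := max_cts (jv inner t y) (divr_gt0 e0 (ltr0Sn R 5)).
  exists d => // w hw; have := hd w hw; rewrite -mulrBr normrM ger0_norm // ltr_pdivlMr //; lra.
Qed.

Lemma heat_chi x t y : heat (jchi x) t y =
  6 * n%:R * bmp (y - x) ^+ 2 - 24 * bmp (y - x) * nsq (y - x).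
Proof.
rewrite /heat /= big_split /= sumrN /nsq.
rewrite (eq_bigr (fun=> 6 * bmp (y - x) ^+ 2)) => [|i _]; last by rewrite eqxx mulr1.
rewrite sumr_const card_ord -mulr_natr mulr_sumr.
rewrite (eq_bigr (fun i => 24 * bmp (y - x) * ((y - x) ord0 i * (y - x) ord0 i))) => [|i _]; last by rewrite mulrA.
ring.
Qed.

Lemma chi_d_le x i t y : `|jd (jchi x) i t y| <= 6 * `|y - x|.
Proof.
have b2 : bmp (y - x) ^+ 2 <= 1 by rewrite exprn_ile1 ?bmp_ge0 ?bmp_le1.
have b0 : 0 <= bmp (y - x) ^+ 2 by exact: sqr_ge0.
have b6 : 0 <= 6 * bmp (y - x) ^+ 2 by lra.
rewrite /= normrN normrM (ger0_norm b6).
by apply: ler_pM; [lra|exact: normr_ge0|lra|exact: normVE].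
Qed.

Lemma chi_dd_le x i t y : `|jdd (jchi x) i i t y| <= 30.
Proof.
rewrite /= eqxx mulr1; set b := bmp _; set w := (y - x) ord0 i.
have h1 : w * w <= nsq (y - x).
  by rewrite /nsq (bigD1 i) //= lerDl; apply: sumr_ge0 => k _; rewrite -expr2 sqr_ge0.
have := bmp_nsq (y - x); rewrite -/b => h2.
have b0 : 0 <= b := bmp_ge0 _; have b1 : b <= 1 := bmp_le1 _.
have h3 : b * (w * w) <= 1 by apply: le_trans h2; rewrite ler_wpM2l.
have h4 : 0 <= b * (w * w) by rewrite mulr_ge0 // -expr2 sqr_ge0.
have h5 : 0 <= b ^+ 2 <= 1 by rewrite sqr_ge0 exprn_ile1.
by move/andP: h5 => [? ?]; rewrite ler_norml; apply/andP; split; lra.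
Qed.

Lemma chi_heat_le x t y : `|heat (jchi x) t y| <= 6 * n%:R + 24.
Proof.
rewrite heat_chi; set b := bmp _.
have := bmp_nsq (y - x); rewrite -/b => h2.
have b0 : 0 <= b := bmp_ge0 _; have b1 : b <= 1 := bmp_le1 _.
have h4 : 0 <= b * nsq (y - x) by rewrite mulr_ge0 // nsq_ge0.
have h5 : 0 <= b ^+ 2 <= 1 by rewrite sqr_ge0 exprn_ile1.
have nn : 0 <= n%:R :> R by [].
by move/andP: h5 => [? ?]; rewrite ler_norml; apply/andP; split; nra.
Qed.

Definition jcut x u := jmul (jchi x) u.

Lemma cut_zero x u t y : 1 <= `|y - x| ->
  [/\ jv (jcut x u) t y = 0, jt (jcut x u) t y = 0, (forall i, jd (jcut x u) i t y = 0) &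
      forall i k, jdd (jcut x u) i k t y = 0].
Proof.
move=> /bmp_out b0; split => [||i|i k] /=; rewrite b0 ?expr0n /=; ring.
Qed.

Lemma out_nbhd x y : 1 < `|y - x| -> exists2 d, 0 < d & forall w, `|w - y| < d -> 1 <= `|w - x|.
Proof.
move=> h; exists (`|y - x| - 1); first by rewrite subr_gt0.
move=> w hw; have := ler_distD w y x; rewrite (distrC y w); lra.
Qed.

Lemma jc_zero (f : R -> V -> R) t x y : (forall s w, 1 <= `|w - x| -> f s w = 0) ->
  1 < `|y - x| -> jc f t y.
Proof.
move=> h /out_nbhd[d d0 hd]; apply: jc_ext (jc_cst 0 t y); exists d => // s w _ hw.
by rewrite h // hd.
Qed.

Lemma pd_zero w (f : V -> R) x y : (forall w, 1 <= `|w - x| -> f w = 0) ->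
  1 < `|y - x| -> pd w f y 0.
Proof.
move=> h /out_nbhd[d d0 hd]; apply: pd_ext (pdcst w 0 y); exists d => // q hq.
by rewrite h // hd.
Qed.

(** Regularity of u is asked for in the closed unit ball; beyond it the product vanishes in a
    neighbourhood, whatever u is there. *)
Lemma C12_cut x u t y : (`|y - x| <= 1 -> C12 u t y) -> C12 (jcut x u) t y.
Proof.
move=> h; have [h1|h1] := lerP `|y - x| 1.
  by apply: C12M; [exact: C12_chi|exact: h].
have z0 s w (hw : 1 <= `|w - x|) := @cut_zero x u s w hw.
have [z1 z2 z3 z4] := z0 t y (ltW h1).
split => [|i|i k|||i|i k].
- rewrite z2; apply: der_ext (dcst 0 t); exists 1 => // q _.
  by have [-> _ _ _] := z0 (t + q) y (ltW h1).
- by rewrite z3; apply: (@pd_zero _ _ x) => // w hw; have [-> _ _ _] := z0 t w hw.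
- by rewrite z4; apply: (@pd_zero _ _ x) => // w hw; have [_ _ -> _] := z0 t w hw.
- by apply: (@jc_zero _ _ x) => // s w hw; have [-> _ _ _] := z0 s w hw.
- by apply: (@jc_zero _ _ x) => // s w hw; have [_ -> _ _] := z0 s w hw.
- by apply: (@jc_zero _ _ x) => // s w hw; have [_ _ -> _] := z0 s w hw.
- by apply: (@jc_zero _ _ x) => // s w hw; have [_ _ _ ->] := z0 s w hw.
Qed.

Lemma cut_bnd (f : R -> V -> R) x (a b : R) : (forall s y, a <= s <= b -> `|y - x| <= 1 -> jc f s y) ->
  (forall s y, 1 <= `|y - x| -> f s y = 0) ->
  exists2 B, 0 <= B & forall s y, a <= s <= b -> `|f s y| <= B.
Proof.
move=> h1 h2; have [|C hC] := @bounded2 R n f a b (`|x| + 1).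
  move=> t w ht _; have [hw|hw] := lerP `|w - x| 1; first exact: h1.
  exact: (@jc_zero _ _ x).
exists `|C| => // s y hs; apply: le_trans (_ : C <= _); last exact: ler_norm.
have [hy|hy] := lerP `|y - x| 1.
  by apply: hC => //; have := ler_normD (y - x) x; rewrite subrK; lra.
have h3 : `|f s x| <= C by apply: hC => //; rewrite lerDl.
by rewrite h2 ?normr0; [exact: le_trans (normr_ge0 _) h3|exact: ltW].
Qed.

Section AtPoint.
Variables (u : @jf R n) (t : R) (x : V).
Hypothesis uC : forall s y, t - 1 <= s <= t -> `|y - x| <= 1 -> C12 u s y.
Local Tactic Notation "sra1" hyp_list(l) := revert l; lra_in uC.

Lemma zC s y : t - 1 ^+ 2 <= s <= t -> C12 (jcut x u) s y.
Proof. by rewrite expr1n => hs; apply: C12_cut => hy; exact: uC. Qed.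

Lemma zB_ex : exists2 B, 0 <= B & forall s y, t - 1 ^+ 2 <= s <= t ->
  [/\ `|jv (jcut x u) s y| <= B, `|jt (jcut x u) s y| <= B,
      (forall i, `|jd (jcut x u) i s y| <= B) & forall i k, `|jdd (jcut x u) i k s y| <= B].
Proof.
have z0 s w (hw : 1 <= `|w - x|) := @cut_zero x u s w hw.
have h0 s y (hs : t - 1 ^+ 2 <= s <= t) := @zC s y hs.
have zv s w : 1 <= `|w - x| -> jv (jcut x u) s w = 0 by move=> hw; have [] := z0 s w hw.
have zt s w : 1 <= `|w - x| -> jt (jcut x u) s w = 0 by move=> hw; have [] := z0 s w hw.
have zd i s w : 1 <= `|w - x| -> jd (jcut x u) i s w = 0 by move=> hw; have [_ _ -> _] := z0 s w hw.
have zdd i k s w : 1 <= `|w - x| -> jdd (jcut x u) i k s w = 0 by move=> hw; have [_ _ _ ->] := z0 s w hw.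
have [B1 B10 b1] : exists2 B, 0 <= B & forall s y, t - 1 ^+ 2 <= s <= t -> `|jv (jcut x u) s y| <= B.
  have [||B hB hB'] := @cut_bnd (jv (jcut x u)) x (t - 1 ^+ 2) t; [|exact: zv|by exists B].
  by move=> s y hs _; exact: (c_v0 (h0 s y hs)).
have [B2 B20 b2] : exists2 B, 0 <= B & forall s y, t - 1 ^+ 2 <= s <= t -> `|jt (jcut x u) s y| <= B.
  have [||B hB hB'] := @cut_bnd (jt (jcut x u)) x (t - 1 ^+ 2) t; [|exact: zt|by exists B].
  by move=> s y hs _; exact: (c_t0 (h0 s y hs)).
have hB3 i : exists B, 0 <= B /\ forall s y, t - 1 ^+ 2 <= s <= t -> `|jd (jcut x u) i s y| <= B.
  have [||B hB hB'] := @cut_bnd (jd (jcut x u) i) x (t - 1 ^+ 2) t; [|exact: (zd i)|by exists B].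
  by move=> s y hs _; exact: (c_d0 (h0 s y hs)).
have hB4 ik : exists B, 0 <= B /\ forall s y, t - 1 ^+ 2 <= s <= t -> `|jdd (jcut x u) ik.1 ik.2 s y| <= B.
  have [||B hB hB'] := @cut_bnd (jdd (jcut x u) ik.1 ik.2) x (t - 1 ^+ 2) t; [|exact: (zdd ik.1 ik.2)|by exists B].
  by move=> s y hs _; exact: (c_dd0 (h0 s y hs)).
have [B3 b3] := choice hB3; have [B4 b4] := choice hB4.
have S3 : 0 <= \sum_i B3 i by apply: sumr_ge0 => i _; have [] := b3 i.
have S4 : 0 <= \sum_ik B4 ik by apply: sumr_ge0 => i _; have [] := b4 i.
exists (B1 + B2 + \sum_i B3 i + \sum_ik B4 ik); first by rewrite !addr_ge0.
move=> s y hs; split => [||i|i k].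
- by have := b1 s y hs; sra1 B20 S3 S4.
- by have := b2 s y hs; sra1 B10 S3 S4.
- have [_ /(_ s y hs) h] := b3 i; apply: le_trans h _.
  have : B3 i <= \sum_i B3 i by rewrite (bigD1 i) //= lerDl; apply: sumr_ge0 => l _; have [] := b3 l.
  sra1 B10 B20 S4.
- have [_ /(_ s y hs) /= h] := b4 (i, k); apply: le_trans h _.
  have : B4 (i, k) <= \sum_ik B4 ik by rewrite (bigD1 (i, k)) //= lerDl; apply: sumr_ge0 => l _; have [] := b4 l.
  sra1 B10 B20 S3.
Qed.

(** At the centre chi = 1, grad chi = 0 and D^2 chi = -6 I; the last is the origin of the correction
    6 delta_ij u in the Hessian estimates. *)
Lemma cut_center : [/\ jv (jcut x u) t x = jv u t x, (forall i, jd (jcut x u) i t x = jd u i t x) &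
  forall i k, jdd (jcut x u) i k t x = jdd u i k t x - 6 * (i == k)%:R * jv u t x].
Proof.
by split => [|i|i k] /=; rewrite subrr bmp0 ?mxE; ring.
Qed.

(* [N s] stands for the weighted mean [hN] of the cut-off solution *)
Lemma N_limit (N : R -> R) (f : R -> V -> R) (c L K g s : R) :
  (forall s', 0 < s' -> s' < 1 -> N s' = c * gmean (fun y => f (t - s' ^+ 2) (x + s' *: y))) ->
  (exists2 B, 0 <= B & forall s y, t - 1 ^+ 2 <= s <= t -> `|f s y| <= B) ->
  jc f t x -> L = c * f t x ->
  0 < s < 1 -> (forall s', 0 < s' <= s -> `|N s - N s'| <= K) -> `|N s - L| <= K.
Proof.
move=> hN [B B0 hB] hj -> /andP[s0 s1] hK.
apply/ler_addgt0Pr => e e0.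
have c1 : 0 < `|c| + 1 by have := normr_ge0 c; lra.
have [d d0 hd] := gmean_shrink ltr01 hB hj (divr_gt0 e0 c1).
pose s' := Num.min s (d / 2).
have d2 : 0 < d / 2 by lra.
have s'0 : 0 < s' by rewrite lt_min s0 d2.
have s's : s' <= s by rewrite ge_min lexx.
have s'd : s' < d by have : s' <= d / 2 by [rewrite ge_min lexx orbT]; sra1 d0.
have h1 : `|N s - N s'| <= K by apply: hK; rewrite s'0.
have := hd s' s'0 s'd; rewrite ler_pdivlMr // => h2.
rewrite (_ : N s - c * f t x = N s - N s' + c * (gmean (fun y => f (t - s' ^+ 2) (x + s' *: y)) - f t x)).
  apply: le_normD; rewrite normrM.
  by have := normr_ge0 (gmean (fun y => f (t - s' ^+ 2) (x + s' *: y)) - f t x); nra.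
rewrite (hN s') //; [ring|sra1 s's s1].
Qed.

Lemma cts_supp (f : R -> V -> R) : (forall s y, t - 1 <= s <= t -> `|y - x| <= 1 -> jc f s y) ->
  (forall s y, 1 <= `|y - x| -> f s y = 0) -> forall s y, t - 1 <= s <= t -> cts (f s) y.
Proof.
move=> h1 h2 s y hs; apply: (@jc_cts R n f s y).
by have [hy|hy] := lerP `|y - x| 1; [exact: h1|exact: (@jc_zero _ _ x)].
Qed.

End AtPoint.

End Cutoff.

Lemma powR_ge_id (R : realType) (a g : R) : 0 <= a -> a <= 1 -> g <= 1 -> 0 < g -> a <= a `^ g.
Proof.
move=> a0 a1 g1 g0; have [->|an0] := eqVneq a 0; first exact: powR_ge0.
have ap : 0 < a by rewrite lt_neqAle eq_sym an0.
rewrite -[leLHS](lnK ap) /powR (negbTE an0) ler_expR.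
have : ln a <= 0 by rewrite -ln1 ler_ln ?posrE.
nra.
Qed.

Lemma powR_ge1 (R : realType) (a g : R) : 1 <= a -> 0 <= g -> 1 <= a `^ g.
Proof. move=> a1 g0; have <- : (1:R) `^ g = 1 by rewrite powR1.
by rewrite ge0_ler_powR // nnegrE; lra. Qed.

Lemma powR_le_1D (R : realType) (a g : R) : 0 <= a -> g <= 1 -> 0 < g -> a `^ g <= 1 + a.
Proof.
move=> a0 g1 g0; have [h|h] := lerP a 1.
  have h1 : (1:R) `^ g = 1 by rewrite powR1.
  have : a `^ g <= 1 by rewrite -h1 ge0_ler_powR ?nnegrE // ltW.
  lra.
apply: le_trans (_ : a `^ 1 <= _); last by rewrite powRr1 //; lra.
by apply: ler_powR => //; exact: ltW.
Qed.

(** * Interior gradient estimate *)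

Section Estimates.
Context {R : realType} {n : nat}.
Local Notation V := 'rV[R]_n.
Implicit Types (x y : V) (A t s : R) (u : @jf R n).

Definition oncyl (P : R -> V -> Prop) t x := forall s y, t - 1 <= s <= t -> `|y - x| <= 1 -> P s y.

(** Mean with the Hermite weight y_i, normalised so that by Stein's identity it tends to 2 u_i(t, x)
    as s tends to 0. Only values of u enter. *)
Definition wav i u t x s := s^-1 * gmean (fun y : V => y ord0 i * jv (jcut x u) (t - s ^+ 2) (x + s *: y)).

Lemma in_cyl t s : 0 < s < 1 -> t - 1 <= t - s ^+ 2 <= t.
Proof. by move=> hs; have := @zin R t 1 ltr01 s hs; rewrite expr1n. Qed.

(** Degree 1 in Duhamel's formula. The heat operator of chi u contains grad chi . grad u, so a
    direct bound would be circular; this term is integrated by parts until only u and its heat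
    operator are left. K does not depend on u, as the compactness arguments require. *)
Lemma grad_est : exists2 K, 0 <= K & forall u t x A,
  oncyl (C12 u) t x -> oncyl (fun s y => `|jv u s y| <= A) t x ->
  oncyl (fun s y => `|heat u s y| <= A) t x ->
  forall i s, 0 < s < 1 -> `|2 * jd u i t x - wav i u t x s| <= K * A * s.
Proof.
pose KG : R := (6 * n%:R + 25) * @momK R n 1 + 2 * (n%:R * (3 * @momK R n 3 + 36 * @momK R n 1)).
have mk k : 0 <= @momK R n k := momK_ge0 k.
have KG0 : 0 <= KG.
  have h1 := mk 1%N; have h3 := mk 3%N.
  by apply: addr_ge0; [apply: mulr_ge0 => //; lra|do 2 apply: mulr_ge0 => //; lra].
exists (2 * KG); first by rewrite mulr_ge0.
move=> u t x A uC uA gA i s hs.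
have A0 : 0 <= A.
  by apply: le_trans (uA t x _ _); rewrite ?normr_ge0 ?subrr ?normr0 ?lexx ?andbT // gerBl.
have [B B0 hB] := zB_ex uC; have zC := zC uC.
pose H (y : V) := y ord0 i.
have hG (q : R) : 0 < q <= s -> `|hG (jcut x u) t x H q| <= KG * A * q `^ (1 + 1%:R - 2).
  move=> /andP[q0 qs]; have /andP[sp sl] := hs.
  have hq : 0 < q < 1 by rewrite q0 (le_lt_trans qs sl).
  have hin := in_cyl t hq; set s' := t - q ^+ 2 in hin *.
  rewrite (_ : 1 + 1%:R - 2 = 0 :> R) ?powRr0 ?mulr1; last by ring.
  rewrite /hG.
  pose F1 (y : V) := jv (jchi x) s' y * heat u s' y + jv u s' y * heat (jchi x) s' y.
  pose F2 k (y : V) := jd (jchi x) k s' y * jd u k s' y.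
  have hE y : heat (jcut x u) s' y = F1 y - 2 * \sum_k F2 k y by rewrite heatM.
  have F1b y : `|F1 y| <= A * (6 * n%:R + 25).
    have [hy|hy] := lerP `|y - x| 1; last first.
      rewrite /F1 heat_chi /= bmp_out ?(ltW hy) // !expr0n /= !mulr0 !mul0r subr0 mulr0 addr0 normr0.
      by rewrite mulr_ge0 //; lra.
    apply: le_normD.
    have h1 : `|jv (jchi x) s' y| <= 1.
      by rewrite /= normrX exprn_ile1 // ger0_norm ?bmp_ge0 ?bmp_le1.
    have h2 : `|jv (jchi x) s' y * heat u s' y| <= 1 * A.
      by rewrite normrM; apply: ler_pM => //; exact: gA.
    have h3 : `|jv u s' y * heat (jchi x) s' y| <= A * (6 * n%:R + 24).
      by rewrite normrM; apply: ler_pM => //; [exact: uA|exact: chi_heat_le].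
    sra h2 h3.
  have cF2 k s1 y : t - 1 <= s1 <= t -> `|y - x| <= 1 ->
      jc (fun s y => jd (jchi x) k s y * jd u k s y) s1 y.
    move=> h1 h2; apply: jcM; first exact: (c_d0 (C12_chi x s1 y)).
    exact: (c_d0 (uC s1 y h1 h2)).
  have zF2 k s1 y : 1 <= `|y - x| -> jd (jchi x) k s1 y * jd u k s1 y = 0.
    by move=> h /=; rewrite bmp_out // expr0n /= mulr0 mul0r oppr0 mul0r.
  have PF2 k : PG (fun y => F2 k (x + q *: y)).
    have [b _ hb] := cut_bnd (cF2 k) (zF2 k).
    by apply: (@PG_bnd _ _ b) => y; exact: hb.
  have PH : PG H := PG_coord i.
  have P3 k : PG (fun y => y ord0 i * F2 k (x + q *: y)) by exact: PGM.
  (* Stein's identity turns the gradient of u into a factor of the cut-off *)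
  pose w k (y : V) := jd (jchi x) k s' y * jv u s' y.
  (* grad chi vanishes at the centre, hence the factor q |y|: it pays for the division by q that
     Stein's identity costs in [key]. *)
  have wb k y : `|w k (x + q *: y)| <= 6 * q * A * `|y|.
    have [hy|hy] := lerP `|x + q *: y - x| 1; last first.
      rewrite /w /= bmp_out ?(ltW hy) // expr0n /= mulr0 mul0r oppr0 mul0r normr0.
      by rewrite !mulr_ge0 // ltW.
    rewrite /w normrM; have h1 := @chi_d_le R n x k s' (x + q *: y).
    rewrite addrCK normrZ (gtr0_norm q0) in h1.
    have h2 := uA s' _ hin hy.
    have -> : 6 * q * A * `|y| = 6 * (q * `|y|) * A by ring.
    by apply: ler_pM.
  have wb' k y : `|w k (x + q *: y)| <= 6 * q * A * (1 + `|y|).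
    by apply: le_trans (wb k y) _; rewrite ler_wpM2l ?lerDr ?mulr_ge0 // ltW.
  have Pw k : PG (fun y => w k (x + q *: y)) by exists 1%N, (6 * q * A) => y; rewrite expr1; exact: wb'.
  pose w2 k (y : V) := jdd (jchi x) k k s' y * jv u s' y.
  have w2b k y : `|w2 k y| <= 30 * A.
    have [hy|hy] := lerP `|y - x| 1; last first.
      rewrite /w2 /= bmp_out ?(ltW hy) // expr0n /= !(mulr0, mul0r, oppr0, addr0) normr0.
      by rewrite mulr_ge0.
    by rewrite normrM; apply: ler_pM => //; [exact: chi_dd_le|exact: uA].
  have Pw2 k : PG (fun y => w2 k (x + q *: y)) by apply: (@PG_bnd _ _ (30 * A)) => y; exact: w2b.
  have pdw k y : pd (evec R k) (w k) y (w2 k y + F2 k y).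
    have [hy|hy] := lerP `|y - x| 1.
      have := pdM (c_dd (C12_chi x s' y) k k) (c_d (uC s' y hin hy) k).
      by congr (pd _ _ _ _); rewrite /w2 /F2; ring.
    have -> : w2 k y + F2 k y = 0.
      by rewrite /w2 /F2 /= bmp_out ?(ltW hy) // expr0n /= !(mulr0, mul0r, oppr0, addr0).
    apply: (@pd_zero _ _ _ _ x) => // z hz.
    by rewrite /w /= bmp_out // expr0n /= mulr0 mul0r oppr0 mul0r.
  have cw k y : cts (w k) y.
    apply: (@cts_supp R n t x (fun s y => jd (jchi x) k s y * jv u s y)) => //.
      move=> s1 y1 h1 h2; apply: jcM; first exact: (c_d0 (C12_chi x s1 y1)).
      exact: (c_v0 (uC s1 y1 h1 h2)).
    by move=> s1 y1 h /=; rewrite bmp_out // expr0n /= mulr0 mul0r oppr0 mul0r.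
  have cw2 k y : cts (w2 k) y.
    apply: (@cts_supp R n t x (fun s y => jdd (jchi x) k k s y * jv u s y)) => //.
      move=> s1 y1 h1 h2; apply: jcM; first exact: (c_dd0 (C12_chi x s1 y1)).
      exact: (c_v0 (uC s1 y1 h1 h2)).
    by move=> s1 y1 h /=; rewrite bmp_out // expr0n /= !(mulr0, mul0r, oppr0, addr0).
  have cF k y : cts (F2 k) y by apply: (@cts_supp R n t x _ (cF2 k) (zF2 k)).
  have key k : 2 * q * gmean (fun y => y ord0 i * F2 k (x + q *: y)) =
      gmean (fun y => y ord0 k * (y ord0 i * w k (x + q *: y))) -
      2 * (k == i)%:R * gmean (fun y => w k (x + q *: y)) -
      2 * q * gmean (fun y => y ord0 i * w2 k (x + q *: y)).
    have Q1 : PG (fun y : V => (k == i)%:R * w k (x + q *: y)) by exact: PG_Z.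
    have Q2 : PG (fun y : V => y ord0 i * w2 k (x + q *: y)) by exact: PGM.
    rewrite (@gmean_ibp R n k _ (fun y => q * (y ord0 i * F2 k (x + q *: y)) +
       (q * (y ord0 i * w2 k (x + q *: y)) + (k == i)%:R * w k (x + q *: y)))).
    - rewrite gmeanD ?gmeanD ?gmeanZ //; [ring|exact: PG_Z|exact: PG_Z|].
      by apply: PGD => //; exact: PG_Z.
    - exact: PGM.
    - by apply: PGD; [exact: PG_Z|apply: PGD => //; exact: PG_Z].
    - move=> y; have := pdM (pd_co i k y) (pd_scale (pdw k (x + q *: y))).
      by congr (pd _ _ _ _); ring.
    - move=> y; apply: ctsD; first apply: ctsM (ctsC _ _) _.
        by apply: ctsM; [exact: cts_co|exact: cts_scale].
      apply: ctsD; first apply: ctsM (ctsC _ _) _.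
        by apply: ctsM; [exact: cts_co|exact: cts_scale].
      by apply: ctsM; [exact: ctsC|exact: cts_scale].
  have b1 k : `|gmean (fun y => y ord0 k * (y ord0 i * w k (x + q *: y)))| <= 6 * q * A * @momK R n 3.
    apply: gmean_bnd => y; move: (wb' k y); move: (w k _) => W h3; rewrite !normrM.
    have h1 := normVE y k; have h2 := normVE y i.
    have -> : 6 * q * A * (1 + `|y|) ^+ 3 = (1 + `|y|) * ((1 + `|y|) * (6 * q * A * (1 + `|y|))) by ring.
    have y1 : forall a : R, a <= `|y| -> a <= 1 + `|y| by move=> a; move/le_trans; apply; rewrite lerDr.
    apply: ler_pM => //; rewrite ?mulr_ge0 //; first exact: y1.
    by apply: ler_pM => //; exact: y1.
  have b2 k : `|gmean (fun y => w k (x + q *: y))| <= 6 * q * A * @momK R n 1.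
    by apply: gmean_bnd => y; rewrite expr1.
  have b3 k : `|gmean (fun y => y ord0 i * w2 k (x + q *: y))| <= 30 * A * @momK R n 1.
    apply: gmean_bnd => y; rewrite normrM expr1 mulrC; apply: ler_pM => //.
    by have := normVE y i; sra.
  have b4 k : `|gmean (fun y => y ord0 i * F2 k (x + q *: y))| <= A * (3 * @momK R n 3 + 36 * @momK R n 1).
    have q2 : 0 < 2 * q by rewrite mulr_gt0.
    rewrite -(ler_pM2l q2) -{1}(gtr0_norm q2) -normrM key.
    have := b1 k; have := b2 k; have := b3 k.
    set X := gmean _; set Y := gmean _; set Z := gmean _ => h3 h2 h1.
    apply: le_normB; apply: le_trans (lerD (ler_normB _ _) (lexx _)) _.
    rewrite !normrM !(gtr0_norm q0) !(@ger0_norm _ 2) //.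
    have h4 : `|(k == i)%:R : R| <= 1 by case: (k == i); rewrite ?normr1 ?normr0.
    have h5 : 2 * `|(k == i)%:R : R| * `|Y| <= 2 * (6 * q * A * @momK R n 1).
      by apply: ler_pM; rewrite ?mulr_ge0 //; sra h4.
    have h6 : 2 * q * `|X| <= 2 * q * (30 * A * @momK R n 1) by rewrite ler_wpM2l // ltW.
    sra h1 h5 h6.
  have PF1 : PG (fun y => F1 (x + q *: y)) by apply: (@PG_bnd _ _ (A * (6 * n%:R + 25))) => y.
  have P1 : PG (fun y => y ord0 i * F1 (x + q *: y)) by exact: PGM.
  have -> : gmean (fun y => H y * heat (jcut x u) s' (x + q *: y)) =
      gmean (fun y => y ord0 i * F1 (x + q *: y)) - 2 * \sum_k gmean (fun y => y ord0 i * F2 k (x + q *: y)).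
    rewrite -gmean_sum // -gmeanZ; last exact: PG_sum.
    rewrite -gmeanB //; last by apply: PG_Z; exact: PG_sum.
    apply: gmeanE => y; rewrite hE /H mulrBr; congr (_ - _).
    by rewrite mulrCA mulr_sumr.
  apply: le_normB; rewrite normrM (@ger0_norm _ 2) //.
  have b5 : `|gmean (fun y => y ord0 i * F1 (x + q *: y))| <= A * (6 * n%:R + 25) * @momK R n 1.
    apply: gmean_bnd => y; rewrite normrM expr1 mulrC; apply: ler_pM => //.
    by have := normVE y i; sra.
  have b6 : `|\sum_k gmean (fun y => y ord0 i * F2 k (x + q *: y))| <=
      n%:R * (A * (3 * @momK R n 3 + 36 * @momK R n 1)).
    apply: le_norm_sum; apply: le_trans (ler_sum _ (fun k _ => b4 k)) _.
    by rewrite sumr_const card_ord -[leLHS]mulr_natl.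
  rewrite /KG; sra b5 b6.
rewrite -normrN opprB.
have -> : wav i u t x s = hN (jcut x u) t x H 1 s by rewrite /wav /hN expr1 mulrC.
apply: (@N_limit R n t x (hN (jcut x u) t x H 1) (jd (jcut x u) i) 2 _ _ 0) => //.
- move=> q q0 q1; rewrite /hN /hM expr1.
  have hq : 0 < q < 1 by rewrite q0.
  have hin := @zin R t 1 ltr01 q hq.
  rewrite (@gmean_ibp R n i _ (fun y => q * jd (jcut x u) i (t - q ^+ 2) (x + q *: y))).
  + rewrite gmeanZ; first by field; rewrite gt_eqF.
    by apply: (@PG_bnd _ _ B) => y; have [_ _ h _] := hB _ (x + q *: y) hin.
  + by apply: (@PG_bnd _ _ B) => y; have [h _ _ _] := hB _ (x + q *: y) hin.
  + apply: PG_Z; apply: (@PG_bnd _ _ B) => y; by have [_ _ h _] := hB _ (x + q *: y) hin.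
  + by move=> y; apply: pd_scale; exact: (c_d (zC _ _ hin)).
  + move=> y; apply: ctsM; first exact: ctsC.
    apply: cts_scale; apply: (@jc_cts R n (jd (jcut x u) i)); exact: (c_d0 (zC _ _ hin)).
- by exists B => // s' y hs'; have [_ _ h _] := hB s' y hs'.
- by apply: (c_d0 (zC _ _ _)); rewrite lexx andbT gerBl sqr_ge0.
- by have [_ -> _] := cut_center u t x.
- move=> s' hs'.
  have -> : 2 * KG * A * s = 2 * (KG * A) / 1 * s `^ 1.
    by rewrite divr1 powRr1 ?mulrA //; have /andP[/ltW] := hs.
  have H1 (k : 'I_n) (y : V) : pd (evec R k) H y ((k == i)%:R) by exact: pd_co.
  apply: (@hN_bound R n (jcut x u) t 1 B x ltr01 zC hB H (fun k _ => (k == i)%:R) (fun _ _ => 0) 1) => //.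
  + exact: PG_coord.
  + by move=> k; exact: PGC.
  + by move=> k; exact: PGC.
  + by move=> y; exact: cts_co.
  + by move=> k y; exact: ctsC.
  + by move=> k y; exact: ctsC.
  + by move=> k y; exact: pdcst.
  + move=> y; rewrite mul1r (bigD1 i) //= eqxx mulr1 mulr0 subr0 big1 ?addr0 //.
    by move=> k /negbTE ->; rewrite !mulr0 subr0.
Qed.

End Estimates.

(** * Interior Hessian estimate *)

Section Hessian.
Context {R : realType} {n : nat}.
Local Notation V := 'rV[R]_n.
Implicit Types (x y : V) (A t s g : R) (u : @jf R n).

Lemma pow_le_powR (a g : R) : 0 <= a -> a <= 1 -> g <= 1 -> 0 < g -> a ^+ 2 <= a `^ g.
Proof.
move=> a0 a1 g1 g0; apply: le_trans (powR_ge_id a0 a1 g1 g0).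
by rewrite expr2 ler_piMr.
Qed.

(** The reference value is the heat operator of chi u at the centre, where -Delta chi = 6 n. The
    constant adds five errors: 1 from the oscillation of the heat operator of u, 3 n from that of
    chi, 12 n^2 + 24 n from that of Delta chi, 6 n from that of u, and 12 n from the product of
    gradients. *)
Lemma cut_heat_hoelder u s x y A g : 0 < g <= 1 -> 0 <= A ->
  (`|y - x| <= 1 -> [/\ `|jv u s y| <= A, `|jv u s y - jv u s x| <= A * `|y - x|,
     `|heat u s y - heat u s x| <= A * `|y - x| `^ g & forall k, `|jd u k s y| <= A]) ->
  `|jv u s x| <= A -> `|heat u s x| <= A ->
  `|heat (jcut x u) s y - (heat u s x + 6 * n%:R * jv u s x)| <=
    (1 + 45 * n%:R + 12 * n%:R ^+ 2) * A * `|y - x| `^ g.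
Proof.
move=> /andP[g0 g1] A0 hin ux gx.
have nn : 0 <= n%:R :> R by [].
set nr : R := n%:R in nn *; set r := `|y - x|; have r0 : 0 <= r by exact: normr_ge0.
rewrite heatM.
have [r1|r1] := lerP r 1; last first.
  have bo : bmp (y - x) = 0 by apply: bmp_out; apply: ltW.
  have S0 : grad2 (jchi x) u s y = 0.
    by rewrite /grad2 big1 // => k _ /=; rewrite bo !expr0n /= !(mulr0, mul0r, oppr0).
  rewrite S0 heat_chi /= bo !expr0n /= !(mulr0, mul0r, subr0, addr0) sub0r normrN; apply: le_normD.
  rewrite normrM (@ger0_norm _ (6 * nr)); last by rewrite mulr_ge0.
  have : 1 <= r `^ g by apply: powR_ge1; exact: ltW.
  move: (r `^ g) => rg hrg.
  have h1 : 6 * nr * `|jv u s x| <= 6 * nr * A by rewrite ler_wpM2l // mulr_ge0.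
  have h2 : (1 + 6 * nr) * A <= (1 + 45 * nr + 12 * nr ^+ 2) * A.
    by apply: ler_wpM2r => //; have := sqr_ge0 nr; sra nn.
  have h3 : (1 + 45 * nr + 12 * nr ^+ 2) * A <= (1 + 45 * nr + 12 * nr ^+ 2) * A * rg.
    by rewrite ler_peMr //; apply: mulr_ge0 => //; have := sqr_ge0 nr; sra nn.
  sra gx h1 h2 h3.
have [uy ul gl ud] := hin r1.
rewrite -/r in ul gl.
set b := bmp (y - x); set w := nsq (y - x).
have b0 : 0 <= b := bmp_ge0 _; have b1 : b <= 1 := bmp_le1 _.
have /andP[_ bw] : 0 <= 1 - b <= w := bmp_lip _.
have w0 : 0 <= w := nsq_ge0 _.
have rr : r ^+ 2 <= r `^ g by exact: pow_le_powR.
have rg1 : r <= r `^ g by exact: powR_ge_id.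
have wr : w <= nr * r `^ g.
  by apply: le_trans (nsq_le _) _; rewrite -/nr -/r ler_wpM2l.
have c1 : `|b ^+ 3 - 1| <= 3 * w.
  have e1 : b * b <= 1 by rewrite mulr_ile1.
  have e2 : (1 - b) * (1 + b + b * b) <= w * 3.
    apply: ler_pM => //; [by rewrite subr_ge0|have := mulr_ge0 b0 b0; sra b0|sra b1 e1].
  rewrite distrC ger0_norm; first by sra e2.
  by rewrite subr_ge0 exprn_ile1.
have c2 : `|heat (jchi x) s y - 6 * nr| <= (12 * nr + 24) * w.
  have E : heat (jchi x) s y - 6 * nr = - (6 * nr * (1 - b ^+ 2) + 24 * (b * w)).
    by rewrite heat_chi -/b -/w -/nr; ring.
  have e1 : 0 <= 1 - b ^+ 2 <= 2 * w by apply/andP; split; nra.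
  have /andP[e2 e3] := e1.
  have e4 : 0 <= b * w <= w by rewrite mulr_ge0 // ler_piMl.
  have /andP[e5 e6] := e4.
  have e7 : 0 <= 6 * nr * (1 - b ^+ 2) <= 6 * nr * (2 * w).
    by rewrite mulr_ge0 ?mulr_ge0 //= ler_wpM2l ?mulr_ge0.
  by rewrite E normrN ger0_norm; sra e4 e7.
have c3 : `|\sum_k jd (jchi x) k s y * jd u k s y| <= nr * (6 * r * A).
  apply: le_norm_sum.
  rewrite [leRHS]mulr_natl -[X in _ *+ X](card_ord n) -sumr_const; apply: ler_sum => k _.
  rewrite normrM; apply: ler_pM => //; exact: chi_d_le.
have jchiE : jv (jchi x) s y = b ^+ 3 by [].
rewrite jchiE /grad2; move: c3; set S := \sum_k _ => c3.
move: c2 gl ul uy ux gx; set hc := heat (jchi x) s y; set ux := jv u s x; set uy := jv u s y.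
set gx := heat u s x; set gy := heat u s y => c2 gl ul huy hux hgx.
have -> : b ^+ 3 * gy + uy * hc - 2 * S - (gx + 6 * nr * ux) =
   b ^+ 3 * (gy - gx) + (b ^+ 3 - 1) * gx + uy * (hc - 6 * nr) + 6 * nr * (uy - ux) - 2 * S by ring.
move: rr rg1 wr gl; set q := r `^ g => rr rg1 wr gl.
have b30 : 0 <= b ^+ 3 by rewrite exprn_ge0.
have b31 : b ^+ 3 <= 1 by rewrite exprn_ile1.
have t1 : `|b ^+ 3 * (gy - gx)| <= 1 * (A * q).
  by rewrite normrM (ger0_norm b30); apply: ler_pM.
have t2 : `|(b ^+ 3 - 1) * gx| <= 3 * (nr * q) * A.
  by rewrite normrM; apply: ler_pM => //; sra c1 wr.
have t3 : `|uy * (hc - 6 * nr)| <= A * ((12 * nr + 24) * (nr * q)).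
  rewrite normrM; apply: ler_pM => //; apply: le_trans c2 _; apply: ler_wpM2l => //; sra nn.
have t4 : `|6 * nr * (uy - ux)| <= 6 * nr * (A * q).
  rewrite normrM (@ger0_norm _ (6 * nr)) ?mulr_ge0 //; apply: ler_wpM2l; first by rewrite mulr_ge0.
  by apply: le_trans ul _; rewrite ler_wpM2l.
have t5 : `|2 * S| <= 2 * (nr * (6 * q * A)).
  rewrite normrM (@ger0_norm _ 2) // ler_wpM2l //; apply: le_trans c3 _.
  by rewrite ler_wpM2l // ler_wpM2r // ler_wpM2l.
apply: le_normB.
apply: le_trans (lerD (ler_normD _ _) (lexx _)) _.
have := ler_normD (b ^+ 3 * (gy - gx) + (b ^+ 3 - 1) * gx) (uy * (hc - 6 * nr)).
have := ler_normD (b ^+ 3 * (gy - gx)) ((b ^+ 3 - 1) * gx).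
have -> : (1 + 45 * nr + 12 * nr ^+ 2) * A * q = 1 * (A * q) + 3 * (nr * q) * A + A * ((12 * nr + 24) * (nr * q))
  + 6 * nr * (A * q) + 2 * (nr * (6 * q * A)) by ring.
sra t1 t2 t3 t4 t5.
Qed.

(** Mean with the Hermite polynomial of degree 2; as s tends to 0 it tends to 4 times the Hessian of
    chi u. *)
Definition hav i j u t x s :=
  s^-1 * s^-1 * gmean (fun y : V => (y ord0 i * y ord0 j - 2 * (i == j)%:R) * jv (jcut x u) (t - s ^+ 2) (x + s *: y)).

Lemma gmean_herm (i j : 'I_n) : gmean (fun y : V => y ord0 i * y ord0 j - 2 * (i == j)%:R) = 0.
Proof.
rewrite gmeanB; [|by apply: PGM; exact: PG_coord|exact: PGC].
rewrite (@gmean_ibp R n i _ (fun=> (i == j)%:R)); last 1 first.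
- by move=> y; exact: ctsC.
- by rewrite !gmeanC subrr.
- exact: PG_coord.
- exact: PGC.
- by move=> y; exact: pd_co.
Qed.

Lemma herm_bnd (i j : 'I_n) (y : V) : `|y ord0 i * y ord0 j - 2 * (i == j)%:R| <= 2 * (1 + `|y|) ^+ 2.
Proof.
apply: le_normB; rewrite !normrM (@ger0_norm _ 2) //.
have h : `|(i == j)%:R : R| <= 1 by case: (i == j); rewrite ?normr1 ?normr0.
have : `|y ord0 i| * `|y ord0 j| <= `|y| * `|y| by apply: ler_pM => //; exact: normVE.
have := normr_ge0 y; move: `|y| `|_| `|_| h => Y a b; nra.
Qed.

(** Degree 2 in Duhamel's formula, where a source that is merely bounded would leave a divergent
    integral. The weight has mean zero, so the central value of the source may be subtracted; the
    Hoelder modulus then supplies the factor q^g that makes the integral converge. *)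
Lemma hess_est : exists2 K, 0 <= K & forall u t x A g, 0 < g <= 1 ->
  oncyl (C12 u) t x -> oncyl (fun s y => `|jv u s y| <= A) t x ->
  oncyl (fun s y => `|heat u s y| <= A) t x ->
  oncyl (fun s y => forall k, `|jd u k s y| <= A) t x ->
  oncyl (fun s y => `|jv u s y - jv u s x| <= A * `|y - x|) t x ->
  oncyl (fun s y => `|heat u s y - heat u s x| <= A * `|y - x| `^ g) t x ->
  forall i j s, 0 < s < 1 ->
   `|4 * (jdd u i j t x - 6 * (i == j)%:R * jv u t x) - hav i j u t x s| <= K * A / g * s `^ g.
Proof.
pose C1 : R := 1 + 45 * n%:R + 12 * n%:R ^+ 2.
have nn : 0 <= n%:R :> R by [].
have C10 : 0 <= C1 by have := sqr_ge0 (n%:R : R); rewrite /C1; lra.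
have m3 := @momK_ge0 R n 3.
exists (4 * (C1 * @momK R n 3)); first by apply: mulr_ge0 => //; exact: mulr_ge0.
move=> u t x A g hg uC uA gA dA uL gL i j s hs; have /andP[g0 g1] := hg.
have A0 : 0 <= A.
  by apply: le_trans (uA t x _ _); rewrite ?normr_ge0 ?subrr ?normr0 ?lexx ?andbT // gerBl.
have [B B0 hB] := zB_ex uC; have zC := zC uC.
pose H (y : V) := y ord0 i * y ord0 j - 2 * (i == j)%:R.
have PH : PG H by apply: PG_B; [apply: PGM; exact: PG_coord|exact: PGC].
have hG (q : R) : 0 < q <= s -> `|hG (jcut x u) t x H q| <= 2 * C1 * A * @momK R n 3 * q `^ (g + 2%:R - 2).
  move=> /andP[q0 qs]; have /andP[sp sl] := hs.
  have hq : 0 < q < 1 by rewrite q0 (le_lt_trans qs sl).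
  have hin := in_cyl t hq; rewrite /hG; set s' := t - q ^+ 2 in hin *.
  rewrite addrK; have xx : `|x - x| <= 1 by rewrite subrr normr0.
  pose F0 := heat u s' x + 6 * n%:R * jv u s' x.
  have hF y : `|heat (jcut x u) s' y - F0| <= C1 * A * `|y - x| `^ g.
    apply: cut_heat_hoelder => //; [|exact: uA|exact: gA] => hy.
    by split; [exact: uA|exact: uL|exact: gL|exact: dA].
  have PF : PG (fun y => heat (jcut x u) s' (x + q *: y)).
    apply: (@PG_bnd _ _ (B + n%:R * B)) => y; have hin1 : t - 1 ^+ 2 <= s' <= t by rewrite expr1n.
    have [_ h1 _ h2] := hB s' (x + q *: y) hin1.
    apply: le_normB; apply: lerD => //; apply: le_norm_sum.
    by rewrite [leRHS]mulr_natl -[X in _ *+ X](card_ord n) -sumr_const; apply: ler_sum.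
  have -> : gmean (fun y => H y * heat (jcut x u) s' (x + q *: y)) =
     gmean (fun y => H y * (heat (jcut x u) s' (x + q *: y) - F0)).
    rewrite (@gmeanE _ _ (fun y => H y * (heat (jcut x u) s' (x + q *: y) - F0))
      (fun y => H y * heat (jcut x u) s' (x + q *: y) - F0 * H y)); last by move=> y; ring.
    by rewrite gmeanB ?gmeanZ ?gmean_herm ?mulr0 ?subr0 //; [exact: PGM|exact: PG_Z].
  rewrite mulrAC; apply: gmean_bnd => y; rewrite normrM.
  have := hF (x + q *: y); rewrite addrCK normrZ (gtr0_norm q0) powRM ?(ltW q0) // => h1.
  have h2 : `|y| `^ g <= 1 + `|y| by exact: powR_le_1D.
  have h3 := herm_bnd i j y.
  have -> : 2 * C1 * A * q `^ g * (1 + `|y|) ^+ 3 = 2 * (1 + `|y|) ^+ 2 * (C1 * A * (q `^ g * (1 + `|y|))) by ring.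
  apply: ler_pM => //; apply: le_trans h1 _; apply: ler_wpM2l; first by rewrite mulr_ge0.
  by rewrite ler_wpM2l // powR_ge0.
rewrite -normrN opprB.
have -> : hav i j u t x s = hN (jcut x u) t x H 2 s by rewrite /hav /hN /hM exprS expr1 invfM mulrC.
apply: (@N_limit R n t x (hN (jcut x u) t x H 2) (jdd (jcut x u) i j) 4 _ _ 0) => //.
- move=> q q0 q1; rewrite /hN /hM.
  have hq : 0 < q < 1 by rewrite q0.
  have hin := @zin R t 1 ltr01 q hq.
  set s' := t - q ^+ 2 in hin *.
  have P1 : PG (fun y => jv (jcut x u) s' (x + q *: y)).
    by apply: (@PG_bnd _ _ B) => y; have [h _ _ _] := hB _ (x + q *: y) hin.
  have P2 k : PG (fun y => jd (jcut x u) k s' (x + q *: y)).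
    by apply: (@PG_bnd _ _ B) => y; have [_ _ h _] := hB _ (x + q *: y) hin.
  have P3 k l : PG (fun y => jdd (jcut x u) k l s' (x + q *: y)).
    by apply: (@PG_bnd _ _ B) => y; have [_ _ _ h] := hB _ (x + q *: y) hin.
  have c1 k y : cts (fun y => jd (jcut x u) k s' (x + q *: y)) y.
    by apply: cts_scale; apply: (@jc_cts R n (jd (jcut x u) k)); exact: (c_d0 (zC _ _ hin)).
  have c2 k l y : cts (fun y => jdd (jcut x u) k l s' (x + q *: y)) y.
    by apply: cts_scale; apply: (@jc_cts R n (jdd (jcut x u) k l)); exact: (c_dd0 (zC _ _ hin)).
  have c0 y : cts (fun y => jv (jcut x u) s' (x + q *: y)) y.
    by apply: cts_scale; apply: (@jc_cts R n (jv (jcut x u))); exact: (c_v0 (zC _ _ hin)).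
  have E1 : gmean (fun y => y ord0 j * jd (jcut x u) i s' (x + q *: y)) =
     2 * (q * gmean (fun y => jdd (jcut x u) i j s' (x + q *: y))).
    rewrite (@gmean_ibp R n j _ (fun y => q * jdd (jcut x u) i j s' (x + q *: y))) ?gmeanZ //.
    + exact: PG_Z.
    + by move=> y; apply: pd_scale; exact: (c_dd (zC _ _ hin)).
    + by move=> y; apply: ctsM; [exact: ctsC|exact: c2].
  have E2 : gmean (fun y => y ord0 i * (y ord0 j * jv (jcut x u) s' (x + q *: y))) =
     2 * (q * gmean (fun y => y ord0 j * jd (jcut x u) i s' (x + q *: y)) +
          (i == j)%:R * gmean (fun y => jv (jcut x u) s' (x + q *: y))).
    have Q1 : PG (fun y : V => y ord0 j * jd (jcut x u) i s' (x + q *: y)).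
      by apply: PGM => //; exact: PG_coord.
    rewrite (@gmean_ibp R n i _ (fun y => q * (y ord0 j * jd (jcut x u) i s' (x + q *: y)) +
        (i == j)%:R * jv (jcut x u) s' (x + q *: y))).
    + by rewrite gmeanD ?gmeanZ //; exact: PG_Z.
    + by apply: PGM => //; exact: PG_coord.
    + by apply: PGD; exact: PG_Z.
    + move=> y; have := pdM (pd_co j i y) (pd_scale (c_d (zC s' (x + q *: y) hin) i)).
      by congr (pd _ _ _ _); ring.
    + move=> y; apply: ctsD; apply: ctsM; try exact: ctsC; try exact: c0.
      by apply: ctsM; [exact: cts_co|exact: c1].
  rewrite (@gmeanE _ _ _ (fun y => y ord0 i * (y ord0 j * jv (jcut x u) s' (x + q *: y)) -
     (2 * (i == j)%:R) * jv (jcut x u) s' (x + q *: y))); last by move=> y; rewrite /H; ring.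
  have Pc k : PG (fun y : V => y ord0 k) by exact: PG_coord.
  rewrite gmeanB ?gmeanZ ?E2 ?E1 //; last by exact: PG_Z.
    by field; rewrite gt_eqF.
  by apply: PGM => //; apply: PGM.
- by exists B => // s' y hs'; have [_ _ _ h] := hB s' y hs'.
- by apply: (c_dd0 (zC _ _ _)); rewrite lexx andbT gerBl sqr_ge0.
- by have [_ _ ->] := cut_center u t x.
- move=> s' hs'.
  have -> : 4 * (C1 * @momK R n 3) * A / g = 2 * (2 * C1 * A * @momK R n 3) / g by ring.
  pose Hk (k : 'I_n) (y : V) := y ord0 i * (k == j)%:R + y ord0 j * (k == i)%:R.
  pose Hkk (k : 'I_n) (y : V) : R := 2 * ((k == i)%:R * (k == j)%:R).
  apply: (@hN_bound R n (jcut x u) t 1 B x ltr01 zC hB H Hk Hkk 2) => //.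
  + move=> k; apply: PGD; apply: PGM; try exact: PG_coord; exact: PGC.
  + by move=> k; exact: PGC.
  + move=> y; apply: ctsD; last exact: ctsC.
    by apply: ctsM; exact: cts_co.
  + move=> k y; apply: ctsD; apply: ctsM; try exact: cts_co; exact: ctsC.
  + by move=> k y; exact: ctsC.
  + move=> k y; have := pdD (pdM (pd_co i k y) (pd_co j k y)) (pdcst (evec R k) (- (2 * (i == j)%:R)) y).
    by rewrite addr0.
  + move=> k y; have := pdD (pdM (pd_co i k y) (pdcst (evec R k) (k == j)%:R y))
        (pdM (pd_co j k y) (pdcst (evec R k) (k == i)%:R y)).
    by congr (pd _ _ _ _); rewrite /Hkk; ring.
  + move=> y; rewrite /Hk /Hkk sumrB.
    rewrite (eq_bigr (fun k => y ord0 i * (y ord0 k * (k == j)%:R) + y ord0 j * (y ord0 k * (k == i)%:R))); last by move=> k _; ring.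
    rewrite big_split /= -!mulr_sumr.
    have S1 (l : 'I_n) (f : 'I_n -> R) : \sum_k f k * (k == l)%:R = f l.
      by rewrite (bigD1 l) //= eqxx mulr1 big1 ?addr0 // => k /negbTE ->; rewrite mulr0.
    have -> : \sum_(k < n) y ord0 k * (k == j)%:R = y ord0 j by exact: (S1 j (fun k => y ord0 k)).
    have -> : \sum_(k < n) y ord0 k * (k == i)%:R = y ord0 i by exact: (S1 i (fun k => y ord0 k)).
    have -> : \sum_(k < n) (k == i)%:R * (k == j)%:R = (j == i)%:R :> R by exact: (S1 j (fun k => (k == i)%:R)).
    by rewrite /H eq_sym; ring.
Qed.

End Hessian.

(** * Interior regularity from bounds on the heat operator *)

Section Interior.
Context {R : realType} {n : nat}.
Local Notation V := 'rV[R]_n.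
Implicit Types (x y v : V) (A c d t s g a b Y : R) (u : @jf R n) (f : V -> R).

Lemma pd_dir v f (fi : 'I_n -> V -> R) x :
  (exists2 d, 0 < d & forall y, `|y - x| < d -> forall i, pd (evec R i) f y (fi i y)) ->
  (forall i, cts (fi i) x) -> pd v f x (\sum_i v ord0 i * fi i x).
Proof.
move=> [d d0 hd] hc.
have := @chain R n (fun _ => f) (fun _ _ => 0) (fun i _ => fi i) (fun _ => 0) (fun s => x + s *: v) 0 0 v.
rewrite mul0r add0r scale0r addr0; apply => //.
- exists d => // s y _ hy; split; [exact: dcst|exact: hd].
- exact: jc_cst.
- by move=> i; apply: cts_jc; exact: hc.
- move=> i; have := dD (dcst (x ord0 i) 0) (dM (did (0 : R)) (dcst (v ord0 i) 0)).
  have -> : (fun s => x ord0 i + s * v ord0 i) = (fun s : R => (x + s *: v) ord0 i).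
    by apply/funext => s; rewrite !mxE.
  by congr (is_derive _ _ _ _); ring.
Qed.

Lemma seg_norm x y (r : R) Y : `|x| <= Y -> `|y| <= Y -> 0 <= r <= 1 -> `|x + r *: (y - x)| <= Y.
Proof.
move=> hx hy /andP[r0 r1].
have -> : x + r *: (y - x) = (1 - r) *: x + r *: y.
  by rewrite scalerBr scalerBl scale1r addrA addrAC.
apply: le_normD; rewrite !normrZ !ger0_norm ?subr_ge0 //.
have : (1 - r) * `|x| <= (1 - r) * Y by rewrite ler_wpM2l ?subr_ge0.
have : r * `|y| <= r * Y by rewrite ler_wpM2l.
lra.
Qed.

Lemma itv_lip (F dF : R -> R) a b K : a <= b -> (forall x : R, a <= x <= b -> is_derive x 1 F (dF x)) ->
  (forall x : R, a <= x <= b -> `|dF x| <= K) -> `|F b - F a| <= K * (b - a).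
Proof.
rewrite le_eqVlt => /orP[/eqP ->|ab] hF hK; first by rewrite !subrr normr0 mulr0.
have [c /andP[c1 c2] ->] := mvt ab hF.
have hc : a <= c <= b by rewrite !ltW.
by rewrite normrM (@ger0_norm _ (b - a)) ?subr_ge0 ?(ltW ab) // ler_wpM2r ?hK // subr_ge0 ltW.
Qed.

Lemma sp_lip u s Y Y' A : Y < Y' -> 0 <= A ->
  (forall y, `|y| <= Y' -> C12 u s y /\ forall i, `|jd u i s y| <= A) ->
  forall x y, `|x| <= Y -> `|y| <= Y -> `|jv u s y - jv u s x| <= n%:R * A * `|y - x|.
Proof.
move=> YY A0 h x y hx hy; set v := y - x.
have hz (r : R) : 0 <= r <= 1 -> `|x + r *: v| <= Y by exact: seg_norm.
have dr (r : R) : 0 <= r <= 1 -> is_derive r 1 (fun r => jv u s (x + r *: v)) (\sum_i v ord0 i * jd u i s (x + r *: v)).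
  move=> hr; suff hp : pd v (jv u s) (x + r *: v) (\sum_i v ord0 i * jd u i s (x + r *: v)) by exact: (pd_shift hp).
  apply: (@pd_dir v (jv u s) (fun i => jd u i s)) => [|i]; last first.
    apply: (@jc_cts R n (jd u i)); apply: c_d0; apply: (h _ _).1; apply: le_trans (ltW YY); exact: hz.
  exists (Y' - Y); first by rewrite subr_gt0.
  move=> z hzz i; apply: c_d; apply: (h z _).1.
  have := ler_normD (z - (x + r *: v)) (x + r *: v); rewrite subrK.
  by have := hz r hr; lra.
have := itv_lip (@ler01 R) dr (K := n%:R * A * `|v|).
rewrite scale1r scale0r addr0 /v addrBC subr0 mulr1; apply.
move=> r hr; apply: le_norm_sum.
rewrite -mulrA [leRHS]mulr_natl -[X in _ *+ X](card_ord n) -sumr_const; apply: ler_sum => i _.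
rewrite normrM mulrC; apply: ler_pM => //; last exact: normVE.
by apply: (h _ _).2; apply: le_trans (ltW YY); exact: hz.
Qed.

Lemma jcut_bnd u x s y A : 0 <= A -> (`|y - x| <= 1 -> `|jv u s y| <= A) -> `|jv (jcut x u) s y| <= A.
Proof.
move=> A0 h; have [hy|hy] := lerP `|y - x| 1.
  rewrite /= normrM -[leRHS]mul1r; apply: ler_pM => //; last exact: h.
  by rewrite normrX exprn_ile1 // ger0_norm ?bmp_ge0 ?bmp_le1.
by rewrite /= bmp_out ?(ltW hy) // expr0n /= mul0r normr0.
Qed.

Lemma grad_reg : exists2 K, 0 <= K & forall u a b Y A,
  (forall s y, a - 1 <= s <= b -> `|y| <= Y + 1 -> [/\ C12 u s y, `|jv u s y| <= A & `|heat u s y| <= A]) ->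
  forall i s y, a <= s <= b -> `|y| <= Y -> `|jd u i s y| <= K * A.
Proof.
have [K K0 hK] := @grad_est R n; have m0 := @momK_ge0 R n 1.
exists (K + @momK R n 1); first by rewrite addr_ge0.
move=> u a b Y A h i s y hs hy; have /andP[as' sb] := hs.
have hc (P : R -> V -> Prop) : (forall s y, a - 1 <= s <= b -> `|y| <= Y + 1 -> P s y) -> oncyl P s y.
  move=> hP s1 y1 /andP[h1 h2] h3; apply: hP; first by apply/andP; split; sra h1 h2 hs.
  by have := ler_normD (y1 - y) y; rewrite subrK; sra h3 hy.
have A0 : 0 <= A.
  have [_ hA _] := h s y ltac:(apply/andP; split; sra hs) ltac:(lra).
  exact: le_trans hA.
have h2 : 0 < (1 / 2 : R) < 1 by sra.
have := hK u s y A (hc _ (fun s y hs hy => let: And3 h _ _ := h s y hs hy in h))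
  (hc _ (fun s y hs hy => let: And3 _ h _ := h s y hs hy in h))
  (hc _ (fun s y hs hy => let: And3 _ _ h := h s y hs hy in h)) i (1 / 2) h2.
have : `|wav i u s y (1 / 2)| <= 2 * (A * @momK R n 1).
  rewrite /wav normrM; apply: ler_pM => //; first by rewrite ger0_norm; sra.
  apply: gmean_bnd => z; rewrite normrM expr1 mulrC; apply: ler_pM => //; last first.
    by have := normVE z i; sra.
  apply: jcut_bnd => // hz.
  apply: (hc (fun s y => `|jv u s y| <= A)) => //; last exact: in_cyl.
  by move=> s1 y1 h5 h6; have [] := h s1 y1 h5 h6.
set W := wav _ _ _ _ _ => h3 h4.
have := ler_normD (2 * jd u i s y - W) W; rewrite subrK normrM ger0_norm //.
have := mulr_ge0 K0 A0; sra h3 h4.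
Qed.

Definition wgt2 (H : V -> R) := forall y, `|H y| <= 2 * (1 + `|y|) ^+ 2.

Lemma cut_mean_lip (H : V -> R) u t t' x x' (q A L : R) : wgt2 H -> 0 <= A -> 0 <= L -> 0 < q < 1 ->
  oncyl (fun s y => `|jv u s y| <= A) t x -> oncyl (fun s y => `|jv u s y| <= A) t' x' ->
  (forall z, `|z| <= 1 -> `|jv u (t - q ^+ 2) (x + z) - jv u (t' - q ^+ 2) (x' + z)| <= L) ->
  `|gmean (fun y => H y * jv (jcut x u) (t - q ^+ 2) (x + q *: y)) -
    gmean (fun y => H y * jv (jcut x' u) (t' - q ^+ 2) (x' + q *: y))| <= 2 * @momK R n 2 * L.
Proof.
move=> hH A0 L0 hq uA uA' hL.
have PH : PG H by exists 2%N, 2.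
have P (t1 : R) (x1 : V) : oncyl (fun s y => `|jv u s y| <= A) t1 x1 ->
    PG (fun y => H y * jv (jcut x1 u) (t1 - q ^+ 2) (x1 + q *: y)).
  move=> h; apply: PGM => //; apply: (@PG_bnd _ _ A) => y; apply: jcut_bnd => // hy.
  by apply: h => //; exact: in_cyl.
rewrite -gmeanB; [|exact: P|exact: P].
rewrite mulrAC; apply: gmean_bnd => y; rewrite -mulrBr normrM mulrAC; apply: ler_pM => //.
rewrite /= !addrCK -mulrBr normrM.
have [hy|hy] := lerP `|q *: y| 1.
  rewrite -[leRHS]mul1r; apply: ler_pM => //; last exact: hL.
  by rewrite normrX exprn_ile1 // ger0_norm ?bmp_ge0 ?bmp_le1.
by rewrite bmp_out ?(ltW hy) // expr0n /= normr0 mul0r.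
Qed.

(** The data of [hess_est] on a cylinder enlarged by 2 in time and 4 in space, so that unit
    cylinders attached to the points of an intermediate cylinder stay inside. *)
Definition ctl g u a b Y A := [/\ 0 <= A,
  (forall s y, a - 2 <= s <= b -> `|y| <= Y + 4 ->
    [/\ C12 u s y, `|jv u s y| <= A, `|heat u s y| <= A & forall i, `|jd u i s y| <= A]) &
  (forall s x y, a - 2 <= s <= b -> `|x| <= Y + 4 -> `|y| <= Y + 4 ->
     `|heat u s y - heat u s x| <= A * `|y - x| `^ g)].

(** The scale r is left free in the first conclusion, for the equicontinuity below. The value 1/2
    gives the bounds in the second one, and the time derivative is the sum of the heat operator and
    the Laplacian. *)
Lemma hess_reg g : 0 < g <= 1 -> exists2 K, 0 <= K & forall u a b Y A, ctl g u a b Y A ->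
  (forall s x, a - 1 <= s <= b -> `|x| <= Y + 2 -> forall i j r, 0 < r < 1 ->
    `|4 * (jdd u i j s x - 6 * (i == j)%:R * jv u s x) - hav i j u s x r| <= K * A * r `^ g) /\
  forall s x, a - 1 <= s <= b -> `|x| <= Y + 2 -> (forall i j, `|jdd u i j s x| <= K * A) /\ `|jt u s x| <= K * A.
Proof.
move=> hg; have /andP[g0 g1] := hg.
have [Kh Kh0 hKh] := @hess_est R n.
have nn : 0 <= n%:R :> R by [].
have m0 := @momK_ge0 R n 2; set m2 := @momK R n 2 in m0 *; set nr : R := n%:R in nn *.
pose k0 : R := Kh * (nr + 1) / g.
have k00 : 0 <= k0 by rewrite /k0 !mulr_ge0 ?invr_ge0 ?(ltW g0) //; sra nn.
pose Kb : R := 24 + 8 * m2 + k0.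
have Kb0 : 0 <= Kb by rewrite /Kb; sra k00 m0.
have nKb : 0 <= nr * Kb by exact: mulr_ge0.
exists (1 + nr * Kb + Kb); first by sra Kb0 nKb.
move=> u a b Y A [A0 h hH].
have uL (s1 : R) (x1 y1 : V) : a - 2 <= s1 <= b -> `|x1| <= Y + 3 -> `|y1| <= Y + 3 ->
    `|jv u s1 y1 - jv u s1 x1| <= nr * A * `|y1 - x1|.
  move=> h1 h2 h3; apply: (@sp_lip u s1 (Y + 3) (Y + 4) A) => //; first by sra.
  by move=> z hz; have [? _ _ ?] := h s1 z h1 hz.
pose A1 := (nr + 1) * A; have A10 : 0 <= A1 by rewrite /A1 mulr_ge0 //; sra nn.
have AA1 : A <= A1 by rewrite /A1 ler_peMl //; sra nn.
have nA1 : nr * A <= A1 by rewrite /A1 ler_wpM2r //; sra.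
have he (s1 : R) (x1 : V) (i j : 'I_n) (r : R) : a - 1 <= s1 <= b -> `|x1| <= Y + 2 -> 0 < r < 1 ->
    `|4 * (jdd u i j s1 x1 - 6 * (i == j)%:R * jv u s1 x1) - hav i j u s1 x1 r| <= k0 * A * r `^ g.
  move=> h1 h2 h3; have -> : k0 * A = Kh * A1 / g by rewrite /k0 /A1; ring.
  have hc (P : R -> V -> Prop) : (forall s y, a - 2 <= s <= b -> `|y| <= Y + 3 -> P s y) -> oncyl P s1 x1.
    move=> hP s2 x2 h4 h5; apply: hP; first by sra h1 h4.
    by have := ler_normD (x2 - x1) x1; rewrite subrK; sra h2 h5.
  have h4 y : `|y| <= Y + 3 -> `|y| <= Y + 4 by sra.
  have x3 : `|x1| <= Y + 3 by sra h2.
  apply: hKh => //; apply: hc => s y hs hy.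
  - by have [] := h s y hs (h4 y hy).
  - by have [_ ? _ _] := h s y hs (h4 y hy); lra.
  - by have [_ _ ? _] := h s y hs (h4 y hy); lra.
  - by have [_ _ _ hh] := h s y hs (h4 y hy) => k; apply: le_trans (hh k) AA1.
  - by apply: le_trans (uL _ _ _ hs x3 hy) _; rewrite ler_wpM2r.
  - by apply: le_trans (hH _ _ _ hs (h4 _ x3) (h4 _ hy)) _; rewrite ler_wpM2r // powR_ge0.
split=> [s x hs hx i j r hr|s x hs hx].
  apply: le_trans (he s x i j r hs hx hr) _; rewrite ler_wpM2r ?powR_ge0 // ler_wpM2r //.
  have : k0 <= Kb by rewrite /Kb; sra m0.
  sra nKb.
have hdd i j : `|jdd u i j s x| <= Kb * A.
  have h2 : 0 < (1 / 2 : R) < 1 by sra.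
  have h1 := he s x i j _ hs hx h2.
  have p1 : (1 / 2 : R) `^ g <= 1.
    have p1 : (1 : R) `^ g = 1 by rewrite powR1.
    apply: (@le_trans _ _ (1 `^ g)); last by rewrite p1.
    by rewrite ge0_ler_powR ?nnegrE ?(ltW g0) //; sra.
  have h3 : `|hav i j u s x (1 / 2)| <= 4 * (2 * A * m2).
    rewrite /hav normrM; apply: ler_pM => //; first by rewrite ger0_norm; sra.
    apply: gmean_bnd => z; rewrite normrM mulrAC; apply: ler_pM => //; first exact: herm_bnd.
    apply: jcut_bnd => // hz; have hin := in_cyl s h2.
    have [] := h (s - (1 / 2) ^+ 2) (x + (1 / 2) *: z) _ _ => //; first by sra hs.
    by have := ler_normD (x + (1 / 2) *: z - x) x; rewrite subrK; sra hx hz.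
  have h4 : `|6 * (i == j)%:R * jv u s x| <= 6 * A.
    have [_ ? _ _] := h s x ltac:(sra hs) ltac:(sra hx).
    rewrite !normrM (@ger0_norm _ 6) // -mulrA ler_wpM2l // -[leRHS]mul1r; apply: ler_pM => //.
    by case: (i == j); rewrite ?normr1 ?normr0.
  have h5 : k0 * A * (1 / 2) `^ g <= k0 * A by rewrite ler_piMr // mulr_ge0.
  move: h1 h3 h4; set W := hav _ _ _ _ _ _; set U := 6 * _ * _; set D := jdd _ _ _ _ _.
  rewrite !ler_norml /Kb => /andP[? ?] /andP[? ?] /andP[? ?].
  by apply/andP; split; lra.
have KA : 0 <= Kb * A by exact: mulr_ge0.
have nKA : 0 <= nr * Kb * A by exact: mulr_ge0.
split=> [i j|]; first by apply: le_trans (hdd i j) _; lra.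
have -> : jt u s x = heat u s x + \sum_i jdd u i i s x by rewrite /heat subrK.
have [_ _ ? _] := h s x ltac:(lra) ltac:(lra).
apply: le_normD.
have : `|\sum_i jdd u i i s x| <= nr * (Kb * A).
  apply: le_norm_sum.
  by rewrite [leRHS]mulr_natl -[X in _ *+ X](card_ord n) -sumr_const; apply: ler_sum.
lra.
Qed.

End Interior.

(** * Equicontinuity of derivatives *)

Section Interior2.
Context {R : realType} {n : nat}.
Local Notation V := 'rV[R]_n.
Implicit Types (x y : V) (A c e d s g a b Y : R) (u : @jf R n).

(** At scale q the derivatives differ from weighted means of u by errors of order q and q^g. These
    means inherit the Lipschitz continuity of u in (t, x), at the cost of q^-1 and q^-2 from their
    normalisation. The free parameter q is balanced against the distance in [small_mod]. *)
Lemma equi g : 0 < g <= 1 -> exists2 K, 0 <= K & forall u a b Y A, ctl g u a b Y A ->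
  forall s s' x x' q, a <= s <= b -> a <= s' <= b -> `|x| <= Y -> `|x'| <= Y -> 0 < q < 1 ->
    let d := `|s - s'| + `|x - x'| in
    [/\ `|jv u s x - jv u s' x'| <= K * A * d,
        forall i, `|jd u i s x - jd u i s' x'| <= K * A * (q + q^-1 * d) &
        forall i j, `|jdd u i j s x - jdd u i j s' x'| <= K * A * (q `^ g + q^-1 * q^-1 * d)].
Proof.
move=> hg; have /andP[g0 g1] := hg.
have [Kg Kg0 hKg] := @grad_est R n; have [Kh Kh0 hKh] := @hess_reg R n g hg.
have nn : 0 <= n%:R :> R by [].
have m0 := @momK_ge0 R n 2; set m2 := @momK R n 2 in m0 *; set nr : R := n%:R in nn *.
pose KL := Kh + nr.
have KL0 : 0 <= KL by rewrite /KL; sra Kh0 nn.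
have mK : 0 <= m2 * KL by rewrite mulr_ge0.
exists (KL + (Kg + m2 * KL) + (6 * KL + Kh + m2 * KL)); first by sra KL0 Kg0 Kh0 mK.
move=> u a b Y A H; have [hA hB] := hKh u a b Y A H; have [A0 h hH] := H.
move=> s s' x x' q hs hs' hx hx' hq; have /andP[q0 q1] := hq.
have uL (s1 s2 : R) (x1 x2 : V) : a - 1 <= s1 <= b -> a - 1 <= s2 <= b -> `|x1| <= Y + 2 -> `|x2| <= Y + 2 ->
    `|jv u s1 x1 - jv u s2 x2| <= KL * A * (`|s1 - s2| + `|x1 - x2|).
  move=> h1 h2 h3 h4.
  have l1 : `|jv u s1 x1 - jv u s1 x2| <= nr * A * `|x1 - x2|.
    apply: (@sp_lip R n u s1 (Y + 2) (Y + 4) A) => //; first by sra.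
    by move=> z hz; have [? _ _ ?] := h s1 z ltac:(sra h1 q1) hz.
  have l2 : `|jv u s1 x2 - jv u s2 x2| <= Kh * A * `|s1 - s2|.
    have T (c e : R) : a - 1 <= c -> c <= e -> e <= b -> `|jv u e x2 - jv u c x2| <= Kh * A * (e - c).
      move=> hc ce he; apply: (@itv_lip R (fun s => jv u s x2) (fun s => jt u s x2)) => // r hr.
        have r2 : a - 2 <= r <= b by clear -hr hc he; lra.
        have x24 : `|x2| <= Y + 4 by clear -h4; lra.
        by apply: c_t; have [] := h r x2 r2 x24.
      by have [] := hB r x2 ltac:(sra hc he hr) h4.
    move/andP: h1 => [? ?]; move/andP: h2 => [? ?].
    have [ss|ss] := lerP s1 s2.
      by rewrite distrC; exact: T.
    by apply: T => //; exact: ltW.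
  have -> : jv u s1 x1 - jv u s2 x2 = jv u s1 x1 - jv u s1 x2 + (jv u s1 x2 - jv u s2 x2) by rewrite addrA subrK.
  apply: le_normD; rewrite /KL.
  have := mulr_ge0 (mulr_ge0 nn A0) (normr_ge0 (s1 - s2)).
  have := mulr_ge0 (mulr_ge0 Kh0 A0) (normr_ge0 (x1 - x2)).
  sra l1 l2.
move=> d; have d0 : 0 <= d by rewrite addr_ge0.
have cyl (P : R -> V -> Prop) (s1 : R) (x1 : V) : a <= s1 <= b -> `|x1| <= Y ->
    (forall s y, a - 2 <= s <= b -> `|y| <= Y + 4 -> P s y) -> oncyl P s1 x1.
  move=> h1 h2 hP s2 x2 h4 h5; apply: hP; first by sra h1 h4.
  by have := ler_normD (x2 - x1) x1; rewrite subrK; sra h2 h5.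
have bA (s1 : R) (x1 : V) : a <= s1 <= b -> `|x1| <= Y -> oncyl (fun s y => `|jv u s y| <= A) s1 x1.
  by move=> h1 h2; apply: cyl => // s2 y2 h3 h4; have [] := h s2 y2 h3 h4.
have q2 : 0 < q ^+ 2 < 1 by rewrite exprn_gt0 //= exprn_ilt1 // ltW.
have zL z : `|z| <= 1 -> `|jv u (s - q ^+ 2) (x + z) - jv u (s' - q ^+ 2) (x' + z)| <= KL * A * d.
  move=> hz; apply: le_trans (uL _ _ _ _ _ _ _ _) _; [clear -hs q2; lra|clear -hs' q2; lra| | |].
  - by have := ler_normD x z; sra hx hz.
  - by have := ler_normD x' z; sra hx' hz.
  rewrite /d (_ : s - q ^+ 2 - (s' - q ^+ 2) = s - s'); last by ring.
  by rewrite (_ : x + z - (x' + z) = x - x') // opprD addrACA subrr addr0.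
have LA : 0 <= KL * A * d by rewrite !mulr_ge0.
have mLA : 0 <= m2 * KL * A * d by exact: mulr_ge0 (mulr_ge0 mK A0) d0.
have qi0 : 0 <= q^-1 by rewrite invr_ge0 ltW.
have qi1 : 1 <= q^-1 by rewrite invf_ge1 ?(ltW q1).
have c1 : 0 <= KL * A by exact: mulr_ge0.
have c2 : 0 <= Kg * A by exact: mulr_ge0.
have c3 : 0 <= Kh * A by exact: mulr_ge0.
have c4 : 0 <= m2 * KL * A by exact: mulr_ge0.
have W H (hH : wgt2 H) := cut_mean_lip hH A0 LA hq (bA s x hs hx) (bA s' x' hs' hx') zL.
have C0 (i : 'I_n) (s1 : R) (x1 : V) : a <= s1 <= b -> `|x1| <= Y -> `|2 * jd u i s1 x1 - wav i u s1 x1 q| <= Kg * A * q.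
  move=> h1 h2; apply: hKg => //; apply: cyl => // s2 y2 h3 h4; by have [] := h s2 y2 h3 h4.
clear cyl zL h H hKg.
have sa : a - 1 <= s <= b by clear -hs; lra.
have sa' : a - 1 <= s' <= b by clear -hs'; lra.
have xa : `|x| <= Y + 2 by clear -hx; lra.
have xa' : `|x'| <= Y + 2 by clear -hx'; lra.
have uab := uL s s' x x' sa sa' xa xa'.
rewrite -/d in uab.
clear bA uL hB.
split.
- by apply: le_trans uab _; apply: ler_wpM2r => //; sra c1 c2 c3 c4.
- move=> i.
  have wi : wgt2 (fun y : V => y ord0 i).
    move=> y; have := normVE y i; have := normr_ge0 y; rewrite expr2; clear; move: `|y| `|_| => *; nra.
  have hw : `|wav i u s x q - wav i u s' x' q| <= q^-1 * (2 * m2 * (KL * A * d)).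
    by rewrite /wav -mulrBr normrM (ger0_norm qi0) ler_wpM2l // W.
  have k1 := C0 i s x hs hx; have k2 := C0 i s' x' hs' hx'.
  have -> : jd u i s x - jd u i s' x' = (2 * jd u i s x - wav i u s x q - (2 * jd u i s' x' - wav i u s' x' q) +
     (wav i u s x q - wav i u s' x' q)) / 2 by field.
  rewrite normrM (@ger0_norm _ 2^-1) ?invr_ge0 //.
  have := ler_normD (2 * jd u i s x - wav i u s x q - (2 * jd u i s' x' - wav i u s' x' q)) (wav i u s x q - wav i u s' x' q).
  have := ler_normB (2 * jd u i s x - wav i u s x q) (2 * jd u i s' x' - wav i u s' x' q).
  move=> k3 k4; rewrite ler_pdivrMr //.
  clear C0 W wi hA LA mLA c1 c2 c3 c4 uab.
  have e1 : 0 <= (KL + m2 * KL + (6 * KL + Kh + m2 * KL)) * A * q by rewrite !mulr_ge0 ?(ltW q0) //; sra KL0 Kh0 mK.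
  have e2 : 0 <= (KL + Kg + (6 * KL + Kh + m2 * KL)) * A * (q^-1 * d) by rewrite !mulr_ge0 //; sra KL0 Kg0 Kh0 mK.
  move: e1 e2 k1 k2 k3 k4 hw; set q' := q^-1; clear; sra.
- move=> i j.
  have hw : `|hav i j u s x q - hav i j u s' x' q| <= q^-1 * q^-1 * (2 * m2 * (KL * A * d)).
    rewrite /hav -mulrBr normrM (ger0_norm (mulr_ge0 qi0 qi0)) ler_wpM2l ?mulr_ge0 // W //.
    exact: herm_bnd.
  have k1 := hA s x sa xa i j q hq; have k2 := hA s' x' sa' xa' i j q hq.
  have k5 : `|6 * (i == j)%:R * (jv u s x - jv u s' x')| <= 6 * (KL * A * d).
    rewrite normrM; apply: ler_pM => //; rewrite normrM (@ger0_norm _ 6) // -[leRHS]mulr1 ler_wpM2l //.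
    by case: (i == j); rewrite ?normr1 ?normr0.
  clear C0 W hA.
  move: hw k1 k2 k5; set W1 := hav _ _ _ _ _ _; set W2 := hav _ _ _ _ _ _; set D1 := jdd _ _ _ _ _; set D2 := jdd _ _ _ _ _.
  set u1 := jv _ _ _; set u2 := jv _ _ _; set dl : R := (i == j)%:R.
  have qg0 : 0 <= q `^ g by exact: powR_ge0.
  have e3 : 1 * d <= q^-1 * q^-1 * d by apply: ler_wpM2r => //; rewrite -[leLHS]mulr1; apply: ler_pM.
  have e4 : 6 * (KL * A) * d <= 6 * (KL * A) * (q^-1 * q^-1 * d) by rewrite ler_wpM2l ?mulr_ge0 //; sra e3.
  have e1 : 0 <= (KL + (Kg + m2 * KL) + (6 * KL + m2 * KL)) * A * q `^ g by rewrite !mulr_ge0 //; sra KL0 Kg0 mK.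
  have e2 : 0 <= (KL + (Kg + m2 * KL) + Kh) * A * (q^-1 * q^-1 * d) by rewrite !mulr_ge0 //; sra KL0 Kg0 Kh0 mK.
  move: e1 e2 e4; set qq := q^-1 * q^-1; rewrite !ler_norml; clear.
  move=> e1 e2 e4 /andP[? ?] /andP[? ?] /andP[? ?] /andP[? ?]; apply/andP; split; lra.
Qed.


Lemma small_mod g : 0 < g <= 1 -> forall e, 0 < e -> exists q d0, [/\ 0 < q < 1, 0 < d0 & forall d, 0 <= d -> d < d0 ->
  [/\ d < e, q + q^-1 * d < e & q `^ g + q^-1 * q^-1 * d < e]].
Proof.
move=> /andP[g0 g1] e e0; pose q : R := Num.min (1 / 2) ((e / 2) `^ g^-1).
have p0 : 0 < (e / 2) `^ g^-1 by apply: powR_gt0; lra.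
have q0 : 0 < q by rewrite lt_min p0 andbT; lra.
have q12 : q <= 1 / 2 by rewrite ge_min lexx.
have q1 : q < 1 by lra.
have qe : q `^ g <= e / 2.
  have -> : e / 2 = ((e / 2) `^ g^-1) `^ g by rewrite -powRrM mulVf ?powRr1 //; [lra|rewrite gt_eqF].
  by rewrite ge0_ler_powR ?nnegrE ?(ltW q0) ?(ltW g0) ?(ltW p0) // ge_min lexx orbT.
have qq : q <= q `^ g by apply: powR_ge_id => //; exact: ltW.
exists q, (q * q * (e / 2)); split; [by rewrite q0|by rewrite !mulr_gt0 //; lra|move=> d d0 dd].
have w0 : 0 < q^-1 by rewrite invr_gt0.
have w1 : 1 <= q^-1 by rewrite invf_ge1 // ltW.
have h1 : q^-1 * q^-1 * d < e / 2 by rewrite -invfM mulrC ltr_pdivrMr ?mulr_gt0 // mulrC.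
have h2 : q^-1 * d <= q^-1 * (q^-1 * d) by rewrite ler_wpM2l ?(ltW w0) // ler_peMl.
have h3 : d <= q^-1 * d by rewrite ler_peMl.
by rewrite mulrA in h2; split; lra.
Qed.

Lemma min1_powR (r B g : R) : 0 < g <= 1 -> 0 <= r -> 0 <= B -> Num.min 1 r * B <= B * r `^ g.
Proof.
move=> /andP[g0 g1] r0 B0; rewrite mulrC ler_wpM2l //.
have [h|h] := lerP 1 r; first by apply: powR_ge1 => //; exact: ltW.
by apply: powR_ge_id => //; exact: ltW.
Qed.

(** The modulus of the source may involve u itself, because in the application the source is a
    function of x and u; [ctl_of] removes this term by the gradient bound. *)
Definition hctl g u A s0 s1 Y := (forall s y, s0 <= s <= s1 -> `|y| <= Y ->
    [/\ C12 u s y, `|jv u s y| <= A & `|heat u s y| <= A]) /\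
  (forall s x y, s0 <= s <= s1 -> `|x| <= Y -> `|y| <= Y ->
     `|heat u s y - heat u s x| <= A * (`|y - x| `^ g + `|jv u s y - jv u s x|)).

Lemma ctl_of g : 0 < g <= 1 -> exists Af : R -> R, forall u a b Y A, 0 <= A ->
  hctl g u A (a - 3) b (Y + 6) -> ctl g u a b Y (Af A).
Proof.
move=> hg; have [K K0 hK] := @grad_reg R n.
exists (fun A => A + K * A + A * (1 + (2 * A + n%:R * (K * A)))) => u a b Y A A0 [h1 h2].
have KA : 0 <= K * A by exact: mulr_ge0.
have nKA : 0 <= n%:R * (K * A) by exact: mulr_ge0.
have B0 : 0 <= A * (1 + (2 * A + n%:R * (K * A))) by apply: mulr_ge0 => //; lra.
have hd i s y : a - 2 <= s <= b -> `|y| <= Y + 5 -> `|jd u i s y| <= K * A.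
  move=> hs hy; apply: (hK u (a - 2) b (Y + 5) A) => // s1 y1 h3 h4; apply: h1; lra.
split; first by lra.
  move=> s y hs hy; have hy' : `|y| <= Y + 5 by lra.
  have [||c1 c2 c3] := h1 s y; [by lra|by lra|split => //; try lra].
  by move=> i; have := hd i s y hs hy'; lra.
move=> s x y hs hx hy; apply: le_trans (h2 s x y _ _ _) _; [by lra|by lra|by lra|].
apply: (@le_trans _ _ (A * (1 + (2 * A + n%:R * (K * A))) * `|y - x| `^ g)); last first.
  by rewrite ler_wpM2r ?powR_ge0 //; lra.
rewrite -mulrA ler_wpM2l // mulrDl mul1r lerD2l.
apply: le_trans (min1_powR hg (normr_ge0 (y - x)) _); last by lra.
have e1 : `|jv u s y - jv u s x| <= n%:R * (K * A) * `|y - x|.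
  apply: (@sp_lip R n u s (Y + 4) (Y + 5)) => //; first by lra.
  move=> z hz; split; last by move=> i; exact: hd.
  by have [] := h1 s z ltac:(lra) ltac:(lra).
have e2 : `|jv u s y - jv u s x| <= 2 * A.
  have [_ ? _] := h1 s x ltac:(lra) ltac:(lra); have [_ ? _] := h1 s y ltac:(lra) ltac:(lra).
  by apply: le_normB; lra.
have [h|h] := lerP 1 `|y - x|; first by lra.
apply: le_trans e1 _; rewrite mulrC ler_wpM2l //; lra.
Qed.

End Interior2.

(** * Locally uniform convergence and parabolic compactness *)

Section Limits.
Context {R : realType} {n : nat}.
Local Notation V := 'rV[R]_n.
Implicit Types (x y v : V) (A C c e d t s g a b l : R) (w : nat -> @jf R n) (f h : nat -> R -> V -> R).

(** Closeness to l on a whole neighbourhood of (t, x) for almost all k. This notion is stable under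
    algebra, makes the limit continuous ([cc_jc]) and lets derivatives pass to the limit
    ([lim_is_derive]). *)
Definition cc f l t x := forall e, 0 < e -> exists2 d, 0 < d &
  ev (fun k => forall s y, `|s - t| < d -> `|y - x| < d -> `|f k s y - l| < e).

Lemma cc_ucv f l t x : cc f l t x -> ucv (fun k => f k t x) l.
Proof.
move=> h e e0; have [d d0 hd] := h e e0; apply: evS hd => k; apply; by rewrite subrr normr0.
Qed.

Lemma cc_equi f l t x : ucv (fun k => f k t x) l ->
  (forall e, 0 < e -> exists2 d, 0 < d &
    ev (fun k => forall s y, `|s - t| < d -> `|y - x| < d -> `|f k s y - f k t x| < e)) -> cc f l t x.
Proof.
move=> hl h e e0; have e2 : 0 < e / 2 by lra.
have [d d0 hd] := h _ e2; exists d => //; apply: (ev2 _ hd (hl _ e2)) => k h1 h2 s y hs hy.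
have -> : f k s y - l = (f k s y - f k t x) + (f k t x - l) by rewrite addrA subrK.
apply: lt_normD; have := h1 s y hs hy; sra h2.
Qed.

Lemma cc_ext f h l t x : (exists2 d, 0 < d &
   ev (fun k => forall s y, `|s - t| < d -> `|y - x| < d -> f k s y = h k s y)) -> cc f l t x -> cc h l t x.
Proof.
move=> [d d0 hd] hc e e0; have [d1 d10 h1] := hc e e0; exists (Num.min d d1); first by rewrite lt_min d0.
apply: (ev2 _ hd h1) => k h2 h3 s y; rewrite !lt_min => /andP[? ?] /andP[? ?]; rewrite -h2 //; exact: h3.
Qed.

Lemma cc_jc2 (p : R -> R -> R) f h l m t x : (forall e, 0 < e -> exists2 d, 0 < d & forall a b, `|a - l| < d -> `|b - m| < d -> `|p a b - p l m| < e) ->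
  cc f l t x -> cc h m t x -> cc (fun k s y => p (f k s y) (h k s y)) (p l m) t x.
Proof.
move=> hp hf hh e e0; have [d0 d00 h0] := hp e e0; have [d1 d10 h1] := hf d0 d00; have [d2 d20 h2] := hh d0 d00.
exists (Num.min d1 d2); first by rewrite lt_min d10.
apply: (ev2 _ h1 h2) => k h3 h4 s y; rewrite !lt_min => /andP[? ?] /andP[? ?].
by apply: h0; [exact: h3|exact: h4].
Qed.

Lemma ccD f h l m t x : cc f l t x -> cc h m t x -> cc (fun k s y => f k s y + h k s y) (l + m) t x.
Proof.
apply: (@cc_jc2 (fun a b => a + b)) => e e0; exists (e / 2) => [|a b ha hb]; first by lra.
by rewrite opprD addrACA; apply: lt_normD; lra.
Qed.

Lemma ccM f h l m t x : cc f l t x -> cc h m t x -> cc (fun k s y => f k s y * h k s y) (l * m) t x.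
Proof.
apply: (@cc_jc2 (fun a b => a * b)) => e e0.
have D0 : 0 < 1 + `|l| + `|m| by have := normr_ge0 l; have := normr_ge0 m; lra.
exists (Num.min 1 (e / (1 + `|l| + `|m|))) => [|a b]; first by rewrite lt_min ltr01 divr_gt0.
rewrite !lt_min => /andP[a1 a2] /andP[b1 b2].
have -> : a * b - l * m = (a - l) * (b - m) + l * (b - m) + m * (a - l) by ring.
apply: lt_normD; apply: le_lt_trans (lerD (ler_normD _ _) (lexx _)) _.
rewrite !normrM; rewrite ltr_pdivlMr // in a2; rewrite ltr_pdivlMr // in b2.
have := normr_ge0 l; have := normr_ge0 m; have := normr_ge0 (a - l); have := normr_ge0 (b - m).
move: `|a - l| `|b - m| `|l| `|m| a1 a2 b1 b2 {D0} => p q r s a1 a2 b1 b2 *.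
have [hpq|hpq] := lerP p q.
  have : p * q <= q by rewrite ler_piMl //; lra.
  have : s * p <= s * q by rewrite ler_wpM2l.
  sra b2.
have : p * q <= p by rewrite ler_piMr //; lra.
have : r * q <= r * p by rewrite ler_wpM2l //; lra.
sra a2.
Qed.

Lemma cc_cst l t x : cc (fun _ _ _ => l) l t x.
Proof. by move=> e e0; exists 1 => //; apply: evE => k s y _ _; rewrite subrr normr0. Qed.

Lemma ccZ c f l t x : cc f l t x -> cc (fun k s y => c * f k s y) (c * l) t x.
Proof. by move=> h; apply: ccM => //; exact: cc_cst. Qed.

Lemma cc_sum (I : finType) (F : I -> nat -> R -> V -> R) (l : I -> R) t x :
  (forall i, cc (F i) (l i) t x) -> cc (fun k s y => \sum_i F i k s y) (\sum_i l i) t x.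
Proof.
move=> h; suff H (r : seq I) : cc (fun k s y => \sum_(i <- r) F i k s y) (\sum_(i <- r) l i) t x by exact: H.
elim: r => [|i r IH].
  rewrite big_nil; apply: (@cc_ext (fun _ _ _ => 0)); last exact: cc_cst.
  by exists 1 => //; apply: evE => k s y _ _; rewrite big_nil.
rewrite big_cons; apply: (@cc_ext (fun k s y => F i k s y + \sum_(j <- r) F j k s y)).
  by exists 1 => //; apply: evE => k s y _ _; rewrite big_cons.
exact: ccD.
Qed.

Lemma cc_comp (p : R -> R) f l t x : ctsat p l -> cc f l t x -> cc (fun k s y => p (f k s y)) (p l) t x.
Proof.
move=> hp hf e e0; have [d0 d00 h0] := hp e e0; have [d1 d10 h1] := hf d0 d00.
by exists d1 => //; apply: evS h1 => k h3 s y h4 h5; apply: h0; exact: h3.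
Qed.

Lemma cc_jc f (F : R -> V -> R) t x : cc f (F t x) t x ->
  (exists2 d, 0 < d & forall s y, `|s - t| < d -> `|y - x| < d -> ucv (fun k => f k s y) (F s y)) -> jc F t x.
Proof.
move=> hc [d d0 hd] e e0; have e2 : 0 < e / 2 by lra.
have [d1 d10 h1] := hc _ e2; exists (Num.min d d1); first by rewrite lt_min d0.
move=> s y; rewrite !lt_min => /andP[s1 s2] /andP[y1 y2].
apply: (@le_lt_trans _ _ (e / 2)); last by sra e0.
apply: ucv_lel (ucv_norm (ucvB (hd s y s1 y1) (ucv_cst (F t x)))) _.
by apply: evS h1 => k hk; apply: ltW; exact: hk.
Qed.

Lemma cc_shift f l (t0 q : R) x0 t x : 0 < q ->
  cc (fun k s y => f k (t0 + q ^+ 2 * s) (x0 + q *: y)) l t x -> cc f l (t0 + q ^+ 2 * t) (x0 + q *: x).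
Proof.
move=> q0 h e e0; have [d d0 hd] := h e e0.
have q2 : 0 < q ^+ 2 by rewrite exprn_gt0.
exists (Num.min (q ^+ 2 * d) (q * d)); first by rewrite lt_min !mulr_gt0.
apply: evS hd => k hk s y; rewrite !lt_min => /andP[s1 _] /andP[_ y2].
have := hk (q ^- 2 * (s - t0)) (q^-1 *: (y - x0)).
rewrite mulVKf ?gt_eqF // scalerA mulfV ?gt_eqF // scale1r (addrC t0) subrK (addrC x0) subrK; apply.
  have -> : q ^- 2 * (s - t0) - t = q ^- 2 * (s - (t0 + q ^+ 2 * t)) by field; rewrite gt_eqF.
  by rewrite normrM ger0_norm ?invr_ge0 ?(ltW q2) // ltr_pdivrMl.
have -> : q^-1 *: (y - x0) - x = q^-1 *: (y - (x0 + q *: x)).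
  by rewrite !scalerBr scalerDr scalerA mulVf ?gt_eqF // scale1r opprD addrA.
by rewrite normrZ ger0_norm ?invr_ge0 ?(ltW q0) // ltr_pdivrMl.
Qed.

(** Subtracting the linear function with slope l leaves functions whose derivative is at most e near
    z; the resulting mean value bound passes to the limit. *)
Lemma lim_is_derive (F F' : nat -> R -> R) (G : R -> R) (l z d : R) : 0 < d ->
  (forall s, `|s - z| < d -> ucv (fun k => F k s) (G s)) ->
  ev (fun k => forall s, `|s - z| < d -> is_derive s 1 (F k) (F' k s)) ->
  (forall e, 0 < e -> exists2 d, 0 < d & ev (fun k => forall s, `|s - z| < d -> `|F' k s - l| < e)) ->
  is_derive z 1 G l.
Proof.
move=> d0 hG hF hl; apply/derP => e e0; have [d1 d10 h1] := hl e e0.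
exists (Num.min d d1); first by rewrite lt_min d0.
move=> q; rewrite lt_min => /andP[q1 q2].
have hz : `|z - z| < d by rewrite subrr normr0.
have hzq : `|z + q - z| < d by rewrite addrCK.
apply: ucv_lel (ucv_norm (ucvB (ucvB (hG _ hzq) (hG _ hz)) (ucv_cst (l * q)))) _.
apply: (ev2 _ hF h1) => k h2 h3.
have := @derive_bound R (fun s => F k s - l * s) (fun s => F' k s - l) z (z + q) e.
rewrite addrCK => h.
have -> : F k (z + q) - F k z - l * q = F k (z + q) - l * (z + q) - (F k z - l * z) by ring.
apply: h => s hs; have hs1 := le_lt_trans hs q1; have hs2 := le_lt_trans hs q2.
  have := dB (h2 s hs1) (dZ l (did s)); by rewrite mulr1.
exact: ltW (h3 s hs2).
Qed.

Record jcc w (U : @jf R n) t x : Prop := Jcc {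
  j_v : cc (fun k => jv (w k)) (jv U t x) t x;
  j_t : cc (fun k => jt (w k)) (jt U t x) t x;
  j_d : forall i, cc (fun k => jd (w k) i) (jd U i t x) t x;
  j_dd : forall i j, cc (fun k => jdd (w k) i j) (jdd U i j t x) t x }.

Lemma lim_C12 w U t x : (exists2 d, 0 < d & (forall s y, `|s - t| < d -> `|y - x| < d -> jcc w U s y) /\
    ev (fun k => forall s y, `|s - t| < d -> `|y - x| < d -> C12 (w k) s y)) -> C12 U t x.
Proof.
move=> [d d0 [hj hC]].
have xx : `|x - x| < d by rewrite subrr normr0.
have tt' : `|t - t| < d by rewrite subrr normr0.
have h0 := hj t x tt' xx.
have pdl (f : nat -> V -> R) (f' : nat -> R -> V -> R) (F : V -> R) (l : R) (v : V) :
    (forall y, `|y - x| < d -> ucv (fun k => f k y) (F y)) ->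
    ev (fun k => forall y, `|y - x| < d -> pd v (f k) y (f' k t y)) -> cc f' l t x -> pd v F x l.
  move=> h1 h2 h3; rewrite /pd; have v0 : 0 < `|v| + 1 by have := normr_ge0 v; lra.
  have dv (e s : R) : 0 < e -> `|s - 0| < e / (`|v| + 1) -> `|x + s *: v - x| < e.
    rewrite subr0 addrCK normrZ ltr_pdivlMr // => e0 h; apply: le_lt_trans h.
    by rewrite ler_wpM2l // lerDl.
  apply: (@lim_is_derive (fun k s => f k (x + s *: v)) (fun k s => f' k t (x + s *: v)) _ _ _ (d / (`|v| + 1))).
  - by rewrite divr_gt0.
  - by move=> s hs; apply: h1; exact: dv.
  - by apply: evS h2 => k hk s hs; apply: pd_shift; apply: hk; exact: dv.
  - move=> e e0; have [d1 d10 hd1] := h3 e e0; exists (d1 / (`|v| + 1)); first by rewrite divr_gt0.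
    by apply: evS hd1 => k hk s hs; apply: hk; [rewrite subrr normr0|exact: dv].
split.
- apply: (@lim_is_derive (fun k s => jv (w k) s x) (fun k s => jt (w k) s x) _ _ _ d) => //.
  + by move=> s hs; apply: (@cc_ucv (fun k => jv (w k))); exact: (j_v (hj s x hs xx)).
  + by apply: evS hC => k hk s hs; exact: (c_t (hk s x hs xx)).
  + move=> e e0; have [d1 d10 hd1] := j_t h0 e0; exists d1 => //.
    by apply: evS hd1 => k hk s hs; apply: hk => //; rewrite subrr normr0.
- move=> i; apply: (pdl (fun k => jv (w k) t) (fun k => jd (w k) i)) (j_d h0 i).
  + by move=> y hy; apply: (@cc_ucv (fun k => jv (w k))); exact: (j_v (hj t y tt' hy)).
  + by apply: evS hC => k hk y hy; exact: (c_d (hk t y tt' hy)).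
- move=> i l; apply: (pdl (fun k => jd (w k) i t) (fun k => jdd (w k) i l)) (j_dd h0 i l).
  + by move=> y hy; apply: (@cc_ucv (fun k => jd (w k) i)); exact: (j_d (hj t y tt' hy) i).
  + by apply: evS hC => k hk y hy; exact: (c_dd (hk t y tt' hy) i l).
- by apply: cc_jc (j_v h0) _; exists d => // s y hs hy; apply: (@cc_ucv (fun k => jv (w k))); exact: (j_v (hj s y hs hy)).
- by apply: cc_jc (j_t h0) _; exists d => // s y hs hy; apply: (@cc_ucv (fun k => jt (w k))); exact: (j_t (hj s y hs hy)).
- by move=> i; apply: cc_jc (j_d h0 i) _; exists d => // s y hs hy; apply: (@cc_ucv (fun k => jd (w k) i)); exact: (j_d (hj s y hs hy)).
- by move=> i j; apply: cc_jc (j_dd h0 i j) _; exists d => // s y hs hy; apply: (@cc_ucv (fun k => jdd (w k) i j)); exact: (j_dd (hj s y hs hy)).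
Qed.

Lemma jcc_heat w U t x : jcc w U t x -> cc (fun k => heat (w k)) (heat U t x) t x.
Proof.
move=> h; rewrite /heat -[- _]mulN1r.
apply: (@cc_ext (fun k s y => jt (w k) s y + -1 * \sum_i jdd (w k) i i s y)).
  by exists 1 => //; apply: evE => k s y _ _; rewrite mulN1r.
by apply: ccD; [exact: j_t|apply: ccZ; apply: cc_sum => i; exact: j_dd].
Qed.

Definition jlim w : @jf R n := Jf (fun t x => ulim (fun k => jv (w k) t x)) (fun t x => ulim (fun k => jt (w k) t x))
  (fun i t x => ulim (fun k => jd (w k) i t x)) (fun i j t x => ulim (fun k => jdd (w k) i j t x)).

Definition jscale (c q t0 : R) x0 (u : @jf R n) : @jf R n :=
  Jf (fun t x => c * jv u (t0 + q ^+ 2 * t) (x0 + q *: x))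
     (fun t x => c * q ^+ 2 * jt u (t0 + q ^+ 2 * t) (x0 + q *: x))
     (fun i t x => c * q * jd u i (t0 + q ^+ 2 * t) (x0 + q *: x))
     (fun i j t x => c * q ^+ 2 * jdd u i j (t0 + q ^+ 2 * t) (x0 + q *: x)).

Lemma jc_aff (F : R -> V -> R) (c q t0 : R) x0 t x : 0 < q -> jc F (t0 + q ^+ 2 * t) (x0 + q *: x) ->
  jc (fun s y => c * F (t0 + q ^+ 2 * s) (x0 + q *: y)) t x.
Proof.
move=> q0 h; apply: jcZ => e e0; have [d d0 hd] := h e e0.
have q2 : 0 < q ^+ 2 by rewrite exprn_gt0.
exists (Num.min (q ^- 2 * d) (q^-1 * d)); first by rewrite lt_min !mulr_gt0 ?invr_gt0.
move=> s y; rewrite !lt_min => /andP[s1 _] /andP[_ y2]; apply: hd.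
  rewrite (_ : _ - _ = q ^+ 2 * (s - t)); last by ring.
  by rewrite normrM ger0_norm ?(ltW q2) // -ltr_pdivlMl.
rewrite (_ : _ - _ = q *: (y - x)); last by rewrite scalerBr opprD addrACA subrr add0r.
by rewrite normrZ ger0_norm ?(ltW q0) // -ltr_pdivlMl.
Qed.

Lemma C12_scale (c q t0 : R) x0 u t x : 0 < q -> C12 u (t0 + q ^+ 2 * t) (x0 + q *: x) ->
  C12 (jscale c q t0 x0 u) t x.
Proof.
move=> q0 h; have q2 : 0 < q ^+ 2 by rewrite exprn_gt0.
have pds (f : V -> R) (l c1 : R) (v : V) : pd v f (x0 + q *: x) l -> pd v (fun y => c1 * f (x0 + q *: y)) x (c1 * q * l).
  move=> hp; have := pdM (pdcst v c1 x) (pd_scale hp); by congr (pd _ _ _ _); ring.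
split; try (move=> *; exact: jc_aff).
- have h1 := dD (dcst t0 t) (dZ (q ^+ 2) (did t)).
  have := dZ c (@dcomp R (fun s => jv u s (x0 + q *: x)) (fun s => t0 + q ^+ 2 * s) t _ _ (c_t h) h1); by congr (is_derive _ _ _ _); rewrite add0r /=; ring.
- move=> i; exact: pds (c_d h i).
- move=> i j; have := pds _ _ (c * q) _ (c_dd h i j); by congr (pd _ _ _ _); rewrite /= expr2; ring.
- exact: jc_aff (c_v0 h).
- exact: jc_aff (c_t0 h).
- move=> i; exact: jc_aff (c_d0 h i).
- move=> i j; exact: jc_aff (c_dd0 h i j).
Qed.

Lemma heat_scale (c q t0 : R) x0 u t x :
  heat (jscale c q t0 x0 u) t x = c * q ^+ 2 * heat u (t0 + q ^+ 2 * t) (x0 + q *: x).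
Proof. by rewrite /heat /= mulrBr mulr_sumr. Qed.

Lemma cc_ulim f l t x : cc f l t x -> cc f (ulim (fun k => f k t x)) t x.
Proof. by move=> h; rewrite (ulimE (cc_ucv h)). Qed.

Lemma cc_lim f (C : R) t x : ev (fun k => `|f k t x| <= C) ->
  (forall e, 0 < e -> exists2 d, 0 < d &
    ev (fun k => forall s y, `|s - t| < d -> `|y - x| < d -> `|f k s y - f k t x| < e)) ->
  exists l, cc f l t x.
Proof. by move=> /ucv_ex [l hl] h; exists l; exact: cc_equi. Qed.

Lemma cc_unscale (c q t0 : R) x0 f l t x : 0 < q -> c != 0 ->
  cc (fun k s y => c * f k (t0 + q ^+ 2 * s) (x0 + q *: y)) l t x ->
  cc f (ulim (fun k => f k (t0 + q ^+ 2 * t) (x0 + q *: x))) (t0 + q ^+ 2 * t) (x0 + q *: x).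
Proof.
move=> q0 c0 h; apply: (@cc_ulim _ (c^-1 * l)); apply: cc_shift => //.
apply: cc_ext (ccZ c^-1 h); exists 1 => //; apply: evE => k s y _ _.
by rewrite mulKf.
Qed.

Definition hloc g A (u : @jf R n) (r t0 : R) x0 :=
  (forall s y, `|s - t0| < r -> `|y - x0| < r -> [/\ C12 u s y, `|jv u s y| <= A & `|heat u s y| <= A]) /\
  (forall s x y, `|s - t0| < r -> `|x - x0| < r -> `|y - x0| < r ->
     `|heat u s y - heat u s x| <= A * (`|y - x| `^ g + `|jv u s y - jv u s x|)).

Lemma hloc_scale g A u (r t0 q : R) x0 : 0 < g <= 1 -> 0 <= A -> 0 < q -> q <= 1 / 8 -> 8 * q <= r -> hloc g A u r t0 x0 ->
  hctl g (jscale 1 q t0 x0 u) A (-1 - 3) 1 (1 + 6).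
Proof.
move=> /andP[g0 g1] A0 q0 q8 qr [h1 h2].
have q2 : 0 < q ^+ 2 by rewrite exprn_gt0.
have q2q : q ^+ 2 <= q by rewrite expr2 ler_piMr //; sra q0 q8.
have q21 : q ^+ 2 <= 1 by sra q2q q8.
have hs s : -1 - 3 <= s <= 1 -> `|t0 + q ^+ 2 * s - t0| < r.
  move=> hs; rewrite addrCK normrM (ger0_norm (ltW q2)).
  have : `|s| <= 4 by rewrite ler_norml; sra hs.
  by move=> h; have : q ^+ 2 * `|s| <= q * 4 by [apply: ler_pM => //; exact: ltW]; sra q0 qr.
have hy y : `|y| <= 1 + 6 -> `|x0 + q *: y - x0| < r.
  by move=> h; rewrite addrCK normrZ (ger0_norm (ltW q0)); have : q * `|y| <= q * (1 + 6) by [rewrite ler_wpM2l // ltW]; sra q0 qr.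
split=> [s y h3 h4|s x y h3 h4 h5].
  have [c1 c2 c3] := h1 _ _ (hs s h3) (hy y h4).
  split; [exact: C12_scale|by rewrite /= mul1r|].
  rewrite heat_scale mul1r normrM (ger0_norm (ltW q2)) -[leRHS]mul1r; exact: ler_pM (ltW q2) _ _ _.
rewrite !heat_scale /= !mul1r -mulrBr normrM (ger0_norm (ltW q2)).
have := h2 _ _ _ (hs s h3) (hy x h4) (hy y h5).
rewrite (_ : x0 + q *: y - (x0 + q *: x) = q *: (y - x)); last by rewrite scalerBr opprD addrACA subrr add0r.
rewrite normrZ (ger0_norm (ltW q0)) powRM ?(ltW q0) //.
set D := `|heat _ _ _ - _|; set Z := `|jv _ _ _ - _|; set G := `|y - x| `^ g => hD.
have G0 : 0 <= G by exact: powR_ge0.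
have : q ^+ 2 * D <= D by rewrite ler_piMl // normr_ge0.
have qg1 : q `^ g <= 1.
  have <- : (1 : R) `^ g = 1 by rewrite powR1.
  by rewrite ge0_ler_powR ?nnegrE ?(ltW q0) ?(ltW g0) //; sra q8.
have : A * (q `^ g * G + Z) <= A * (G + Z) by rewrite ler_wpM2l // lerD2r ler_piMl.
sra hD.
Qed.

(** A small cylinder is rescaled to unit size, where [equi] gives equicontinuity of u and of its
    first and second space derivatives, which then converge. Convergence of the time derivative is
    read off from that of the heat operator. As L may depend on the limit of u, the hypothesis on L
    presupposes that u converges. *)
Lemma compact_loc g w A (r t0 : R) x0 (L : R -> V -> R) : 0 < g <= 1 -> 0 < r -> 0 <= A ->
  ev (fun k => hloc g A (w k) r t0 x0) ->
  (forall s y, `|s - t0| < r -> `|y - x0| < r -> (exists l, cc (fun k => jv (w k)) l s y) ->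
     cc (fun k => heat (w k)) (L s y) s y) ->
  exists2 r', 0 < r' & forall s y, `|s - t0| < r' -> `|y - x0| < r' ->
    [/\ jcc w (jlim w) s y, C12 (jlim w) s y & heat (jlim w) s y = L s y].
Proof.
move=> hg r0 A0 hw hL.
have [Af hAf] := @ctl_of R n g hg; have [Ke Ke0 hKe] := @equi R n g hg; have [Kh Kh0 hKh] := @hess_reg R n g hg.
set B := Af A in hAf.
(* After rescaling, data are used for |y| <= 7 and for times in [-4, 1]; 8 q <= r keeps them in the
   given cylinder. *)
have [q [q0 q8 qr]] : exists q : R, [/\ 0 < q, q <= 1 / 8 & 8 * q <= r].
  exists (Num.min 1 r / 8).
  have m0 : 0 < Num.min 1 r by rewrite lt_min ltr01.
  have m1 : Num.min 1 r <= 1 by rewrite ge_min lexx.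
  have mr : Num.min 1 r <= r by rewrite ge_min lexx orbT.
  by split; sra m0 m1 mr.
have q2 : 0 < q ^+ 2 by rewrite exprn_gt0.
have q2q : q ^+ 2 <= q by rewrite expr2 ler_piMr //; sra q0 q8.
pose W k := jscale 1 q t0 x0 (w k).
have hW : ev (fun k => ctl g (W k) (-1) 1 1 B).
  apply: evS hw => k hk; rewrite /B; apply: hAf => //; rewrite /W.
  exact: (@hloc_scale g A (w k) r t0 q x0).
have B0 : 0 <= B by have [k [? _ _]] := ev_ex hW.
have md e : 0 < e -> exists2 d0, 0 < d0 & forall t x, `|t| < 1 -> `|x| < 1 -> ev (fun k => forall s y, `|s| < 1 -> `|y| < 1 ->
    `|s - t| < d0 -> `|y - x| < d0 -> [/\ `|jv (W k) s y - jv (W k) t x| < e,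
      forall i, `|jd (W k) i s y - jd (W k) i t x| < e & forall i j, `|jdd (W k) i j s y - jdd (W k) i j t x| < e]).
  move=> e0; have KB1 : 0 < Ke * B + 1 by have := mulr_ge0 Ke0 B0; sra.
  have [q' [d0 [hq' d00 hd0]]] := small_mod hg (divr_gt0 e0 KB1).
  exists (d0 / 2) => [|t x ht hx]; first by sra d00.
  apply: evS hW => k hk s y hs hy h1 h2.
  have it (z : R) : `|z| < 1 -> -1 <= z <= 1 by rewrite ltr_norml => /andP[z1 z2]; rewrite !ltW.
  have := hKe _ _ _ _ _ hk s t y x q' (it _ hs) (it _ ht) (ltW hy) (ltW hx) hq'.
  set d := _ + _; move=> [k1 k2 k3].
  have [||e1 e2 e3] := hd0 d; [by rewrite addr_ge0|by rewrite /d; sra h1 h2|].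
  have fin X m : X <= Ke * B * m -> 0 <= m -> m < e / (Ke * B + 1) -> X < e.
    by move=> h3 h4 h5; apply: le_lt_trans h3 _; move: h5; rewrite ltr_pdivlMr //; sra h4.
  have /andP[q'0 _] := hq'.
  have d1 : 0 <= d by rewrite addr_ge0.
  have i1 : 0 <= q'^-1 by rewrite invr_ge0 ltW.
  split; first exact: fin k1 _ e1.
    by move=> i; apply: fin (k2 i) _ e2; rewrite addr_ge0 ?mulr_ge0 // ltW.
  by move=> i j; apply: fin (k3 i j) _ e3; rewrite addr_ge0 ?mulr_ge0 ?powR_ge0.
have ccW t x : `|t| < 1 -> `|x| < 1 -> [/\ exists l, cc (fun k => jv (W k)) l t x,
   forall i, exists l, cc (fun k => jd (W k) i) l t x & forall i j, exists l, cc (fun k => jdd (W k) i j) l t x].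
  move=> ht hx.
  have ht1 : -1 - 1 <= t <= 1 by move: ht; rewrite ltr_norml; sra.
  have ht2 : -1 - 2 <= t <= 1 by move: ht; rewrite ltr_norml; sra.
  have near (f : nat -> R -> V -> R) : (forall e, 0 < e -> exists2 d0, 0 < d0 & ev (fun k => forall s y, `|s| < 1 -> `|y| < 1 ->
      `|s - t| < d0 -> `|y - x| < d0 -> `|f k s y - f k t x| < e)) ->
      forall e, 0 < e -> exists2 d, 0 < d & ev (fun k => forall s y, `|s - t| < d -> `|y - x| < d -> `|f k s y - f k t x| < e).
    move=> h e e0; have [d0 d00 hd] := h e e0.
    exists (Num.min d0 (Num.min (1 - `|t|) (1 - `|x|))); first by rewrite !lt_min d00; sra ht hx.
    apply: evS hd => k hk s y; rewrite !lt_min => /and3P[s1 s2 s3] /and3P[y1 y2 y3].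
    apply: hk => //.
      by have := ler_normD (s - t) t; rewrite subrK; sra s2.
    by have := ler_normD (y - x) x; rewrite subrK; sra y3.
  split=> [|i|i j].
  - apply: (@cc_lim _ B).
      by apply: evS hW => k [_ h _]; have [] := h t x ht2; first sra hx.
    apply: near => e e0; have [d0 d00 hd] := md e e0; exists d0 => //.
    by apply: evS (hd t x ht hx) => k hk s y h1 h2 h3 h4; have [] := hk s y h1 h2 h3 h4.
  - apply: (@cc_lim _ B).
      by apply: evS hW => k [_ h _]; have [|_ _ _ hh] := h t x ht2; first sra hx.
    apply: near => e e0; have [d0 d00 hd] := md e e0; exists d0 => //.
    by apply: evS (hd t x ht hx) => k hk s y h1 h2 h3 h4; have [] := hk s y h1 h2 h3 h4.
  - apply: (@cc_lim _ (Kh * B)).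
      apply: evS hW => k hk; have [_ hh] := hKh _ _ _ _ _ hk; have [|] := hh t x ht1; first sra hx.
      by move=> h _; exact: h.
    apply: near => e e0; have [d0 d00 hd] := md e e0; exists d0 => //.
    by apply: evS (hd t x ht hx) => k hk s y h1 h2 h3 h4; have [] := hk s y h1 h2 h3 h4.
have hj s y : `|s - t0| < q ^+ 2 -> `|y - x0| < q ^+ 2 -> jcc w (jlim w) s y.
  move=> hs hy; pose t := q ^- 2 * (s - t0); pose x := q^-1 *: (y - x0).
  have ht : `|t| < 1 by rewrite /t normrM ger0_norm ?invr_ge0 ?(ltW q2) // ltr_pdivrMl // mulr1.
  have hx : `|x| < 1.
    by rewrite /x normrZ ger0_norm ?invr_ge0 ?(ltW q0) // ltr_pdivrMl // mulr1; exact: lt_le_trans hy q2q.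
  have Es : s = t0 + q ^+ 2 * t by rewrite /t mulVKf ?gt_eqF // addrBC.
  have Ey : y = x0 + q *: x by rewrite /x scalerA mulfV ?gt_eqF // scale1r addrBC.
  have [[l1 c1] c2 c3] := ccW t x ht hx.
  have j2 i : cc (fun k => jd (w k) i) (jd (jlim w) i s y) s y.
    have [l hl] := c2 i; rewrite Es Ey; apply: (@cc_unscale (1 * q) q _ _ _ l) => //.
    by rewrite mul1r gt_eqF.
  have j3 i j : cc (fun k => jdd (w k) i j) (jdd (jlim w) i j s y) s y.
    have [l hl] := c3 i j; rewrite Es Ey; apply: (@cc_unscale (1 * q ^+ 2) q _ _ _ l) => //.
    by rewrite mul1r gt_eqF.
  have j1 : cc (fun k => jv (w k)) (jv (jlim w) s y) s y.
    by rewrite Es Ey; apply: (@cc_unscale 1 q _ _ _ l1) => //; exact: oner_neq0.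
  split => //.
  apply: (@cc_ulim _ (L s y + \sum_i jdd (jlim w) i i s y)).
  have hs' : `|s - t0| < r by clear -hs q2q q8 qr q0; lra.
  have hy' : `|y - x0| < r by clear -hy q2q q8 qr q0; lra.
  have j1' : exists l, cc (fun k => jv (w k)) l s y by exists (jv (jlim w) s y).
  have hsum := ccD (hL s y hs' hy' j1') (cc_sum (fun i => j3 i i)).
  apply: (cc_ext _ hsum).
  by exists 1 => //; apply: evE => k z v _ _; rewrite /heat subrK.
exists (q ^+ 2) => // s y hs hy; have hjs := hj s y hs hy; split => //; last first.
  have j1' : exists l, cc (fun k => jv (w k)) l s y by exists (jv (jlim w) s y); exact: j_v hjs.
  have hs' : `|s - t0| < r by clear -hs q2q q8 qr q0; lra.
  have hy' : `|y - x0| < r by clear -hy q2q q8 qr q0; lra.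
  exact: ucv_uniq (cc_ucv (jcc_heat hjs)) (cc_ucv (hL s y hs' hy' j1')).
apply: (@lim_C12 w); exists (Num.min (q ^+ 2 - `|s - t0|) (q ^+ 2 - `|y - x0|)).
  by rewrite lt_min !subr_gt0 hs.
split=> [s1 y1|].
  rewrite !lt_min => /andP[s2 _] /andP[_ y2]; apply: hj.
    by have := ler_normD (s1 - s) (s - t0); rewrite addrA subrK; sra s2.
  by have := ler_normD (y1 - y) (y - x0); rewrite addrA subrK; sra y2.
apply: evS hw => k [hk _] s1 y1; rewrite !lt_min => /andP[s2 _] /andP[_ y2].
have [] // := hk s1 y1.
  by have := ler_normD (s1 - s) (s - t0); rewrite addrA subrK; sra q2q qr r0 s2.
by have := ler_normD (y1 - y) (y - x0); rewrite addrA subrK; sra q2q qr r0 y2.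
Qed.

End Limits.

(** * Higher regularity by difference quotients *)

Section DiffQuotients.
Context {R : realType} {n : nat}.
Local Notation V := 'rV[R]_n.
Implicit Types (x y v : V) (A c e d t s r a b l h : R) (u : @jf R n) (f : V -> R).

Lemma fn_lip f (fi : 'I_n -> V -> R) (x0 : V) d A : 0 <= A ->
  (forall y, `|y - x0| < d -> forall i, [/\ pd (evec R i) f y (fi i y), cts (fi i) y & `|fi i y| <= A]) ->
  forall x y, `|x - x0| < d -> `|y - x0| < d -> `|f y - f x| <= n%:R * A * `|y - x|.
Proof.
move=> A0 h x y hx hy; set v := y - x.
pose m := Num.max `|x - x0| `|y - x0|.
have md : m < d by rewrite /m gt_max hx.
have hz (r : R) : 0 <= r <= 1 -> `|x + r *: v - x0| <= m.
  move=> hr; have -> : x + r *: v - x0 = (x - x0) + r *: ((y - x0) - (x - x0)).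
    have -> : y - x0 - (x - x0) = v by rewrite opprB addrA subrK.
    by rewrite addrAC.
  by apply: seg_norm => //; rewrite /m le_max lexx ?orbT.
have hz' (r : R) : 0 <= r <= 1 -> `|x + r *: v - x0| < d by move=> /hz h1; exact: le_lt_trans h1 md.
have dr (r : R) : 0 <= r <= 1 -> is_derive r 1 (fun r => f (x + r *: v)) (\sum_i v ord0 i * fi i (x + r *: v)).
  move=> hr; suff hp : pd v f (x + r *: v) (\sum_i v ord0 i * fi i (x + r *: v)) by exact: (pd_shift hp).
  apply: (@pd_dir R n v f fi) => [|i]; last by have [] := h _ (hz' r hr) i.
  exists (d - m); first by rewrite subr_gt0.
  move=> z hzz i; have zd : `|z - x0| < d.
    have := ler_normD (z - (x + r *: v)) (x + r *: v - x0); rewrite addrA subrK.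
    by have := hz r hr; lra.
  by have [] := h z zd i.
have := itv_lip (@ler01 R) dr (K := n%:R * A * `|v|).
rewrite scale1r scale0r addr0 /v addrBC subr0 mulr1; apply.
move=> r hr; apply: le_norm_sum.
rewrite -mulrA [leRHS]mulr_natl -[X in _ *+ X](card_ord n) -sumr_const; apply: ler_sum => i _.
rewrite normrM mulrC; apply: ler_pM => //; last exact: normVE.
by have [] := h _ (hz' r hr) i.
Qed.

Lemma tri_lt (W : normedZmodType R) (z y x : W) d r : `|z - y| < d -> d <= r - `|y - x| -> `|z - x| < r.
Proof. by move=> h1 h2; have := ler_normD (z - y) (y - x); rewrite addrA subrK; lra. Qed.

Definition jdq v h u : @jf R n :=
  Jf (fun t x => h^-1 * (jv u t (x + h *: v) - jv u t x)) (fun t x => h^-1 * (jt u t (x + h *: v) - jt u t x))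
     (fun i t x => h^-1 * (jd u i t (x + h *: v) - jd u i t x))
     (fun i j t x => h^-1 * (jdd u i j t (x + h *: v) - jdd u i j t x)).

Lemma jc_transl (F : R -> V -> R) t x v : jc F t (x + v) -> jc (fun s y => F s (y + v)) t x.
Proof.
move=> hF e e0; have [d d0 hd] := hF e e0; exists d => // s y hs hy; apply: hd => //.
by rewrite opprD addrACA subrr addr0.
Qed.

Lemma pd_transl (w v : V) f x l : pd w f (x + v) l -> pd w (fun y => f (y + v)) x l.
Proof.
by rewrite /pd (_ : (fun s => f (x + v + s *: w)) = fun s => f (x + s *: w + v)) //; apply/funext => s; rewrite addrAC.
Qed.

Lemma C12_dq v h u t x : C12 u t (x + h *: v) -> C12 u t x -> C12 (jdq v h u) t x.
Proof.
move=> h1 h2.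
have J (F : R -> V -> R) : jc F t (x + h *: v) -> jc F t x -> jc (fun s y => h^-1 * (F s (y + h *: v) - F s y)) t x.
  by move=> j1 j2; apply: jcZ; apply: jcD; [exact: jc_transl|exact: jcN].
have P (w : V) f l l' : pd w f (x + h *: v) l -> pd w f x l' -> pd w (fun y => h^-1 * (f (y + h *: v) - f y)) x (h^-1 * (l - l')).
  by move=> p1 p2; have := dZ h^-1 (dB (pd_transl p1) p2).
split.
- by have := dZ h^-1 (dB (c_t h1) (c_t h2)).
- by move=> i; exact: P (c_d h1 i) (c_d h2 i).
- by move=> i j; exact: P (c_dd h1 i j) (c_dd h2 i j).
- exact: J (c_v0 h1) (c_v0 h2).
- exact: J (c_t0 h1) (c_t0 h2).
- by move=> i; exact: J (c_d0 h1 i) (c_d0 h2 i).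
- by move=> i j; exact: J (c_dd0 h1 i j) (c_dd0 h2 i j).
Qed.

Lemma heat_dq v h u t x : heat (jdq v h u) t x = h^-1 * (heat u t (x + h *: v) - heat u t x).
Proof. by rewrite /heat /= -mulr_sumr -mulrBr sumrB; congr (_ * _); ring. Qed.

Lemma dq_le f (f' : V -> R) x v h K L : 0 < h ->
  (forall r, 0 <= r <= h -> pd v f (x + r *: v) (f' (x + r *: v))) ->
  (forall r, 0 <= r <= h -> `|f' (x + r *: v) - L| <= K) -> `|h^-1 * (f (x + h *: v) - f x) - L| <= K.
Proof.
move=> h0 hf hK; have hi : 0 <= h^-1 by rewrite invr_ge0 ltW.
have := @itv_lip R (fun r => f (x + r *: v) - L * r) (fun r => f' (x + r *: v) - L) 0 h K (ltW h0).
rewrite scale0r addr0 mulr0 !subr0 => H.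
have -> : h^-1 * (f (x + h *: v) - f x) - L = h^-1 * (f (x + h *: v) - L * h - f x) by field; rewrite gt_eqF.
rewrite normrM (ger0_norm hi) ler_pdivrMl // [leRHS]mulrC; apply: H => // r hr.
by have := dB (pd_shift (hf r hr)) (dZ L (did r)); rewrite mulr1.
Qed.

(** Its value is the derivative u_i, but as a jet it carries one more order of derivatives than the
    jet of u; all higher regularity comes from here. *)
Definition jdx i u : @jf R n := jlim (fun k => jdq (evec R i) k.+1%:R^-1 u).

Lemma ev_inv d : 0 < d -> ev (fun k => k.+1%:R^-1 < d :> R).
Proof.
move=> d0; apply: evS (ucv_inv d0) => k; rewrite subr0 ger0_norm //; by rewrite invr_ge0.
Qed.

Lemma inv0 k : 0 < k.+1%:R^-1 :> R. Proof. by rewrite invr_gt0. Qed.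

(* The difference quotients solve the heat equation with the difference quotients of the source,
   so the interior estimates apply to them. *)
Lemma jdxP i u (gi : R -> V -> R) (gij : 'I_n -> R -> V -> R) t0 x0 r : 0 < r ->
  (forall s y, `|s - t0| < r -> `|y - x0| < r -> [/\ C12 u s y, pd (evec R i) (heat u s) y (gi s y), jc gi s y &
     forall j, pd (evec R j) (gi s) y (gij j s y) /\ jc (gij j) s y]) ->
  exists2 r', 0 < r' & forall s y, `|s - t0| < r' -> `|y - x0| < r' ->
    [/\ C12 (jdx i u) s y, jv (jdx i u) s y = jd u i s y & heat (jdx i u) s y = gi s y].
Proof.
move=> r0 H; have tt0 : `|t0 - t0| < r by rewrite subrr normr0.
have xx0 : `|x0 - x0| < r by rewrite subrr normr0.
have [C0 _ j0 j1] := H t0 x0 tt0 xx0.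
have [d1 d10 b1] := jc_bnd (c_d0 C0 i); have [d2 d20 b2] := jc_bnd j0.
have [d3 d30 b3] := fin_min (fun j => s2valP (cid2 (jc_bnd (j1 j).2))).
have b3' j s y : `|s - t0| < d3 -> `|y - x0| < d3 -> `|gij j s y| <= `|gij j t0 x0| + 1.
  by move=> hs hy; apply: (s2valP' (cid2 (jc_bnd (j1 j).2))); exact: lt_le_trans (b3 j).
pose d := Num.min r (Num.min d1 (Num.min d2 d3)); pose q := d / 2.
have d0 : 0 < d by rewrite !lt_min r0 d10 d20.
have dr : d <= r by rewrite ge_min lexx.
have dd1 : d <= d1 by rewrite !ge_min lexx !orbT.
have dd2 : d <= d2 by rewrite !ge_min lexx !orbT.
have dd3 : d <= d3 by rewrite !ge_min lexx !orbT.
have q0 : 0 < q by rewrite /q; sra d0.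
have qd : q + q = d by rewrite /q; sra.
move: dr dd1 dd2 dd3 => + + + +; clearbody q; move: d d0 qd => d d0 qd dr dd1 dd2 dd3.
pose A := `|jd u i t0 x0| + 1 + (`|gi t0 x0| + 1) + n%:R * \sum_j (`|gij j t0 x0| + 1).
have S0 : 0 <= \sum_j (`|gij j t0 x0| + 1) by apply: sumr_ge0 => j _; have := normr_ge0 (gij j t0 x0); sra.
have nS0 : 0 <= n%:R * \sum_j (`|gij j t0 x0| + 1) by apply: mulr_ge0.
have g0 := normr_ge0 (gi t0 x0); have u0 := normr_ge0 (jd u i t0 x0).
have A0 : 0 <= A by rewrite /A; sra g0 nS0 u0.
have AU : `|jd u i t0 x0| + 1 <= A by rewrite /A; sra g0 nS0.
have AG : `|gi t0 x0| + 1 <= A by rewrite /A; sra nS0 u0.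
have AS : n%:R * \sum_j (`|gij j t0 x0| + 1) <= A by rewrite /A; sra g0 u0.
have sd s : `|s - t0| < q -> `|s - t0| < d by clear -q0 qd => h; lra.
have yq y : `|y - x0| < q -> `|y - x0| < d by clear -q0 qd => h; lra.
have sh y a (h : R) : `|y - x0| < q -> 0 <= a <= h -> h < q -> `|y + a *: evec R i - x0| < d.
  move=> hy /andP[a0 ah] hq; rewrite addrAC; apply: lt_normD.
  by rewrite normrZ norm_evec mulr1 (ger0_norm a0); clear -hy ah hq qd; lra.
(* The exponent 1 is available because the local bound on [gij] makes the quotients of the source
   Lipschitz in space, uniformly in the step. *)
have hloc_k : ev (fun k => hloc 1 A (jdq (evec R i) k.+1%:R^-1 u) q t0 x0).
  apply: evS (ev_inv q0) => k; have := inv0 k; move: (k.+1%:R^-1) => h h0 hq.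
  have hh : 0 <= h <= h by rewrite (ltW h0) lexx.
  have sr s : `|s - t0| < q -> `|s - t0| < r by move=> hs; exact: lt_le_trans (sd s hs) dr.
  split=> [s y hs hy|s x y hs hx hy].
    have yr : `|y - x0| < r by exact: lt_le_trans (yq y hy) dr.
    have [C1 _ _ _] := H s y (sr s hs) yr.
    have [C2 _ _ _] := H s (y + h *: evec R i) (sr s hs) (lt_le_trans (sh y h h hy hh hq) dr).
    split; first exact: C12_dq.
      rewrite /= -[X in `|X|]subr0; apply: (@dq_le (jv u s) (jd u i s)) => // a ha; have ya := sh y a h hy ha hq.
        by have [c _ _ _] := H s _ (sr s hs) (lt_le_trans ya dr); exact: c_d.
      rewrite subr0; apply: le_trans AU; apply: b1; [exact: lt_le_trans (sd s hs) dd1|exact: lt_le_trans ya dd1].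
    rewrite heat_dq -[X in `|X|]subr0; apply: (@dq_le (heat u s) (gi s)) => // a ha; have ya := sh y a h hy ha hq.
      by have [_ c _ _] := H s _ (sr s hs) (lt_le_trans ya dr).
    rewrite subr0; apply: le_trans AG; apply: b2; [exact: lt_le_trans (sd s hs) dd2|exact: lt_le_trans ya dd2].
  rewrite !heat_dq powRr1 //.
  have L : `|h^-1 * ((heat u s (y + h *: evec R i) - heat u s (x + h *: evec R i)) - (heat u s y - heat u s x))| <=
      n%:R * (\sum_j (`|gij j t0 x0| + 1)) * `|y - x|.
    have P (a : R) : 0 <= a <= h -> [/\ `|y + a *: evec R i - x0| < d, `|x + a *: evec R i - x0| < d &
       `|gi s (y + a *: evec R i) - gi s (x + a *: evec R i)| <= n%:R * (\sum_j (`|gij j t0 x0| + 1)) * `|y - x|].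
      move=> ha; have ya := sh y a h hy ha hq; have xa := sh x a h hx ha hq; split => //.
      rewrite (_ : `|y - x| = `|y + a *: evec R i - (x + a *: evec R i)|); last by rewrite opprD addrACA subrr addr0.
      apply: (@fn_lip (gi s) (fun j => gij j s) x0 d) => // z hz j.
      have [_ _ _ c] := H s z (sr s hs) (lt_le_trans hz dr); have [c1 c2] := c j; split => //.
        exact: (@jc_cts R n (gij j)).
      apply: le_trans (b3' j s z (lt_le_trans (sd s hs) dd3) (lt_le_trans hz dd3)) _.
      by rewrite (bigD1 j) //= lerDl; apply: sumr_ge0 => l _; rewrite addr_ge0.
    rewrite -[X in `|X|]subr0.
    have := @dq_le (fun z => heat u s (z + (y - x)) - heat u s z) (fun z => gi s (z + (y - x)) - gi s z) x (evec R i) h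
       (n%:R * (\sum_j (`|gij j t0 x0| + 1)) * `|y - x|) 0 h0.
    have E z : x + z + (y - x) = y + z by rewrite addrAC addrBC.
    rewrite !E (addrBC x y); apply => a ha; have [ya xa hL] := P a ha.
      have [_ p1 _ _] := H s _ (sr s hs) (lt_le_trans ya dr); have [_ p2 _ _] := H s _ (sr s hs) (lt_le_trans xa dr).
      have p1' : pd (evec R i) (heat u s) (x + a *: evec R i + (y - x)) (gi s (y + a *: evec R i)) by rewrite E.
      by rewrite E; exact: dB (pd_transl p1') p2.
    by rewrite E subr0.
  have -> : h^-1 * (heat u s (y + h *: evec R i) - heat u s y) - h^-1 * (heat u s (x + h *: evec R i) - heat u s x) =
    h^-1 * ((heat u s (y + h *: evec R i) - heat u s (x + h *: evec R i)) - (heat u s y - heat u s x)) by ring.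
  apply: le_trans L _; apply: (@le_trans _ _ (A * `|y - x|)); first by rewrite ler_wpM2r.
  by rewrite ler_wpM2l // lerDl.
have hcc s y : `|s - t0| < q -> `|y - x0| < q -> cc (fun k => heat (jdq (evec R i) k.+1%:R^-1 u)) (gi s y) s y.
  move=> hs hy; have sr : `|s - t0| < r by exact: lt_le_trans (sd s hs) dr.
  have yr : `|y - x0| < r by exact: lt_le_trans (yq y hy) dr.
  have [_ _ jg _] := H s y sr yr.
  move=> e e0; have e2 : 0 < e / 2 by sra e0.
  have [b b0 hb] := jg _ e2.
  pose b' := Num.min (Num.min b (r - `|s - t0|)) (r - `|y - x0|).
  have b'0 : 0 < b' by rewrite !lt_min b0 !subr_gt0 sr.
  have b'1 : b' <= b by rewrite !ge_min lexx.
  have b'2 : b' <= r - `|s - t0| by rewrite !ge_min lexx !orbT.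
  have b'3 : b' <= r - `|y - x0| by rewrite ge_min lexx orbT.
  have b''0 : 0 < b' / 2 by sra b'0.
  exists (b' / 2) => //; apply: evS (ev_inv b''0) => k; have := inv0 k; move: (k.+1%:R^-1) => h h0 hq s1 y1 hs1 hy1.
  have b2b : b' / 2 < b by clear -b'0 b'1; lra.
  apply: (@le_lt_trans _ _ (e / 2)); last by clear -e0; lra.
  have nz (a : R) : 0 <= a <= h -> `|y1 + a *: evec R i - y| < b'.
    move=> /andP[a0 ah]; rewrite addrAC; apply: lt_normD.
    by rewrite normrZ norm_evec mulr1 (ger0_norm a0); clear -hy1 ah hq; lra.
  rewrite heat_dq; apply: (@dq_le (heat u s1) (gi s1)) => // a ha; have na := nz a ha.
    have [] // := H s1 (y1 + a *: evec R i) _ _.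
      by apply: tri_lt hs1 _; clear -b'0 b'2; lra.
    exact: tri_lt na b'3.
  by apply: ltW; apply: hb; [exact: lt_trans b2b|exact: lt_le_trans b'1].
have one : 0 < (1 : R) <= 1 by rewrite ltr01 lexx.
have [r' r'0 hr'] : exists2 r', 0 < r' & forall s y, `|s - t0| < r' -> `|y - x0| < r' ->
    [/\ jcc (fun k => jdq (evec R i) k.+1%:R^-1 u) (jdx i u) s y, C12 (jdx i u) s y & heat (jdx i u) s y = gi s y].
  by apply: (@compact_loc R n 1 _ A q t0 x0 gi one q0 A0 hloc_k) => s y hs hy _; exact: hcc.
exists (Num.min r r') => [|s y]; first by rewrite lt_min r0.
rewrite !lt_min => /andP[s1 s2] /andP[y1 y2]; have [_ c1 c2] := hr' s y s2 y2; split => //.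
apply: ulimE => e e0; have [c _ _ _] := H s y s1 y1.
have e2 : 0 < e / 2 by sra e0.
have [b b0 hb] := (derP _ _ _).1 (c_d c i) _ e2.
apply: evS (ev_inv b0) => k; have := inv0 k; move: (k.+1%:R^-1) => h h0 hq.
have := hb h; rewrite add0r scale0r addr0 (gtr0_norm h0) => /(_ hq) h3.
rewrite /= (_ : _ - _ = h^-1 * (jv u s (y + h *: evec R i) - jv u s y - jd u i s y * h)); last by field; rewrite gt_eqF.
rewrite normrM gtr0_norm ?invr_gt0 // ltr_pdivrMl //; apply: le_lt_trans h3 _.
by rewrite mulrC ltr_pM2l //; sra e0.
Qed.

End DiffQuotients.

(** * Parabolic maximum principle *)

Section MaxPrinciple.
Context {R : realType} {n : nat}.
Local Notation V := 'rV[R]_n.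
Implicit Types (x y a : V) (e d t s r : R) (u : @jf R n).

(** At the first time s at which u fails to be positive, a zero is an interior spatial minimum, and
    u is positive before s. Hence u_t <= 0, grad u = 0 and u_ii >= 0 there, so the heat operator is
    at most 0. Its strict positivity is accordingly asked for at critical zeros. *)
Lemma maxp u a (rho t1 t2 : R) : 0 < rho ->
  (forall t x, t1 <= t <= t2 -> `|x - a| <= rho -> jc (jv u) t x) ->
  (forall x, `|x - a| <= rho -> 0 < jv u t1 x) ->
  (forall t x, t1 <= t <= t2 -> `|x - a| = rho -> 0 < jv u t x) ->
  (forall t x, t1 < t <= t2 -> `|x - a| < rho -> C12 u t x) ->
  (forall t x, t1 < t <= t2 -> `|x - a| < rho -> jv u t x = 0 -> (forall i, jd u i t x = 0) -> 0 < heat u t x) ->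
  forall t x, t1 <= t <= t2 -> `|x - a| <= rho -> 0 < jv u t x.
Proof.
move=> rho0 hc h1 hb hC hh t0 x0 ht0 hx0; rewrite ltNge; apply/negP => hn.
pose S : set R := [set t | t1 <= t <= t2 /\ exists2 x, `|x - a| <= rho & jv u t x <= 0].
have S0 : S t0 by split => //; exists x0.
have Sinf : has_inf S by split; [exists t0|exists t1 => t [/andP[]]].
pose ts := inf S.
have hk (k : nat) : exists q : R * V, [/\ t1 <= q.1 <= t2, `|q.2 - a| <= rho, jv u q.1 q.2 <= 0 & q.1 < ts + k.+1%:R^-1].
  have [|t [ht [x hx hx1]] htt] := @inf_adherent R S k.+1%:R^-1 _ Sinf; first by rewrite invr_gt0.
  by exists (t, x); split.
have [q hq] := choice hk.
have [|s hs cs] := @ucv_itv R t1 t2 (fun k => (q k).1); first by move=> k; have [] := hq k.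
have [|x' hx' cx'] := @ucv_ball R n (fun k => (q k).2 - a) rho; first by move=> k; have [] := hq k.
pose x := x' + a; have hx : `|x - a| <= rho by rewrite /x addrK.
have cx e : 0 < e -> ev (fun k => `|(q k).2 - x| < e).
  by move=> e0; apply: evS (cx' e e0) => k; rewrite /x opprD addrA addrAC.
have sts : s = ts.
  apply/eqP; rewrite eq_le; apply/andP; split.
    apply/ler_addgt0Pr => e e0; apply: ucv_lel cs _; apply: evS (ev_inv e0) => k hke.
    have [_ _ _ h] := hq k; have h2 : ts + k.+1%:R^-1 < ts + e by rewrite ltrD2l.
    exact: ltW (lt_trans h h2).
  apply: ucv_ler cs _; apply: evE => k; have [h2 h3 h4 _] := hq k.
  by apply: ge_inf; [exists t1 => t [/andP[]]|split => //; exists (q k).2].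
have us : jv u s x <= 0.
  apply/ler_addgt0Pr => e e0; rewrite add0r.
  have [d d0 hd] := hc s x hs hx e e0.
  have [k [k1 k2]] := ev_ex (evI (cs _ d0) (cx _ d0)).
  by have [_ _ h4 _] := hq k; have := hd _ _ k1 k2; rewrite ltr_norml => /andP[? ?]; lra.
have ge0 r y : t1 <= r < s -> `|y - a| <= rho -> 0 < jv u r y.
  move=> /andP[r1 rs] hy; rewrite ltNge; apply/negP => hle.
  have : ts <= r.
    apply: ge_inf; first by exists t1 => t [/andP[]].
    by split; [rewrite r1 /= (le_trans (ltW rs)) //; case/andP: hs|exists y].
  by rewrite -sts leNgt rs.
have s1 : t1 < s.
  have /andP[hs1 _] := hs; rewrite lt_neqAle hs1 andbT; apply/eqP => E.
  by have := h1 x hx; rewrite E; sra us.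
have ge0s y : `|y - a| <= rho -> 0 <= jv u s y.
  move=> hy; rewrite leNgt; apply/negP => hlt.
  have [|d d0 hd] := hc s y hs hy (- jv u s y); first by sra hlt.
  pose r := Num.max t1 (s - d / 2).
  have rs : r < s by rewrite gt_max s1 /=; sra d0.
  have r1 : t1 <= r by rewrite le_max lexx.
  have rd : s - d / 2 <= r by rewrite le_max lexx orbT.
  have := hd r y _ _; rewrite subrr normr0 => h2.
  have := ge0 r y _ hy; rewrite r1 rs => /(_ isT) h3.
  have : `|r - s| < d by rewrite ltr_norml; apply/andP; split; sra d0 rd rs.
  by move=> h4; have := h2 h4 d0; rewrite ltr_norml => /andP[? ?]; lra.
have xi : `|x - a| < rho.
  rewrite lt_neqAle hx andbT; apply/eqP => E; have := hb s x hs E; sra us.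
have s2 : t1 < s <= t2 by rewrite s1; case/andP: hs.
have C0 := hC s x s2 xi.
have u0 : jv u s x = 0 by apply/eqP; rewrite eq_le us ge0s.
have nb i (h : R) : `|h| < rho - `|x - a| -> `|x + h *: evec R i - a| < rho.
  move=> hh1; apply: (@tri_lt R V _ x a (rho - `|x - a|)) => //; rewrite addrCK normrZ norm_evec mulr1 //.
have d0 : 0 < rho - `|x - a| by rewrite subr_gt0.
have Cn i (h : R) : `|h| < rho - `|x - a| -> C12 u s (x + h *: evec R i) by move=> hh1; exact: hC s2 (nb i h hh1).
have mn i (h : R) : `|h| < rho - `|x - a| -> jv u s (x + 0 *: evec R i) <= jv u s (x + (0 + h) *: evec R i).
  by move=> hh1; rewrite scale0r addr0 u0 add0r; apply: ge0s; exact: ltW (nb i h hh1).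
have g0 i : jd u i s x = 0.
  exact: (@derive_min0 R (fun h => jv u s (x + h *: evec R i)) 0 _ _ (c_d C0 i) d0 (mn i)).
have := hh s x s2 xi u0 g0.
have tl : jt u s x <= 0.
  apply: (@derive_left_min R (fun s => jv u s x) s _ (s - t1) (c_t C0)); first by rewrite subr_gt0.
  by move=> h /andP[h2 h3]; rewrite u0; apply: ltW; apply: ge0 => //; apply/andP; split; sra h2 h3.
have sl i : 0 <= jdd u i i s x.
  apply: (@derive2_min R (fun h => jv u s (x + h *: evec R i)) (fun h => jd u i s (x + h *: evec R i)) 0 _ _ d0 _ _ (mn i)).
    by move=> h hh1; rewrite add0r; apply: pd_shift; exact: (c_d (Cn i h hh1) i).
  exact: (c_dd C0 i i).
rewrite /heat; have : 0 <= \sum_i jdd u i i s x by apply: sumr_ge0.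
sra tl.
Qed.

Lemma cmpp u w a (rho t1 t2 : R) : 0 < rho ->
  (forall t x, t1 <= t <= t2 -> `|x - a| <= rho -> jc (jv u) t x /\ jc (jv w) t x) ->
  (forall x, `|x - a| <= rho -> jv u t1 x < jv w t1 x) ->
  (forall t x, t1 <= t <= t2 -> `|x - a| = rho -> jv u t x < jv w t x) ->
  (forall t x, t1 < t <= t2 -> `|x - a| < rho -> C12 u t x /\ C12 w t x) ->
  (forall t x, t1 < t <= t2 -> `|x - a| < rho -> jv u t x = jv w t x -> heat u t x < heat w t x) ->
  forall t x, t1 <= t <= t2 -> `|x - a| <= rho -> jv u t x < jv w t x.
Proof.
move=> r0 hc h1 hb hC hh t x ht hx; pose z := jadd w (jmul (jcst (-1)) u).
have zE s y : jv z s y = jv w s y - jv u s y by rewrite /= mulN1r.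
have hz s y : heat z s y = heat w s y - heat u s y.
  rewrite heatD heatM heat_cst mulr0 addr0 /grad2 big1 => [|i _]; last by rewrite /= mul0r.
  by rewrite mulr0 subr0 /= mulN1r.
suff : 0 < jv z t x by rewrite zE subr_gt0.
apply: (@maxp z a rho t1 t2) => //.
- move=> s y hs hy; have [c1 c2] := hc s y hs hy; apply: jcD => //.
  by apply: jcM => //; exact: jc_cst.
- by move=> y hy; rewrite zE subr_gt0 h1.
- by move=> s y hs hy; rewrite zE subr_gt0 hb.
- move=> s y hs hy; have [c1 c2] := hC s y hs hy; apply: C12D => //; apply: C12M => //; exact: C12_cst.
- by move=> s y hs hy /eqP; rewrite zE subr_eq0 => /eqP E _; rewrite hz subr_gt0 hh.
Qed.

End MaxPrinciple.

(** * Real powers and the type I exponent *)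

Section Powers.
Context {R : realType}.
Implicit Types (a b x y r s e d p q al th M : R).

Lemma powR_anti a b q : 0 < a -> a <= b -> 0 <= q -> b `^ (- q) <= a `^ (- q).
Proof.
move=> a0 ab q0; have b0 := lt_le_trans a0 ab.
by rewrite !powRN lef_pV2 ?posrE ?powR_gt0 // ge0_ler_powR // nnegrE ltW.
Qed.

Lemma powR_le a b q : 0 <= a -> a <= b -> 0 <= q -> a `^ q <= b `^ q.
Proof. by move=> a0 ab q0; rewrite ge0_ler_powR // nnegrE //; exact: le_trans ab. Qed.

Lemma powR_split v p : 0 <= v -> 1 < p -> v `^ p = v `^ (p - 1) * v.
Proof.
move=> v0 p1; have [->|vn] := eqVneq v 0; first by rewrite mulr0 powR0 //; lra.
by rewrite -{3}(powRr1 v0) -powRD ?subrK //; apply/implyP => _.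
Qed.

(** Truncation at 0 makes the power continuous on the whole line, so it can be composed with
    convergent sequences without a sign condition. *)
Lemma powp_cts p : 0 < p -> forall l, ctsat (fun r => (Num.max 0 r) `^ p) l.
Proof.
move=> p0 l e e0; have [l0|l0|l0] := ltrgtP l 0.
- exists (- l) => [|y hy]; first by lra.
  have y0 : y < 0 by move: hy; rewrite ltr_norml => /andP[_ ?]; lra.
  by rewrite (max_idPl (ltW y0)) subrr normr0.
- have [d d0 hd] := powR_cts p l0 e0.
  exists (Num.min l d) => [|y]; first by rewrite lt_min l0.
  rewrite lt_min => /andP[y1 y2]; have y0 : 0 < y by move: y1; rewrite ltr_norml => /andP[? _]; lra.
  by rewrite (max_idPr (ltW y0)); exact: hd.
- exists (e `^ p^-1); first exact: powR_gt0.
  move=> y; rewrite l0 subr0 => hy; rewrite [X in _ - X]powR0 ?gt_eqF // subr0 ger0_norm ?powR_ge0 //.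
  have [y0|y0] := lerP y 0; first by rewrite powR0 ?gt_eqF.
  have -> : e = (e `^ p^-1) `^ p by rewrite -powRrM mulVf ?powRr1 ?gt_eqF // ltW.
  rewrite gt0_ltr_powR // ?nnegrE ?powR_ge0 ?(ltW y0) //; by apply: le_lt_trans hy; exact: ler_norm.
Qed.

Lemma pow_cts0 p : 0 < p -> forall l, 0 <= l -> forall e, 0 < e ->
  exists2 d, 0 < d & forall r, 0 <= r -> `|r - l| < d -> `|r `^ p - l `^ p| < e.
Proof.
move=> p0 l l0 e e0; have [d d0 hd] := powp_cts p0 l e0; exists d => // r r0 hr.
by have := hd r hr; rewrite (max_idPr r0) (max_idPr l0).
Qed.

Section Alpha.
Variables (p al : R).
Hypotheses (p1 : 1 < p) (hal : al * (p - 1) = 1).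

Lemma al_gt0 : 0 < al.
Proof. by have h : 0 < p - 1 by [rewrite subr_gt0]; rewrite -(pmulr_lgt0 _ h) hal. Qed.

Lemma pw_alp th : 0 < th -> (th `^ (- al)) `^ p = th `^ (- al - 1).
Proof. by move=> th0; rewrite -powRrM; congr (_ `^ _); have := hal; lra. Qed.

Lemma pw_al1 th : 0 < th -> (th `^ (- al)) `^ (p - 1) = th^-1.
Proof.
move=> th0; rewrite -powRrM mulNr hal powRN powRr1 //; exact: ltW.
Qed.

Lemma pw_alS th : 0 < th -> th `^ (- al - 1) = th `^ (- al) * th^-1.
Proof. by move=> th0; rewrite (powRDp th0) [X in _ * X]powRN powRr1 // ltW. Qed.

(** The type I bound linearises the nonlinearity: since al (p - 1) = 1, it gives v^(p - 1) <= M^(p -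
    1) / theta. *)
Lemma pw_up v M th : 0 < th -> 0 <= v -> v <= M * th `^ (- al) -> 0 <= M -> v `^ p <= M `^ (p - 1) * th^-1 * v.
Proof.
move=> th0 v0 h M0; rewrite powR_split // ler_wpM2r //.
by rewrite -pw_al1 // -powRM ?powR_ge0 //; apply: powR_le => //; rewrite subr_ge0 ltW.
Qed.
End Alpha.
End Powers.

(** * Barriers *)

Section Barriers.
Context {R : realType} {n : nat}.
Local Notation V := 'rV[R]_n.
Implicit Types (x y a : V) (A c e t s r M eta : R) (u w : @jf R n).

Definition jz c u := jmul (jcst c) u.

Lemma jzE c u : [/\ jv (jz c u) = (fun t x => c * jv u t x), jt (jz c u) = (fun t x => c * jt u t x),
  jd (jz c u) = (fun i t x => c * jd u i t x) & jdd (jz c u) = fun i j t x => c * jdd u i j t x].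
Proof.
split; apply/funext => i; apply/funext => j //=; try (apply/funext => t; try (apply/funext => x)).
- by rewrite mulr0 addr0.
- by rewrite mulr0 addr0.
- by rewrite !(mulr0, mul0r, addr0).
Qed.

Lemma heatZ c u t x : heat (jz c u) t x = c * heat u t x.
Proof. by rewrite heatM heat_cst mulr0 addr0 /grad2 big1 ?mulr0 ?subr0 // => i _; rewrite mul0r. Qed.

Lemma C12_Z c u t x : C12 u t x -> C12 (jz c u) t x.
Proof. by move=> h; apply: C12M => //; exact: C12_cst. Qed.

Definition jth (tau : R) : @jf R n := jadd (jcst tau) (jz (-1) (@jtime R n)).

Lemma jthE tau t x : jv (jth tau) t x = tau - t. Proof. by rewrite /= mulN1r. Qed.
Lemma C12_th tau t x : C12 (jth tau) t x.
Proof. by apply: C12D; [exact: C12_cst|apply: C12_Z; exact: C12_time]. Qed.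
Lemma heat_th tau t x : heat (jth tau) t x = -1.
Proof. by rewrite heatD heat_cst heatZ heat_time mulr1 add0r. Qed.
Lemma jd_th tau i t x : jd (jth tau) i t x = 0.
Proof. by rewrite /= !(mulr0, mul0r, addr0). Qed.

Lemma grad2_0l u w t x : (forall i, jd u i t x = 0) -> grad2 u w t x = 0.
Proof. by move=> h; rewrite /grad2 big1 // => i _; rewrite h mul0r. Qed.

Lemma heat_thp tau q t x : t < tau -> heat (jpow q (jth tau)) t x = - (q * (tau - t) `^ (q - 1)).
Proof. by move=> h; rewrite heat_comp grad2_0l ?mulr0 ?subr0 ?heat_th ?jthE ?mulrN1 // => i; exact: jd_th. Qed.

Lemma jd_thp tau q i t x : jd (jpow q (jth tau)) i t x = 0.
Proof. by rewrite /= !(mulr0, mul0r, addr0). Qed.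

(** Comparison with c (1 - |x|^2/rho^2 - 2 n (t - t1)/rho^2), a solution of the heat equation that
    is nonpositive on the lateral boundary. The terms with e make the comparison strict and are
    removed at the end. *)
Lemma lower_bar u rho t1 t2 c : 0 < rho -> 0 <= c ->
  (forall t x, t1 <= t <= t2 -> `|x| <= rho -> [/\ C12 u t x, 0 <= heat u t x & 0 <= jv u t x]) ->
  (forall x, `|x| <= rho -> c <= jv u t1 x) ->
  forall t, t1 <= t <= t2 -> c * (1 - 2 * n%:R * (t - t1) / rho ^+ 2) <= jv u t 0.
Proof.
move=> r0 c0 hu h1 t ht; have r2 : 0 < rho ^+ 2 by rewrite exprn_gt0.
set iq := (rho ^+ 2)^-1; have iq0 : 0 < iq by rewrite invr_gt0.
have K : forall e, 0 < e -> c * (1 - 2 * n%:R * (t - t1) / rho ^+ 2) - e * (1 + (t - t1)) < jv u t 0.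
  move=> e e0; pose k := - (c * (2 * n%:R * iq)) - e.
  pose w := jadd (jz (- (c * iq)) (jsq (0 : V))) (jadd (jz k (@jtime R n)) (jcst (c - e - k * t1))).
  have wE s y : jv w s y = c * (1 - nsq y * iq - 2 * n%:R * (s - t1) * iq) - e * (1 + (s - t1)).
    have -> : jv w s y = - (c * iq) * jv (jsq (0 : V)) s y + (k * s + (c - e - k * t1)) by [].
    by rewrite jsqE subr0 /k; ring.
  have Cw s y : C12 w s y.
    by apply: C12D; [apply: C12_Z; exact: C12_sq|apply: C12D; [apply: C12_Z; exact: C12_time|exact: C12_cst]].
  have hw s y : heat w s y = - e.
    by rewrite !heatD !heatZ heat_sq heat_time heat_cst /k; ring.
  have n0 : nsq (0 : V) = 0 by rewrite /nsq big1 // => i _; rewrite mxE mulr0.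
  suff : jv w t 0 < jv u t 0 by rewrite wE n0 mul0r subr0.
  apply: (@cmpp R n w u 0 rho t1 t2) => //.
  - by move=> s y hs; rewrite subr0 => hy; have [? _ _] := hu s y hs hy; split; exact: c_v0.
  - move=> y; rewrite subr0 => hy; rewrite wE subrr mulr0 mul0r subr0 addr0 mulr1.
    have := h1 y hy; have := mulr_ge0 c0 (mulr_ge0 (nsq_ge0 y) (ltW iq0)); lra.
  - move=> s y hs; rewrite subr0 => hy; have [|_ _ u0] := hu s y hs; first by rewrite hy.
    apply: lt_le_trans u0; rewrite wE; have /andP[s1 _] := hs.
    have q1 : 1 <= nsq y * iq by rewrite ler_pdivlMr // mul1r -hy; exact: nsq_norm.
    have q2 : 0 <= 2 * n%:R * (s - t1) * iq by rewrite !mulr_ge0 ?subr_ge0 // ltW.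
    have := mulr_ge0 c0 (_ : 0 <= nsq y * iq - 1 + 2 * n%:R * (s - t1) * iq).
    have := mulr_ge0 (ltW e0) (_ : 0 <= s - t1); rewrite subr_ge0 => /(_ s1) m1 m2.
    by have := m2 ltac:(sra q1 q2); sra e0 m1.
  - move=> s y /andP[s1 s2]; rewrite subr0 => hy; split => //.
    by have [] := hu s y; rewrite ?(ltW s1) ?(ltW hy).
  - move=> s y /andP[s1 s2]; rewrite subr0 => hy _; rewrite hw.
    by have [] := hu s y; rewrite ?(ltW s1) ?(ltW hy) // => _ h _; lra.
  - by rewrite subr0 normr0 ltW.
apply/ler_addgt0Pr => e e0; have /andP[s1 _] := ht.
have D0 : 0 < 1 + (t - t1) by lra.
have := K (e / (1 + (t - t1))) (divr_gt0 e0 D0); rewrite divfK ?gt_eqF // -/iq; lra.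
Qed.

Section TypeOne.
Variables (p al C0 : R).
Hypotheses (p1 : 1 < p) (hal : al * (p - 1) = 1) (C00 : 0 < C0).
Local Tactic Notation "sra2" hyp_list(l) := revert l; lra_in (p1, hal, C00).

Lemma small_pow (A B : R) : 0 < A -> 0 < B -> exists2 e, 0 < e & B * e `^ (p - 1) <= A.
Proof.
move=> A0 B0; have pp : 0 < p - 1 by rewrite subr_gt0.
exists ((A / B) `^ al); first by rewrite powR_gt0 // divr_gt0.
by rewrite -powRrM hal powRr1 ?divr_ge0 ?(ltW A0) ?(ltW B0) // mulrC divfK ?gt_eqF.
Qed.

Lemma big_pow (A B : R) : 0 < A -> 0 < B -> exists2 q, 0 < q & forall th, 0 < th -> th <= q -> B <= A * th `^ (- al - 1).
Proof.
move=> A0 B0; have a0 : 0 < al + 1 by have := al_gt0 p1 hal; lra.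
exists ((A / B) `^ (al + 1)^-1); first by rewrite powR_gt0 // divr_gt0.
move=> th th0 hth; have -> : - al - 1 = - (al + 1) by ring.
rewrite powRN ler_pdivlMr ?powR_gt0 // mulrC -ler_pdivlMr //.
have -> : A / B = ((A / B) `^ (al + 1)^-1) `^ (al + 1).
  by rewrite -powRrM mulVf ?gt_eqF // powRr1 // divr_ge0 // ltW.
by apply: powR_le => //; exact: ltW.
Qed.

Lemma chi_grad2 x t y : grad2 (jchi x) (jchi x) t y <= 36 * bmp (y - x) ^+ 3.
Proof.
have -> : grad2 (jchi x) (jchi x) t y = 36 * bmp (y - x) ^+ 3 * (bmp (y - x) * nsq (y - x)).
  by rewrite /grad2 /nsq !mulr_sumr; apply: eq_bigr => i _ /=; ring.
by rewrite ler_piMr ?bmp_nsq // mulr_ge0 // exprn_ge0 // bmp_ge0.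
Qed.

(* The barrier is [K (theta + e chi)^-al], which dominates the type I profile on the lateral boundary,
   where the cut-off [chi] vanishes, but stays bounded near the centre. *)
Lemma barrier_bounded : exists K e0 q0, [/\ 0 < K, 0 < e0 & 0 < q0] /\
  forall eta u (tau t1 t2 e : R), 0 < eta -> eta * 2 `^ al < K -> 0 < e <= e0 -> e <= tau - t1 -> tau - t1 <= q0 -> t2 < tau ->
  (forall t x, t1 <= t <= t2 -> `|x| <= 1 -> [/\ C12 u t x, heat u t x <= C0 * (jv u t x `^ p + 1), 0 <= jv u t x &
     jv u t x <= eta * (tau - t) `^ (- al)]) ->
  forall t x, t1 <= t <= t2 -> `|x| <= 1 -> jv u t x <= K * (tau - t + e * bmp x ^+ 3) `^ (- al).
Proof.
have a0 := al_gt0 p1 hal.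
have a8 : 0 < al / 8 by rewrite divr_gt0.
(* K is so small that the power in the reaction costs al/8 of K X^(-al - 1), and q below is so small
   that the additive constant costs another al/8. The heat operator of the barrier leaves al/2. *)
have [K K0 hK] := small_pow a8 C00.
have [q q0 hq] := big_pow (mulr_gt0 a8 K0) C00.
pose D : R := 6 * n%:R + 24 + 36 * (al + 1).
have D0 : 0 < D by rewrite /D; have : 0 <= n%:R :> R by []; lra.
exists K, (Num.min (q / 2) (1 / (2 * D))), (q / 2); split.
  by split => //; rewrite ?lt_min ?divr_gt0 ?mulr_gt0.
move=> eta u tau t1 t2 e eta0 etaK /andP[e0]; rewrite le_min => /andP[eq eD] et tq t2t hu t x ht hx.
apply: ltW; pose Q := jadd (jth tau) (jz e (jchi (0 : V))).
have QE s y : jv Q s y = tau - s + e * bmp y ^+ 3 by rewrite -(jthE tau s y) -[X in bmp X]subr0.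
have bc y : 0 <= bmp y ^+ 3 by rewrite exprn_ge0 // bmp_ge0.
have b1 y : bmp y ^+ 3 <= 1 by rewrite exprn_ile1 ?bmp_ge0 ?bmp_le1.
have eb y : 0 <= e * bmp y ^+ 3 by rewrite mulr_ge0 // ltW.
have eb1 y : e * bmp y ^+ 3 <= e by rewrite ler_piMr // ltW.
have Q0 s y : s <= t2 -> 0 < jv Q s y by move=> hs; rewrite QE; have := eb y; sra2 hs t2t.
pose w := jz K (jpow (- al) Q).
have wE s y : jv w s y = K * jv Q s y `^ (- al) by [].
have CQ s y : C12 Q s y by apply: C12D; [exact: C12_th|apply: C12_Z; exact: C12_chi].
have Cw s y : s <= t2 -> C12 w s y by move=> hs; apply: C12_Z; apply: C12_pow => //; exact: Q0.
rewrite -QE -wE; apply: (@cmpp R n u w 0 1 t1 t2) => //.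
- by move=> s y hs; rewrite subr0 => hy; split; [have [/c_v0] := hu s y hs hy|apply: c_v0; apply: Cw; case/andP: hs].
- move=> y; rewrite subr0 => hy; have t12 : t1 <= t1 <= t2 by rewrite lexx; case/andP: ht => /le_trans h /h.
  have [_ _ _ h] := hu t1 y t12 hy; apply: le_lt_trans h _; rewrite wE QE.
  have th0 : 0 < tau - t1 by sra2 e0 et.
  have : (2 * (tau - t1)) `^ (- al) <= (tau - t1 + e * bmp y ^+ 3) `^ (- al).
    by apply: powR_anti; [have := eb y; sra2 e0 et|have := eb1 y; sra2 et|exact: ltW].
  rewrite powRM ?(ltW th0) // => h1; apply: lt_le_trans (ler_wpM2l (ltW K0) h1).
  rewrite mulrA ltr_pM2r ?powR_gt0 // powRN ltr_pdivlMr // powR_gt0 //.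
- move=> s y hs; rewrite subr0 => hy; have [|_ _ _ h] := hu s y hs; first by rewrite hy.
  apply: le_lt_trans h _; rewrite wE QE bmp_out ?hy // expr0n /= mulr0 addr0 ltr_pM2r ?powR_gt0 //.
    apply: le_lt_trans etaK; rewrite ler_peMr ?(ltW eta0) //; apply: powR_ge1; [sra2|exact: ltW].
  by case/andP: hs => _; sra2 t2t.
- by move=> s y /andP[s1 s2]; rewrite subr0 => hy; split; [have [] := hu s y; rewrite ?(ltW s1) ?(ltW hy)|exact: Cw].
- move=> s y /andP[s1 s2]; rewrite subr0 => hy E.
  have [|//|_ h _ _] := hu s y; rewrite ?(ltW s1) ?(ltW hy) //; apply: le_lt_trans h _.
  have Qp := Q0 s y s2; rewrite E wE.
  have hheat : heat w s y >= K * jv Q s y `^ (- al - 1) * (al / 2).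
    rewrite heatZ heat_comp; set X := jv Q s y in Qp *.
    have -> : - al * ((- al - 1) * X `^ (- al - 1 - 1)) = al * (al + 1) * (X `^ (- al - 1) * X^-1).
      by rewrite [X `^ (_ - 1)](powRDp Qp) [X `^ (- 1)]powRN powRr1 ?(ltW Qp) //; ring.
    have -> : heat Q s y = -1 + e * heat (jchi (0 : V)) s y by rewrite heatD heat_th heatZ.
    have -> : grad2 Q Q s y = e ^+ 2 * grad2 (jchi (0 : V)) (jchi 0) s y.
      by rewrite /grad2 mulr_sumr; apply: eq_bigr => i _; rewrite /= !(mulr0, mul0r, addr0, add0r); ring.
    set G := grad2 _ _ _ _; set Hc := heat _ _ _.
    have hG : e ^+ 2 * G * X^-1 <= 36 * e.
      rewrite ler_pdivrMr //; have : G <= 36 * bmp (y - 0) ^+ 3 := chi_grad2 _ _ _.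
      rewrite subr0 => hG; have : e ^+ 2 * G <= e ^+ 2 * (36 * bmp y ^+ 3) by rewrite ler_wpM2l // sqr_ge0.
      have : 36 * e * (e * bmp y ^+ 3) <= 36 * e * X.
        by rewrite ler_wpM2l ?mulr_ge0 ?(ltW e0) // /X QE; sra2 s2 t2t.
      rewrite expr2; sra2.
    have hH : e * Hc <= e * (6 * n%:R + 24).
      by rewrite ler_wpM2l ?(ltW e0) //; apply: le_trans (ler_norm _) _; exact: chi_heat_le.
    have P0 : 0 < X `^ (- al - 1) by exact: powR_gt0.
    have -> : K * (- al * X `^ (- al - 1) * (-1 + e * Hc) - al * (al + 1) * (X `^ (- al - 1) / X) * (e ^+ 2 * G)) =
       K * X `^ (- al - 1) * (al * (1 - e * Hc - (al + 1) * (e ^+ 2 * G * X^-1))) by ring.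
    apply: ler_wpM2l; first by rewrite mulr_ge0 ?(ltW K0) // ltW.
    have e2 : e * D <= 1 / 2.
      have := ler_wpM2r (ltW D0) eD; rewrite (_ : 1 / (2 * D) * D = 1 / 2) //; field; exact: lt0r_neq0.
    have h3 : (al + 1) * (e ^+ 2 * G * X^-1) <= (al + 1) * (36 * e) by rewrite ler_wpM2l //; sra2 a0.
    rewrite (_ : al / 2 = al * (1 / 2)); last by ring.
    apply: ler_wpM2l; first exact: ltW.
    move: e2; rewrite /D; clear -hH h3; lra.
  apply: lt_le_trans hheat; set X := jv Q s y in Qp *.
  have XQ : X <= q by rewrite /X QE; have := eb1 y; sra2 eq s1 tq.
  have h4 := hq X Qp XQ; rewrite mulrC powRM ?(ltW K0) ?powR_ge0 // (pw_alp hal) //.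
  have P0 : 0 < X `^ (- al - 1) by exact: powR_gt0.
  have h5 : C0 * (K `^ p * X `^ (- al - 1)) <= al / 8 * K * X `^ (- al - 1).
    by rewrite mulrA ler_wpM2r ?(ltW P0) // powR_split ?(ltW K0) // mulrA ler_wpM2r // ltW.
  have := mulr_gt0 (mulr_gt0 a0 K0) P0; sra2 h4 h5.
- by rewrite subr0.
Qed.


(** An integer exponent allows the argument to vanish, as it does at the centre of the next barrier,
    where [C12_pow] does not apply. *)
Lemma jpowS_nat (k : nat) u t x : C12 u t x ->
  C12 (jcomp (fun r => r ^+ k.+2) (fun r => k.+2%:R * r ^+ k.+1) (fun r => k.+2%:R * (k.+1%:R * r ^+ k)) u) t x.
Proof.
have dX (m : nat) (r : R) : is_derive r 1 (fun r => r ^+ m.+1) (m.+1%:R * r ^+ m).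
  elim: m => [|m IH]; first by rewrite expr0 mulr1; have := did r.
  have := dM (did r) IH; rewrite (_ : (fun s => s * s ^+ m.+1) = fun s => s ^+ m.+2); last by apply/funext => s; rewrite -exprS.
  by congr (is_derive _ _ _ _); rewrite -[m.+2]addn1 natrD exprS; ring.
move=> h; apply: C12_comp => //.
case: k => [|k] e e0; first by exists 1 => // y _; rewrite !expr0 subrr normr0.
by have := der_cts (dZ k.+3%:R (dZ k.+2%:R (dX k (jv u t x)))); apply.
Qed.

(* The barrier is [theta^-al (eta + M (|x - a|^2 / (S theta))^m)] with a large exponent [m]. *)
Lemma barrier_small (M : R) : 0 < M -> exists2 eta0, 0 < eta0 & forall eta, 0 < eta <= eta0 -> exists S q0, [/\ 0 < S, 0 < q0 &
  forall u a (tau rho t1 t2 : R), tau - t1 <= q0 -> 0 < rho -> S * (tau - t1) <= rho ^+ 2 -> t2 < tau ->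
  (forall t x, t1 <= t <= t2 -> `|x - a| <= rho -> [/\ C12 u t x, heat u t x <= C0 * (jv u t x `^ p + 1), 0 <= jv u t x &
     jv u t x <= M * (tau - t) `^ (- al)]) ->
  (forall x, `|x - a| <= rho -> jv u t1 x < eta * (tau - t1) `^ (- al)) ->
  forall t, t1 <= t <= t2 -> jv u t a <= eta * (tau - t) `^ (- al)].
Proof.
move=> M0; have a0 := al_gt0 p1 hal; have nn : 0 <= n%:R :> R by [].
have Mp : 0 <= M `^ (p - 1) by exact: powR_ge0.
(* The time derivative of the m-th power, m = k + 2, yields the rate m / theta, which has to beat
   the linearised reaction C0 M^(p - 1) / theta with a factor 2 to spare. *)
have [k hk] : exists k : nat, 2 * C0 * M `^ (p - 1) <= k.+2%:R.
  exists (Num.truncn (2 * C0 * M `^ (p - 1))); have := truncnS_gt (2 * C0 * M `^ (p - 1)).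
  by move=> /ltW h; apply: le_trans h _; rewrite ler_nat.
set m : R := k.+2%:R in hk; have m2 : 2 <= m by rewrite /m ler_nat.
have a4 : 0 < al / 4 by rewrite divr_gt0.
have C2 : 0 < C0 * 2 `^ p by rewrite mulr_gt0 // powR_gt0.
have [e1 e10 he1] := small_pow a4 C2.
exists e1 => // eta /andP[eta0 etae].
have [q0 q00 hq0] := big_pow (mulr_gt0 a4 eta0) C00.
pose kap : R := m * (2 * n%:R + 4 * k.+1%:R).
have kap0 : 0 <= kap by apply: mulr_ge0; [lra|apply: addr_ge0; exact: mulr_ge0].
have ae0 : 0 < al * eta by exact: mulr_gt0.
(* A large S makes the Laplacian of the m-th power, which carries the factor [kap] / S, small
   against the gain from theta^-al. *)
have [S [S0 S1 S2]] : exists S, [/\ 0 < S, M * kap * S^-1 <= al * eta / 4 & kap * S^-1 <= al].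
  have x1 : 0 <= 4 * M * kap / (al * eta) by rewrite !mulr_ge0 ?invr_ge0 ?(ltW M0) ?(ltW ae0).
  have x2 : 0 <= kap / al by rewrite mulr_ge0 // invr_ge0 ltW.
  exists (4 * M * kap / (al * eta) + kap / al + 1); split; first by sra2 x1 x2.
    rewrite ler_pdivrMr; last by sra2 x1 x2.
    rewrite !mulrDr; have -> : al * eta / 4 * (4 * M * kap / (al * eta)) = M * kap by field; rewrite !gt_eqF.
    by have := mulr_ge0 (ltW (divr_gt0 ae0 (ltr0Sn R 3))) x2; sra2 ae0.
  rewrite ler_pdivrMr; last by sra2 x1 x2.
  rewrite !mulrDr; have -> : al * (kap / al) = kap by field; rewrite gt_eqF.
  by have := mulr_ge0 (ltW a0) x1; sra2 a0.
exists S, q0; split => // u a tau rho t1 t2 tq r0 Sr t2t hu h1 t ht.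
pose iS := S^-1; have iS0 : 0 < iS by rewrite invr_gt0.
pose Y := jz iS (jmul (jsq a) (jpow (-1) (jth tau))).
pose P := jcomp (fun r => r ^+ k.+2) (fun r => k.+2%:R * r ^+ k.+1) (fun r => k.+2%:R * (k.+1%:R * r ^+ k)) Y.
pose w := jmul (jpow (- al) (jth tau)) (jadd (jcst eta) (jz M P)).
have Cw s y : s < tau -> C12 w s y.
  move=> hs; have T0 : 0 < jv (jth tau) s y by rewrite jthE subr_gt0.
  apply: C12M; first by apply: C12_pow => //; exact: C12_th.
  apply: C12D; first exact: C12_cst.
  apply: C12_Z; apply: jpowS_nat; apply: C12_Z; apply: C12M; first exact: C12_sq.
  by apply: C12_pow => //; exact: C12_th.
have inv1 (z : R) : 0 < z -> z `^ (-1) = z^-1 by move=> z0; rewrite powRN powRr1 // ltW.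
have YE s y : s < tau -> jv Y s y = iS * (nsq (y - a) * (tau - s)^-1).
  by move=> hs; rewrite -inv1 ?subr_gt0 // -(jthE tau s y) -(jsqE a s y).
have PE s y : jv P s y = jv Y s y ^+ k.+2 by [].
have wE s y : jv w s y = (tau - s) `^ (- al) * (eta + M * jv P s y) by rewrite -(jthE tau s y).
have Y0 s y : s < tau -> 0 <= jv Y s y.
  by move=> hs; rewrite YE // !mulr_ge0 ?nsq_ge0 ?invr_ge0 ?subr_ge0 ?(ltW iS0) // ltW.
have Pv0 s y : s < tau -> 0 <= jv P s y by move=> hs; rewrite PE exprn_ge0 // Y0.
have M1 := ltW M0.
have wa : jv w t a = eta * (tau - t) `^ (- al).
  have tt : t < tau by case/andP: ht => _; sra2 t2t.
  rewrite wE PE YE // subrr (_ : nsq 0 = 0); last by rewrite /nsq big1 // => i _; rewrite mxE mulr0.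
  by rewrite mul0r mulr0 expr0n /= mulr0 addr0 mulrC.
rewrite -wa; apply: ltW; apply: (@cmpp R n u w a rho t1 t2) => //; last by rewrite subrr normr0 ltW.
- move=> s y hs hy; split; first by have [/c_v0] := hu s y hs hy.
  by apply: c_v0; apply: Cw; case/andP: hs => _; sra2 t2t.
- move=> y hy; apply: lt_le_trans (h1 y hy) _; have t1t : t1 < tau by case/andP: ht; sra2 t2t.
  by rewrite wE mulrC; apply: ler_wpM2l; [exact: powR_ge0|rewrite lerDl mulr_ge0 // Pv0].
- move=> s y hs hy; have [|_ _ _ h] := hu s y hs; first by rewrite hy.
  have /andP[s1 s2] := hs; have st : s < tau by sra2 hs t2t.
  apply: le_lt_trans h _; rewrite wE mulrC ltr_pM2l ?powR_gt0 ?subr_gt0 //.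
  have y1 : 1 <= jv Y s y.
    rewrite YE // mulrA ler_pdivlMr ?subr_gt0 // mul1r mulrC ler_pdivlMr // mulrC.
    apply: (@le_trans _ _ (S * (tau - t1))); first by rewrite ler_wpM2l ?(ltW S0) //; sra2 hs.
    by apply: le_trans Sr _; rewrite -hy; exact: nsq_norm.
  have p11 : 1 <= jv P s y by rewrite PE exprn_ege1.
  by have := ler_wpM2l M1 p11; sra2 eta0.
- by move=> s y /andP[s1 s2] hy; split; [have [] := hu s y; rewrite ?(ltW s1) ?(ltW hy)|apply: Cw; sra2 s2 t2t].
- move=> s y /andP[s1 s2] hy E.
  have st : s < tau by sra2 s2 t2t.
  have [|_ h u0 uM] := hu s y _ (ltW hy); first by rewrite (ltW s1).
  apply: le_lt_trans h _.
  set th := tau - s in uM; have th0 : 0 < th by rewrite subr_gt0.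
  set T := th `^ (- al) in uM; have T0 : 0 < T by exact: powR_gt0.
  pose ti := th^-1; have ti0 : 0 < ti by rewrite invr_gt0.
  set z := jv P s y; have z0 : 0 <= z by exact: Pv0.
  have vE : jv w s y = T * (eta + M * z) by exact: wE.
  have TT : th `^ (- al - 1) = T * ti by exact: pw_alS.
  have g0 j : grad2 (jpow (- al) (jth tau)) j s y = 0 by apply: grad2_0l => i; exact: jd_thp.
  have heatY : heat Y s y = ti * (jv Y s y - 2 * n%:R * iS).
    rewrite heatZ heatM heat_sq heat_thp //.
    have -> : grad2 (jsq a) (jpow (-1) (jth tau)) s y = 0.
      by rewrite /grad2 big1 // => i _; rewrite jd_thp mulr0.
    rewrite YE // jsqE -/th.
    have -> : th `^ (-1 - 1) = ti * ti by rewrite (powRDp th0) inv1.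
    have -> : jv (jpow (-1) (jth tau)) s y = ti by rewrite /ti -inv1 // /th -(jthE tau s y).
    by rewrite -/ti; ring.
  have gradY : grad2 Y Y s y = 4 * iS * ti * jv Y s y.
    have -> : grad2 Y Y s y = (iS * ti) ^+ 2 * grad2 (jsq a) (jsq a) s y.
      rewrite /grad2 mulr_sumr; apply: eq_bigr => i _.
      have -> : jd Y i s y = iS * ti * jd (jsq a) i s y.
        have -> : jd Y i s y = iS * (jv (jsq a) s y * jd (jpow (-1) (jth tau)) i s y + jv (jpow (-1) (jth tau)) s y * jd (jsq a) i s y) + jv (jmul (jsq a) (jpow (-1) (jth tau))) s y * 0 by [].
        rewrite mulr0 addr0 jd_thp; have -> : jv (jpow (-1) (jth tau)) s y = ti by rewrite /ti -inv1 // /th -(jthE tau s y).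
        ring.
      ring.
    rewrite grad2_sq YE // -/th -/ti.
    have -> : \sum_i (y - a) ord0 i * jd (jsq a) i s y = 2 * nsq (y - a).
      by rewrite /nsq mulr_sumr; apply: eq_bigr => i _; rewrite jd_sq; ring.
    ring.
  have heatw : heat w s y = T * ti * (M * (m * z - kap * iS * jv Y s y ^+ k.+1) + al * (eta + M * z)).
    rewrite heatM g0 mulr0 subr0 heat_thp // heatD heat_cst add0r heatZ heat_comp heatY gradY.
    have -> : jv (jadd (jcst eta) (jz M P)) s y = eta + M * z by [].
    have -> : jv (jpow (- al) (jth tau)) s y = T by rewrite /T /th -(jthE tau s y).
    rewrite -/th TT /z PE /kap -/m !exprS; ring.
  set y1 := jv Y s y in heatw; have y10 : 0 <= y1 by exact: Y0.
  have yz : y1 ^+ k.+1 <= 1 + z.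
    rewrite /z PE -/y1; have [yl|yl] := lerP y1 1.
      by have := exprn_ile1 k.+1 y10 yl; have := exprn_ge0 k.+2 y10; sra2.
    have : y1 ^+ k.+1 <= y1 ^+ k.+2 by rewrite [leRHS]exprS ler_peMl ?exprn_ge0 // ltW.
    by sra2.
  have P0 : 0 < T * ti by exact: mulr_gt0.
  have low : T * ti * (m * (M * z) + 3 / 4 * (al * eta)) <= heat w s y.
    rewrite heatw; apply: ler_wpM2l; first exact: ltW.
    have x1 : M * kap * iS * y1 ^+ k.+1 <= M * kap * iS * (1 + z).
      by apply: ler_wpM2l => //; rewrite !mulr_ge0 // ltW.
    have x2 : kap * iS * (M * z) <= al * (M * z) by apply: ler_wpM2r; [exact: mulr_ge0|exact: S2].
    move: S1; rewrite -/iS => S1; sra2 S1 x1 x2.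
  apply: lt_le_trans low; rewrite mulrDr mulr1.
  have c0 : C0 <= T * ti * (al * eta / 4).
    have thq : th <= q0 by rewrite /th; clear -tq s1; lra.
    by have := hq0 th th0 thq; rewrite TT (_ : al / 4 * eta * (T * ti) = T * ti * (al * eta / 4)) //; ring.
  have cp : C0 * jv u s y `^ p <= T * ti * (m * (M * z) + al * eta / 4).
    (* Near the centre v <= 2 eta theta^-al and the smallness of eta controls v^p. Elsewhere v <= 2
       M z theta^-al, and the type I bound linearises v^p, so that the large exponent m wins. *)
    have [c|c] := lerP (M * z) eta.
      apply: (@le_trans _ _ (T * ti * (al * eta / 4))); last first.
        apply: ler_wpM2l; first exact: ltW.
        by rewrite lerDr; apply: mulr_ge0; [apply: le_trans m2|exact: mulr_ge0].
      have : jv u s y `^ p <= (2 * eta * T) `^ p.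
        apply: powR_le => //; last exact: ltW (lt_trans ltr01 p1).
        by rewrite E vE mulrC ler_wpM2r ?(ltW T0) //; sra2 c.
      rewrite powRM ?mulr_ge0 ?(ltW eta0) ?(ltW T0) // powRM ?(ltW eta0) // (pw_alp hal) // TT => h3.
      have : C0 * jv u s y `^ p <= C0 * (2 `^ p * eta `^ p * (T * ti)) by rewrite ler_wpM2l // ltW.
      move/le_trans; apply.
      have : C0 * 2 `^ p * eta `^ (p - 1) <= al / 4.
        apply: le_trans he1; rewrite ler_wpM2l ?(ltW C2) //; apply: powR_le => //; [exact: ltW|by rewrite subr_ge0 ltW].
      move=> h4; rewrite (powR_split (ltW eta0) p1).
      have := ler_wpM2r (ltW (mulr_gt0 eta0 P0)) h4; sra2.
    have h3 := pw_up p1 hal th0 u0 uM M1; rewrite -/ti in h3.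
    have h4 : jv u s y <= T * (2 * (M * z)) by rewrite E vE ler_wpM2l ?(ltW T0) //; sra2 c.
    have h5 : C0 * jv u s y `^ p <= C0 * (M `^ (p - 1) * ti * (T * (2 * (M * z)))).
      rewrite ler_wpM2l ?(ltW C00) //; apply: le_trans h3 _.
      by rewrite ler_wpM2l // mulr_ge0 // ltW.
    apply: le_trans h5 _; have Mz : 0 <= M * z by exact: mulr_ge0.
    have := ler_wpM2r (mulr_ge0 (ltW P0) Mz) hk.
    have := mulr_ge0 (ltW P0) (_ : 0 <= al * eta / 4); rewrite divr_ge0 ?(ltW ae0) // => /(_ isT); sra2.
  have := mulr_gt0 P0 ae0; sra2 c0 cp.
Qed.

End TypeOne.
End Barriers.

(** * Ancient solutions and approximating sequences *)

Section Ancient.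
Context {R : realType} {n : nat}.
Local Notation V := 'rV[R]_n.
Variables (p al : R).
Hypotheses (p1 : 1 < p) (hal : al * (p - 1) = 1).
Local Tactic Notation "sra1" hyp_list(l) := revert l; lra_in (p1, hal).
Implicit Types (x y : V) (A B C e d t s r M : R) (U : @jf R n) (w : nat -> @jf R n).

Lemma p_gt0 : 0 < p. Proof. exact: lt_trans ltr01 p1. Qed.
Lemma pm1_gt0 : 0 < p - 1. Proof. by rewrite subr_gt0. Qed.

Lemma pow_lip B r s : 0 <= r <= B -> 0 <= s <= B -> `|r `^ p - s `^ p| <= p * B `^ (p - 1) * `|r - s|.
Proof.
wlog rs : r s / s <= r.
  move=> H hr hs; have /orP[h|h] := le_total s r; first exact: H.
  by rewrite distrC (distrC r); exact: H.
move=> /andP[r0 rB] /andP[s0 sB]; have B0 := le_trans r0 rB.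
have pm := ltW pm1_gt0; have p0 := ltW p_gt0.
have Bp : 0 <= B `^ (p - 1) by exact: powR_ge0.
have [s00|s00] := eqVneq s 0.
  rewrite s00 (powR0 (lt0r_neq0 p_gt0)) !subr0 ger0_norm ?powR_ge0 // (ger0_norm r0) powR_split //.
  apply: ler_wpM2r => //; apply: (@le_trans _ _ (1 * B `^ (p - 1))); first by rewrite mul1r; exact: powR_le.
  by apply: ler_wpM2r => //; exact: ltW.
have sp : 0 < s by rewrite lt_neqAle eq_sym s00.
rewrite (@ger0_norm _ (r - s)) ?subr_ge0 //.
apply: (@itv_lip R (fun z => z `^ p) (fun z => p * z `^ (p - 1))) => // z /andP[z1 z2].
  by apply: dpow; exact: lt_le_trans z1.
by rewrite ger0_norm ?mulr_ge0 ?powR_ge0 // ler_wpM2l //; apply: powR_le => //; [lra|lra].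
Qed.

(** The constant M is invariant under the parabolic rescaling [rsc], so estimates uniform over this
    class apply to all rescalings at once. *)
Definition clA M U := forall t x, t < 0 -> [/\ C12 U t x, heat U t x = jv U t x `^ p, 0 <= jv U t x &
  jv U t x <= M * (- t) `^ (- al)].

(** Common frame for three families: rescalings of the given solution, rescalings of an ancient
    solution, and ancient solutions renormalised at bad points. The cylinders exhaust space and the
    past and reach up to tau; the type I bound refers to tau, which may tend to 0. *)
Record apx (g C0 M : R) w (G : nat -> V -> R -> R) (tau L : nat -> R) : Prop := Apx {
  ax_L : forall B, ev (fun k => B < L k);
  ax_tau : ev (fun k => 0 <= tau k);
  ax_eq : ev (fun k => forall t x, - L k < t < tau k -> `|x| < L k ->
    [/\ C12 (w k) t x, heat (w k) t x = G k x (jv (w k) t x), 0 <= jv (w k) t x &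
        jv (w k) t x <= M * (tau k - t) `^ (- al)]);
  ax_G1 : forall B, exists2 C, 0 <= C & ev (fun k => forall x x' r r', `|x| <= B -> `|x'| <= B -> 0 <= r <= B ->
    0 <= r' <= B -> `|G k x r - G k x' r'| <= C * (`|x - x'| `^ g + `|r - r'|));
  ax_G2 : forall B e, 0 < e -> ev (fun k => forall x r, `|x| <= B -> 0 <= r <= B -> `|G k x r - r `^ p| < e);
  ax_G3 : ev (fun k => forall x r, `|x| < L k -> 0 <= r -> 0 <= G k x r <= C0 * (r `^ p + 1)) }.

Lemma apx_hloc g C0 M w G tau L (t0 r B : R) x0 : 0 < g <= 1 -> apx g C0 M w G tau L -> 0 <= B ->
  ev (fun k => forall t x, `|t - t0| < r -> `|x - x0| < r -> t < tau k /\ jv (w k) t x <= B) ->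
  exists2 A, 0 <= A & ev (fun k => hloc g A (w k) r t0 x0).
Proof.
move=> hg ax B0 hB; pose B' := B + `|x0| + `|r|.
have x00 := normr_ge0 x0; have r0 := normr_ge0 r.
have BB : B <= B' by rewrite /B'; lra.
have [C C0' h1] := ax_G1 ax B'; have h2 := ax_G2 ax B' (@ltr01 R).
have Bp : 0 <= B `^ p by exact: powR_ge0.
exists (B + (B `^ p + 1) + C); first by lra.
have h3 := ax_L ax (`|x0| + `|r| + `|t0|).
apply: (ev2 _ (evI h1 h2) (evI h3 (evI hB (ax_eq ax)))) => k [c1 c2] [c3 [c4 c5]].
have reg t x : `|t - t0| < r -> `|x - x0| < r -> [/\ C12 (w k) t x, heat (w k) t x = G k x (jv (w k) t x), 0 <= jv (w k) t x,
    jv (w k) t x <= B & `|x| <= B'].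
  move=> ht hx; have [c6 c7] := c4 t x ht hx.
  have rr := ler_norm r; have xB : `|x| < `|x0| + `|r| by have := ler_normD (x - x0) x0; rewrite subrK; clear -hx rr; lra.
  have [||C1 C2 C3 _] := c5 t x; last by split => //; rewrite /B'; clear -xB B0; lra.
    rewrite c6 andbT; move: ht; rewrite ltr_norml => /andP[t1 _].
    by have := ler_norm (- t0); rewrite normrN; clear -t1 c3 x00 rr; lra.
  by have := normr_ge0 t0; clear -xB c3; lra.
split=> [s y hs hy|s x y hs hx hy].
  have [C1 C2 C3 C4 C5] := reg s y hs hy; split => //.
    by rewrite ger0_norm //; clear -C4 Bp C0'; lra.
  have : jv (w k) s y `^ p <= B `^ p by apply: powR_le => //; exact: ltW p_gt0.
  have := powR_ge0 (jv (w k) s y) p.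
  have := c2 y (jv (w k) s y) C5; rewrite C3 (le_trans C4 BB) C2 => /(_ isT).
  by rewrite ltr_norml => /andP[? ?] ? ?; rewrite ler_norml; apply/andP; split; lra.
have [_ -> x1 x2 x3] := reg s x hs hx; have [_ -> y1 y2 y3] := reg s y hs hy.
apply: le_trans (c1 _ _ _ _ y3 x3 _ _) _; rewrite ?x1 ?y1 ?(le_trans x2 BB) ?(le_trans y2 BB) //.
by apply: ler_wpM2r; [rewrite addr_ge0 ?powR_ge0|sra1 B0 Bp].
Qed.

Lemma apx_cc g C0 M w G tau L t x : apx g C0 M w G tau L -> (exists l, cc (fun k => jv (w k)) l t x) ->
  (exists2 d, 0 < d & ev (fun k => forall s y, `|s - t| < d -> `|y - x| < d -> s < tau k)) ->
  cc (fun k => heat (w k)) (ulim (fun k => jv (w k) t x) `^ p) t x.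
Proof.
move=> ax [l hl] [d0 d00 hd0]; rewrite (ulimE (cc_ucv hl)).
have inL : ev (fun k => `|t| + 1 + (`|x| + 1) < L k) := ax_L ax _.
have reg : ev (fun k => forall s y, `|s - t| < Num.min 1 d0 -> `|y - x| < Num.min 1 d0 ->
    [/\ heat (w k) s y = G k y (jv (w k) s y), 0 <= jv (w k) s y & `|y| <= `|x| + 1]).
  apply: (ev2 _ (evI inL hd0) (ax_eq ax)) => k [c1 c0] c2 s y; rewrite !lt_min => /andP[s1 s2] /andP[y1 y2].
  have yB : `|y| <= `|x| + 1 by have := ler_normD (y - x) x; rewrite subrK; clear -y1; lra.
  have [||C1 C2 C3 _] := c2 s y => //.
    rewrite (c0 s y s2 y2) andbT; move: s1; rewrite ltr_norml => /andP[s1 _].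
    by have := ler_norm (- t); have := normr_ge0 x; rewrite normrN; clear -s1 c1; lra.
  by have := normr_ge0 t; clear -yB c1; lra.
have m0 : 0 < Num.min 1 d0 by rewrite lt_min ltr01.
have l0 : 0 <= l.
  apply: ucv_ler (cc_ucv hl) _; apply: evS reg => k h; have [] // := h t x; by rewrite subrr normr0.
move=> e e0; have e2 : 0 < e / 2 by lra.
have [d d0' hd] := pow_cts0 p_gt0 l0 e2.
have [d1 d10 hd1] := hl _ d0'; have [d2 d20 hd2] := hl _ (@ltr01 R).
exists (Num.min (Num.min 1 d0) (Num.min d1 d2)); first by rewrite (lt_min _ (Num.min 1 d0)) m0 lt_min d10.
have hG := ax_G2 ax (l + 1 + (`|x| + 1)) e2.
apply: (ev2 _ (evI hd1 hd2) (evI reg hG)) => k [a1 a2] [a3 a4] s y.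
rewrite (lt_min _ (Num.min 1 d0)) (lt_min _ d1) => /and3P[s1 s2 s3].
rewrite (lt_min _ (Num.min 1 d0)) (lt_min _ d1) => /and3P[y1 y2 y3].
have [b1 b2 b3] := a3 s y s1 y1; rewrite b1.
have b4 := a2 s y s3 y3; have xx := normr_ge0 x.
have := a4 y (jv (w k) s y); rewrite b2 => /(_ _ _) b5.
have b6 := hd _ b2 (a1 s y s2 y2).
rewrite (_ : G k y _ - _ = G k y (jv (w k) s y) - jv (w k) s y `^ p + (jv (w k) s y `^ p - l `^ p)); last by ring.
apply: lt_normD; rewrite [e]splitr ltrD //; apply: b5; first by clear -b3 l0; lra.
by move: b4; rewrite ltr_norml => /andP[_ b4]; clear -b4 xx; lra.
Qed.

(** For t < 0 the distance tau - t >= -t keeps the type I bound uniform in k, so [compact_loc]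
    applies. Nothing is claimed at t = 0; this is left to the barriers. *)
Lemma apx_lim g C0 M w G tau L : 0 < g <= 1 -> 0 <= M -> apx g C0 M w G tau L ->
  clA M (jlim w) /\ forall t x, t < 0 -> jcc w (jlim w) t x.
Proof.
move=> hg M0 ax.
have H t x : t < 0 -> [/\ jcc w (jlim w) t x, C12 (jlim w) t x & heat (jlim w) t x = jv (jlim w) t x `^ p].
  move=> t0; have [r [r0 rE]] : exists r : R, 0 < r /\ r + r = - t by exists (- t / 2); split; lra.
  have B0 : 0 <= M * r `^ (- al) by rewrite mulr_ge0 // powR_ge0.
  have hB : ev (fun k => forall s y, `|s - t| < r -> `|y - x| < r -> s < tau k /\ jv (w k) s y <= M * r `^ (- al)).
    apply: (ev2 _ (evI (ax_tau ax) (ax_eq ax)) (ax_L ax (`|t| + r + (`|x| + r)))) => k [c1 c2] c3 s y hs hy.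
    have s1 : s < - r by move: hs; rewrite ltr_norml => /andP[_ ?]; clear B0; lra.
    have st : s < tau k by clear -s1 c1 r0; lra.
    split => //; have [||_ _ _ h] := c2 s y.
    - rewrite st andbT; move: hs; rewrite ltr_norml => /andP[s2 _].
      by have := ler_norm (- t); have := normr_ge0 x; rewrite normrN; clear -s2 c3 r0; lra.
    - by have := ler_normD (y - x) x; rewrite subrK; have := normr_ge0 t; clear -hy c3 r0; lra.
    apply: le_trans h _; apply: ler_wpM2l => //; apply: powR_anti => //; last exact: ltW (al_gt0 p1 hal).
    by clear -s1 c1; lra.
  have [A A0 hA] := apx_hloc hg ax B0 hB.
  have cH s y : `|s - t| < r -> `|y - x| < r -> (exists l, cc (fun k => jv (w k)) l s y) ->
      cc (fun k => heat (w k)) (jv (jlim w) s y `^ p) s y.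
    move=> hs hy hl; apply: (apx_cc ax) => //; exists (r - `|s - t|); first by rewrite subr_gt0.
    by apply: evS hB => k hk s' y' h1 h2; have [] := hk s' x (tri_lt h1 (lexx _)) _; rewrite ?subrr ?normr0.
  have [r' r'0 hr'] := compact_loc hg r0 A0 hA cH.
  by apply: hr'; rewrite subrr normr0.
split=> [t x t0|t x t0]; have [h1 h2 h3] := H t x t0 => //; split => //.
  apply: ucv_ler (cc_ucv (j_v h1)) _.
  apply: (ev2 _ (evI (ax_tau ax) (ax_eq ax)) (ax_L ax (`|t| + `|x|))) => k [c1 c2] c3.
  have [||_ _ //] := c2 t x.
    by have := ler_norm (- t); have := normr_ge0 x; rewrite normrN => ? ?; apply/andP; split; lra.
  by have := normr_ge0 t; lra.
apply: ucv_lel (cc_ucv (j_v h1)) _.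
apply: (ev2 _ (evI (ax_tau ax) (ax_eq ax)) (ax_L ax (`|t| + `|x|))) => k [c1 c2] c3.
have [||_ _ _ h] := c2 t x.
- by have := ler_norm (- t); have := normr_ge0 x; rewrite normrN => ? ?; apply/andP; split; lra.
- by have := normr_ge0 t; lra.
apply: le_trans h _; apply: ler_wpM2l => //; apply: powR_anti; [lra|lra|exact: ltW (al_gt0 p1 hal)].
Qed.

Lemma heat_shift (t0 : R) x0 U t x : heat (jscale 1 1 t0 x0 U) t x = heat U (t0 + 1 ^+ 2 * t) (x0 + 1 *: x).
Proof. by rewrite heat_scale expr1n !mul1r. Qed.

(** After translation of (t, x) to the origin the interior estimates use only the past of t, where
    the type I bound is at most M d^-al. *)
Lemma A_bounds M (d : R) : 0 <= M -> 0 < d -> exists2 K, 0 <= K & forall U, clA M U -> forall t x, t <= - d ->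
  [/\ `|jv U t x| <= K, `|jt U t x| <= K, (forall i, `|jd U i t x| <= K) & forall i j, `|jdd U i j t x| <= K].
Proof.
move=> M0 d0; pose B := M * d `^ (- al); have B0 : 0 <= B by rewrite mulr_ge0 // powR_ge0.
have hB U t x : clA M U -> t <= - d -> 0 <= jv U t x <= B.
  move=> hU td; have t0 : t < 0 by lra.
  have [_ _ -> h] := hU t x t0; apply: le_trans h _; apply: ler_wpM2l => //.
  by apply: powR_anti => //; [lra|exact: ltW (al_gt0 p1 hal)].
have one : 0 < (1 : R) <= 1 by rewrite ltr01 lexx.
have [Af hAf] := @ctl_of R n 1 one; have [Kh Kh0 hKh] := @hess_reg R n 1 one.
pose A := B + B `^ p + p * B `^ (p - 1).
have Bp : 0 <= B `^ p by exact: powR_ge0.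
have pB : 0 <= p * B `^ (p - 1) by rewrite mulr_ge0 ?powR_ge0 // ltW // p_gt0.
have A0 : 0 <= A by rewrite /A; lra.
have key U t x : clA M U -> t <= - d -> ctl 1 (jscale 1 1 t x U) 0 0 0 (Af A).
  move=> hU td; apply: hAf => //.
  have sd s : 0 - 3 <= s <= 0 -> t + 1 ^+ 2 * s <= - d by rewrite expr1n mul1r => /andP[_ ?]; lra.
  split=> [s y hs hy|s z y hs hz hy].
    have s1 := sd s hs; have s0 : t + 1 ^+ 2 * s < 0 by sra1 d0 hs td.
    have [C1 C2 C3 _] := hU _ (x + 1 *: y) s0; have /andP[u0 uB] := hB U _ (x + 1 *: y) hU s1; split.
    - exact: C12_scale.
    - by rewrite /= mul1r ger0_norm // /A; sra1 Bp pB uB.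
    rewrite heat_shift C2 ger0_norm ?powR_ge0 //.
    have : jv U (t + 1 ^+ 2 * s) (x + 1 *: y) `^ p <= B `^ p by apply: powR_le => //; exact: ltW p_gt0.
    by rewrite /A; sra1 B0 pB.
  have s1 := sd s hs; have s0 : t + 1 ^+ 2 * s < 0 by sra1 d0 hs td.
  rewrite !heat_shift /= !mul1r; have [_ -> _ _] := hU _ (x + 1 *: y) s0; have [_ -> _ _] := hU _ (x + 1 *: z) s0.
  apply: le_trans (pow_lip (hB U _ (x + 1 *: y) hU s1) (hB U _ (x + 1 *: z) hU s1)) _.
  rewrite powRr1 //; apply: ler_pM => //; first by rewrite /A; sra1 B0 Bp.
  by rewrite lerDr.
exists (B + `|Af A| + Kh * Af A + `|Kh * Af A|); first by have := ler_norm (- (Kh * Af A)); rewrite normrN; have := normr_ge0 (Af A); sra1 B0.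
move=> U hU t x td; have ck := key U t x hU td; have [Af0 h1 _] := ck; have [_ h2] := hKh _ _ _ _ _ ck.
have z1 : 0 - 2 <= (0 : R) <= 0 by rewrite lexx andbT; sra1.
have z2 : 0 - 1 <= (0 : R) <= 0 by rewrite lexx andbT; sra1.
have z3 : `|0 : V| <= 0 + 4 by rewrite normr0; sra1.
have z4 : `|0 : V| <= 0 + 2 by rewrite normr0; sra1.
have [_ _ _ h3] := h1 0 0 z1 z3; have [h4 h5] := h2 0 0 z2 z4.
have KA : 0 <= Kh * Af A by exact: mulr_ge0.
have nA := normr_ge0 (Kh * Af A); have nA' := ler_norm (Af A).
have E f : f (t + 1 ^+ 2 * 0) (x + 1 *: 0) = f t x :> R by rewrite mulr0 scaler0 !addr0.
have /andP[u0 uB] := hB U t x hU td.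
split.
- by rewrite ger0_norm //; sra1 Af0 KA nA nA' uB.
- by move: h5; rewrite /= E expr1n !mul1r; sra1 Af0 B0 nA nA'.
- by move=> i; move: (h3 i); rewrite /= E !mul1r; sra1 B0 KA nA nA'.
- by move=> i j; move: (h4 i j); rewrite /= E expr1n !mul1r; sra1 Af0 B0 nA nA'.
Qed.

End Ancient.

(** * Strong maximum principle for ancient solutions *)

Section Positivity.
Context {R : realType} {n : nat}.
Local Notation V := 'rV[R]_n.
Variables (p al M : R).
Hypotheses (p1 : 1 < p) (hal : al * (p - 1) = 1) (M0 : 0 <= M).
Local Tactic Notation "sra1" hyp_list(l) := revert l; lra_in (p1, hal, M0).
Implicit Types (x y : V) (B C c e d t s r h : R) (U : @jf R n).
Local Notation clA := (clA p al M).

Lemma A_gm U t x s : clA U -> t < 0 -> 0 < s -> PG (fun y => jv U (t - s ^+ 2) (x + s *: y)).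
Proof.
move=> hU t0 s0; have t0' : 0 < - t by rewrite oppr_gt0.
have [B B0 hB'] := @A_bounds R n p al p1 hal M _ M0 t0'; have hB := hB' U hU; apply: (@PG_bnd _ _ B) => y.
by have [|h _ _ _] := hB (t - s ^+ 2) (x + s *: y) => //; rewrite opprK gerBl sqr_ge0.
Qed.

(** Degree 0 in Duhamel's formula: the mean over the slice t - q^2 decreases in q at the rate 2 q
    times the mean of U^p, which lies between 0 and E. *)
Lemma A_duhamel U t x s E : clA U -> t < 0 -> 0 < s ->
  (forall q y, 0 < q <= s -> jv U (t - q ^+ 2) y `^ p <= E) ->
  gmean (fun y => jv U (t - s ^+ 2) (x + s *: y)) <= jv U t x <=
  gmean (fun y => jv U (t - s ^+ 2) (x + s *: y)) + E * s ^+ 2.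
Proof.
move=> hU t0 s0 hE; have t0' : 0 < - t by rewrite oppr_gt0.
have [B B0 hB'] := @A_bounds R n p al p1 hal M _ M0 t0'; have hB := hB' U hU; rewrite opprK in hB.
pose r := s + 1; have r0 : 0 < r by rewrite /r; lra.
have zC s' y : t - r ^+ 2 <= s' <= t -> C12 U s' y.
  by move=> /andP[_ st]; have [] := hU s' y (le_lt_trans st t0).
have zB s' y : t - r ^+ 2 <= s' <= t -> [/\ `|jv U s' y| <= B, `|jt U s' y| <= B, (forall i, `|jd U i s' y| <= B) &
      forall i k, `|jdd U i k s' y| <= B] by move=> /andP[_ st]; exact: hB.
pose f q := hM U t x (fun=> 1) q.
have fE q : f q = gmean (fun y => jv U (t - q ^+ 2) (x + q *: y)) by apply: gmeanE => y; rewrite mul1r.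
have df q : 0 < q < r -> is_derive q 1 f (- (2 * q * hG U t x (fun=> 1) q)).
  move=> hq; have := @hM_deriv R n U t r B x r0 zC zB (fun=> 1) (fun _ _ => 0) (fun _ _ => 0) 0
    (PGC 1) (fun _ => PGC 0) (fun _ => PGC 0) (fun _ => ctsC _ _) (fun _ _ => ctsC _ _) (fun _ _ => ctsC _ _)
    (fun _ _ => pdcst _ _ _) (fun _ _ => pdcst _ _ _) _ q hq.
  rewrite !mul0r sub0r; apply => y; rewrite big1 ?mul0r // => i _; ring.
have hGE q : 0 < q <= s -> 0 <= hG U t x (fun=> 1) q <= E.
  move=> hq; have tq : t - q ^+ 2 < 0 by have := sqr_ge0 q; sra1 t0.
  have -> : hG U t x (fun=> 1) q = gmean (fun y => jv U (t - q ^+ 2) (x + q *: y) `^ p).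
    by apply: gmeanE => y; rewrite mul1r; have [_ ->] := hU _ (x + q *: y) tq.
  have PGp : PG (fun y => jv U (t - q ^+ 2) (x + q *: y) `^ p).
    by apply: (@PG_bnd _ _ E) => y; rewrite ger0_norm ?powR_ge0 //; exact: hE.
  apply/andP; split; first by apply: gmean_ge0 => // y; exact: powR_ge0.
  rewrite -(@gmeanC R n E); apply: gmean_le => //; first exact: PGC.
  by move=> y; exact: hE.
have mono q : 0 < q <= s -> f s <= f q <= f s + E * s ^+ 2.
  move=> /andP[q0 qs].
  have rng z : q <= z <= s -> 0 < z < r by rewrite /r => /andP[? ?]; lra.
  have rng' z : q <= z <= s -> 0 < z <= s by move=> /andP[? ?]; lra.
  apply/andP; split.
    rewrite -lerN2; apply: (@derive_mono R (fun z => - f z) (fun z => 2 * z * hG U t x (fun=> 1) z)) => // z hz.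
      by have := dN (df z (rng z hz)); rewrite opprK.
    by have /andP[h _] := hGE z (rng' z hz); have /andP[z0 _] := rng z hz; rewrite !mulr_ge0 // ltW.
  apply: (@le_trans _ _ (f q + E * q ^+ 2)).
    have /andP[e1 e2] := hGE q (rng' q ltac:(sra1 qs)).
    by rewrite lerDl mulr_ge0 ?sqr_ge0 //; sra1 e1 e2.
  apply: (@derive_mono R (fun z => f z + E * z ^+ 2) (fun z => 2 * z * (E - hG U t x (fun=> 1) z))) => // z hz.
    have := dD (df z (rng z hz)) (dZ E (dM (did z) (did z))).
    by congr (is_derive _ _ _ _); ring.
  have /andP[_ h] := hGE z (rng' z hz); have /andP[z0 _] := rng z hz.
  by rewrite !mulr_ge0 ?subr_ge0 // ltW.
have bU s' y : t - r ^+ 2 <= s' <= t -> `|jv U s' y| <= B by move=> h; have [] := zB s' y h.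
have jU : jc (jv U) t x by have [/c_v0] := hU t x t0.
rewrite -fE; apply/andP; split; apply/ler_addgt0Pr => e e0; have [d d0 hd] := gmean_shrink r0 bU jU e0.
  pose q := Num.min s (d / 2).
  have q0 : 0 < q by rewrite lt_min s0; sra1 d0.
  have qs : q <= s by rewrite ge_min lexx.
  have qd : q < d by have : q <= d / 2 by [rewrite ge_min lexx orbT]; sra1 d0.
  have := hd q q0 qd; rewrite -fE ler_norml => /andP[_ h1].
  by have /andP[h2 _] := mono q ltac:(by rewrite q0); sra1 h1 h2.
pose q := Num.min s (d / 2).
have q0 : 0 < q by rewrite lt_min s0; sra1 d0.
have qs : q <= s by rewrite ge_min lexx.
have qd : q < d by have : q <= d / 2 by [rewrite ge_min lexx orbT]; sra1 d0.
have := hd q q0 qd; rewrite -fE ler_norml => /andP[h1 _].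
by have /andP[_ h2] := mono q ltac:(by rewrite q0); sra1 h1 h2.
Qed.

Lemma A_bnd U (d : R) : clA U -> 0 < d -> exists2 B, 0 <= B & forall t x, t <= - d -> 0 <= jv U t x <= B.
Proof.
move=> hU d0; have [B B0 hB'] := @A_bounds R n p al p1 hal M _ M0 d0; have hB := hB' U hU; exists B => // t x td.
have t0 : t < 0 by lra.
have [_ _ -> _] := hU t x t0; have [h _ _ _] := hB t x td; apply: le_trans h; exact: ler_norm.
Qed.

(** The mean over each earlier slice lies between 0 and U(t, x) = 0, and the Gaussian mean is
    faithful. *)
Lemma A_zero_past U t x : clA U -> t < 0 -> jv U t x = 0 -> forall t' y, t' < t -> jv U t' y = 0.
Proof.
move=> hU t0 ux t' y tt; pose s := Num.sqrt (t - t').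
have s2 : s ^+ 2 = t - t' by rewrite sqr_sqrtr // subr_ge0 ltW.
have s0 : 0 < s by rewrite sqrtr_gt0 subr_gt0.
have t0n : 0 < - t by rewrite oppr_gt0.
have [B B0 hB] := A_bnd hU t0n.
have [E hE] : exists E, forall q y, 0 < q <= s -> jv U (t - q ^+ 2) y `^ p <= E.
  exists (B `^ p) => q z _; have /andP[u0 uB] : 0 <= jv U (t - q ^+ 2) z <= B by apply: hB; rewrite opprK gerBl sqr_ge0.
  by apply: powR_le => //; exact: ltW (p_gt0 p1).
have /andP[h1 _] := A_duhamel x hU t0 s0 hE; rewrite ux in h1.
have t'E : t - s ^+ 2 = t' by rewrite s2; ring.
have t'0 := lt_trans tt t0.
have n0 z : 0 <= jv U (t - s ^+ 2) (x + s *: z) by rewrite t'E; have [] := hU t' (x + s *: z) t'0.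
have P := A_gm x hU t0 s0.
have := @gmean_faithful R n (fun z => jv U (t - s ^+ 2) (x + s *: z)) P _ n0 _ (s^-1 *: (y - x)).
rewrite scalerA mulfV ?gt_eqF // scale1r addrBC t'E; apply.
  move=> z; apply: cts_scale; apply: (@jc_cts R n (jv U)); apply: c_v0.
  by have [] := hU t' (x + s *: z) t'0.
by apply/eqP; rewrite eq_le -{1}t'E h1 -t'E gmean_ge0.
Qed.

(** Uniqueness for bounded solutions: on time steps of length h with L h = 1/2, where U^p <= L U,
    Duhamel's formula halves any bound for U, so U vanishes on each step. *)
Lemma A_zero_future U (t0 : R) : clA U -> t0 < 0 -> (forall x, jv U t0 x = 0) -> forall t x, t0 <= t < 0 -> jv U t x = 0.
Proof.
move=> hU t00 h0 t1 x1 /andP[t01 t10].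
have t1n : 0 < - t1 by rewrite oppr_gt0.
have [B B0 hB] := A_bnd hU t1n.
rewrite opprK in hB; pose L := B `^ (p - 1) + 1.
have Bp : 0 <= B `^ (p - 1) by exact: powR_ge0.
have L0 : 0 < L by rewrite /L; lra.
pose h := 1 / (2 * L); have h0' : 0 < h by rewrite divr_gt0 // mulr_gt0.
have hL : L * h = 1 / 2 by rewrite /h; field; rewrite gt_eqF.
have step s0 : (forall x, jv U s0 x = 0) -> forall C, 0 <= C -> C <= B ->
    (forall t x, s0 <= t <= s0 + h -> t <= t1 -> jv U t x <= C) ->
    forall t x, s0 <= t <= s0 + h -> t <= t1 -> jv U t x <= C / 2.
  move=> hs0 C C0 CB hC t x /andP[st th] tt1.
  have [->|ne] := eqVneq t s0; first by rewrite hs0 divr_ge0.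
  have {}st : s0 < t by rewrite lt_neqAle eq_sym ne.
  have t0' : t < 0 by sra1 t10 tt1.
  pose s := Num.sqrt (t - s0).
  have s2 : s ^+ 2 = t - s0 by rewrite sqr_sqrtr // subr_ge0 ltW.
  have sp : 0 < s by rewrite sqrtr_gt0 subr_gt0.
  have hE q y : 0 < q <= s -> jv U (t - q ^+ 2) y `^ p <= L * C.
    move=> /andP[q0 qs]; have q2 : 0 <= q ^+ 2 <= s ^+ 2 by rewrite sqr_ge0 ler_pXn2r // nnegrE ltW.
    have tq : t - q ^+ 2 <= t1 by move/andP: q2; sra1 tt1.
    have /andP[u0 uB] := hB _ y tq.
    have uC : jv U (t - q ^+ 2) y <= C by apply: hC => //; move/andP: q2; rewrite s2 => -[? ?]; lra.
    rewrite powR_split //; apply: ler_pM => //; first exact: powR_ge0.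
    by apply: (@le_trans _ _ (B `^ (p - 1))); [apply: powR_le => //; exact: ltW (pm1_gt0 p1)|rewrite /L lerDl].
  have /andP[_] := A_duhamel x hU t0' sp hE.
  rewrite (@gmeanE _ _ _ (fun=> 0)) ?gmeanC ?add0r => [|y]; last first.
    by rewrite s2 (_ : t - (t - s0) = s0) ?hs0 //; ring.
  move/le_trans; apply; rewrite s2; have : L * C * (t - s0) <= L * C * h by rewrite ler_wpM2l ?mulr_ge0 ?(ltW L0) //; sra1 th.
  by have -> : L * C * h = C / 2 by rewrite mulrAC hL; ring.
have zero s0 : (forall x, jv U s0 x = 0) -> forall t x, s0 <= t <= s0 + h -> t <= t1 -> jv U t x = 0.
  move=> hs0 t x ht tt1.
  have it k : forall t x, s0 <= t <= s0 + h -> t <= t1 -> jv U t x <= B / 2 ^+ k.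
    elim: k => [|k IH].
      by move=> t' x' _ /hB h'; rewrite expr0 divr1; have /andP[] := h' x'.
    have -> : B / 2 ^+ k.+1 = B / 2 ^+ k / 2 by rewrite exprS; field; rewrite expf_neq0.
    have k1 : 1 <= (2 : R) ^+ k by rewrite exprn_ege1 //; lra.
    apply: step => //; first by rewrite divr_ge0 // exprn_ge0.
    by rewrite ler_pdivrMr ?exprn_gt0 // ler_peMr.
  have /andP[u0 _] := hB t x tt1; apply/eqP; rewrite eq_le u0 andbT leNgt; apply/negP => up.
  pose k := (Num.truncn (B / jv U t x)).+1.
  have h1 : B / jv U t x < k%:R by exact: truncnS_gt.
  have h2 : k%:R <= (2 : R) ^+ k by rewrite -natrX ler_nat ltnW // ltn_expl.
  have := it k t x ht tt1; rewrite ler_pdivlMr ?exprn_gt0 //.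
  rewrite ltr_pdivrMr // in h1; have := ler_wpM2l u0 h2; sra1 h1.
have all k : forall t x, t0 <= t <= t0 + k%:R * h -> t <= t1 -> jv U t x = 0.
  elim: k => [|k IH] t x /andP[ht1 ht2] tt1.
    by rewrite (_ : t = t0) ?h0 //; apply/eqP; rewrite eq_le ht1 andbT; sra1 ht2.
  have [c|c] := lerP t (t0 + k%:R * h); first by apply: IH => //; rewrite ht1.
  have kh : 0 <= k%:R * h by rewrite mulr_ge0 // ltW.
  apply: (zero (t0 + k%:R * h)) => //.
    by move=> y; apply: IH; [rewrite lerDl kh lexx|lra].
  by rewrite ltW //= (le_trans ht2) // -natr1; lra.
pose k := (Num.truncn ((t1 - t0) / h)).+1.
have hk : (t1 - t0) / h < k%:R by exact: truncnS_gt.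
rewrite ltr_pdivrMr // in hk; apply: (all k) => //; rewrite t01 /=; lra.
Qed.

(** Positivity gives access to U^(p - 2), which appears in the equations for the derivatives and may
    be singular at 0. *)
Lemma A_pos U : clA U -> (forall t x, t < 0 -> jv U t x = 0) \/ (forall t x, t < 0 -> 0 < jv U t x).
Proof.
move=> hU; have [[t [x [t0 ux]]]|hn] := pselect (exists t x, t < 0 /\ jv U t x = 0); [left|right].
  move=> t' y t'0; have hp := A_zero_past hU t0 ux.
  have [c|c] := ltrP t' t; first exact: hp.
  apply: (A_zero_future hU (t0 := t - 1)); [lra| |lra].
  by move=> z; apply: hp; lra.
move=> t x t0; rewrite lt_neqAle; have [_ _ -> _] := hU t x t0; rewrite andbT eq_sym; apply/eqP => E.
by apply: hn; exists t, x.
Qed.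

End Positivity.

(** * Derivatives and self-similar rescaling of ancient solutions *)

Section AncientSmooth.
Context {R : realType} {n : nat}.
Local Notation V := 'rV[R]_n.
Variables (p al M : R).
Hypotheses (p1 : 1 < p) (hal : al * (p - 1) = 1) (M0 : 0 <= M).
Implicit Types (x y v a : V) (A B C c e d t s r h l : R) (U : @jf R n).
Local Notation clA := (@clA R n p al M).

Definition posA U := forall t x, t < 0 -> 0 < jv U t x.

Lemma pd_uniq v (f : V -> R) x l m : pd v f x l -> pd v f x m -> l = m.
Proof. by move=> h1 h2; rewrite -(@derive_val _ _ _ _ _ _ _ h1) -(@derive_val _ _ _ _ _ _ _ h2). Qed.

Lemma jdx_jet i u J t0 x0 r : 0 < r ->
  (forall s y, `|s - t0| < r -> `|y - x0| < r -> [/\ C12 u s y, C12 J s y & heat u s y = jv J s y]) ->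
  exists2 r', 0 < r' & forall s y, `|s - t0| < r' -> `|y - x0| < r' ->
    [/\ C12 (jdx i u) s y, jv (jdx i u) s y = jd u i s y & heat (jdx i u) s y = jd J i s y].
Proof.
move=> r0 H; apply: (@jdxP R n i u (jd J i) (fun j => jdd J i j) t0 x0 r r0) => s y hs hy.
have [C1 C2 _] := H s y hs hy; split => //; last by move=> j; split; [exact: c_dd|exact: c_dd0].
  apply: pd_ext (c_d C2 i); exists (r - `|y - x0|); first by rewrite subr_gt0.
  by move=> z hz; have [_ _ ->] := H s z hs (tri_lt hz (lexx _)).
exact: c_d0.
Qed.

(** Symmetry of second derivatives: the j-derivative stored in [jdx i u] is a limit of difference
    quotients of u_j in direction i, hence u_ji, and it is also the derivative u_ij of its value. *)
Lemma jdx_dd i u t x : C12 u t x -> C12 (jdx i u) t x ->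
  (exists2 d, 0 < d & forall y, `|y - x| < d -> jv (jdx i u) t y = jd u i t y) ->
  forall j, jd (jdx i u) j t x = jdd u i j t x /\ jdd u i j t x = jdd u j i t x.
Proof.
move=> C1 C2 he j.
have E : jd (jdx i u) j t x = jdd u i j t x by apply: pd_uniq (pd_ext he (c_d C2 j)) (c_dd C1 i j).
split => //; rewrite -E; apply: ulimE => e e0; have e2 : 0 < e / 2 by lra.
have [b b0 hb] := (derP _ _ _).1 (c_dd C1 j i) _ e2.
apply: evS (ev_inv b0) => k; have := @inv0 R k; move: (k.+1%:R^-1) => h h0 hq.
have := hb h; rewrite add0r scale0r addr0 (gtr0_norm h0) => /(_ hq) h3.
rewrite /= (_ : _ - _ = h^-1 * (jd u j t (x + h *: evec R i) - jd u j t x - jdd u j i t x * h)); last by field; rewrite gt_eqF.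
rewrite normrM gtr0_norm ?invr_gt0 // ltr_pdivrMl //; apply: le_lt_trans h3 _.
by rewrite mulrC ltr_pM2l //; lra.
Qed.

Section Smooth.
Variable U : @jf R n.
Hypotheses (hU : clA U) (Up : posA U).

Lemma tri_neg s t : `|s - t| < - t -> s < 0.
Proof. by rewrite ltr_norml => /andP[_ ?]; lra. Qed.

Lemma A_dx i t x : t < 0 -> [/\ C12 (jdx i U) t x, jv (jdx i U) t x = jd U i t x &
  heat (jdx i U) t x = p * jv U t x `^ (p - 1) * jd U i t x].
Proof.
move=> t0; have t0' : 0 < - t by rewrite oppr_gt0.
have [r' r0 h] := @jdx_jet i U (jpow p U) t x (- t) t0' (fun s y hs _ => let: And4 h1 h2 _ _ := hU y (tri_neg hs) in
  And3 h1 (C12_pow p h1 (Up y (tri_neg hs))) h2).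
by apply: h; rewrite subrr normr0.
Qed.

Lemma A_dxd i j t x : t < 0 -> jd (jdx i U) j t x = jdd U i j t x /\ jdd U i j t x = jdd U j i t x.
Proof.
move=> t0; have [C1 _ _] := A_dx i x t0; have [C2 _ _ _] := hU x t0.
apply: jdx_dd => //; exists 1 => // y _; by have [] := A_dx i y t0.
Qed.

Lemma A_dxx i j t x : t < 0 -> [/\ C12 (jdx j (jdx i U)) t x, jv (jdx j (jdx i U)) t x = jdd U i j t x &
  heat (jdx j (jdx i U)) t x = p * (jv U t x `^ (p - 1) * jdd U i j t x +
    (p - 1) * jv U t x `^ (p - 1 - 1) * jd U i t x * jd U j t x)].
Proof.
move=> t0; have t0' : 0 < - t by rewrite oppr_gt0.
pose J := jz p (jmul (jpow (p - 1) U) (jdx i U)).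
have JC s y : s < 0 -> C12 J s y.
  move=> s0; apply: C12_Z; apply: C12M; last by have [] := A_dx i y s0.
  by apply: C12_pow; [have [] := hU y s0|exact: Up].
have Jh s y : s < 0 -> heat (jdx i U) s y = jv J s y.
  move=> s0; have [_ E ->] := A_dx i y s0.
  have -> : jv J s y = p * (jv U s y `^ (p - 1) * jv (jdx i U) s y) by [].
  by rewrite E; ring.
have [r' r0 h] := @jdx_jet j (jdx i U) J t x (- t) t0' (fun s y hs _ => let: And3 h1 _ _ := A_dx i y (tri_neg hs) in
  And3 h1 (JC s y (tri_neg hs)) (Jh s y (tri_neg hs))).
have [||h1 h2 h3] := h t x; rewrite ?subrr ?normr0 //; split => //.
  by rewrite h2; have [] := A_dxd i j x t0.
rewrite h3 -(A_dxd i j x t0).1; have [_ E _] := A_dx i x t0.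
have -> : jd J j t x = p * (jv U t x `^ (p - 1) * jd (jdx i U) j t x + jv (jdx i U) t x * ((p - 1) * jv U t x `^ (p - 1 - 1) * jd U j t x)) +
  jv (jmul (jpow (p - 1) U) (jdx i U)) t x * 0 by [].
by rewrite E; ring.
Qed.

Lemma A_cts t x : t < 0 -> [/\ cts (jv U t) x, cts (jt U t) x, (forall i, cts (jd U i t) x) & forall i j, cts (jdd U i j t) x].
Proof.
move=> t0; have [C1 _ _ _] := hU x t0; split.
- exact: (@jc_cts R n (jv U)) (c_v0 C1).
- exact: (@jc_cts R n (jt U)) (c_t0 C1).
- by move=> i; exact: (@jc_cts R n (jd U i)) (c_d0 C1 i).
- by move=> i j; exact: (@jc_cts R n (jdd U i j)) (c_dd0 C1 i j).
Qed.
End Smooth.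

(** The scaling l^(2 al) U(l^2 t, l x) preserves the equation. Its slice at t = -1 is the
    self-similar profile of U at time -l^2; large l look into the past. *)
Definition rsc l U : @jf R n := jscale ((l ^+ 2) `^ al) l 0 0 U.

Lemma rscE l U t x : [/\ jv (rsc l U) t x = (l ^+ 2) `^ al * jv U (l ^+ 2 * t) (l *: x),
   jt (rsc l U) t x = (l ^+ 2) `^ al * l ^+ 2 * jt U (l ^+ 2 * t) (l *: x),
   (forall i, jd (rsc l U) i t x = (l ^+ 2) `^ al * l * jd U i (l ^+ 2 * t) (l *: x)) &
   forall i j, jdd (rsc l U) i j t x = (l ^+ 2) `^ al * l ^+ 2 * jdd U i j (l ^+ 2 * t) (l *: x)].
Proof. by split; rewrite /rsc /= !add0r // => i; rewrite !add0r. Qed.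

Lemma rsc_rsc l m U t x : 0 < l -> 0 < m -> [/\ jv (rsc m (rsc l U)) t x = jv (rsc (m * l) U) t x &
  forall i, jd (rsc m (rsc l U)) i t x = jd (rsc (m * l) U) i t x].
Proof.
move=> l0 m0; have E : ((m * l) ^+ 2) `^ al = (m ^+ 2) `^ al * (l ^+ 2) `^ al by rewrite exprMn powRM ?sqr_ge0.
have [a1 _ a3 _] := rscE m (rsc l U) t x; have [b1 _ b3 _] := rscE l U (m ^+ 2 * t) (m *: x).
have [c1 _ c3 _] := rscE (m * l) U t x.
have E1 : l ^+ 2 * (m ^+ 2 * t) = (m * l) ^+ 2 * t by ring.
have E2 : l *: (m *: x) = (m * l) *: x by rewrite scalerA mulrC.
split; first by rewrite a1 b1 c1 E E1 E2; ring.
by move=> i; rewrite a3 b3 c3 E E1 E2; ring.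
Qed.

Lemma A_rsc l U : 0 < l -> clA U -> clA (rsc l U).
Proof.
move=> l0 hU t x t0; have l2 : 0 < l ^+ 2 by rewrite exprn_gt0.
have lt : l ^+ 2 * t < 0 by rewrite pmulr_rlt0.
have c0 : 0 <= (l ^+ 2) `^ al by exact: powR_ge0.
have [C1 C2 C3 C4] := hU _ (l *: x) lt; have [E1 _ _ _] := rscE l U t x; rewrite E1; split.
- by apply: C12_scale => //; rewrite !add0r.
- rewrite heat_scale !add0r C2 powRM // -powRrM.
  have -> : al * p = al + 1 by have := hal; lra.
  by rewrite (powRDp l2) powRr1 // ltW.
- by rewrite mulr_ge0.
apply: le_trans (ler_wpM2l c0 C4) _.
have -> : - (l ^+ 2 * t) = l ^+ 2 * - t by ring.
rewrite powRM ?(ltW l2) ?oppr_ge0 ?(ltW t0) // [X in _ * (_ * (X * _))]powRN.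
have cp : (l ^+ 2) `^ al != 0 by rewrite gt_eqF // powR_gt0.
by rewrite mulrCA mulVKf.
Qed.

Lemma pos_rsc l U : 0 < l -> posA U -> posA (rsc l U).
Proof.
move=> l0 hU t x t0; have l2 : 0 < l ^+ 2 by rewrite exprn_gt0.
have [-> _ _ _] := rscE l U t x; rewrite mulr_gt0 ?powR_gt0 //; apply: hU; by rewrite pmulr_rlt0.
Qed.

End AncientSmooth.

(** * Integration by parts for the Gaussian mean *)

Section Green.
Context {R : realType} {n : nat}.
Local Notation V := 'rV[R]_n.
Implicit Types (x y a : V) (C c e d t s r h : R) (f : V -> R).

(** Stein's identity for f h_i, summed over i: the operator Delta - y/2 . grad is symmetric for the
    Gaussian mean. *)
Lemma green f (fi hi hii : 'I_n -> V -> R) : PG f -> (forall i, PG (fi i)) -> (forall i, PG (hi i)) -> (forall i, PG (hii i)) ->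
  (forall y, cts f y) -> (forall i y, cts (fi i) y) -> (forall i y, cts (hi i) y) -> (forall i y, cts (hii i) y) ->
  (forall i y, pd (evec R i) f y (fi i y)) -> (forall i y, pd (evec R i) (hi i) y (hii i y)) ->
  gmean (fun y => \sum_i fi i y * hi i y) = - gmean (fun y => f y * (\sum_i hii i y - 2^-1 * \sum_i y ord0 i * hi i y)).
Proof.
move=> Pf Pfi Phi Phii cf cfi ch chii df dh.
have P1 i : PG (fun y => fi i y * hi i y) by exact: PGM.
have P2 i : PG (fun y => f y * hii i y) by exact: PGM.
have P3 i : PG (fun y => y ord0 i * (f y * hi i y)) by apply: PGM; [exact: PG_coord|exact: PGM].
have E i : gmean (fun y => y ord0 i * (f y * hi i y)) = 2 * (gmean (fun y => fi i y * hi i y) + gmean (fun y => f y * hii i y)).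
  rewrite (@gmean_ibp R n i _ (fun y => fi i y * hi i y + f y * hii i y)).
  - by rewrite gmeanD.
  - exact: PGM.
  - exact: PGD.
  - by move=> y; have := pdM (df i y) (dh i y); congr (pd _ _ _ _); ring.
  - by move=> y; apply: ctsD; exact: ctsM.
rewrite (@gmeanE _ _ (fun y => f y * _) (fun y => \sum_i (f y * hii i y) - 2^-1 * \sum_i (y ord0 i * (f y * hi i y)))); last first.
  move=> y; rewrite mulrBr mulr_sumr; congr (_ - _).
  rewrite mulrCA; congr (_ * _); rewrite mulr_sumr; apply: eq_bigr => i _; ring.
rewrite gmeanB ?gmeanZ ?gmean_sum //; [|exact: PG_sum|exact: PG_sum|by apply: PG_Z; exact: PG_sum].
rewrite (eq_bigr _ (fun i _ => E i)) -mulr_sumr big_split /=.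
by field.
Qed.

Lemma stein_radial f (fi : 'I_n -> V -> R) : PG f -> (forall i, PG (fi i)) -> (forall y, cts f y) ->
  (forall i y, cts (fi i) y) -> (forall i y, pd (evec R i) f y (fi i y)) ->
  gmean (fun y => \sum_i y ord0 i * fi i y) = 2^-1 * gmean (fun y => nsq y * f y) - n%:R * gmean f.
Proof.
move=> Pf Pfi cf cfi df.
have P1 i : PG (fun y => y ord0 i * fi i y) by apply: PGM => //; exact: PG_coord.
have P3 i : PG (fun y => y ord0 i * (y ord0 i * f y)) by apply: PGM; [exact: PG_coord|apply: PGM => //; exact: PG_coord].
have E i : gmean (fun y => y ord0 i * (y ord0 i * f y)) = 2 * (gmean f + gmean (fun y => y ord0 i * fi i y)).
  rewrite (@gmean_ibp R n i _ (fun y => f y + y ord0 i * fi i y)).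
  - by rewrite gmeanD.
  - by apply: PGM => //; exact: PG_coord.
  - exact: PGD.
  - by move=> y; have := pdM (pd_co i i y) (df i y); congr (pd _ _ _ _); rewrite eqxx mulr1n; ring.
  - by move=> y; apply: ctsD => //; apply: ctsM => //; exact: cts_co.
rewrite (@gmeanE _ _ (fun y => nsq y * f y) (fun y => \sum_i (y ord0 i * (y ord0 i * f y)))); last first.
  by move=> y; rewrite /nsq mulr_suml; apply: eq_bigr => i _; ring.
rewrite !gmean_sum // (eq_bigr _ (fun i _ => E i)) -mulr_sumr big_split /= sumr_const card_ord -mulr_natl.
by field.
Qed.

(** The factor a_s - a_s0 vanishes at s0, so b enters through its value there and is not
    differentiated. In this way the gradient energy is differentiated in s without mixed derivatives
    of U in time and space. *)
Lemma gmean_qderiv (a a' b : R -> V -> R) (s0 r : R) m C : 0 < r ->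
  (forall s y, `|s - s0| < r -> is_derive s 1 (a ^~ y) (a' s y)) ->
  (forall y, jc a' s0 y) -> (forall y, jc b s0 y) ->
  (forall s, `|s - s0| < r -> pgr m C (a' s)) -> (forall s, `|s - s0| < r -> pgr m C (b s)) ->
  is_derive s0 1 (fun s => gmean (fun y => (a s y - a s0 y) * b s y)) (gmean (fun y => a' s0 y * b s0 y)).
Proof.
move=> r0 ha ja jb ba bb; apply/derP => e e0.
have s00 : `|s0 - s0| < r by rewrite subrr normr0.
have C0 := pgr_ge0 (ba _ s00).
have e2 : 0 < e / 2 by lra.
have C2 : 0 <= 2 * C ^+ 2 * @momK R n (m + m).+1 by rewrite mulr_ge0 ?momK_ge0 ?mulr_ge0 ?sqr_ge0.
have [Y Y0 hY] := small_div C2 e2.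
pose Q := C * (1 + Y) ^+ m; have Q0 : 0 <= Q by rewrite mulr_ge0 // exprn_ge0 //; lra.
have e3 : 0 < e / 2 / (2 * (Q + 1)) by rewrite divr_gt0 // mulr_gt0 //; lra.
have at0 t : s0 <= t <= s0 -> t = s0 by move=> /andP[t1 t2]; apply/eqP; rewrite eq_le t1 t2.
have [|d d0 hd] := @unif_cont2 R n a' s0 s0 Y _ _ e3; first by move=> t x /at0 ->.
have [|d' d0' hd'] := @unif_cont2 R n b s0 s0 Y _ _ e3; first by move=> t x /at0 ->.
exists (Num.min (Num.min d d') r); first by rewrite !lt_min d0 d0'.
move=> h; rewrite !lt_min => /andP[/andP[hd1 hd2] hr1].
have hs : `|s0 + h - s0| < r by rewrite addrC addKr.
rewrite [X in _ - X - _](_ : _ = 0); last first.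
  by rewrite -[RHS](@gmeanC R n); apply: gmeanE => y; rewrite subrr mul0r.
rewrite subr0 [X in _ - X]mulrC.
have P (f1 f2 : V -> R) : pgr m C f1 -> pgr m C f2 -> PG (fun y => f1 y * f2 y).
  by move=> h1 h2; apply: PGM; exists m, C.
have key y : exists2 c, `|c - s0| <= `|h| & a (s0 + h) y - a s0 y = h * a' c y.
  have [|c hc' ec] := @mvt_sym R (a^~ y) (a'^~ y) s0 (s0 + h).
    by move=> x hx; apply: ha; apply: le_lt_trans hx _; rewrite addrC addKr.
  rewrite addrCK in hc' ec; exists c => //.
  by rewrite ec; ring.
have PD : pgr m (`|h| * C) (fun y => a (s0 + h) y - a s0 y).
  move=> y; have [c hc' ->] := key y; rewrite normrM -mulrA ler_wpM2l //.
  exact: ba c (le_lt_trans hc' hr1) y.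
rewrite -gmeanZ; last exact: P (ba _ s00) (bb _ s00).
rewrite -gmeanB; last first.
- by apply: PG_Z; exact: P (ba _ s00) (bb _ s00).
- by apply: PGM; [exists m, (`|h| * C)|exists m, C; exact: bb].
have q1 : pgr (m + m) (`|h| * (2 * C ^+ 2)) (fun y => (a (s0 + h) y - a s0 y) * b (s0 + h) y - h * (a' s0 y * b s0 y)).
  move=> y; have [c hc' ->] := key y; rewrite -mulrA -mulrBr normrM -!mulrA ler_wpM2l //.
  have B1 := ba c (le_lt_trans hc' hr1) y; have B2 := ba s0 s00 y.
  have B3 := bb _ hs y; have B4 := bb s0 s00 y.
  apply: le_normB; rewrite !normrM exprD.
  have : `|a' c y| * `|b (s0 + h) y| <= (C * (1 + `|y|) ^+ m) * (C * (1 + `|y|) ^+ m) by apply: ler_pM.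
  have : `|a' s0 y| * `|b s0 y| <= (C * (1 + `|y|) ^+ m) * (C * (1 + `|y|) ^+ m) by apply: ler_pM.
  sra.
have q2 y : `|y| <= Y -> `|(a (s0 + h) y - a s0 y) * b (s0 + h) y - h * (a' s0 y * b s0 y)| <= `|h| * (e / 2).
  move=> hy; have [c hc' ->] := key y; rewrite -mulrA -mulrBr normrM ler_wpM2l //.
  have yY : C * (1 + `|y|) ^+ m <= Q.
    by apply: ler_wpM2l => //; apply: lerXn2r; rewrite ?nnegrE; have := normr_ge0 y; sra Y0 hy.
  have B2 := le_trans (ba s0 s00 y) yY; have B3 := le_trans (bb _ hs y) yY.
  have s0s0 : s0 <= s0 <= s0 by rewrite lexx.
  have D1 : `|a' c y - a' s0 y| < e / 2 / (2 * (Q + 1)).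
    by apply: (hd s0 y c y) => //; rewrite ?subrr ?normr0 //; exact: le_lt_trans hc' _.
  have D2 : `|b (s0 + h) y - b s0 y| < e / 2 / (2 * (Q + 1)).
    by apply: (hd' s0 y (s0 + h) y) => //; rewrite ?subrr ?normr0 // addrCK.
  have -> : a' c y * b (s0 + h) y - a' s0 y * b s0 y = (a' c y - a' s0 y) * b (s0 + h) y + a' s0 y * (b (s0 + h) y - b s0 y) by ring.
  apply: le_normD; rewrite !normrM.
  have E3 : e / 2 / (2 * (Q + 1)) * Q <= e / 4.
    by rewrite mulrAC ler_pdivrMr; sra Q0 e0.
  have : `|a' c y - a' s0 y| * `|b (s0 + h) y| <= e / 2 / (2 * (Q + 1)) * Q by apply: ler_pM => //; exact: ltW.
  have : `|a' s0 y| * `|b (s0 + h) y - b s0 y| <= Q * (e / 2 / (2 * (Q + 1))) by apply: ler_pM => //; exact: ltW.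
  sra E3.
have q3 : 0 <= `|h| * (e / 2) by rewrite mulr_ge0 // ltW.
have := gmean_tail q1 q3 Y0 q2 => q4; apply: le_trans q4 _.
have -> : `|h| * (2 * C ^+ 2) / (1 + Y) * @momK R n (m + m).+1 = `|h| * (2 * C ^+ 2 * @momK R n (m + m).+1 / (1 + Y)) by ring.
have -> : e * `|h| = `|h| * (e / 2) + `|h| * (e / 2) by field.
by rewrite lerD2l ler_wpM2l.
Qed.

End Green.

(** * The self-similar energy and its monotonicity *)

Section Energy.
Context {R : realType} {n : nat}.
Local Notation V := 'rV[R]_n.
Variables (p al M : R).
Hypotheses (p1 : 1 < p) (hal : al * (p - 1) = 1) (M0 : 0 <= M).
Implicit Types (x y a : V) (C c e d t s r h : R) (U : @jf R n).
Local Notation clA := (@clA R n p al M).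
Local Notation rsc := (@rsc R n al).

(** Potential of the similarity equation w_s = Delta w - y/2 . grad w - al w + w^p. [En] is its
    Giga-Kohn energy, [Lw] its linear operator, and [Sg] the derivative of the rescaled profile with
    respect to l at l = 1, which vanishes for self-similar solutions. *)
Definition Pot r := al / 2 * (r * r) - r `^ (p + 1) / (p + 1).
Definition En U := gmean (fun y => 2^-1 * (\sum_i jd U i (-1) y * jd U i (-1) y) + Pot (jv U (-1) y)).
Definition Lw U y := \sum_i jdd U i i (-1) y - 2^-1 * \sum_i y ord0 i * jd U i (-1) y.
Definition Sg U y := 2 * al * jv U (-1) y - 2 * jt U (-1) y + \sum_i y ord0 i * jd U i (-1) y.

Lemma neg1 : (-1 : R) < 0. Proof. by rewrite oppr_lt0. Qed.

Lemma Sg_eq U y : clA U -> Sg U y = - 2 * (Lw U y - al * jv U (-1) y + jv U (-1) y `^ p).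
Proof.
move=> hU; have [_ h _ _] := hU (-1) y neg1; move: h; rewrite /heat /Sg /Lw => h.
have -> : jt U (-1) y = jv U (-1) y `^ p + \sum_i jdd U i i (-1) y by rewrite -h subrK.
by field.
Qed.

Lemma rsc1 U : rsc 1 U = U.
Proof.
have E (f : R -> V -> R) c : c = 1 -> (fun t x => c * f (0 + 1 ^+ 2 * t) (0 + 1 *: x)) = f.
  by move=> ->; apply/funext => t; apply/funext => x; rewrite expr1n !mul1r !add0r scale1r.
have c1 : (1 ^+ 2 : R) `^ al = 1 by rewrite expr1n powR1.
case: U => a b c d; rewrite /rsc /jscale /=; congr Jf.
- exact: E c1.
- by apply: E; rewrite c1 expr1n mulr1.
- by apply/funext => i; apply: E; rewrite c1 mulr1.
- by apply/funext => i; apply/funext => j; apply: E; rewrite c1 expr1n mulr1.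
Qed.

Lemma sq_pow_derive s : 0 < s -> is_derive s 1 (fun s => (s ^+ 2) `^ al) (2 * al * (s ^+ 2) `^ al / s).
Proof.
move=> s0; have s2 : 0 < s ^+ 2 by rewrite exprn_gt0.
have h : is_derive s 1 (fun s : R => s ^+ 2) (2 * s) by have := dM (did s) (did s); congr (is_derive _ _ _ _); ring.
have := @dcomp R (fun r => r `^ al) (fun s => s ^+ 2) s _ _ (dpow al s2) h; congr (is_derive _ _ _ _).
have -> : (s ^+ 2) `^ (al - 1) = (s ^+ 2) `^ al * (s ^+ 2)^-1.
  by rewrite (powRDp s2) [X in _ * X]powRN powRr1 ?(ltW s2).
by field; rewrite gt_eqF.
Qed.

Lemma neg_sq s : 0 < s -> s ^+ 2 * (-1) < 0.
Proof. by move=> s0; rewrite mulrN1 oppr_lt0 exprn_gt0. Qed.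

Lemma rsc_deriv U y s : clA U -> 0 < s -> is_derive s 1 (fun s => jv (rsc s U) (-1) y) (s^-1 * Sg (rsc s U) y).
Proof.
move=> hU s0; have s2 : 0 < s ^+ 2 by rewrite exprn_gt0.
have [C1 _ _ _] := hU _ (s *: y) (neg_sq s0).
have da : is_derive s 1 (fun s : R => s ^+ 2 * (-1)) (- (2 * s)).
  have := dZ (-1) (dM (did s) (did s)).
  have -> : (fun s : R => -1 * (s * s)) = fun s : R => s ^+ 2 * (-1) by apply/funext => z; ring.
  by congr (is_derive _ _ _ _); ring.
have db i : is_derive s 1 (fun s : R => (s *: y) ord0 i) (y ord0 i).
  have := dM (did s) (dcst (y ord0 i) s).
  have -> : (fun s : R => s * y ord0 i) = fun s : R => (s *: y) ord0 i by apply/funext => z; rewrite mxE.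
  by congr (is_derive _ _ _ _); ring.
have near : exists2 d, 0 < d & forall s' z, `|s' - s ^+ 2 * (-1)| < d -> `|z - s *: y| < d ->
   is_derive s' 1 (jv U ^~ z) (jt U s' z) /\ forall i, pd (evec R i) (jv U s') z (jd U i s' z).
  exists (s ^+ 2) => // s' z hs' _; have s'0 : s' < 0 by move: hs'; rewrite ltr_norml => /andP[_ ?]; lra.
  by have [C2 _ _ _] := hU s' z s'0; split; [exact: c_t|move=> i; exact: c_d].
have := @chain R n (jv U) (jt U) (jd U) (fun s => s ^+ 2 * (-1)) (fun s => s *: y) s _ y near (c_t0 C1) (c_d0 C1) da db.
move=> h; have := dM (sq_pow_derive s0) h.
have -> : (fun s => jv (rsc s U) (-1) y) = fun s => (s ^+ 2) `^ al * jv U (s ^+ 2 * -1) (s *: y).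
  by apply/funext => z; have [-> _ _ _] := rscE al z U (-1) y.
congr (is_derive _ _ _ _); rewrite /Sg; have [-> -> E _] := rscE al s U (-1) y.
have -> : \sum_i y ord0 i * jd (rsc s U) i (-1) y = (s ^+ 2) `^ al * s * \sum_i y ord0 i * jd U i (s ^+ 2 * -1) (s *: y).
  by rewrite mulr_sumr; apply: eq_bigr => i _; rewrite E; ring.
set S := \sum_i _; set c := _ `^ al; set u := jv U _ _; set ut := jt U _ _.
by field; rewrite gt_eqF.
Qed.

Lemma jc_rsc (f : R -> V -> R) (e : R -> R) s y : ctsat e s -> jc f (s ^+ 2 * (-1)) (s *: y) ->
  jc (fun s y => e s * f (s ^+ 2 * (-1)) (s *: y)) s y.
Proof.
move=> he hf; apply: jcM; first by apply: (@jc_comp R n e (fun s _ => s)) => //; exact: jc_time.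
have E (z : R) : 0 - z ^+ 2 = z ^+ 2 * (-1) by ring.
have := @jc_param R n f 0 0 s y; rewrite E add0r => /(_ hf).
by apply: jc_ext; exists 1 => // s' y' _ _; rewrite E add0r.
Qed.

Lemma rsc_jc U y s : clA U -> 0 < s -> [/\ jc (fun s y => jv (rsc s U) (-1) y) s y, jc (fun s y => jt (rsc s U) (-1) y) s y,
  (forall i, jc (fun s y => jd (rsc s U) i (-1) y) s y) & forall i j, jc (fun s y => jdd (rsc s U) i j (-1) y) s y].
Proof.
move=> hU s0; have [C1 _ _ _] := hU _ (s *: y) (neg_sq s0).
have c1 := der_cts (sq_pow_derive s0); have c2 := der_cts (dM (sq_pow_derive s0) (did s)).
have c3 := der_cts (dM (sq_pow_derive s0) (dM (did s) (did s))).
have ext (f g : R -> V -> R) : (forall s y, f s y = g s y) -> jc f s y -> jc g s y.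
  by move=> h; apply: jc_ext; exists 1 => // s' y' _ _; exact: h.
split=> [||i|i j].
- by apply: ext (jc_rsc c1 (c_v0 C1)) => s' y'; have [-> _ _ _] := rscE al s' U (-1) y'.
- by apply: ext (jc_rsc c3 (c_t0 C1)) => s' y'; have [_ -> _ _] := rscE al s' U (-1) y'; rewrite expr2.
- by apply: ext (jc_rsc c2 (c_d0 C1 i)) => s' y'; have [_ _ -> _] := rscE al s' U (-1) y'.
- by apply: ext (jc_rsc c3 (c_dd0 C1 i j)) => s' y'; have [_ _ _ ->] := rscE al s' U (-1) y'; rewrite expr2.
Qed.

Lemma jc_Lw U y s : clA U -> 0 < s -> jc (fun s y => Lw (rsc s U) y) s y.
Proof.
move=> hU s0; have [_ _ j3 j4] := rsc_jc y hU s0; apply: jcD; first by apply: jc_sum => i; exact: j4.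
apply: jcN; apply: jcZ; apply: jc_sum => i; apply: jcM; [exact: jc_coord|exact: j3].
Qed.

Lemma jc_Sg U y s : clA U -> 0 < s -> jc (fun s y => Sg (rsc s U) y) s y.
Proof.
move=> hU s0; have [j1 j2 j3 _] := rsc_jc y hU s0; apply: jcD.
  by apply: jcD; [exact: jcZ|apply: jcN; exact: jcZ].
by apply: jc_sum => i; apply: jcM; [exact: jc_coord|exact: j3].
Qed.

Lemma dPot r : 0 < r -> is_derive r 1 Pot (al * r - r `^ p).
Proof.
move=> r0; have pp : p + 1 != 0 by rewrite gt_eqF //; have := p1; lra.
have := dB (dZ (al / 2) (dM (did r) (did r))) (dZ (p + 1)^-1 (dpow (p + 1) r0)).
have -> : (fun s => al / 2 * (s * s) - (p + 1)^-1 * s `^ (p + 1)) = Pot by apply/funext => s; rewrite /Pot (mulrC _ (p + 1)^-1).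
by rewrite addrK; congr (is_derive _ _ _ _); field.
Qed.

Lemma Pot_bnd K r : 0 <= r <= K -> `|Pot r| <= al / 2 * K ^+ 2 + K `^ (p + 1) / (p + 1).
Proof.
move=> /andP[r0 rK]; have pp : 0 < p + 1 by have := p1; lra.
have a0 := al_gt0 p1 hal; have a2 : 0 <= al / 2 by rewrite divr_ge0 // ltW.
apply: le_normB.
rewrite !ger0_norm; [|by rewrite divr_ge0 ?powR_ge0 // ltW|by rewrite mulr_ge0 // mulr_ge0].
apply: lerD; first by rewrite ler_wpM2l // expr2 ler_pM.
by rewrite ler_wpM2r ?invr_ge0 ?(ltW pp) //; apply: powR_le => //; exact: ltW.
Qed.

Lemma A_unif : exists2 K : R, 0 < K & forall U, clA U -> forall y, [/\ 0 <= jv U (-1) y <= K, `|jt U (-1) y| <= K,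
   (forall i, `|jd U i (-1) y| <= K) & forall i j, `|jdd U i j (-1) y| <= K].
Proof.
have [K K0 hK] := @A_bounds R n p al p1 hal M 1 M0 ltr01.
exists (K + 1) => [|U hU y]; first by lra.
have [h1 h2 h3 h4] := hK U hU (-1) y (lexx _).
have [_ _ u0 _] := hU (-1) y neg1; rewrite (ger0_norm u0) in h1.
split; [by rewrite u0; lra|lra|by move=> i; have := h3 i; lra|by move=> i j; have := h4 i j; lra].
Qed.

Lemma sum_yb (f : 'I_n -> R) (K : R) y : 0 <= K -> (forall i, `|f i| <= K) -> `|\sum_i y ord0 i * f i| <= n%:R * K * (1 + `|y|).
Proof.
move=> K0 h; apply: le_norm_sum.
rewrite -mulrA [leRHS]mulr_natl -[X in _ *+ X](card_ord n) -sumr_const; apply: ler_sum => i _.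
rewrite normrM mulrC; apply: ler_pM => //; have := normVE y i; lra.
Qed.

Lemma sum_bb (f : 'I_n -> R) (K : R) : 0 <= K -> (forall i, `|f i| <= K) -> `|\sum_i f i| <= n%:R * K.
Proof.
move=> K0 h; apply: le_norm_sum.
by rewrite [leRHS]mulr_natl -[X in _ *+ X](card_ord n) -sumr_const; apply: ler_sum.
Qed.

Lemma Lw_Sg_bnd : exists2 C : R, 0 <= C & forall U, clA U -> pgr 1 C (Lw U) /\ pgr 1 C (Sg U).
Proof.
have [K K0 hK] := A_unif; have a0 := al_gt0 p1 hal; have nn : 0 <= n%:R :> R by [].
have nK : 0 <= n%:R * K by rewrite mulr_ge0 // ltW.
have aK : 0 <= al * K by rewrite mulr_ge0 // ltW.
exists (2 * (n%:R * K) + 2 * (al * K) + 2 * K) => [|U hU]; first by lra.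
split=> y; have [/andP[h0 h1] h2 h3 h4] := hK U hU y; have y0 := normr_ge0 y; rewrite expr1.
all: have s1 := sum_yb y (ltW K0) h3.
all: have z1 := mulr_ge0 nK y0; have z2 := mulr_ge0 aK y0; have z3 := mulr_ge0 (ltW K0) y0.
  have s2 := sum_bb (ltW K0) (fun i => h4 i i).
  rewrite /Lw; apply: le_normB; rewrite normrM ger0_norm ?invr_ge0 //.
  have s3 : 2^-1 * `|\sum_i y ord0 i * jd U i (-1) y| <= 2^-1 * (n%:R * K * (1 + `|y|)) by rewrite ler_wpM2l ?invr_ge0.
  apply: le_trans (lerD s2 s3) _; lra.
rewrite /Sg; apply: le_normD; apply: le_trans (lerD (ler_normB _ _) (lexx _)) _.
have -> : `|2 * al * jv U (-1) y| = 2 * (al * jv U (-1) y) by rewrite ger0_norm ?mulrA // !mulr_ge0 // ltW.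
rewrite normrM (@ger0_norm _ 2) //.
have : al * jv U (-1) y <= al * K by rewrite ler_wpM2l // ltW.
lra.
Qed.

Lemma A_PG U : clA U -> [/\ PG (jv U (-1)), (forall i, PG (jd U i (-1))), (forall i j, PG (jdd U i j (-1))), PG (Lw U) & PG (Sg U)].
Proof.
move=> hU; have [K K0 hK] := A_unif; have [C C0 hC] := Lw_Sg_bnd; have [L1 L2] := hC U hU.
split; [| | |by exists 1%N, C|by exists 1%N, C].
- by apply: (@PG_bnd _ _ K) => y; have [/andP[h0 h1] _ _ _] := hK U hU y; rewrite ger0_norm.
- by move=> i; apply: (@PG_bnd _ _ K) => y; have [_ _ h _] := hK U hU y.
- by move=> i j; apply: (@PG_bnd _ _ K) => y; have [_ _ _ h] := hK U hU y.
Qed.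

Definition Gr U := gmean (fun y => 2^-1 * \sum_i jd U i (-1) y * jd U i (-1) y).
Definition Po U := gmean (fun y => Pot (jv U (-1) y)).

Lemma PG_Pot U : clA U -> PG (fun y => Pot (jv U (-1) y)).
Proof.
move=> hU; have [K K0 hK] := A_unif; apply: (@PG_bnd _ _ (al / 2 * K ^+ 2 + K `^ (p + 1) / (p + 1))) => y.
by apply: Pot_bnd; have [] := hK U hU y.
Qed.

Lemma PG_grad U : clA U -> PG (fun y => 2^-1 * \sum_i jd U i (-1) y * jd U i (-1) y).
Proof. by move=> hU; have [_ h _ _ _] := A_PG hU; apply: PG_Z; apply: PG_sum => i; exact: PGM. Qed.

Lemma EnE U : clA U -> En U = Gr U + Po U.
Proof. by move=> hU; rewrite /En gmeanD //; [exact: PG_grad|exact: PG_Pot]. Qed.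

(** |grad W|^2 - |grad U|^2 is the product of the gradients of W - U and W + U; Green's identity
    takes the derivatives off the difference, which is the form treated by [gmean_qderiv]. *)
Lemma Gr_diff U W : clA U -> clA W -> Gr W - Gr U =
  - 2^-1 * gmean (fun y => (jv W (-1) y - jv U (-1) y) * (Lw W y + Lw U y)).
Proof.
move=> hU hW; have [u1 u2 u3 _ _] := A_PG hU; have [w1 w2 w3 _ _] := A_PG hW.
have cU y := A_cts hU y neg1; have cW y := A_cts hW y neg1.
have := @green R n (fun y => jv W (-1) y - jv U (-1) y) (fun i y => jd W i (-1) y - jd U i (-1) y)
  (fun i y => jd W i (-1) y + jd U i (-1) y) (fun i y => jdd W i i (-1) y + jdd U i i (-1) y).
have ctsB f g y : cts f y -> cts g y -> cts (fun z => f z - g z) y.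
  move=> c1 c2; have := ctsD c1 (ctsM (ctsC (-1) y) c2); congr (cts _ _).
  by apply/funext => z; rewrite mulN1r.
move=> /(_ (PG_B w1 u1) (fun i => PG_B (w2 i) (u2 i)) (fun i => PGD (w2 i) (u2 i)) (fun i => PGD (w3 i i) (u3 i i))).
have z1 y : cts (fun y => jv W (-1) y - jv U (-1) y) y by have [? _ _ _] := cU y; have [? _ _ _] := cW y; exact: ctsB.
have z2 i y : cts (fun y => jd W i (-1) y - jd U i (-1) y) y by have [_ _ ? _] := cU y; have [_ _ ? _] := cW y; exact: ctsB.
have z3 i y : cts (fun y => jd W i (-1) y + jd U i (-1) y) y by have [_ _ ? _] := cU y; have [_ _ ? _] := cW y; exact: ctsD.
have z4 i y : cts (fun y => jdd W i i (-1) y + jdd U i i (-1) y) y by have [_ _ _ ?] := cU y; have [_ _ _ ?] := cW y; exact: ctsD.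
move=> /(_ z1 z2 z3 z4) => H.
have E : gmean (fun y => \sum_i (jd W i (-1) y - jd U i (-1) y) * (jd W i (-1) y + jd U i (-1) y)) = 2 * (Gr W - Gr U).
  have gU := PG_grad hU; have gW := PG_grad hW.
  rewrite /Gr -gmeanB // -gmeanZ; last exact: PG_B.
  apply: gmeanE => y; rewrite -mulrBr -sumrB mulrA mulfV // mul1r; apply: eq_bigr => i _; ring.
rewrite E in H; apply: (mulfI (_ : 2 != 0)) => //; rewrite H; first last.
- by move=> i y; have [C1 _ _ _] := hU (-1) y neg1; have [C2 _ _ _] := hW (-1) y neg1; exact: pdD (c_dd C2 i i) (c_dd C1 i i).
- by move=> i y; have [C1 _ _ _] := hU (-1) y neg1; have [C2 _ _ _] := hW (-1) y neg1; have := dB (c_d C2 i) (c_d C1 i).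
rewrite (_ : 2 * (- 2^-1 * _) = - gmean (fun y => (jv W (-1) y - jv U (-1) y) * (Lw W y + Lw U y))); last by field.
congr (- _); apply: gmeanE => y; congr (_ * _); rewrite /Lw big_split /=.
have -> : \sum_i y ord0 i * (jd W i (-1) y + jd U i (-1) y) = \sum_i y ord0 i * jd W i (-1) y + \sum_i y ord0 i * jd U i (-1) y.
  by rewrite -big_split; apply: eq_bigr => i _; rewrite mulrDr.
ring.
Qed.

(** The derivatives of the gradient part and of the potential part combine through [Sg_eq] into a
    square. The sign means that the energy grows with l, that is, towards the past. *)
Lemma En_deriv U : clA U -> posA U -> is_derive (1 : R) 1 (fun s => En (rsc s U)) (2^-1 * gmean (fun y => Sg U y * Sg U y)).
Proof.
move=> hU Up; have [C C0 hC] := Lw_Sg_bnd; have [K K0 hK] := A_unif.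
have pos s : `|s - 1| < 1 / 2 -> 0 < s by rewrite ltr_norml => /andP[? _]; lra.
have inv2 s : `|s - 1| < 1 / 2 -> `|s^-1| <= 2.
  move=> hs; have s0 := pos s hs; rewrite gtr0_norm ?invr_gt0 // -[leRHS]invrK lef_pV2 ?posrE ?invr_gt0 //.
  by move: hs; rewrite ltr_norml => /andP[? _]; lra.
have h12 : 0 < 1 / 2 :> R by lra.
have hR s : `|s - 1| < 1 / 2 -> clA (rsc s U) by move=> hs; apply: A_rsc => //; exact: pos.
have [P1 P2 P3 P4 P5] := A_PG hU.
have dPo : is_derive (1 : R) 1 (fun s => Po (rsc s U)) (gmean (fun y => (al * jv U (-1) y - jv U (-1) y `^ p) * Sg U y)).
  pose Kp := al * K + K `^ p.
  have := @gmean_deriv R n (fun s y => Pot (jv (rsc s U) (-1) y))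
    (fun s y => (al * jv (rsc s U) (-1) y - jv (rsc s U) (-1) y `^ p) * (s^-1 * Sg (rsc s U) y)) 1 (1 / 2) 1 (Kp * (2 * C)) h12.
  rewrite (_ : gmean _ = gmean (fun y => (al * jv U (-1) y - jv U (-1) y `^ p) * Sg U y)); last first.
    by apply: gmeanE => y; rewrite rsc1 invr1 mul1r.
  apply.
  - move=> s y hs; have s0 := pos s hs.
    by apply: dcomp (rsc_deriv y hU s0); apply: dPot; apply: pos_rsc Up _ _ neg1.
  - move=> y; have [j1 _ _ _] := rsc_jc y hU (@ltr01 R); apply: jcM.
      apply: jcD; [exact: jcZ|apply: jcN; apply: (@jc_comp R n (fun r => r `^ p)) => //].
      by apply: powR_cts; rewrite rsc1; exact: Up neg1.
    apply: jcM; last exact: jc_Sg.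
    by apply: (@jc_comp R n (fun r => r^-1) (fun s _ => s)); [apply: der_cts (dinv _); exact: oner_neq0|exact: jc_time].
  - move=> s hs y; have [_ hS] := hC _ (hR s hs); rewrite normrM -[leRHS]mulrA; apply: ler_pM => //.
      have [/andP[k1 k2] _ _ _] := hK _ (hR s hs) y; have a0 := al_gt0 p1 hal.
      have k3 : 0 <= al * jv (rsc s U) (-1) y by apply: mulr_ge0 => //; exact: ltW.
      apply: le_normB; rewrite (ger0_norm k3) ger0_norm ?powR_ge0 // /Kp.
      by apply: lerD; [rewrite ler_wpM2l // ltW|apply: powR_le => //; exact: ltW (p_gt0 p1)].
    by rewrite normrM -mulrA; apply: ler_pM => //; exact: inv2.
  - by move=> s hs; apply: PG_Pot; exact: hR.
have dGr : is_derive (1 : R) 1 (fun s => Gr (rsc s U)) (- 2^-1 * gmean (fun y => Sg U y * (2 * Lw U y))).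
  have Q := @gmean_qderiv R n (fun s y => jv (rsc s U) (-1) y) (fun s y => s^-1 * Sg (rsc s U) y)
    (fun s y => Lw (rsc s U) y + Lw U y) 1 (1 / 2) 1 (2 * C) h12.
  have Q1 : is_derive (1 : R) 1 (fun s => gmean (fun y => (jv (rsc s U) (-1) y - jv (rsc 1 U) (-1) y) * (Lw (rsc s U) y + Lw U y)))
     (gmean (fun y => 1^-1 * Sg (rsc 1 U) y * (Lw (rsc 1 U) y + Lw U y))).
    apply: Q.
    - by move=> s y hs; exact: (rsc_deriv y hU (pos s hs)).
    - move=> y; apply: jcM; last exact: jc_Sg.
      by apply: (@jc_comp R n (fun r => r^-1) (fun s _ => s)); [apply: der_cts (dinv _); exact: oner_neq0|exact: jc_time].
    - move=> y; apply: jcD; first exact: jc_Lw.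
      have := @jc_cts R n _ 1 y (jc_Lw y hU (@ltr01 R)); rewrite rsc1; exact: cts_jc.
    - move=> s hs y; have [_ hS] := hC _ (hR s hs).
      by rewrite normrM -mulrA; apply: ler_pM => //; exact: inv2.
    - move=> s hs y; have [hL _] := hC _ (hR s hs); have [hL' _] := hC _ hU.
      by apply: le_normD; have := hL y; have := hL' y; lra.
  have := dD (dcst (Gr U) 1) (dZ (- 2^-1) Q1); rewrite rsc1 add0r.
  rewrite (_ : gmean (fun y => 1^-1 * _ * _) = gmean (fun y => Sg U y * (2 * Lw U y))); last first.
    by apply: gmeanE => y; rewrite invr1; ring.
  apply: der_ext; exists (1 / 2); [by []|move=> h hh].
  have hs : `|1 + h - 1| < 1 / 2 by rewrite addrCK.
  by rewrite -(Gr_diff hU (hR _ hs)) addrBC.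
have := dD dGr dPo.
have E : - 2^-1 * gmean (fun y => Sg U y * (2 * Lw U y)) + gmean (fun y => (al * jv U (-1) y - jv U (-1) y `^ p) * Sg U y) =
  2^-1 * gmean (fun y => Sg U y * Sg U y).
  have Pv : PG (fun y => jv U (-1) y `^ p).
    apply: (@PG_bnd _ _ (K `^ p)) => y; rewrite ger0_norm ?powR_ge0 //.
    by have [/andP[k1 k2] _ _ _] := hK _ hU y; apply: powR_le => //; exact: ltW (p_gt0 p1).
  have Q1 : PG (fun y => Sg U y * (2 * Lw U y)) by apply: PGM => //; exact: PG_Z.
  have Q2 : PG (fun y => (al * jv U (-1) y - jv U (-1) y `^ p) * Sg U y) by apply: PGM => //; apply: PG_B => //; exact: PG_Z.
  have Q3 : PG (fun y => - 2^-1 * (Sg U y * (2 * Lw U y))) by exact: PG_Z.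
  rewrite -!gmeanZ //; last exact: PGM.
  rewrite -gmeanD //; apply: gmeanE => y.
  by rewrite [in RHS](Sg_eq y hU) [in LHS](Sg_eq y hU); field.
rewrite E; apply: der_ext; exists (1 / 2); [by []|move=> h hh].
have hs : `|1 + h - 1| < 1 / 2 by rewrite addrCK.
by rewrite -(EnE (hR _ hs)).
Qed.

End Energy.

(** * Pohozaev's identity and stationary profiles *)

Section Pohozaev.
Context {R : realType} {n : nat}.
Local Notation V := 'rV[R]_n.
Variables (p al M : R).
Hypotheses (p1 : 1 < p) (hal : al * (p - 1) = 1) (M0 : 0 <= M) (psub : n%:R * (p - 1) < 2 * (p + 1)).
Implicit Types (y a : V) (r h : R) (U : @jf R n).
Local Notation clA := (@clA R n p al M).
Local Notation rsc := (@rsc R n al).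
Local Notation N1 := (neg1 (R := R)).

Lemma PG_nsq : PG (fun y : V => nsq y).
Proof. by apply: PG_sum => i; apply: PGM; exact: PG_coord. Qed.

Lemma cts_nsq0 y : cts (fun y : V => nsq y) y.
Proof. by apply: cts_sum => i; apply: ctsM; exact: cts_co. Qed.

Lemma pd_nsq0 i y : pd (evec R i) (fun y : V => nsq y) y (2 * y ord0 i).
Proof.
have := pd_nsq (0 : V) i y; rewrite subr0.
by have -> : (fun y => nsq (y - 0)) = (fun y : V => nsq y) by apply/funext => z; rewrite subr0.
Qed.

(* The three test functions [w], [|y|^2 w] and [y . grad w] give linear relations between the moments;
   the potential terms cancel and leave a positive combination of two gradient integrals. *)
Lemma pohozaev U : clA U -> posA U -> (forall y, Sg al U y = 0) -> forall i y, jd U i (-1) y = 0.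
Proof.
move=> hU Up hS.
have [Pw P1 P2 PL _] := A_PG p1 hal M0 hU.
have hc y := A_cts hU y N1.
pose w := jv U (-1); pose wi i := jd U i (-1); pose wij i j := jdd U i j (-1).
have cw y : cts w y by have [] := hc y.
have cwi i y : cts (wi i) y by have [_ _ h _] := hc y; exact: h.
have cwij i j y : cts (wij i j) y by have [_ _ _ h] := hc y; exact: h.
have dw i y : pd (evec R i) w y (wi i y) by have [C1 _ _ _] := hU (-1) y N1; exact: c_d.
have dwi i j y : pd (evec R j) (wi i) y (wij i j y) by have [C1 _ _ _] := hU (-1) y N1; exact: c_dd.
have sym i j y : wij i j y = wij j i y by have [] := A_dxd hU Up i j y N1.
have w0 y : 0 < w y by exact: Up N1.
pose wp y := w y `^ p.
have LE y : \sum_i wij i i y - 2^-1 * (\sum_i y ord0 i * wi i y) = al * w y - wp y.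
  by have := Sg_eq y hU; rewrite hS /Lw => h; rewrite /wp /w /wij /wi; lra.
have cwp y : cts wp y by apply: (@cts_comp R n (fun r => r `^ p)) => //; exact: powR_cts.
have Pw' : PG w by exact: Pw.
have Pwp : PG wp.
  have [K K0 hK] := @A_unif R n p al M p1 hal M0; apply: (@PG_bnd _ _ (K `^ p)) => y; rewrite ger0_norm ?powR_ge0 //.
  by have [/andP[k1 k2] _ _ _] := hK _ hU y; apply: powR_le => //; exact: ltW (p_gt0 p1).
have Pwi i : PG (wi i) by exact: P1.
have Pwij i j : PG (wij i j) by exact: P2.
suff : forall i y, wi i y = 0 by [].
clear Pw P1 P2 PL hc hS; clearbody w wi wij.
have Pn := PG_nsq; have Pc i : PG (fun y : V => y ord0 i) by exact: PG_coord.
pose gr y := \sum_i wi i y * wi i y.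
have Pgr : PG gr by apply: PG_sum => i; exact: PGM.
have cgr y : cts gr y by apply: cts_sum => i; exact: ctsM.
have Pww : PG (fun y => w y * w y) by exact: PGM.
have Pwwp : PG (fun y => w y * wp y) by exact: PGM.
pose a := gmean gr; pose b := gmean (fun y => nsq y * gr y).
pose A0 := gmean (fun y => w y * w y); pose C0 := gmean (fun y => w y * wp y).
pose A2 := gmean (fun y => nsq y * (w y * w y)); pose C2 := gmean (fun y => nsq y * (w y * wp y)).
(* Weak form of the profile equation with test function f. *)
have GL f (fi : 'I_n -> V -> R) : PG f -> (forall i, PG (fi i)) -> (forall y, cts f y) -> (forall i y, cts (fi i) y) ->
    (forall i y, pd (evec R i) f y (fi i y)) -> gmean (fun y => \sum_i fi i y * wi i y) = - gmean (fun y => f y * (al * w y - wp y)).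
  move=> h1 h2 h3 h4 h5; rewrite (@green R n f fi wi (fun i => wij i i)) //.
  by congr (- _); apply: gmeanE => y; rewrite LE.
have E1 : a = - (al * A0 - C0).
  rewrite /a /gr (GL w wi) // (@gmeanE _ _ _ (fun y => al * (w y * w y) - w y * wp y)); last by move=> y; ring.
  by rewrite gmeanB ?gmeanZ //; exact: PG_Z.
have E2 : b + (2^-1 * A2 - n%:R * A0) = - (al * A2 - C2).
  pose f y := nsq y * w y; pose fi i y := nsq y * wi i y + w y * (2 * y ord0 i).
  have H := GL f fi.
  have h1 : PG f by exact: PGM.
  have h2 i : PG (fi i) by apply: PGD; apply: PGM => //; exact: PG_Z.
  have h3 y : cts f y by apply: ctsM => //; exact: cts_nsq0.
  have h4 i y : cts (fi i) y.
    by apply: ctsD; apply: ctsM => //; [exact: cts_nsq0|apply: ctsM; [exact: ctsC|exact: cts_co]].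
  have h5 i y : pd (evec R i) f y (fi i y) by exact: pdM (pd_nsq0 i y) (dw i y).
  have {H} := H h1 h2 h3 h4 h5.
  rewrite [X in _ = - X](@gmeanE _ _ _ (fun y => al * (nsq y * (w y * w y)) - nsq y * (w y * wp y))); last by move=> y; rewrite /f; ring.
  have Q1 : PG (fun y => nsq y * (w y * w y)) by exact: PGM.
  have Q2 : PG (fun y => nsq y * (w y * wp y)) by exact: PGM.
  rewrite gmeanB ?gmeanZ //; last exact: PG_Z.
  move=> <-; rewrite (@gmeanE _ _ (fun y => \sum_i fi i y * wi i y) (fun y => nsq y * gr y + \sum_i y ord0 i * (w y * wi i y + w y * wi i y))); last first.
    move=> y; rewrite /gr mulr_sumr -big_split; apply: eq_bigr => i _; rewrite /fi /=; ring.
  have Q3 i : PG (fun y => w y * wi i y + w y * wi i y) by apply: PGD; exact: PGM.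
  have Q4 : PG (fun y => \sum_i y ord0 i * (w y * wi i y + w y * wi i y)) by apply: PG_sum => i; exact: PGM.
  rewrite gmeanD //; last exact: PGM.
  congr (_ + _); rewrite -(@stein_radial R n (fun y => w y * w y) (fun i y => w y * wi i y + w y * wi i y)) //.
  - by move=> y; exact: ctsM.
  - by move=> i y; apply: ctsD; exact: ctsM.
  - by move=> i y; exact: pdM (dw i y) (dw i y).
have E3 : a + 2^-1 * (2^-1 * b - n%:R * a) = - (2^-1 * (al / 2 * A2 - (p + 1)^-1 * C2) - n%:R * (al / 2 * A0 - (p + 1)^-1 * C0)).
  pose f y := \sum_j y ord0 j * wi j y; pose fi i y := \sum_j (y ord0 j * wij j i y + wi j y * (i == j)%:R).
  have H := GL f fi.
  have h1 : PG f by apply: PG_sum => j; exact: PGM.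
  have h2 i : PG (fi i).
    by apply: PG_sum => j; apply: PGD; apply: PGM => //; exact: PGC.
  have h3 y : cts f y by apply: cts_sum => j; apply: ctsM => //; exact: cts_co.
  have h4 i y : cts (fi i) y.
    by apply: cts_sum => j; apply: ctsD; apply: ctsM => //; [exact: cts_co|exact: ctsC].
  have h5 i y : pd (evec R i) f y (fi i y) by apply: pdsum => j; exact: pdM (pd_co j i y) (dwi j i y).
  have {H} := H h1 h2 h3 h4 h5.
  rewrite (@gmeanE _ _ (fun y => \sum_i fi i y * wi i y)
    (fun y => gr y + 2^-1 * \sum_j y ord0 j * \sum_i (wi i y * wij i j y + wi i y * wij i j y))); last first.
    move=> y; rewrite /gr (eq_bigr (fun i => wi i y * wi i y + \sum_j y ord0 j * (wij i j y * wi i y))).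
      rewrite big_split /= exchange_big /=; congr (_ + _); rewrite mulr_sumr; apply: eq_bigr => j _.
      by rewrite !mulr_sumr; apply: eq_bigr => i _; field.
    move=> i _; rewrite /fi big_split /= mulrDl addrC; congr (_ + _).
      by rewrite (bigD1 i) //= eqxx mulr1 big1 ?addr0 // => j /negbTE; rewrite eq_sym => ->; rewrite mulr0.
    by rewrite mulr_suml; apply: eq_bigr => j _; rewrite (sym j i); ring.
  have Q1 j : PG (fun y => \sum_i (wi i y * wij i j y + wi i y * wij i j y)).
    by apply: PG_sum => i; apply: PGD; exact: PGM.
  have Q2 : PG (fun y => \sum_j y ord0 j * \sum_i (wi i y * wij i j y + wi i y * wij i j y)) by apply: PG_sum => j; exact: PGM.
  rewrite gmeanD ?gmeanZ //; last exact: PG_Z.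
  rewrite (@stein_radial R n gr (fun j y => \sum_i (wi i y * wij i j y + wi i y * wij i j y))) //; first last.
  - by move=> j y; apply: pdsum => i; exact: pdM (dwi i j y) (dwi i j y).
  - by move=> j y; apply: cts_sum => i; apply: ctsD; exact: ctsM.
  rewrite -/a -/b => ->; congr (- _).
  pose Ph y := al / 2 * (w y * w y) - (p + 1)^-1 * (w y * wp y).
  have PhE y : Ph y = Pot p al (w y).
    have pp : 0 <= w y by exact: ltW.
    by rewrite /Ph /Pot /wp (powRDp (w0 y)) powRr1 //; ring.
  rewrite (@gmeanE _ _ _ (fun y => \sum_i y ord0 i * ((al * w y - wp y) * wi i y))); last first.
    by move=> y; rewrite /f mulr_suml; apply: eq_bigr => i _; ring.
  have Q3 : PG (fun y => al / 2 * (w y * w y)) by exact: PG_Z.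
  have Q4 : PG (fun y => (p + 1)^-1 * (w y * wp y)) by exact: PG_Z.
  have PPh : PG Ph by exact: PG_B.
  rewrite (@stein_radial R n Ph (fun i y => (al * w y - wp y) * wi i y)); try exact: PPh.
  - rewrite (@gmeanE _ _ (fun y => nsq y * Ph y) (fun y => al / 2 * (nsq y * (w y * w y)) - (p + 1)^-1 * (nsq y * (w y * wp y)))); last by move=> y; rewrite /Ph; ring.
    have Q5 : PG (fun y => nsq y * (w y * w y)) by exact: PGM.
    have Q6 : PG (fun y => nsq y * (w y * wp y)) by exact: PGM.
    by rewrite /Ph !gmeanB ?gmeanZ //; exact: PG_Z.
  - by move=> i; apply: PGM => //; apply: PG_B => //; exact: PG_Z.
  - move=> y; apply: (@cts_pd R n Ph (fun i y => (al * w y - wp y) * wi i y)).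
      move=> i z; have := pdcomp (@dPot R p al p1 _ (w0 z)) (dw i z).
      by have -> : (fun y => Pot p al (w y)) = Ph by apply/funext => y'; rewrite PhE.
    move=> i; apply: ctsM => //; apply: ctsD; first by apply: ctsM => //; exact: ctsC.
    by have := ctsM (ctsC (-1) y) (cwp y); congr (cts _ _); apply/funext => z; rewrite mulN1r.
  - move=> i y; apply: ctsM => //; apply: ctsD; first by apply: ctsM => //; exact: ctsC.
    by have := ctsM (ctsC (-1) y) (cwp y); congr (cts _ _); apply/funext => z; rewrite mulN1r.
  - move=> i y; have := pdcomp (@dPot R p al p1 _ (w0 y)) (dw i y).
    by have -> : (fun y => Pot p al (w y)) = Ph by apply/funext => y'; rewrite PhE.
have gr0 y : 0 <= gr y by apply: sumr_ge0 => i _; rewrite -expr2 sqr_ge0.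
have a0 : 0 <= a by exact: gmean_ge0.
have b0 : 0 <= b by apply: gmean_ge0 => [|y]; [exact: PGM|rewrite mulr_ge0 // nsq_ge0].
have pp : 0 < p + 1 by have := p1; lra.
(* This is (p + 1) times the third relation, with [C0] and [C2] eliminated by the first two; [A0]
   and [A2] then drop out. Subcriticality makes the coefficient of a positive. *)
have key : a * (p + 1 - n%:R * (p - 1) / 2) + b * ((p - 1) / 4) = 0.
  have ap : al * (p + 1) = 1 + 2 * al by have := hal; lra.
  have E3' : (p + 1) * (a + 2^-1 * (2^-1 * b - n%:R * a)) =
      - (2^-1 * (al * (p + 1) / 2 * A2 - C2) - n%:R * (al * (p + 1) / 2 * A0 - C0)).
    by rewrite E3; field; rewrite gt_eqF.
  rewrite ap in E3'.
  have C2E : C2 = b + (2^-1 * A2 - n%:R * A0) + al * A2 by rewrite E2; ring.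
  have C0E : C0 = a + al * A0 by rewrite E1; ring.
  by rewrite C2E C0E in E3'; lra.
have az : a = 0.
  have c1 : 0 < p + 1 - n%:R * (p - 1) / 2 by have := psub; lra.
  have c2 : 0 <= b * ((p - 1) / 4) by rewrite mulr_ge0 // divr_ge0 // subr_ge0 ltW.
  apply/eqP; rewrite eq_le a0 andbT -(pmulr_lle0 _ c1); lra.
move=> i y; have := gmean_faithful Pgr cgr gr0 az y.
rewrite /gr => /eqP; rewrite psumr_eq0 => [/allP/(_ i (mem_index_enum i))|j _]; last by rewrite -expr2 sqr_ge0.
by rewrite mulf_eq0 orbb => /eqP.
Qed.

(** The positive constant solution of the profile equation: kap^(p - 1) = al. *)
Definition kap := al `^ al.
Lemma kap_gt0 : 0 < kap. Proof. by rewrite powR_gt0 // (al_gt0 p1 hal). Qed.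

(** This sign separates the two possible stationary limits, 0 and the constant [kap], by their
    energies. *)
Lemma PotK : 0 < Pot p al kap.
Proof.
have k0 := kap_gt0; have a0 := al_gt0 p1 hal.
have kp : kap `^ p = al * kap.
  by rewrite (powR_split (ltW k0) p1) /kap -powRrM hal powRr1 // ltW.
have pp : 0 < p + 1 by have := p1; lra.
rewrite /Pot (powRDp k0) powRr1 ?(ltW k0) // kp.
have -> : al / 2 * (kap * kap) - al * kap * kap / (p + 1) = al * kap * kap * ((p - 1) / (2 * (p + 1))) by field; rewrite gt_eqF.
by rewrite !mulr_gt0 ?invr_gt0 ?mulr_gt0 // subr_gt0.
Qed.

Lemma stationary U : clA U -> posA U -> (forall y, Sg al U y = 0) ->
  (forall y, [/\ jv U (-1) y = kap, (forall i, jd U i (-1) y = 0) & forall i j, jdd U i j (-1) y = 0]) /\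
  En p al U = Pot p al kap.
Proof.
move=> hU Up hS; have d0 := pohozaev hU Up hS.
have dd0 i j y : jdd U i j (-1) y = 0.
  have [C1 _ _ _] := hU (-1) y N1; apply: (pd_uniq (c_dd C1 i j)).
  have -> : jd U i (-1) = fun=> 0 by apply/funext => z; exact: d0.
  exact: pdcst.
have uk y : jv U (-1) y = kap.
  have u0 := Up (-1) y N1; have := Sg_eq y hU; rewrite hS /Lw !big1 => [|i _|i _]; last first.
  - by rewrite dd0.
  - by rewrite d0 mulr0.
  rewrite mulr0 subrr sub0r => h; have {h} : jv U (-1) y `^ (p - 1) * jv U (-1) y = al * jv U (-1) y.
    by rewrite -(powR_split (ltW u0) p1); lra.
  move=> h; have {}h := mulIf (lt0r_neq0 u0) h.
  rewrite /kap (_ : al `^ al = (jv U (-1) y `^ (p - 1)) `^ al); last by rewrite h.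
  by rewrite -powRrM mulrC hal powRr1 // ltW.
split => //; rewrite /En (@gmeanE _ _ _ (fun=> Pot p al kap)) ?gmeanC // => y.
by rewrite uk big1 ?mulr0 ?add0r // => i _; rewrite d0 mulr0.
Qed.

End Pohozaev.

(** * Flatness of ancient solutions in the distant past *)

Section Flat.
Context {R : realType} {n : nat}.
Local Notation V := 'rV[R]_n.
Variables (p al M : R).
Hypotheses (p1 : 1 < p) (hal : al * (p - 1) = 1) (M0 : 0 <= M) (psub : n%:R * (p - 1) < 2 * (p + 1)).
Implicit Types (x y : V) (B C e d t s r h Y : R) (U W : @jf R n) (l : nat -> R).
Local Notation clA := (@clA R n p al M).
Local Notation rsc := (@rsc R n al).
Local Notation En := (@En R n p al).
Local Notation Sg := (@Sg R n al).
Local Notation kap := (kap al).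
Local Notation N1 := (neg1 (R := R)).

Lemma cc_unif (f : nat -> R -> V -> R) (F : V -> R) t Y : (forall y, cc f (F y) t y) ->
  forall e, 0 < e -> ev (fun k => forall y, `|y| <= Y -> `|f k t y - F y| <= e).
Proof.
move=> hc e e0; apply: contrapT => /ev_not hn.
have hk k : exists y : V, (~ (forall y, `|y| <= Y -> `|f k t y - F y| <= e) -> `|y| <= Y /\ e < `|f k t y - F y|).
  have [h|h] := pselect (forall y, `|y| <= Y -> `|f k t y - F y| <= e); first by exists 0.
  have [y hy] : exists y : V, ~ (`|y| <= Y -> `|f k t y - F y| <= e) by apply: contrapT => h'; apply: h => y hy; apply: contrapT => h2; apply: h'; exists y => /(_ hy).
  exists y => _; split; first by apply: contrapT => h2; apply: hy.
  by rewrite ltNge; apply/negP => h2; apply: hy.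
have [q hq] := choice hk.
have bq : ev (fun k => `|q k| <= Y) by apply: evS hn => k /hq [].
have [y0 hy0] := @ucvV_ex R n q Y bq.
have e2 : 0 < e / 2 by lra.
have [d d0 hd] := hc y0 _ e2; have [k [[k1 k2] k3]] := ev_ex (evI (evI (hy0 _ d0) hd) hn).
have [_ k4] := hq k k3; have tt' : `|t - t| < d by rewrite subrr normr0.
have hF : `|F (q k) - F y0| <= e / 2.
  apply: ucv_lel (ucv_norm (ucvB (cc_ucv (hc (q k))) (ucv_cst (F y0)))) _.
  by apply: evS hd => k' hk'; apply: ltW; exact: hk'.
have := k2 t (q k) tt' k1; have := ler_normB (f k t (q k) - F y0) (F (q k) - F y0).
rewrite (_ : f k t (q k) - F y0 - (F (q k) - F y0) = f k t (q k) - F (q k)); last by ring.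
lra.
Qed.

(** Dominated convergence: uniform convergence on balls by [cc_unif], the common growth bound
    outside. *)
Lemma gmean_ucv m C (f : nat -> R -> V -> R) (F : V -> R) t : (forall k, pgr m C (f k t)) -> (forall y, cc f (F y) t y) ->
  ucv (fun k => gmean (f k t)) (gmean F).
Proof.
move=> hp hc; have C0 := pgr_ge0 (hp 0%N).
have pF : pgr m C F.
  by move=> y; apply: ucv_lel (ucv_norm (cc_ucv (hc y))) _; apply: evE => k; exact: hp.
move=> e e0; have e2 : 0 < e / 3 by lra.
have C2 : 0 <= 2 * C * @momK R n m.+1 by rewrite mulr_ge0 ?momK_ge0 ?mulr_ge0.
have [Y Y0 hY] := small_div C2 e2.
apply: evS (cc_unif Y hc e2) => k hk.
have P1 : PG (f k t) by exists m, C.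
have P2 : PG F by exists m, C.
rewrite -gmeanB //.
have q1 : pgr m (2 * C) (fun y => f k t y - F y).
  by move=> y; apply: le_normB; have := hp k y; have := pF y; lra.
apply: le_lt_trans (gmean_tail q1 (ltW e2) Y0 hk) _.
by rewrite mulrAC; lra.
Qed.

Lemma apx_exact (w : nat -> @jf R n) (tau : nat -> R) : ev (fun k => 0 <= tau k) ->
  (forall k t x, t < tau k -> [/\ C12 (w k) t x, heat (w k) t x = jv (w k) t x `^ p, 0 <= jv (w k) t x &
    jv (w k) t x <= M * (tau k - t) `^ (- al)]) ->
  apx p al 1 1 M w (fun _ _ r => r `^ p) tau (fun k => k%:R).
Proof.
move=> ht hw; split => //.
- move=> B; apply: evS (ev_ge (Num.truncn B).+1) => k hk.
  by apply: lt_le_trans (truncnS_gt B) _; rewrite ler_nat.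
- by apply: evE => k t x /andP[_ t0] _; exact: hw.
- move=> B; exists (p * `|B| `^ (p - 1)); first by rewrite mulr_ge0 ?powR_ge0 // ltW // p_gt0.
  apply: evE => k x x' r r' _ _ /andP[r0 rB] /andP[r'0 r'B].
  apply: le_trans (pow_lip p1 (B := `|B|) _ _) _; rewrite ?r0 ?r'0 ?(le_trans rB) ?(le_trans r'B) ?ler_norm //.
  rewrite ler_wpM2l ?mulr_ge0 ?powR_ge0 ?(ltW (p_gt0 p1)) // lerDr powR_ge0 //.
- by move=> B e e0; apply: evE => k x r _ _; rewrite subrr normr0.
- by apply: evE => k x r _ r0; rewrite powR_ge0 mul1r lerDl ler01.
Qed.

Lemma one1 : 0 < (1 : R) <= 1. Proof. by rewrite ltr01 lexx. Qed.

Lemma A_lim (w : nat -> @jf R n) : (forall k, clA (w k)) -> clA (jlim w) /\ forall t x, t < 0 -> jcc w (jlim w) t x.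
Proof.
move=> hw; apply: (apx_lim p1 hal one1 M0 (@apx_exact w (fun=> 0) (evE (fun=> lexx 0)) _)) => k t x t0.
by rewrite sub0r; exact: hw.
Qed.

Lemma En_int_bnd : exists2 C : R, 0 <= C & forall U, clA U ->
  pgr 0 C (fun y => 2^-1 * (\sum_i jd U i (-1) y * jd U i (-1) y) + Pot p al (jv U (-1) y)).
Proof.
have [K K0 hK] := @A_unif R n p al M p1 hal M0; have a0 := al_gt0 p1 hal.
have b0 : 0 <= al / 2 * K ^+ 2 + K `^ (p + 1) / (p + 1).
  have pp : 0 < p + 1 by have := p1; lra.
  by rewrite addr_ge0 ?divr_ge0 ?powR_ge0 ?mulr_ge0 ?sqr_ge0 ?invr_ge0 // ltW.
have K2 : 0 <= n%:R * (K * K) by rewrite !mulr_ge0 // ltW.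
exists (n%:R * (K * K) + (al / 2 * K ^+ 2 + K `^ (p + 1) / (p + 1))) => [|U hU y]; first by rewrite addr_ge0.
rewrite expr0 mulr1; have [k1 _ k2 _] := hK U hU y.
apply: le_normD; apply: lerD; last exact: (@Pot_bnd R p al p1 hal).
rewrite normrM ger0_norm ?invr_ge0 //.
have : `|\sum_i jd U i (-1) y * jd U i (-1) y| <= n%:R * (K * K).
  by apply: sum_bb => [|i]; [rewrite mulr_ge0 // ltW|rewrite normrM; exact: ler_pM].
lra.
Qed.

Lemma En_ext U W : (forall y, jv U (-1) y = jv W (-1) y /\ forall i, jd U i (-1) y = jd W i (-1) y) -> En U = En W.
Proof.
move=> h; apply: gmeanE => y; have [-> h2] := h y; congr (_ * _ + _).
by apply: eq_bigr => i _; rewrite h2.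
Qed.

Lemma En_lim (w : nat -> @jf R n) : (forall k, clA (w k)) -> ucv (fun k => En (w k)) (En (jlim w)).
Proof.
move=> hw; have [C C0 hC] := En_int_bnd; have [hW hj] := A_lim hw.
apply: (@gmean_ucv 0 C (fun k t y => 2^-1 * (\sum_i jd (w k) i t y * jd (w k) i t y) + Pot p al (jv (w k) t y))).
  by move=> k; exact: hC.
move=> y; have jy := hj (-1) y N1; apply: ccD.
  by apply: ccZ; apply: cc_sum => i; apply: ccM; exact: (j_d jy).
have [_ _ u0 _] := hW (-1) y N1; have pp : 0 < p + 1 by have := p1; lra.
have := ccD (ccZ (al / 2) (ccM (j_v jy) (j_v jy))) (ccZ (- (p + 1)^-1) (cc_comp (powp_cts pp _) (j_v jy))).
rewrite (max_idPr u0) => h.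
have -> : Pot p al (jv (jlim w) (-1) y) = al / 2 * (jv (jlim w) (-1) y * jv (jlim w) (-1) y) + - (p + 1)^-1 * jv (jlim w) (-1) y `^ (p + 1).
  by rewrite /Pot; ring.
apply: cc_ext h; exists 1 => //; apply: evE => k s z hs _.
have s0 : s < 0 by move: hs; rewrite ltr_norml => /andP[_ ?]; lra.
by have [_ _ v0 _] := hw k s z s0; rewrite (max_idPr v0) /Pot; ring.
Qed.

Lemma En_rsc U s : clA U -> posA U -> 0 < s ->
  is_derive s 1 (fun s => En (rsc s U)) (2^-1 * gmean (fun y => Sg (rsc s U) y * Sg (rsc s U) y) * s^-1).
Proof.
move=> hU Up s0; have h1 := En_deriv p1 hal M0 (A_rsc hal s0 hU) (pos_rsc al s0 Up).
have h2 : is_derive s 1 (fun z : R => s^-1 * z) s^-1 by have := dZ s^-1 (did s); rewrite mulr1.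
have E : s^-1 * s = 1 by rewrite mulVf // gt_eqF.
rewrite -{1}E in h1; have := @dcomp R (fun z => En (rsc z (rsc s U))) (fun z => s^-1 * z) s _ _ h1 h2.
apply: der_ext; exists s; [exact: s0|move=> h hh]; have z0 : 0 < s + h by move: hh; rewrite ltr_norml => /andP[? _]; lra.
have q0 : 0 < s^-1 * (s + h) by rewrite mulr_gt0 // invr_gt0.
by apply: En_ext => y; have [-> h3] := @rsc_rsc R n al (s) (s^-1 * (s + h)) U (-1) y s0 q0; rewrite mulrAC mulVf ?gt_eqF // mul1r; split => // i; rewrite h3 mulrAC mulVf ?gt_eqF // mul1r.
Qed.

Lemma Sg2_ge0 U : clA U -> 0 <= gmean (fun y => Sg U y * Sg U y).
Proof.
move=> hU; have [_ _ _ _ h] := A_PG p1 hal M0 hU; apply: gmean_ge0 => [|y]; [exact: PGM|by rewrite -expr2 sqr_ge0].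
Qed.

Lemma En_mono U s s' : clA U -> posA U -> 0 < s -> s <= s' -> En (rsc s U) <= En (rsc s' U).
Proof.
move=> hU Up s0 ss; apply: (@derive_mono R (fun s => En (rsc s U)) _ s s' ss (fun z hz => En_rsc hU Up (lt_le_trans s0 (proj1 (andP hz))))).
move=> z /andP[z1 _]; have z0 := lt_le_trans s0 z1.
by rewrite !mulr_ge0 ?invr_ge0 ?(ltW z0) // Sg2_ge0 //; exact: A_rsc.
Qed.

(** A constant energy makes the mean of [Sg] squared vanish, and the Gaussian mean is faithful. *)
Lemma En_const U e : clA U -> posA U -> (forall s, 0 < s -> En (rsc s U) = e) -> forall y, Sg U y = 0.
Proof.
move=> hU Up he; have h1 := En_deriv p1 hal M0 hU Up.
have h2 : is_derive (1 : R) 1 (fun s => En (rsc s U)) 0.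
  apply: der_ext (dcst e 1); exists 1 => // h hh; rewrite he //.
  by move: hh; rewrite ltr_norml => /andP[? _]; lra.
have z : gmean (fun y => Sg U y * Sg U y) = 0.
  have := @derive_val _ _ _ _ _ _ _ h1; rewrite (@derive_val _ _ _ _ _ _ _ h2) => h.
  by have : 2 * 0 = 2 * (2^-1 * gmean (fun y => Sg U y * Sg U y)) by [rewrite h]; rewrite mulr0 mulrA mulfV // mul1r.
have [_ _ _ _ PS] := A_PG p1 hal M0 hU.
have cS y : cts (Sg U) y by have := @jc_cts R n _ 1 y (jc_Sg y hU (@ltr01 R)); rewrite rsc1.
move=> y; have := @gmean_faithful R n (fun y => Sg U y * Sg U y) (PGM PS PS) (fun y => ctsM (cS y) (cS y)) _ z y.
by move=> h; have /eqP := h (fun y => sqr_ge0 (Sg U y)); rewrite mulf_eq0 orbb => /eqP.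
Qed.

Definition flat1 U := forall y, [/\ jv U (-1) y = kap, (forall i, jd U i (-1) y = 0) & forall i j, jdd U i j (-1) y = 0].

(** If the energies at the scales s l_k have the same limit for every s, the limit profile has
    constant energy along its own rescalings, hence is stationary: it is 0 or [kap]. *)
Lemma limit_stat U l e : clA U -> posA U -> (forall k, 0 < l k) ->
  (forall s, 0 < s -> ucv (fun k => En (rsc (s * l k) U)) e) ->
  e = 0 \/ (flat1 (jlim (fun k => rsc (l k) U)) /\ e = Pot p al kap).
Proof.
move=> hU Up l0 he; set W := jlim _.
have hw k : clA (rsc (l k) U) by exact: A_rsc.
have [hW hj] := A_lim hw; rewrite -/W in hW hj.
have EW s : 0 < s -> En (rsc s W) = e.
  move=> s0; have sl k : 0 < s * l k by rewrite mulr_gt0.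
  have hv k : clA (rsc (s * l k) U) by exact: A_rsc.
  apply: ucv_uniq (he s s0); rewrite (_ : En (rsc s W) = En (jlim (fun k => rsc (s * l k) U))); first exact: En_lim.
  have [_ hj'] := A_lim hv.
  apply: En_ext => y; have j1 := hj _ (s *: y) (neg_sq s0); have j2 := hj' (-1) y N1.
  have [-> _ E3 _] := rscE al s W (-1) y; split=> [|i].
    apply: ucv_uniq (ucvZ _ (cc_ucv (j_v j1))) _; apply: ucv_ext (cc_ucv (j_v j2)); apply: evE => k.
    by have [<- _] := @rsc_rsc R n al (l k) s U (-1) y (l0 k) s0; have [-> _ _ _] := rscE al s (rsc (l k) U) (-1) y.
  rewrite E3; apply: ucv_uniq (ucvZ _ (cc_ucv (j_d j1 i))) _; apply: ucv_ext (cc_ucv (j_d j2 i)); apply: evE => k.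
  by have [_ <-] := @rsc_rsc R n al (l k) s U (-1) y (l0 k) s0; have [_ _ -> _] := rscE al s (rsc (l k) U) (-1) y.
have e1 : En W = e by rewrite -(EW 1 ltr01) rsc1.
have [Wz|Wp] := A_pos p1 hal M0 hW; [left|right].
  rewrite -e1 -[RHS](@gmeanC R n); apply: gmeanE => y.
  have d0 i : jd W i (-1) y = 0.
    have [C1 _ _ _] := hW (-1) y N1; apply: (pd_uniq (c_d C1 i)).
    by have -> : jv W (-1) = fun=> 0 by [apply/funext => z; exact: Wz N1]; exact: pdcst.
  rewrite big1 => [|i _]; last by rewrite d0 mulr0.
  have pp : p + 1 != 0 by rewrite gt_eqF //; have := p1; lra.
  by rewrite /Pot (Wz _ y N1) powR0 // !mulr0 mul0r subr0 addr0.
have [h1 h2] := stationary p1 hal M0 psub hW Wp (En_const hW Wp EW).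
by rewrite -e1 -h2.
Qed.

(** If the limit for l -> oo were 0, monotonicity would make all energies at most 0. The limit for
    scales tending to 0 could then not be [kap], whose energy is positive, so it would be 0 as well;
    the energy would vanish identically and U itself would be stationary, with positive energy. *)
Lemma flat U l : clA U -> posA U -> (forall k, 0 < l k) -> (forall B, ev (fun k => B < l k)) ->
  flat1 (jlim (fun k => rsc (l k) U)).
Proof.
move=> hU Up l0 linf; pose E s := En (rsc s U).
have [C C0 hC] := En_int_bnd.
have Eb s : 0 < s -> `|E s| <= C * @momK R n 0 by move=> s0; apply: gmean_bnd; apply: hC; exact: A_rsc.
have Ecv (m : nat -> R) : (forall k, 0 < m k) -> exists e, ucv (fun k => E (m k)) e.
  by move=> m0; apply: ucv_ex; apply: evE => k; exact: Eb (m0 k).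
have [e he] := Ecv l l0.
have same s : 0 < s -> ucv (fun k => E (s * l k)) e.
  move=> s0; have sl k : 0 < s * l k by rewrite mulr_gt0.
  have [e' he'] := Ecv _ sl; suff -> : e = e' by [].
  apply/eqP; rewrite eq_le; apply/andP; split.
    apply: ucv_lel he _; apply: evE => k; apply: ucv_ler he' _.
    apply: evS (linf (l k / s)) => k' hk'; apply: En_mono => //; rewrite mulrC -ler_pdivrMr //; exact: ltW.
  apply: ucv_lel he' _; apply: evE => k; apply: ucv_ler he _.
  by apply: evS (linf (s * l k)) => k' hk'; apply: En_mono => //; exact: ltW.
have [e0|[]//] := limit_stat hU Up l0 same.
exfalso; pose m k : R := k.+1%:R^-1; have m0 k : 0 < m k by rewrite invr_gt0.
have [e' he'] := Ecv m m0.
have Ele s : 0 < s -> E s <= 0.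
  move=> s0; rewrite -e0; apply: ucv_ler he _.
  by apply: evS (linf s) => k hk; apply: En_mono => //; exact: ltW.
have same' s : 0 < s -> ucv (fun k => E (s * m k)) e'.
  move=> s0; have sl k : 0 < s * m k by rewrite mulr_gt0.
  have [e2 he2] := Ecv _ sl; suff -> : e' = e2 by [].
  apply/eqP; rewrite eq_le; apply/andP; split.
    apply: ucv_ler he2 _; apply: evE => k; apply: ucv_lel he' _.
    by apply: evS (ev_inv (sl k)) => k' hk'; apply: En_mono => //; exact: ltW.
  apply: ucv_ler he' _; apply: evE => k; apply: ucv_lel he2 _.
  have q0 : 0 < m k / s by rewrite divr_gt0.
  by apply: evS (ev_inv q0) => k' hk'; apply: En_mono => //; rewrite mulrC -ler_pdivlMr //; exact: ltW.
have Pk := PotK p1 hal.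
have e'0 : e' = 0.
  have [//|[_ e'1]] := limit_stat hU Up m0 same'.
  have : e' <= 0 by apply: ucv_lel he' _; apply: evE => k; exact: Ele.
  by rewrite e'1; lra.
have E0 s : 0 < s -> E s = 0.
  move=> s0; apply/eqP; rewrite eq_le Ele //= -e'0; apply: ucv_lel he' _.
  by apply: evS (ev_inv s0) => k hk; apply: En_mono => //; exact: ltW.
have [_ h2] := stationary p1 hal M0 psub hU Up (En_const hU Up E0).
by have := E0 1 ltr01; rewrite /E rsc1 h2; lra.
Qed.

End Flat.

(** * Maximum principle for the weighted Hessian *)

Section Rigidity.
Context {R : realType} {n : nat}.
Local Notation V := 'rV[R]_n.
Variables (p al M : R).
Hypotheses (p1 : 1 < p) (hal : al * (p - 1) = 1) (M0 : 0 <= M).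
Implicit Types (x s : V) (U W : @jf R n) (t r b : R).

Definition dvf W s t x := \sum_i s ord0 i * jd W i t x.

(* [tr (S D^2 W)] for the positive definite matrix [S = s^T s + A I] *)
Definition hes (A : R) W s t x := \sum_i s ord0 i * (\sum_l s ord0 l * jdd W i l t x) + A * \sum_i jdd W i i t x.

Lemma nsq_le_sq x r : `|x| <= r -> nsq x <= n%:R * r ^+ 2.
Proof.
move=> h; apply: le_trans (nsq_le x) _.
apply: ler_wpM2l; first exact: ler0n.
by rewrite !expr2; apply: ler_pM.
Qed.

Variable U : @jf R n.
Hypotheses (hU : clA p al M U) (Up : posA U).
Variable A : R.
Hypothesis A0 : 0 < A.
Local Notation q t x := (jv U t x `^ (p - 1)).

Lemma powm1 t x b : t < 0 -> jv U t x `^ (b - 1) = jv U t x `^ b / jv U t x.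
Proof. by move=> t0; rewrite powRB ?(lt0r_neq0 (Up x t0)) ?implybT // powRr1 // ltW // Up. Qed.

Definition hesj s := jadd (jsum (fun i : 'I_n => jz (s ord0 i) (jsum (fun l : 'I_n => jz (s ord0 l) (jdx l (jdx i U))))))
  (jz A (jsum (fun i : 'I_n => jdx i (jdx i U)))).

Lemma jz_v b W t x : jv (jz b W) t x = b * jv W t x. Proof. by []. Qed.

(** Differentiating the equation twice gives p U^(p - 1) times [hes], plus p (p - 1) U^(p - 2) times
    the quadratic form S at grad U. The s^T s part of that form is a square and is dropped; the part
    with A is kept. *)
Lemma hesjP s t x : t < 0 -> [/\ C12 (hesj s) t x, jv (hesj s) t x = hes A U s t x &
  p * q t x * hes A U s t x + p * (p - 1) * A * q t x * jv U t x * (\sum_i (jd U i t x / jv U t x) ^+ 2) <= heat (hesj s) t x].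
Proof.
move=> t0; have h (i l : 'I_n) := A_dxx hU Up i l x t0; have u0 := Up x t0; have un := lt0r_neq0 u0.
have E i l : jv (jdx l (jdx i U)) t x = jdd U i l t x by have [_ -> _] := h i l.
split.
- apply: C12D; last by apply: C12_Z; apply: C12_sum => i; have [] := h i i.
  by apply: C12_sum => i; apply: C12_Z; apply: C12_sum => l; apply: C12_Z; have [] := h i l.
- have -> : jv (hesj s) t x = \sum_i jv (jz (s ord0 i) (jsum (fun l : 'I_n => jz (s ord0 l) (jdx l (jdx i U))))) t x +
    A * \sum_i jv (jdx i (jdx i U)) t x by [].
  congr (_ + _ * _); last by apply: eq_bigr => i _; rewrite E.
  by apply: eq_bigr => i _; rewrite jz_v; congr (_ * _); apply: eq_bigr => l _; rewrite jz_v E.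
rewrite heatD heatZ !heat_sum.
have H i l : heat (jdx l (jdx i U)) t x = p * q t x * jdd U i l t x + p * (p - 1) * (q t x / jv U t x) * (jd U i t x * jd U l t x).
  by have [_ _ ->] := h i l; rewrite (powm1 x (p - 1) t0); ring.
have -> : \sum_i heat (jz (s ord0 i) (jsum (fun l : 'I_n => jz (s ord0 l) (jdx l (jdx i U))))) t x =
    p * q t x * (\sum_i s ord0 i * (\sum_l s ord0 l * jdd U i l t x)) + p * (p - 1) * (q t x / jv U t x) * dvf U s t x ^+ 2.
  rewrite expr2 {1}/dvf !(mulr_sumr, mulr_suml) -big_split /=; apply: eq_bigr => i _.
  rewrite heatZ heat_sum /dvf !(mulr_sumr, mulr_suml) -big_split /=; apply: eq_bigr => l _.
  by rewrite heatZ H; ring.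
have -> : \sum_i heat (jdx i (jdx i U)) t x = p * q t x * (\sum_i jdd U i i t x) + p * (p - 1) * q t x * jv U t x * (\sum_i (jd U i t x / jv U t x) ^+ 2).
  by rewrite !mulr_sumr -big_split /=; apply: eq_bigr => i _; rewrite H; field.
have k : 0 <= p * (p - 1) * (q t x / jv U t x) * dvf U s t x ^+ 2.
  apply: mulr_ge0 (sqr_ge0 _); apply: mulr_ge0; last by rewrite divr_ge0 ?powR_ge0 // ltW.
  by apply: mulr_ge0; [exact: ltW (p_gt0 p1)|exact: ltW (pm1_gt0 p1)].
rewrite /hes; move: k; lra.
Qed.

(** At a zero of [hes] + B U^p the terms of order zero cancel. The heat operator of B U^p
    contributes -p (p - 1) B U^(p - 2) |grad U|^2; since 2 B <= A, half of the A term in [hesjP]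
    absorbs it. The other half absorbs the cross term of grad B and grad U by Cauchy-Schwarz, and nu
    pays for the rest, namely 2 n c from the Laplacian of c |x|^2 and the remainder of
    Cauchy-Schwarz. *)
Lemma hes_max s (c nu e t1 t2 rho : R) : 0 < rho -> t1 <= t2 -> t2 < 0 -> 0 <= c -> 0 <= nu -> 0 < e ->
  2 * (e + c * n%:R * rho ^+ 2 + nu * (t2 - t1)) <= A ->
  2 * n%:R * c + 8 * p ^+ 2 * c ^+ 2 / (p * (p - 1) * A) * (n%:R * rho ^+ 2) < nu ->
  (forall x, `|x| <= rho -> 0 < hes A U s t1 x + e * jv U t1 x `^ p) ->
  (forall t x, t1 <= t <= t2 -> `|x| = rho -> - (c * rho ^+ 2) * jv U t x `^ p <= hes A U s t x) ->
  forall t x, t1 <= t <= t2 -> `|x| <= rho -> 0 < hes A U s t x + (e + c * nsq x + nu * (t - t1)) * jv U t x `^ p.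
Proof.
move=> rho0 t12 t20 c0 nu0 e0 hB hnu h1 h2.
pose B := jadd (jz c (jsq (0 : V))) (jadd (jz nu (@jtime R n)) (jcst (e - nu * t1))).
pose F := jadd (hesj s) (jmul B (jpow p U)).
have BE t x : jv B t x = e + c * nsq x + nu * (t - t1).
  have -> : jv B t x = c * jv (jsq (0 : V)) t x + (nu * t + (e - nu * t1)) by [].
  by rewrite jsqE subr0; ring.
have neg t : t <= t2 -> t < 0 by move=> h; exact: le_lt_trans h t20.
have FE t x : t <= t2 -> jv F t x = hes A U s t x + (e + c * nsq x + nu * (t - t1)) * jv U t x `^ p.
  by move=> h; rewrite -BE; have [_ <- _] := hesjP s x (neg t h).
have qp t x : t <= t2 -> 0 < jv U t x `^ p by move=> h; rewrite powR_gt0 // Up // neg.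
have CB t x : C12 B t x.
  by apply: C12D; [apply: C12_Z; exact: C12_sq|apply: C12D; [apply: C12_Z; exact: C12_time|exact: C12_cst]].
have CQ t x : t <= t2 -> C12 (jpow p U) t x.
  by move=> h; apply: C12_pow; [have [] := hU x (neg t h)|exact: Up (neg t h)].
have CF t x : t <= t2 -> C12 F t x.
  move=> h; apply: C12D; first by have [] := hesjP s x (neg t h).
  exact: C12M (CB t x) (CQ t x h).
have ns x : 0 <= c * nsq x by rewrite mulr_ge0 // nsq_ge0.
have sx (x : V) : x - 0 = x by rewrite subr0.
suff H t x : t1 <= t <= t2 -> `|x - 0| <= rho -> 0 < jv F t x.
  by move=> t x ht hx; rewrite -FE ?H ?sx //; have /andP[] := ht.
apply: maxp rho0 _ _ _ _ _ t x.
- by move=> t x /andP[_ h] _; exact: c_v0 (CF t x h).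
- move=> x; rewrite sx FE // subrr mulr0 addr0 => hx; apply: lt_le_trans (h1 x hx) _; rewrite lerD2l.
  by apply: ler_wpM2r; [exact: ltW (qp t1 x t12)|have := ns x; lra].
- move=> t x /andP[ht1 ht2]; rewrite sx FE // => hx; have := h2 t x _ hx; rewrite ht1 ht2 => /(_ isT) h3.
  have q0 := qp t x ht2; have k1 : rho ^+ 2 <= nsq x by rewrite -hx; exact: nsq_norm.
  have k2 : 0 <= nu * (t - t1) by rewrite mulr_ge0 // subr_ge0.
  have k3 : c * rho ^+ 2 * jv U t x `^ p + e * jv U t x `^ p <= (e + c * nsq x + nu * (t - t1)) * jv U t x `^ p.
    by rewrite -mulrDl; apply: ler_wpM2r; [exact: ltW|have := ler_wpM2l c0 k1; lra].
  have : 0 < e * jv U t x `^ p by exact: mulr_gt0.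
  by move: h3 k3; rewrite mulNr; lra.
- by move=> t x /andP[_ h] _; exact: CF.
move=> t x /andP[ht1 ht2]; rewrite sx => hx F0 _; have t0 := neg t ht2.
have u0 := Up x t0; have un := lt0r_neq0 u0; have q0 : 0 < q t x by rewrite powR_gt0.
have [_ hh _ _] := hU x t0; have [_ _ LZ] := hesjP s x t0.
have m2 : jv U t x `^ (p - 1 - 1) = q t x / jv U t x by exact: powm1.
have m4 : jv U t x `^ p = q t x * jv U t x by rewrite [X in _ = X * _]powm1 //; field.
have gg : grad2 B (jpow p U) t x = p * q t x * grad2 B U t x.
  by rewrite /grad2 mulr_sumr; apply: eq_bigr => i _ /=; ring.
have LQ : heat (jpow p U) t x = p * q t x * (q t x * jv U t x) - p * (p - 1) * q t x * jv U t x * (\sum_i (jd U i t x / jv U t x) ^+ 2).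
  rewrite heat_comp hh m4 m2 /grad2; congr (_ - _); rewrite !mulr_sumr; apply: eq_bigr => i _; field; exact: un.
have HB : heat B t x = nu - 2 * n%:R * c.
  by rewrite heatD heatD heatZ heatZ heat_sq heat_time heat_cst; ring.
have gB : grad2 B U t x = 2 * c * jv U t x * \sum_i x ord0 i * (jd U i t x / jv U t x).
  rewrite /grad2 mulr_sumr; apply: eq_bigr => i _.
  have -> : jd B i t x = 2 * c * x ord0 i.
    have -> : jd B i t x = jd (jz c (jsq (0 : V))) i t x + (jd (jz nu (@jtime R n)) i t x + 0) by [].
    by have [_ _ -> _] := jzE c (jsq (0 : V)); have [_ _ -> _] := jzE nu (@jtime R n); rewrite jd_sq sx /=; ring.
  by field.
rewrite heatD heatM gg LQ BE HB gB; move: F0; rewrite FE // => F0.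
have -> : jv (jpow p U) t x = q t x * jv U t x by rewrite -m4.
rewrite m4 in F0.
set b := e + _ + _ in F0 *; set S := \sum_i x ord0 i * _; set g := \sum_i _ ^+ 2 in LZ *.
set K := p * (p - 1) * A; have pm : 0 < p - 1 by rewrite subr_gt0.
have K0 : 0 < K by rewrite !mulr_gt0 // p_gt0.
have ge0 : 0 <= g by apply: sumr_ge0 => i _; exact: sqr_ge0.
have cauchy : 4 * p * c * S <= K / 2 * g + 8 * p ^+ 2 * c ^+ 2 / K * nsq x.
  rewrite /S /g /nsq !mulr_sumr -big_split /=; apply: ler_sum => i _.
  rewrite -subr_ge0 [X in 0 <= X](_ : _ = (K * (jd U i t x / jv U t x) - 4 * p * c * x ord0 i) ^+ 2 / (2 * K)).
    by rewrite divr_ge0 ?sqr_ge0 // mulr_ge0 // ltW.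
  by field; rewrite un (lt0r_neq0 K0).
have nx := nsq_le_sq (ltW hx).
have bb : 2 * b <= A.
  apply: le_trans hB; apply: ler_wpM2l; first by [].
  rewrite /b; apply: lerD; first by rewrite lerD2l -mulrA ler_wpM2l.
  by apply: ler_wpM2l => //; rewrite lerD2r.
have bK : p * (p - 1) * b <= K / 2.
  have pp : 0 <= p * (p - 1) by rewrite mulr_ge0 // ltW // p_gt0.
  by have := ler_wpM2l pp bb; rewrite /K; lra.
have h8 : 0 <= 8 * p ^+ 2 * c ^+ 2 / K.
  by apply: divr_ge0 (mulr_ge0 (mulr_ge0 (ler0n _ _) (sqr_ge0 _)) (sqr_ge0 _)) (ltW K0).
have k1 := ler_wpM2l h8 nx; have k2 := ler_wpM2r ge0 bK.
have k3 : 0 < q t x * jv U t x * (K * g - p * (p - 1) * b * g + nu - 2 * n%:R * c - 4 * p * c * S).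
  by apply: mulr_gt0; [exact: mulr_gt0|move: hnu; rewrite -/K; lra].
have F1 : hes A U s t x = - (b * (q t x * jv U t x)) by apply/eqP; rewrite -addr_eq0; apply/eqP.
rewrite F1 in LZ; apply: lt_le_trans k3 _.
by move: LZ; rewrite -/K => LZ; apply: le_trans (lerD LZ (lexx _)); rewrite le_eqVlt; apply/orP; left; apply/eqP; ring.
Qed.

End Rigidity.

(** * Constancy from a nonnegative weighted Hessian *)

Section Liouville1.
Context {R : realType} {n : nat}.
Local Notation V := 'rV[R]_n.
Implicit Types (x y s a : V) (W u w : @jf R n) (A K e t r b c : R).

Lemma ball_max (f : V -> R) a (rho K : R) : 0 <= rho -> (forall x, `|x - a| <= rho -> cts f x) ->
  (forall x, `|x - a| <= rho -> f x <= K) -> exists2 x, `|x - a| <= rho & forall y, `|y - a| <= rho -> f y <= f x.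
Proof.
move=> rho0 hc hK; pose S := [set r | exists2 x, `|x - a| <= rho & r = f x].
have Sn : S !=set0 by exists (f a), a => //; rewrite subrr normr0.
have Sb : has_sup S by split => //; exists K => _ [x hx ->]; exact: hK.
have hk (k : nat) : exists x : V, `|x - a| <= rho /\ sup S - k.+1%:R^-1 < f x.
  by have [_ [x hx ->] h] := sup_adherent (inv0 k) Sb; exists x.
have [q hq] := choice hk.
have [|x' hx' cx'] := @ucv_ball R n (fun k => q k - a) rho; first by move=> k; have [] := hq k.
exists (x' + a); first by rewrite addrK.
move=> y hy; apply: (@le_trans _ _ (sup S)); first by apply: ub_le_sup; [exact: Sb.2|exists y].
apply/ler_addgt0Pr => e e0; have e2 : 0 < e / 2 by lra.
have hx : `|x' + a - a| <= rho by rewrite addrK.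
have [d d0 hd] := hc _ hx _ e2.
have [k [k1 k2]] := ev_ex (evI (cx' d d0) (ev_inv e2)).
have [_ h3] := hq k; have := hd (q k); rewrite opprD addrA addrAC => /(_ k1).
by rewrite ltr_norml => /andP[_ h4]; move: h3 h4 k2; set z := k.+1%:R^-1; clear; lra.
Qed.

Lemma evec_sum (F : 'I_n -> R) i : \sum_j evec R i ord0 j * F j = F i.
Proof.
rewrite (bigD1 i) //= big1 => [|j ji]; last by rewrite evecE eq_sym (negbTE ji) mul0r.
by rewrite evecE eqxx mul1r addr0.
Qed.

Lemma hes_evec W i t x : \sum_j evec R i ord0 j * (\sum_l evec R i ord0 l * jdd W j l t x) = jdd W i i t x.
Proof. by rewrite evec_sum evec_sum. Qed.

Lemma dir_min W s t x (d : R) : 0 < d -> (forall y, `|y - x| < d -> C12 W t y /\ jv W t x <= jv W t y) ->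
  0 <= \sum_i s ord0 i * (\sum_l s ord0 l * jdd W i l t x).
Proof.
move=> d0 h; have s1 : 0 < `|s| + 1 by have := normr_ge0 s; lra.
have d1 : 0 < d / (`|s| + 1) by exact: divr_gt0.
have nr (z : R) : `|z| < d / (`|s| + 1) -> `|x + z *: s - x| < d.
  move=> hz; rewrite addrCK normrZ; move: hz; rewrite ltr_pdivlMr // mulrDr mulr1; have := normr_ge0 z; lra.
have dir (f : V -> R) (fi : 'I_n -> V -> R) z : `|z - x| < d -> (forall y, `|y - x| < d -> forall i, pd (evec R i) f y (fi i y)) ->
    (forall i, cts (fi i) z) -> pd s f z (\sum_i s ord0 i * fi i z).
  move=> hz hf hc; apply: pd_dir => //; exists (d - `|z - x|); first by rewrite subr_gt0.
  by move=> y hy i; apply: hf; exact: tri_lt hy (lexx _).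
have xx : `|x - x| < d by rewrite subrr normr0.
apply: (@derive2_min R (fun z => jv W t (x + z *: s)) (fun z => \sum_i s ord0 i * jd W i t (x + z *: s)) 0 _ _ d1).
- move=> z hz; rewrite add0r; apply: pd_shift; apply: (dir (jv W t) (fun i => jd W i t)); first exact: nr.
    by move=> y hy i; exact: c_d (h y hy).1 i.
  by move=> i; apply: (@jc_cts R n (jd W i)); exact: c_d0 (h _ (nr z hz)).1 i.
- have C0 := (h x xx).1.
  apply: (@pdsum R n s _ _ (fun i y => s ord0 i * jd W i t y) (fun i => s ord0 i * \sum_l s ord0 l * jdd W i l t x)) => i.
  have k : pd s (jd W i t) x (\sum_l s ord0 l * jdd W i l t x).
    apply: (dir (jd W i t) (fun l => jdd W i l t)) => //.
      by move=> y hy l; exact: c_dd (h y hy).1 i l.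
    by move=> l; apply: (@jc_cts R n (jdd W i l)); exact: c_dd0 C0 i l.
  by have := pdM (pdcst s (s ord0 i) x) k; rewrite mulr0 addr0.
by move=> z hz; rewrite scale0r addr0 add0r; exact: (h _ (nr z hz)).2.
Qed.

Lemma hes_min A W s t x (d : R) : 0 <= A -> 0 < d -> (forall y, `|y - x| < d -> C12 W t y /\ jv W t x <= jv W t y) ->
  0 <= hes A W s t x.
Proof.
move=> A0 d0 h; rewrite /hes; apply: addr_ge0; first exact: dir_min d0 h.
apply: mulr_ge0 => //; apply: sumr_ge0 => i _; rewrite -(hes_evec W i); exact: dir_min d0 h.
Qed.

Lemma hes_lin A u w b c s t x : hes A (jadd (jz b u) (jz c w)) s t x = b * hes A u s t x + c * hes A w s t x.
Proof.
have E i l : jdd (jadd (jz b u) (jz c w)) i l t x = b * jdd u i l t x + c * jdd w i l t x.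
  have -> : jdd (jadd (jz b u) (jz c w)) i l t x = jdd (jz b u) i l t x + jdd (jz c w) i l t x by [].
  by have [_ _ _ ->] := jzE b u; have [_ _ _ ->] := jzE c w.
rewrite /hes (eq_bigr (fun i => b * (s ord0 i * (\sum_l s ord0 l * jdd u i l t x)) + c * (s ord0 i * (\sum_l s ord0 l * jdd w i l t x)))).
  rewrite [\sum_i jdd _ i i t x](eq_bigr (fun i => b * jdd u i i t x + c * jdd w i i t x)) => [|i _]; last by rewrite E.
  by rewrite !big_split /= -!mulr_sumr; ring.
move=> i _; rewrite [in LHS](eq_bigr (fun l => b * (s ord0 l * jdd u i l t x) + c * (s ord0 l * jdd w i l t x))) => [|l _].
  by rewrite big_split /= -!mulr_sumr; ring.
by rewrite E; ring.
Qed.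

Definition A0 : R := (2 * n%:R)^-1.

(** The comparison function is |x - a|^(1/2) in the Euclidean norm, and s is the radial unit vector.
    With P = |x - a|^(-3/2) the radial part is -P/4 and the trace part is A0 P (n/2 - 3/4) = P/4 - 3
    P/(8 n), whence the choice A0 = 1/(2 n). *)
Lemma hes_quarter a t x : (0 < n)%N -> 0 < nsq (x - a) ->
  hes A0 (jpow (1 / 4) (jsq a)) ((Num.sqrt (nsq (x - a)))^-1 *: (x - a)) t x < 0.
Proof.
move=> n0 Q0; set Q := nsq (x - a) in Q0 *; set y := x - a.
have n1 : 0 < n%:R :> R by rewrite ltr0n.
have QE : \sum_i y ord0 i * y ord0 i = Q by [].
have E i l : jdd (jpow (1 / 4) (jsq a)) i l t x =
    1 / 4 * Q `^ (1 / 4 - 1) * (2 * (i == l)%:R) + 1 / 4 * (1 / 4 - 1) * Q `^ (1 / 4 - 1 - 1) * (4 * y ord0 i * y ord0 l).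
  have -> : jdd (jpow (1 / 4) (jsq a)) i l t x = 1 / 4 * jv (jsq a) t x `^ (1 / 4 - 1) * jdd (jsq a) i l t x +
    jd (jsq a) i t x * (1 / 4 * ((1 / 4 - 1) * jv (jsq a) t x `^ (1 / 4 - 1 - 1)) * jd (jsq a) l t x) by [].
  rewrite !jd_sq jsqE -/Q -/y; congr (_ * _ + _); last by ring.
  rewrite /= (bigD1 i) //= big1 => [|j ji]; last by rewrite eq_sym (negbTE ji) !(mulr0, mul0r) !addr0.
  by rewrite eqxx eq_sym; case: (i == l); rewrite /=; ring.
have P2 : Q `^ (1 / 4 - 1 - 1) = Q `^ (1 / 4 - 1) / Q.
  by rewrite powRB ?(lt0r_neq0 Q0) ?implybT // powRr1 // ltW.
have P0 : 0 < Q `^ (1 / 4 - 1) by exact: powR_gt0.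
set P := Q `^ (1 / 4 - 1) in E P2 P0; rewrite P2 in E.
have sq : Num.sqrt Q ^+ 2 = Q by rewrite sqr_sqrtr // ltW.
have sn : Num.sqrt Q != 0 by rewrite gt_eqF // sqrtr_gt0.
have T1 : \sum_i jdd (jpow (1 / 4) (jsq a)) i i t x = P * (n%:R / 2 - 3 / 4).
  rewrite (eq_bigr (fun i => P / 2 + - (3 / 4) * (P / Q) * (y ord0 i * y ord0 i))) => [|i _]; last by rewrite E eqxx mulr1; field; exact: lt0r_neq0.
  rewrite big_split /= sumr_const card_ord -mulr_sumr QE -mulr_natr; field; exact: lt0r_neq0.
have T2 : \sum_i ((Num.sqrt Q)^-1 *: y) ord0 i * (\sum_l ((Num.sqrt Q)^-1 *: y) ord0 l * jdd (jpow (1 / 4) (jsq a)) i l t x) = - (P / 4).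
  rewrite (eq_bigr (fun i => - (P / 4 / Q) * (y ord0 i * y ord0 i))) => [|i _].
    by rewrite -mulr_sumr QE; field; exact: lt0r_neq0.
  rewrite (eq_bigr (fun l => (Num.sqrt Q)^-1 * (P / 2) * (y ord0 l * (i == l)%:R) + - (3 / 4) * (Num.sqrt Q)^-1 * (P / Q) * y ord0 i * (y ord0 l * y ord0 l))) => [|l _].
    rewrite big_split /= -!mulr_sumr QE (bigD1 i) //= big1 => [|l li]; last by rewrite eq_sym (negbTE li) mulr0.
    by rewrite eqxx mulr1 addr0 mxE; move: sn sq; generalize (Num.sqrt Q) => r0 sn sq; rewrite -sq; field.
  by rewrite E mxE; field; rewrite sn lt0r_neq0.
rewrite /hes T1 T2 /A0; have -> : - (P / 4) + (2 * n%:R)^-1 * (P * (n%:R / 2 - 3 / 4)) = - (P * (3 / 8) / n%:R) by field; exact: lt0r_neq0.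
by rewrite oppr_lt0 divr_gt0 // mulr_gt0 //; lra.
Qed.

Lemma nsq_gt0 x : x != 0 -> 0 < nsq x.
Proof. by move=> x0; apply: lt_le_trans (nsq_norm x); rewrite exprn_gt0 // normr_gt0. Qed.

Lemma nsq_unit x : x != 0 -> nsq ((Num.sqrt (nsq x))^-1 *: x) = 1.
Proof.
move=> x0; have q0 := nsq_gt0 x0; rewrite [LHS](eq_bigr (fun i => (nsq x)^-1 * (x ord0 i * x ord0 i))) => [|i _].
  by rewrite -mulr_sumr mulVf // lt0r_neq0.
rewrite !mxE -[in RHS](sqr_sqrtr (ltW q0)); field; by rewrite gt_eqF // sqrtr_gt0.
Qed.

(** u - N |x - a|^(1/2) attains its maximum over the ball of radius rho around a; by [hes_quarter]
    this is not an interior point other than a. With N of order rho^(-1/2) the values on the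
    boundary do not exceed u(a), so u(x) <= u(a) + N |x - a|^(1/2), and rho -> oo gives u(x) <=
    u(a). *)
Lemma hes_const u t K : (0 < n)%N -> (forall x, C12 u t x) -> (forall x, jv u t x <= K) ->
  (forall s x, nsq s = 1 -> 0 <= hes A0 u s t x) -> forall x y, jv u t x = jv u t y.
Proof.
move=> n0 hC hK hh; suff H a x : jv u t x <= jv u t a by move=> x y; apply/eqP; rewrite eq_le !H.
have A00 : 0 <= A0 by rewrite invr_ge0 mulr_ge0.
pose m := Num.max 1 (K - jv u t a); have m0 : 0 < m by rewrite lt_max ltr01.
have mK z : jv u t z <= jv u t a + m.
  by apply: le_trans (hK z) _; rewrite -lerBlDl le_max lexx orbT.
have key rho : 0 < rho -> `|x - a| <= rho -> jv u t x <= jv u t a + m * (rho ^+ 2) `^ (- (1 / 4)) * nsq (x - a) `^ (1 / 4).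
  move=> rho0 hx; set N := m * _; have r2 : 0 < rho ^+ 2 by rewrite exprn_gt0.
  have N0 : 0 < N by rewrite mulr_gt0 // powR_gt0.
  pose f z := jv u t z - N * nsq (z - a) `^ (1 / 4).
  have fle z : f z <= K by apply: le_trans (hK z); rewrite lerBlDr lerDl mulr_ge0 ?powR_ge0 // ltW.
  have cf z : cts f z.
    rewrite /f; apply: ctsD; first by apply: (@jc_cts R n (jv u)); exact: c_v0 (hC z).
    have q4 : 0 < 1 / 4 :> R by lra.
    have h := @jc_cts R n _ t z (jcN (jcZ N (jc_comp (powp_cts q4 (jv (jsq a) t z)) (c_v0 (C12_sq a t z))))).
    move=> e e0; have [d d0 hd] := h e e0; exists d => // z' hz'; have := hd z' hz'.
    by rewrite !jsqE !(max_idPr (nsq_ge0 _)).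
  have [z hz zm] := @ball_max f a rho K (ltW rho0) (fun z _ => cf z) (fun z _ => fle z).
  have := zm x hx; rewrite {1}/f; suff : f z <= jv u t a by lra.
  have [->|za] := eqVneq z a.
    have z0 : nsq (0 : V) = 0 by rewrite /nsq big1 // => i _; rewrite mxE mulr0.
    by rewrite /f subrr z0 powR0 ?mulr0 ?subr0 //; lra.
  have z0 : z - a != 0 by rewrite subr_eq0.
  have Q0 := nsq_gt0 z0.
  move: hz; rewrite le_eqVlt => /orP[/eqP hz|hz].
    have : (rho ^+ 2) `^ (1 / 4) <= nsq (z - a) `^ (1 / 4).
      by apply: powR_le; [exact: ltW|rewrite -hz; exact: nsq_norm|lra].
    move=> /(ler_wpM2l (ltW N0)); rewrite /N -mulrA -(powRDp r2) addNr powRr0 mulr1 /f -/N => h.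
    by have := mK z; lra.
  exfalso; pose W := jadd (jz N (jpow (1 / 4) (jsq a))) (jz (-1) u).
  pose d := Num.min (rho - `|z - a|) `|z - a|.
  have d0 : 0 < d by rewrite lt_min subr_gt0 hz normr_gt0.
  have hW y : `|y - z| < d -> C12 W t y /\ jv W t z <= jv W t y.
    rewrite lt_min => /andP[y1 y2].
    have ya : y - a != 0.
      by apply/eqP => E; move: y2; have -> : y - z = - (z - a) + (y - a) by [apply/rowP => i; rewrite !mxE; ring]; rewrite E addr0 normrN ltxx.
    split; last first.
      have E y' : jv W t y' = - f y' by rewrite /W /f -(jsqE a t y') /=; ring.
      by rewrite !E lerN2; apply: zm; apply: ltW; exact: tri_lt y1 (lexx _).
    have hp : C12 (jpow (1 / 4) (jsq a)) t y by apply: C12_pow; [exact: C12_sq|rewrite jsqE; exact: nsq_gt0].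
    exact: C12D (C12_Z N hp) (C12_Z (-1) (hC y)).
  set s := (Num.sqrt (nsq (z - a)))^-1 *: (z - a).
  have k1 := @hes_min A0 W s t z d A00 d0 hW; rewrite hes_lin in k1.
  have k2 := hes_quarter t n0 Q0; rewrite -/s in k2.
  have k3 := hh s z (nsq_unit z0).
  have : N * hes A0 (jpow (1 / 4) (jsq a)) s t z < 0 by rewrite pmulr_rlt0.
  by lra.
apply/ler_addgt0Pr => e e0; set Q := nsq (x - a) `^ (1 / 4) in key.
have Q0 : 0 <= Q by exact: powR_ge0.
have c0 : 0 < (m * Q + 1) / e by rewrite divr_gt0 // ltr_wpDl // mulr_ge0 // ltW.
(* Chosen so that rho^(-1/2) <= e / (m Q + 1). *)
pose th := ((m * Q + 1) / e) `^ 2; pose rho := th + `|x - a|.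
have th0 : 0 < th by exact: powR_gt0.
have rho0 : 0 < rho by rewrite ltr_pwDl.
apply: le_trans (key rho rho0 _) _; first by rewrite /rho lerDr ltW.
rewrite lerD2l mulrAC.
have h1 : (rho ^+ 2) `^ (- (1 / 4)) <= (th ^+ 2) `^ (- (1 / 4)).
  by apply: powR_anti; [rewrite exprn_gt0|rewrite !expr2; apply: ler_pM; rewrite ?(ltW th0) // /rho lerDl|lra].
have h2 : (th ^+ 2) `^ (- (1 / 4)) = ((m * Q + 1) / e)^-1.
  rewrite powRN -powR_mulrn ?(ltW th0) // -!powRrM; congr (_^-1).
  by rewrite (_ : 2 * (2%:R * (1 / 4)) = 1 :> R) ?powRr1 // ?(ltW c0) //; field.
have mQ : 0 <= m * Q by rewrite mulr_ge0 // ltW.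
apply: le_trans (ler_wpM2l mQ h1) _; rewrite h2 invf_div mulrCA -ler_pdivlMl // mulVf ?lt0r_neq0 //.
by rewrite ler_pdivrMr ?mul1r; lra.
Qed.

End Liouville1.

(** * From a one-sided Hessian bound to spatial constancy *)

Section Liouville2.
Context {R : realType} {n : nat}.
Local Notation V := 'rV[R]_n.
Variables (p al M : R).
Hypotheses (p1 : 1 < p) (hal : al * (p - 1) = 1) (M0 : 0 <= M) (psub : n%:R * (p - 1) < 2 * (p + 1)) (n0 : (0 < n)%N).
Local Tactic Notation "sra1" hyp_list(l) := revert l; lra_in (p1, hal, M0, psub, n0).
Implicit Types (x y s a : V) (U W u : @jf R n) (A e d t r b c N : R).
Local Notation clA := (@clA R n p al M).
Local Notation rsc := (@rsc R n al).
Local Notation kap := (kap al).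
Local Notation A0 := (@A0 R n).
Local Notation N1 := (neg1 (R := R)).

Lemma hes_bnd A W s t x d : 0 <= A -> nsq s = 1 -> (forall i l, `|jdd W i l t x| <= d) ->
  `|hes A W s t x| <= (n%:R * n%:R + A * n%:R) * d.
Proof.
move=> A00 s1 hd.
have d0 : 0 <= d by have := hd (Ordinal n0) (Ordinal n0); exact: le_trans.
have si i : `|s ord0 i| <= 1.
  rewrite -[leLHS]ger0_norm // -(@ler_pXn2r _ 2) ?nnegrE // expr1n normr_id -normrX ger0_norm ?sqr_ge0 //.
  rewrite -s1 /nsq (bigD1 i) //= expr2 lerDl; by apply: sumr_ge0 => l _; rewrite -expr2 sqr_ge0.
have nd : 0 <= n%:R * d by rewrite mulr_ge0.
have mb (a b c : R) : `|a| <= 1 -> `|b| <= c -> `|a * b| <= c by move=> h1 h2; rewrite normrM -[c]mul1r; apply: ler_pM.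
apply: le_normD; rewrite mulrDl -mulrA; apply: lerD.
  apply: sum_bb => // i; apply: (mb _ _ _ (si i)); apply: sum_bb => // l; exact: mb (si l) (hd i l).
rewrite normrM (ger0_norm A00) -mulrA; apply: ler_wpM2l => //; exact: sum_bb.
Qed.

Lemma hes_scale A (c q t0 : R) x0 u s t x :
  hes A (jscale c q t0 x0 u) s t x = c * q ^+ 2 * hes A u s (t0 + q ^+ 2 * t) (x0 + q *: x).
Proof.
rewrite /hes /= mulrDr; congr (_ + _); last by rewrite -mulr_sumr; ring.
rewrite mulr_sumr; apply: eq_bigr => i _; rewrite [RHS]mulrCA; congr (_ * _).
by rewrite mulr_sumr; apply: eq_bigr => l _; ring.
Qed.

Lemma pw_scale c : 0 < c -> (c `^ al) `^ p = c `^ al * c.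
Proof.
move=> c0; rewrite -powRrM (_ : al * p = al + 1); last by rewrite -hal; ring.
by rewrite (powRDp c0) powRr1 // ltW.
Qed.

(** Counterexamples with t -> -oo are rescaled to time -1 by l = sqrt(-t), which maps the cone to a
    fixed ball. There, by [flat], the second derivatives tend to 0 and the profile to [kap] > 0,
    uniformly; both sides of the inequality scale alike. *)
Lemma flat_good U A N e : 0 <= A -> clA U -> posA U -> 0 < e -> exists2 T0, 0 < T0 & forall t x s, t <= - T0 ->
  `|x| <= N * Num.sqrt (- t) -> nsq s = 1 -> `|hes A U s t x| <= e * jv U t x `^ p.
Proof.
move=> A00 hU Up e0; apply: contrapT => hn.
have hk (k : nat) : exists q : R * V * V, [/\ q.1.1 <= - k.+1%:R, `|q.1.2| <= N * Num.sqrt (- q.1.1), nsq q.2 = 1 &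
    e * jv U q.1.1 q.1.2 `^ p < `|hes A U q.2 q.1.1 q.1.2|].
  apply: contrapT => h; apply: hn; exists k.+1%:R => // t x s h1 h2 h3; rewrite leNgt; apply/negP => h4.
  by apply: h; exists (t, x, s).
have [q hq] := choice hk; pose l k := Num.sqrt (- (q k).1.1).
have qn k : k.+1%:R <= - (q k).1.1 by have [h _ _ _] := hq k; rewrite lerNr.
have q0 k : 0 < - (q k).1.1 by apply: lt_le_trans (qn k).
have l0 k : 0 < l k by rewrite sqrtr_gt0.
have l2 k : l k ^+ 2 = - (q k).1.1 by rewrite sqr_sqrtr // ltW.
have linf B : ev (fun k => B < l k).
  apply: evS (ev_ge (Num.truncn (B ^+ 2))) => k hk'; apply: contrapT => /negP; rewrite -leNgt => h.
  have : l k ^+ 2 <= B ^+ 2 by rewrite !expr2; apply: ler_pM; rewrite ?(ltW (l0 k)).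
  rewrite l2 leNgt => /negP; apply; apply: lt_le_trans (qn k); apply: lt_le_trans (truncnS_gt _) _.
  by rewrite ler_nat.
have hw k : clA (rsc (l k) U) by exact: A_rsc.
have [_ hj] := A_lim p1 hal M0 hw; have fl := flat p1 hal M0 psub hU Up l0 linf.
have k0 := kap_gt0 p1 hal.
pose D := n%:R * n%:R + A * n%:R + 1.
have D0 : 0 < D by rewrite /D ltr_wpDl // addr_ge0 // mulr_ge0.
have kp : 0 < e * (kap / 2) `^ p by rewrite mulr_gt0 // powR_gt0 //; sra1 k0.
pose d := Num.min (kap / 2) (e * (kap / 2) `^ p / D).
have d0 : 0 < d by rewrite lt_min divr_gt0 // divr_gt0.
have c1 : ev (fun k => forall y, `|y| <= N -> `|jv (rsc (l k) U) (-1) y - kap| <= d).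
  apply: (@cc_unif R n (fun k => jv (rsc (l k) U)) (fun=> kap) (-1) N _ d d0) => y; have [<- _ _] := fl y; exact: j_v (hj _ y N1).
have c2 : ev (fun k => forall i j y, `|y| <= N -> `|jdd (rsc (l k) U) i j (-1) y - 0| <= d).
  apply: ev_fin => i; apply: ev_fin => j; apply: (@cc_unif R n (fun k => jdd (rsc (l k) U) i j) (fun=> 0) (-1) N _ d d0) => y.
  by have [_ _ h0] := fl y; rewrite -(h0 i j); exact: j_dd (hj _ y N1) i j.
have [k [h1 h2]] := ev_ex (evI c1 c2).
have [_ x1 s1 x2] := hq k; set t := (q k).1.1 in x1 x2 *; set x := (q k).1.2 in x1 x2; set s := (q k).2 in s1 x2.
pose y := (l k)^-1 *: x.
have ly : l k *: y = x by rewrite scalerA mulfV ?scale1r // gt_eqF.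
have lt : l k ^+ 2 * -1 = t by rewrite l2 mulrN1 opprK.
have yN : `|y| <= N by rewrite normrZ ger0_norm ?invr_ge0 ?(ltW (l0 k)) // ler_pdivrMl // mulrC.
have hb i j : `|jdd (rsc (l k) U) i j (-1) y| <= d by rewrite -[X in `|X|]subr0; exact: h2.
have := hes_bnd A00 s1 hb; rewrite hes_scale !add0r lt ly l2.
have := h1 y yN; have [-> _ _ _] := rscE al (l k) U (-1) y; rewrite lt ly l2.
set c := - t; have c0 : 0 < c := q0 k.
have ca : 0 < c `^ al by exact: powR_gt0.
move=> hv hh; have hv2 : kap / 2 <= c `^ al * jv U t x.
  by have : d <= kap / 2 by [rewrite ge_min lexx]; move: hv; rewrite ler_norml => /andP[? _]; lra.
have u0 : 0 <= jv U t x by apply: ltW; apply: Up; rewrite -oppr_gt0.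
have : (kap / 2) `^ p <= (c `^ al * jv U t x) `^ p by apply: powR_le => //; [sra1 k0|exact: ltW (p_gt0 p1)].
rewrite [in X in _ <= X -> _]powRM ?(ltW ca) // pw_scale // => hp.
have : c `^ al * c * `|hes A U s t x| <= c `^ al * c * (e * jv U t x `^ p).
  rewrite -[X in X * `|_|]ger0_norm ?mulr_ge0 ?(ltW ca) ?(ltW c0) // -normrM.
  apply: le_trans hh _; apply: (@le_trans _ _ (D * d)).
    by apply: ler_wpM2r; [exact: ltW|rewrite /D lerDl].
  apply: (@le_trans _ _ (e * (kap / 2) `^ p)); last by rewrite mulrCA ler_wpM2l // ltW.
  by rewrite mulrC -ler_pdivlMr // ge_min lexx orbT.
by rewrite ler_pM2l ?mulr_gt0 // => h; have := lt_le_trans x2 h; rewrite ltxx.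
Qed.

Definition good A U e := forall s t x, nsq s = 1 -> t < 0 -> - (e * jv U t x `^ p) <= hes A U s t x.

(** The bound with e0 = A/(8 n) improves itself to 0. [hes_max] is applied on a ball of radius rho =
    r sqrt(T), starting at time -T: initially [flat_good] gives smallness, laterally the assumed
    bound is used with c = e0 / rho^2, and e0 is such that c n rho^2 = A/8. For large r and T the
    weight B at the fixed point (t, x) is at most d. *)
Lemma good_hes U A : 0 < A -> clA U -> posA U -> good A U (A / (8 * n%:R)) ->
  forall s t x, nsq s = 1 -> t < 0 -> 0 <= hes A U s t x.
Proof.
move=> A00 hU Up hg s t x s1 t0; set e0 := A / _ in hg.
have n1 : 0 < n%:R :> R by rewrite ltr0n.
have e00 : 0 < e0 by rewrite divr_gt0 // mulr_gt0.
have ne : n%:R * e0 = A / 8 by rewrite /e0; field; exact: lt0r_neq0.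
pose K := p * (p - 1) * A; have K0 : 0 < K by rewrite !mulr_gt0 // ?(p_gt0 p1) ?subr_gt0.
have L0 : 0 <= 8 * p ^+ 2 * e0 ^+ 2 / K * n%:R.
  by apply: mulr_ge0 => //; apply: divr_ge0 (mulr_ge0 (mulr_ge0 (ler0n _ _) (sqr_ge0 _)) (sqr_ge0 _)) (ltW K0).
pose K1 := 2 * n%:R * e0 + 8 * p ^+ 2 * e0 ^+ 2 / K * n%:R + 1.
have K10 : 0 < K1 by rewrite /K1; lra.
suff H d : 0 < d -> - (d * jv U t x `^ p) <= hes A U s t x.
  have up : 0 < jv U t x `^ p by rewrite powR_gt0 // Up.
  apply/ler_addgt0Pr => e he; have := H _ (divr_gt0 he up); rewrite divfK ?lt0r_neq0 //; lra.
(* r is so large that nu T = K1 / r^2 is at most A/8 and at most d/3. *)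
move=> d0; pose r : R := 1 + K1 * (8 / A + 3 / d).
have rp : 0 < 8 / A + 3 / d by rewrite addr_gt0 // divr_gt0.
have r1 : 1 <= r by rewrite /r lerDl mulr_ge0 // ltW.
have rr : r <= r ^+ 2 by rewrite expr2 ler_peMl //; sra1 r1.
have r0 : 0 < r by sra1 r1.
have rA : K1 / r ^+ 2 <= A / 8.
  rewrite ler_pdivrMr ?exprn_gt0 //; apply: (@le_trans _ _ (A / 8 * (K1 * (8 / A)))).
    by rewrite le_eqVlt; apply/orP; left; apply/eqP; field; exact: lt0r_neq0.
  apply: ler_wpM2l; first by sra1 A00.
  apply: le_trans rr; rewrite /r; have := mulr_ge0 (ltW K10) (ltW (divr_gt0 (ltr0n R 3) d0)); rewrite mulrDr; sra1.
have rd : K1 / r ^+ 2 <= d / 3.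
  rewrite ler_pdivrMr ?exprn_gt0 //; apply: (@le_trans _ _ (d / 3 * (K1 * (3 / d)))).
    by rewrite le_eqVlt; apply/orP; left; apply/eqP; field; exact: lt0r_neq0.
  apply: ler_wpM2l; first by sra1 d0.
  have a8 : 0 < 8 / A by exact: divr_gt0.
  by apply: le_trans rr; rewrite /r mulrDr; have := mulr_ge0 (ltW K10) (ltW a8); sra1.
pose e := Num.min (A / 8) (d / 3); have e1 : 0 < e by rewrite lt_min; apply/andP; split; sra1 A00 d0.
have eA : e <= A / 8 by rewrite ge_min lexx.
have ed : e <= d / 3 by rewrite ge_min lexx orbT.
have e2 : 0 < e / 2 by sra1 e1.
have [T0 T00 hT] := flat_good r (ltW A00) hU Up e2.
have sq0 : 0 <= e0 * nsq x * (3 / d) by rewrite !mulr_ge0 ?nsq_ge0 ?invr_ge0 // ltW.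
(* T exceeds T0, -t, (|x| + 1)^2 and 3 e0 |x|^2 / d: the start lies in the flat region and before t,
   x lies in the ball, and c |x|^2 <= d/3. *)
pose T : R := T0 - t + (`|x| + 1) ^+ 2 + e0 * nsq x * (3 / d).
have xx : 1 <= (`|x| + 1) ^+ 2 by rewrite expr2; have := normr_ge0 x => h; have : 1 * 1 <= (`|x| + 1) * (`|x| + 1) by [apply: ler_pM => //; sra1 e2 h]; sra1.
have T1 : 0 < T by rewrite /T; sra1 T00 sq0 t0 xx.
pose rho := r * Num.sqrt T; have rho2 : rho ^+ 2 = r ^+ 2 * T by rewrite exprMn sqr_sqrtr // ltW.
have rho0 : 0 < rho by rewrite mulr_gt0 // sqrtr_gt0.
have q0 : 0 < rho ^+ 2 by exact: exprn_gt0.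
have xr : `|x| <= rho.
  apply: (@le_trans _ _ (Num.sqrt T)); last by rewrite /rho ler_peMl // sqrtr_ge0.
  apply: (@le_trans _ _ (`|x| + 1)); first by sra1.
  rewrite -(@ger0_norm _ (`|x| + 1)) ?addr_ge0 // -sqrtr_sqr ler_sqrt ?(ltW T1) // /T; sra1 T00 sq0 t0.
have tT : - T <= t by rewrite /T; sra1 T00 sq0 xx.
have nuT : K1 / rho ^+ 2 * T = K1 / r ^+ 2 by rewrite rho2; field; rewrite !lt0r_neq0.
have tb : 0 <= t - - T <= T by apply/andP; split; sra1 t0 tT.
have nu0 : 0 <= K1 / rho ^+ 2 by rewrite divr_ge0 // ltW.
have nb : K1 / rho ^+ 2 * (t - - T) <= K1 / r ^+ 2.
  by rewrite -nuT; apply: ler_wpM2l => //; case/andP: tb.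
have cn : e0 / rho ^+ 2 * n%:R * rho ^+ 2 = A / 8 by rewrite -ne; field; exact: lt0r_neq0.
have tl : - T <= t <= t by rewrite tT lexx.
have c0 : 0 <= e0 / rho ^+ 2 by rewrite divr_ge0 // ltW.
have hB : 2 * (e + e0 / rho ^+ 2 * n%:R * rho ^+ 2 + K1 / rho ^+ 2 * (t - - T)) <= A by rewrite cn; sra1 A00 eA nb rA.
have hnu : 2 * n%:R * (e0 / rho ^+ 2) + 8 * p ^+ 2 * (e0 / rho ^+ 2) ^+ 2 / (p * (p - 1) * A) * (n%:R * rho ^+ 2) < K1 / rho ^+ 2.
  rewrite -/K (_ : _ + _ = (2 * n%:R * e0 + 8 * p ^+ 2 * e0 ^+ 2 / K * n%:R) / rho ^+ 2); last by field; rewrite !lt0r_neq0.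
  by rewrite ltr_pM2r ?invr_gt0 // /K1 ltrDl.
have h1 z : `|z| <= rho -> 0 < hes A U s (- T) z + e * jv U (- T) z `^ p.
  move=> hz; have up : 0 < jv U (- T) z `^ p by rewrite powR_gt0 // Up // oppr_lt0.
  have := hT (- T) z s _ _ s1; rewrite opprK lerN2 => /(_ _ hz) h.
  have /h : T0 <= T by rewrite /T; sra1 sq0 t0 xx.
  by rewrite ler_norml => /andP[h2 _]; have := mulr_gt0 e2 up; sra1 h2.
have h2 t' z : - T <= t' <= t -> `|z| = rho -> - (e0 / rho ^+ 2 * rho ^+ 2) * jv U t' z `^ p <= hes A U s t' z.
  move=> /andP[_ h] _; rewrite divfK ?lt0r_neq0 // mulNr; apply: hg => //; exact: le_lt_trans h t0.
have := hes_max p1 hU Up A00 rho0 tT t0 c0 nu0 e1 hB hnu h1 h2 tl xr.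
set B := _ + _ + _ => hF; have Bd : B <= d.
  have k1 : e0 / rho ^+ 2 * nsq x <= d / 3.
    rewrite mulrAC ler_pdivrMr //; apply: (@le_trans _ _ (d / 3 * T)); last first.
      apply: ler_wpM2l; first by sra1 d0.
      by rewrite rho2 ler_peMl ?(ltW T1) //; sra1 r1 rr.
    apply: (@le_trans _ _ (d / 3 * (e0 * nsq x * (3 / d)))); last by apply: ler_wpM2l; [sra1 d0|rewrite /T; sra1 T00 t0 xx].
    by rewrite le_eqVlt; apply/orP; left; apply/eqP; field; exact: lt0r_neq0.
  rewrite /B; sra1 ed k1 nb rd.
have := ler_wpM2r (powR_ge0 (jv U t x) p) Bd; sra1 hF.
Qed.

Definition e0 : R := A0 / (8 * n%:R).

Lemma good_const U : clA U -> posA U -> good A0 U e0 -> forall t x y, t < 0 -> jv U t x = jv U t y.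
Proof.
move=> hU Up hg t x y t0.
have A00 : 0 < A0 :> R by rewrite invr_gt0 mulr_gt0 // ltr0n.
apply: (@hes_const R n U t (M * (- t) `^ (- al))) => //.
- by move=> z; have [] := hU t z t0.
- by move=> z; have [] := hU t z t0.
- by move=> s z s1; exact: good_hes A00 hU Up hg s t z s1 t0.
Qed.

End Liouville2.

(** * Second derivatives up to the final time *)

Section Endgame.
Context {R : realType} {n : nat}.
Local Notation V := 'rV[R]_n.
Variables (p al M g C0 : R) (w : nat -> @jf R n) (G : nat -> V -> R -> R) (tau L : nat -> R).
Hypotheses (p1 : 1 < p) (hal : al * (p - 1) = 1) (M0 : 0 < M) (C00 : 0 < C0) (hg : 0 < g <= 1)
  (ax : apx p al g C0 M w G tau L) (tau0 : ev (fun k => 0 < tau k)) (w1 : ev (fun k => jv (w k) 0 0 <= 1)).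
Local Notation W := (jlim w).
Hypothesis Wc : forall t x y, t < 0 -> jv W t x = jv W t y.
Local Tactic Notation "sra2" hyp_list(l) := revert l; lra_in (p1, hal, M0, C00, hg, ax, tau0, w1, Wc).
Implicit Types (x y v a : V) (A B c e d t s r : R).

Lemma end_reg B : ev (fun k => forall t x, - B <= t <= 0 -> `|x| <= B -> [/\ C12 (w k) t x, heat (w k) t x = G k x (jv (w k) t x),
  0 <= heat (w k) t x <= C0 * (jv (w k) t x `^ p + 1), 0 <= jv (w k) t x & jv (w k) t x <= M * (tau k - t) `^ (- al)]).
Proof.
apply: (ev2 _ (evI (ax_L ax B) tau0) (evI (ax_eq ax) (ax_G3 ax))) => k [h1 h2] [h3 h4] t x /andP[t1 t2] xB.
have [||C1 C2 C3 C4] := h3 t x; [by rewrite (le_lt_trans t2 h2) andbT; lra|exact: le_lt_trans xB h1|].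
by split=> //; rewrite C2; apply: h4 => //; exact: le_lt_trans xB h1.
Qed.

Lemma end_unif t Y e : t < 0 -> 0 < e -> ev (fun k => forall y, `|y| <= Y -> `|jv (w k) t y - jv W t 0| <= e).
Proof.
move=> t0 e0; have [_ hj] := apx_lim p1 hal hg (ltW M0) ax.
by apply: (@cc_unif R n (fun k => jv (w k)) (fun=> jv W t 0) t Y _ e e0) => y; rewrite (Wc 0 y t0); exact: j_v (hj t y t0).
Qed.

(** If the limit exceeded 1 at time t, the solutions would exceed some c' > 1 on a large ball at
    that time. On a ball so large that the loss in [lower_bar] is below (c' - 1)/2, this persists at
    the origin until time 0, against [w1]. *)
Lemma end_le1 t : t < 0 -> jv W t 0 <= 1.
Proof.
move=> t0; rewrite leNgt; apply/negP; set c := jv W t 0 => c1.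
pose c' := (1 + c) / 2; have c'1 : 1 < c' by rewrite /c'; lra.
pose th := (c' - 1) / (2 * c'); have th0 : 0 < th by rewrite divr_gt0; lra.
have nt : 0 <= 2 * n%:R * (- t) by rewrite !mulr_ge0 // oppr_ge0 ltW.
pose rho := 1 + 2 * n%:R * (- t) / th.
have nth : 0 <= 2 * n%:R * (- t) / th by rewrite divr_ge0 // ltW.
have r1 : 1 <= rho by rewrite /rho lerDl.
have r0 : 0 < rho by lra.
have e0 : 0 < (c - 1) / 2 by lra.
have [k [[k1 k2] k3]] := ev_ex (evI (evI (end_reg (- t + rho)) (end_unif rho t0 e0)) w1).
have c'0 : 0 <= c' by sra2 c'1.
have h1 s x : t <= s <= 0 -> `|x| <= rho -> [/\ C12 (w k) s x, 0 <= heat (w k) s x & 0 <= jv (w k) s x].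
  move=> /andP[s1 s2] hx; have [||H1 H2 /andP[H3 _] H4 _] := k1 s x => //; [by apply/andP; split; sra2 r1 s1 s2|sra2 hx t0].
have h2 x : `|x| <= rho -> c' <= jv (w k) t x.
  by move=> hx; have := k2 x hx; rewrite ler_norml -/c => /andP[h _]; rewrite /c'; sra2 h.
have t00 : (t <= 0) && ((0 : R) <= 0) by rewrite lexx andbT ltW.
have := lower_bar r0 c'0 h1 h2 t00; rewrite sub0r => h3.
have h4 : 2 * n%:R * (- t) * (rho ^+ 2)^-1 <= th.
  rewrite ler_pdivrMr ?exprn_gt0 //; apply: (@le_trans _ _ (th * rho)).
    by rewrite [leRHS](_ : _ = th + 2 * n%:R * - t) ?lerDr ?(ltW th0) // /rho; field; exact: lt0r_neq0.
  by apply: ler_wpM2l; [exact: ltW|rewrite expr2 ler_peMl // ltW].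
have h5 : c' * th = (c' - 1) / 2 by rewrite /th; field; apply/eqP; sra2 c'1.
have := ler_wpM2l c'0 h4; sra2 c'1 h3 h5 k3.
Qed.

(** If tau stays away from 0, the type I bound suffices. Otherwise tau tends to 0 along the
    ultrafilter. By [end_le1] the solutions are at most 3/2 on a fixed ball at time -d, which for
    small d is below eta theta^-al; [barrier_small] carries a type I bound with the small constant
    eta up to time 0, and [barrier_bounded] turns it into a bound. *)
Lemma end_bnd : exists r B, [/\ 0 < r, 0 <= B & ev (fun k => forall t x, - r <= t <= 0 -> `|x| <= r -> jv (w k) t x <= B)].
Proof.
have a0 := al_gt0 p1 hal.
have [[th th0 hth]|hn] := pselect (exists2 th, 0 < th & ev (fun k => th <= tau k)).
  exists 1, (M * th `^ (- al)); split => //; first by rewrite mulr_ge0 ?powR_ge0 // ltW.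
  apply: (ev2 _ hth (end_reg 1)) => k h1 h2 t x ht hx; have [_ _ _ _ h] := h2 t x ht hx.
  apply: le_trans h _; apply: ler_wpM2l; first exact: ltW.
  by apply: powR_anti => //; [case/andP: ht => _ ?; lra|exact: ltW].
have tsm th : 0 < th -> ev (fun k => tau k < th).
  move=> th0; have h : ~ ev (fun k => th <= tau k) by move=> h; apply: hn; exists th.
  by apply: evS (ev_not h) => k /negP; rewrite -ltNge.
have [K [e0 [q0 [[K0 e00 q00] hB]]]] := @barrier_bounded R n p al C0 p1 hal C00.
have [eta0 eta00 hS] := @barrier_small R n p al C0 p1 hal C00 M M0.
pose eta := Num.min eta0 (K / (2 * 2 `^ al)).
have et0 : 0 < eta by rewrite lt_min eta00 divr_gt0 // mulr_gt0.
have etK : eta * 2 `^ al < K.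
  apply: (@le_lt_trans _ _ (K / (2 * 2 `^ al) * 2 `^ al)); first by apply: ler_wpM2r; [exact: ltW|rewrite ge_min lexx orbT].
  have -> : K / (2 * 2 `^ al) * 2 `^ al = K / 2 by field; rewrite lt0r_neq0.
  sra2 K0.
have etr : 0 < eta <= eta0 by rewrite et0 ge_min lexx.
have [S [q1 [S0 q10 hS1]]] := hS eta etr.
(* For theta below this value eta theta^-al >= 3, which leaves room above 3/2 at the starting
   time. *)
have q20 : 0 < (eta / 3) `^ (p - 1) by rewrite powR_gt0 // divr_gt0.
have q2E : ((eta / 3) `^ (p - 1)) `^ (- al) = 3 / eta.
  rewrite -powRrM (_ : (p - 1) * - al = - 1); last by rewrite mulrN mulrC hal.
  by rewrite powR_inv1 ?invf_div // divr_ge0 // ltW.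
(* Once tau < d, the time tau + d left at the start is at most 2 d; so 2 d has to meet the smallness
   conditions of both barriers. *)
pose d := Num.min (Num.min q0 q1) (Num.min S^-1 ((eta / 3) `^ (p - 1))) / 2.
have m0 : 0 < Num.min (Num.min q0 q1) (Num.min S^-1 ((eta / 3) `^ (p - 1))).
  by rewrite (lt_min _ (Num.min q0 q1)) !lt_min q00 q10 invr_gt0 S0.
have d0 : 0 < d by rewrite divr_gt0.
have dE : 2 * d = Num.min (Num.min q0 q1) (Num.min S^-1 ((eta / 3) `^ (p - 1))) by rewrite /d; field.
have [dq0 dq1 dS dq2] : [/\ 2 * d <= q0, 2 * d <= q1, 2 * d <= S^-1 & 2 * d <= (eta / 3) `^ (p - 1)].
  by rewrite dE !ge_min !lexx !orbT.
have nd : - d < 0 by rewrite oppr_lt0.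
have c1 := end_le1 nd; have h20 : 0 < 1 / 2 :> R by [].
pose e := Num.min e0 d; have ep : 0 < e by rewrite lt_min e00.
pose r := Num.min d (Num.min 1 (2 * (n%:R + 1))^-1).
have r0 : 0 < r by rewrite !lt_min d0 ltr01 invr_gt0 mulr_gt0.
have [rd r1 rn] : [/\ r <= d, r <= 1 & r <= (2 * (n%:R + 1))^-1] by rewrite !ge_min !lexx !orbT.
exists r, (K * (e / 8) `^ (- al)); split => //; first by rewrite mulr_ge0 ?powR_ge0 // ltW.
apply: (ev2 _ (evI (tsm d d0) tau0) (evI (end_reg (d + 2)) (end_unif 2 nd h20))) => k [t1 t2] [k1 k2].
have reg t x : - d <= t <= 0 -> `|x| <= 2 -> [/\ C12 (w k) t x, heat (w k) t x <= C0 * (jv (w k) t x `^ p + 1), 0 <= jv (w k) t x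
    & jv (w k) t x <= M * (tau k - t) `^ (- al)].
  move=> /andP[h1 h2] hx; have ht : - (d + 2) <= t <= 0 by rewrite h2 andbT; apply: le_trans h1; rewrite lerN2 lerDl.
  have hx' : `|x| <= d + 2 by apply: le_trans hx _; rewrite lerDr ltW.
  by have [H1 _ /andP[_ H2] H3 H4] := k1 t x ht hx'.
have td : tau k - - d <= 2 * d by sra2 t1.
have sm a : `|a| <= 1 -> forall t, - d <= t <= 0 -> jv (w k) t a <= eta * (tau k - t) `^ (- al).
  move=> ha; apply: (hS1 (w k) a (tau k) 1 (- d) 0) => //.
  - exact: le_trans td dq1.
  - rewrite expr1n; apply: (@le_trans _ _ (S * (2 * d))); first by apply: ler_wpM2l => //; exact: ltW.
    by rewrite mulrC -ler_pdivlMr // mul1r.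
  - move=> t x ht hx; apply: reg => //; have := ler_normD (x - a) a; rewrite subrK; sra2 ha hx.
  move=> x hx; have xx : `|x| <= 2 by have := ler_normD (x - a) a; rewrite subrK; sra2 ha hx.
  have h3 : jv (w k) (- d) x <= 3 / 2 by have := k2 x xx; rewrite ler_norml => /andP[_ ?]; lra.
  apply: (@lt_le_trans _ _ (eta * (3 / eta))); first by rewrite mulrCA mulfV ?lt0r_neq0 //; sra2 h3.
  rewrite -q2E; apply: ler_wpM2l; first exact: ltW.
  by apply: powR_anti; [sra2 d0 t2|exact: le_trans td dq2|exact: ltW].
have e1 : 0 < e <= e0 by rewrite ep ge_min lexx.
have e2 : e <= tau k - - d by apply: (@le_trans _ _ d); [rewrite ge_min lexx orbT|sra2 t2].
have td0 : tau k - - d <= q0 := le_trans td dq0.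
move=> t x /andP[ht1 ht2] hx.
have big := hB eta (w k) (tau k) (- d) 0 e et0 etK e1 e2 td0 t2.
have htd : - d <= t <= 0 by rewrite ht2 andbT; apply: le_trans ht1; rewrite lerN2.
have hx1 : `|x| <= 1 by exact: le_trans hx r1.
apply: (le_trans (big _ t x htd hx1)).
  move=> s y hs hy; have [|H1 H2 H3 _] := reg s y hs; first by sra2 hy.
  by split => //; exact: sm.
apply: ler_wpM2l; first exact: ltW.
apply: powR_anti; [by sra2 ep| |exact: ltW].
have b2 : 1 / 2 <= bmp x.
  have /andP[_ h] := bmp_lip x; have := nsq_le x; have : n%:R * `|x| ^+ 2 <= 1 / 2; last by sra2 h.
  apply: (@le_trans _ _ ((n%:R + 1) * (2 * (n%:R + 1))^-1)); last by rewrite le_eqVlt; apply/orP; left; apply/eqP; field; exact: lt0r_neq0.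
  apply: ler_pM => //; first by rewrite lerDl.
  apply: le_trans rn; apply: le_trans hx; by rewrite expr2 ler_piMl.
have : (1 / 2) ^+ 3 <= bmp x ^+ 3 by apply: lerXn2r; rewrite ?nnegrE // bmp_ge0.
move=> /(ler_wpM2l (ltW ep)); rewrite (_ : e * (1 / 2) ^+ 3 = e / 8); last by field.
sra2 ht2 t2.
Qed.

Lemma lim_dd0 t x i j : t < 0 -> jdd W i j t x = 0.
Proof.
move=> t0; have [hA _] := apx_lim p1 hal hg (ltW M0) ax.
have d0 y : jd W i t y = 0.
  have [C1 _ _ _] := hA t y t0; apply: (pd_uniq (c_d C1 i)).
  have -> : jv W t = fun=> jv W t 0 by apply/funext => z; exact: Wc.
  exact: pdcst.
have [C1 _ _ _] := hA t x t0; apply: (pd_uniq (c_dd C1 i j)).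
have -> : jd W i t = fun=> 0 by exact/funext.
exact: pdcst.
Qed.

(** At a small negative time the second derivatives tend to those of W, which vanish since W is
    constant in space. As [end_bnd] includes time 0 and the interior estimates look only backwards
    in time, [equi] bounds the change from that time to 0 uniformly in k. *)
Lemma endgame i j : ucv (fun k => jdd (w k) i j 0 0) 0.
Proof.
have [r [B [r0 B0 hB]]] := end_bnd.
have [_ hj] := apx_lim p1 hal hg (ltW M0) ax.
have [Af hAf] := @ctl_of R n g hg; have [Ke Ke0 hKe] := @equi R n g hg.
pose q := Num.min 1 (r / 6); have q0 : 0 < q by rewrite lt_min ltr01 divr_gt0.
have q1 : q <= 1 by rewrite ge_min lexx.
have qr : q <= r / 6 by rewrite ge_min lexx orbT.
have q20 : 0 < q ^+ 2 by rewrite exprn_gt0.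
have q2q : q ^+ 2 <= q by rewrite expr2 ler_piMr // ltW.
have q21 : q ^+ 2 <= 1 by exact: le_trans q2q q1.
have [C C'0 hC] := ax_G1 ax (B + r).
have Bp : 0 <= B `^ p by exact: powR_ge0.
pose A := B + C0 * (B `^ p + 1) + C.
have CB : 0 <= C0 * (B `^ p + 1) by rewrite mulr_ge0 ?(ltW C00) // addr_ge0.
have A0 : 0 <= A by rewrite /A; sra2 B0 C'0 CB.
pose J k := jscale 1 q 0 0 (w k).
have hJ : ev (fun k => ctl g (J k) (-1) 0 0 (Af A)).
  apply: (ev2 _ (evI hB hC) (end_reg r)) => k [k1 k2] k3; apply: hAf => //.
  have tq s : -1 - 3 <= s <= 0 -> - r <= 0 + q ^+ 2 * s <= 0.
    move=> /andP[s1 s2]; rewrite add0r; have q2r : q ^+ 2 * 4 <= r by sra2 q2q qr r0.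
    have := ler_wpM2l (ltW q20) (_ : - s <= 4); rewrite mulrN => /(_ ltac:(sra2 s1)) h.
    by apply/andP; split; [sra2 h q2q qr r0|rewrite -oppr_ge0 -mulrN mulr_ge0 ?(ltW q20) // oppr_ge0].
  have xq (y : V) : `|y| <= 0 + 6 -> `|0 + q *: y| <= r.
    move=> hy; rewrite add0r normrZ gtr0_norm //; have := ler_wpM2l (ltW q0) hy; sra2 qr.
  split=> [s y hs hy|s y z hs hy hz].
    have h1 := tq s hs; have h2 := xq y hy; have [H1 H2 /andP[H3 H4] H5 _] := k3 _ _ h1 h2.
    have u1 := k1 _ _ h1 h2.
    split; first exact: C12_scale.
      by rewrite /= mul1r ger0_norm // /A; sra2 C'0 CB u1.
    rewrite heat_scale mul1r normrM !ger0_norm ?(ltW q20) //.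
    apply: (@le_trans _ _ (1 * heat (w k) (0 + q ^+ 2 * s) (0 + q *: y))); first exact: ler_wpM2r.
    rewrite mul1r; apply: le_trans H4 _; rewrite /A.
    have : C0 * (jv (w k) (0 + q ^+ 2 * s) (0 + q *: y) `^ p + 1) <= C0 * (B `^ p + 1).
      by rewrite ler_wpM2l ?(ltW C00) // lerD2r; apply: powR_le => //; exact: ltW (p_gt0 p1).
    by sra2 B0 C'0.
  have h1 := tq s hs; have hy' := xq y hy; have hz' := xq z hz.
  have [_ Hy _ y0 _] := k3 _ _ h1 hy'; have [_ Hz _ z0 _] := k3 _ _ h1 hz'.
  have uy := k1 _ _ h1 hy'; have uz := k1 _ _ h1 hz'.
  rewrite !heat_scale !mul1r -mulrBr normrM (ger0_norm (ltW q20)) Hy Hz.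
  apply: (@le_trans _ _ (1 * `|G k (0 + q *: z) (jv (w k) (0 + q ^+ 2 * s) (0 + q *: z)) - G k (0 + q *: y) (jv (w k) (0 + q ^+ 2 * s) (0 + q *: y))|)).
    exact: ler_wpM2r.
  have Br v : `|v| <= r -> `|v| <= B + r by move=> hv; apply: le_trans hv _; rewrite lerDr.
  have iB b : 0 <= b -> b <= B -> 0 <= b <= B + r by move=> -> h; apply: (le_trans h); rewrite lerDl ltW.
  have E v : jv (jscale 1 q 0 0 (w k)) s v = jv (w k) (0 + q ^+ 2 * s) (0 + q *: v) by rewrite /= mul1r.
  rewrite mul1r; apply: le_trans (k2 _ _ _ _ (Br _ hz') (Br _ hy') (iB _ z0 uz) (iB _ y0 uy)) _.
  rewrite !E; apply: ler_pM; [by []|exact: addr_ge0 (powR_ge0 _ _) (normr_ge0 _)|by rewrite /A lerDr addr_ge0|].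
  rewrite lerD2r; apply: powR_le => //; last by case/andP: hg => ? _; exact: ltW.
  by rewrite opprD addrACA subrr add0r -scalerBr normrZ gtr0_norm // ler_piMl.
move=> e e0.
have [k0 Ak] : exists k0, ctl g (J k0) (-1) 0 0 (Af A) by exact: ev_ex hJ.
have Af0 : 0 <= Af A by case: Ak.
have KA : 0 < Ke * Af A + 1 by rewrite ltr_wpDl // mulr_ge0.
have e1 : 0 < q ^+ 2 * e / 2 by rewrite divr_gt0 // mulr_gt0.
have [q' [d0 [hq' d00 hd0]]] := small_mod hg (divr_gt0 e1 KA).
pose h := Num.min (d0 / 2) 1; have h0 : 0 < h by rewrite lt_min ltr01 divr_gt0.
have hd : h < d0 by apply: (@le_lt_trans _ _ (d0 / 2)); [rewrite ge_min lexx|sra2 d00].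
have h1 : h <= 1 by rewrite ge_min lexx orbT.
have nh : q ^+ 2 * - h < 0 by rewrite mulrN oppr_lt0 mulr_gt0.
have e2 : 0 < e / 2 by sra2 e0.
have := cc_ucv (j_dd (hj _ 0 nh) i j) e2; rewrite lim_dd0 // => hc.
apply: (ev2 _ hJ hc) => k k1 k2; rewrite subr0 in k2; rewrite subr0.
have i1 : -1 <= - h <= 0 by apply/andP; split; sra2 h0 h1.
have i2 : -1 <= (0 : R) <= 0 by apply/andP; split; sra2.
have z0 : `|0 : V| <= 0 by rewrite normr0.
have [_ _ h3] := hKe _ _ _ _ _ k1 (- h) 0 0 0 q' i1 i2 z0 z0 hq'.
have := h3 i j; have E : `|- h - 0| + `|(0 : V) - 0| = h by rewrite !subr0 normr0 addr0 normrN gtr0_norm.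
rewrite E /= !mul1r !scaler0 !add0r mulr0 -mulrBr normrM (ger0_norm (ltW q20)) => h4.
have [_ _ h5] := hd0 h (ltW h0) hd.
have h6 : Ke * Af A * (q' `^ g + q'^-1 * q'^-1 * h) <= q ^+ 2 * e / 2.
  have /andP[q'0 _] := hq'.
  have x0 : 0 <= q' `^ g + q'^-1 * q'^-1 * h by rewrite addr_ge0 ?powR_ge0 // !mulr_ge0 ?invr_ge0 // ltW.
  by move: h5; rewrite ltr_pdivlMr // mulrDr mulr1 mulrC; sra2 x0.
have h7 := le_trans h4 h6; rewrite -mulrA ler_pM2l // in h7.
have := ler_normB (jdd (w k) i j (q ^+ 2 * - h) 0) (jdd (w k) i j (q ^+ 2 * - h) 0 - jdd (w k) i j 0 0).
rewrite opprB addrC subrK; sra2 h7 k2.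
Qed.

End Endgame.

(** * Point picking and the Liouville theorem *)

Section PointPicking.
Context {R : realType} {n : nat}.
Local Notation V := 'rV[R]_n.
Variables (p al M : R).
Hypotheses (p1 : 1 < p) (hal : al * (p - 1) = 1) (M0 : 0 < M) (psub : n%:R * (p - 1) < 2 * (p + 1)) (n0 : (0 < n)%N).
Local Tactic Notation "sra1" hyp_list(l) := revert l; lra_in (p1, hal, M0, psub, n0).
Implicit Types (x y s : V) (U : @jf R n) (t b c N : R).
Local Notation clA := (@clA R n p al M).
Local Notation A0 := (@A0 R n).
Local Notation e0 := (@e0 R n).
Local Notation good := (@good R n p).

(** Normalisation at a value b: with c = b^(1 - p) the equation is preserved, now up to time -t0/c,
    and the type I constant does not change because c^-al = b. *)
Lemma A_norm U (t0 : R) x0 (c b : R) (w := jscale b^-1 (Num.sqrt c) t0 x0 U) : clA U -> 0 < b -> c = b `^ (1 - p) -> forall t x, t < - t0 / c ->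
  [/\ C12 w t x, heat w t x = jv w t x `^ p, 0 <= jv w t x & jv w t x <= M * (- t0 / c - t) `^ (- al)].
Proof.
move=> hU b0 cE t x ht; have c0 : 0 < c by rewrite cE powR_gt0.
have l0 : 0 < Num.sqrt c by rewrite sqrtr_gt0.
have l2 : Num.sqrt c ^+ 2 = c by rewrite sqr_sqrtr // ltW.
have tn : t0 + Num.sqrt c ^+ 2 * t < 0.
  by rewrite l2; move: ht; rewrite ltr_pdivlMr // mulrC; lra.
have [C1 C2 C3 C4] := hU _ (x0 + Num.sqrt c *: x) tn.
have bi : 0 <= b^-1 by rewrite invr_ge0 ltW.
split; first exact: C12_scale.
- have -> : jv w t x = b^-1 * jv U (t0 + Num.sqrt c ^+ 2 * t) (x0 + Num.sqrt c *: x) by [].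
  rewrite /w heat_scale C2 powRM // -powR_inv1 ?(ltW b0) // l2 cE -powRrM -(powRDp b0).
  by congr (_ `^ _ * _); ring.
- exact: mulr_ge0.
have -> : jv w t x = b^-1 * jv U (t0 + Num.sqrt c ^+ 2 * t) (x0 + Num.sqrt c *: x) by [].
rewrite ler_pdivrMl //; apply: le_trans C4 _; rewrite l2 mulrCA.
have -> : - (t0 + c * t) = c * (- t0 / c - t) by field; exact: lt0r_neq0.
rewrite powRM ?(ltW c0) ?subr_ge0 ?(ltW ht) // (_ : c `^ (- al) = b) //.
rewrite cE -powRrM (_ : (1 - p) * - al = 1) ?powRr1 ?(ltW b0) //.
by have := hal; rewrite mulrBr mulr1; lra.
Qed.

(** In each cone |x| <= N sqrt(-t) the bad points have bounded |t| by [flat_good], so one with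
    nearly maximal |t| exists. After normalisation there, points of the cone earlier by the factor 1
    + 1/N are not bad; for N -> oo a positive limit therefore satisfies [good] and is constant in
    space. By [endgame] the second derivatives tend to 0 at the bad points, against their
    definition. *)
Lemma no_bad0 U : clA U -> posA U -> forall s t, nsq s = 1 -> t < 0 -> - (e0 * jv U t 0 `^ p) <= hes A0 U s t 0.
Proof.
move=> hU Up s0 t0 hs0 ht0; rewrite leNgt; apply/negP => hb.
have A00 : 0 < A0 by rewrite invr_gt0 mulr_gt0 // ltr0n.
have e00 : 0 < e0 by rewrite divr_gt0 // mulr_gt0 // ltr0n.
pose bad t x s := [/\ t < 0, nsq s = 1 & hes A0 U s t x < - (e0 * jv U t x `^ p)].
pose S N := [set T : R | exists x s, bad (- T) x s /\ `|x| <= N * Num.sqrt T].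
have S_nonempty N : 0 <= N -> S N (- t0).
  by move=> N0; exists 0, s0; rewrite opprK normr0 mulr_ge0 // sqrtr_ge0.
have S_sup N : 0 <= N -> has_sup (S N).
  move=> N0; split; first by exists (- t0); exact: S_nonempty.
  have [T0 T00 hT] := flat_good p1 hal (ltW M0) psub n0 N (ltW A00) hU Up e00.
  exists T0 => T [x [s [[h1 h2 h3] h4]]]; rewrite leNgt; apply/negP => h5.
  have := hT (- T) x s _ _ h2; rewrite lerN2 opprK => /(_ (ltW h5) h4).
  by rewrite ler_norml => /andP[h6 _]; move: h3; rewrite ltNge h6.
have hk (k : nat) : exists q : R * V * V, bad q.1.1 q.1.2 q.2 /\ `|q.1.2| <= k.+1%:R * Num.sqrt (- q.1.1) /\
    forall t x s, nsq s = 1 -> t <= (1 + k.+1%:R^-1) * q.1.1 -> `|x| <= k.+1%:R * Num.sqrt (- t) -> - (e0 * jv U t x `^ p) <= hes A0 U s t x.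
  have N0 : 0 <= k.+1%:R :> R by [].
  have hS := S_sup _ N0; have sp : 0 < sup (S k.+1%:R).
    by apply: (@lt_le_trans _ _ (- t0)); [rewrite oppr_gt0|apply: ub_le_sup; [exact: hS.2|exact: S_nonempty]].
  have ep : 0 < sup (S k.+1%:R) - sup (S k.+1%:R) / (1 + k.+1%:R^-1).
    by rewrite subr_gt0 ltr_pdivrMr // ltr_pMr // ltrDl.
  have [T [x [s [hbad hx]]] hT] := sup_adherent ep hS.
  have hT' : sup (S k.+1%:R) < T * (1 + k.+1%:R^-1) by rewrite -ltr_pdivrMr //; move: hT; rewrite opprB addrC subrK.
  exists (- T, x, s); split => //=; rewrite opprK; split => // t y s' hs' ht hy.
  rewrite leNgt; apply/negP => hlt; have Tn : - T < 0 by case: hbad.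
  have tn : t < 0 by apply: le_lt_trans ht _; rewrite pmulr_rlt0.
  have : - t <= sup (S k.+1%:R).
    by apply: ub_le_sup; [exact: hS.2|exists y, s'; rewrite opprK].
  by move: ht hT'; rewrite mulrN (mulrC T) lerNr => h1 h2 h3; have := le_lt_trans h3 h2; rewrite ltNge h1.
have [q hq] := choice hk.
pose b k := jv U (q k).1.1 (q k).1.2; pose c k := b k `^ (1 - p).
pose w k := jscale (b k)^-1 (Num.sqrt (c k)) (q k).1.1 (q k).1.2 U.
pose tau k := - (q k).1.1 / c k.
have qn k : (q k).1.1 < 0 by have [[h _ _] _] := hq k.
have b0 k : 0 < b k by exact: Up.
have c0 k : 0 < c k by rewrite powR_gt0.
have tau0 k : 0 < tau k by rewrite divr_gt0 // oppr_gt0.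
have hw k t x : t < tau k -> [/\ C12 (w k) t x, heat (w k) t x = jv (w k) t x `^ p, 0 <= jv (w k) t x &
    jv (w k) t x <= M * (tau k - t) `^ (- al)] by apply: A_norm.
have ax := apx_exact p1 (evE (fun k => ltW (tau0 k))) hw.
have w00 k : jv (w k) 0 0 = 1 by rewrite /w /= mulr0 scaler0 !addr0 mulVf // lt0r_neq0.
(* The type I bound at the normalised point, where the value is 1, bounds tau by this number. *)
pose B := M `^ (p - 1).
have tauB k : tau k <= B.
  have [_ _ _] := hw k 0 0 (tau0 k); rewrite w00 subr0 => h.
  have k1 : (tau k) `^ al <= M.
    move: h; rewrite powRN ler_pdivlMr ?mul1r //; exact: powR_gt0.
  have <- : (tau k `^ al) `^ (p - 1) = tau k by rewrite -powRrM hal powRr1 // ltW.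
  by apply: powR_le => //; [exact: powR_ge0|exact: ltW (pm1_gt0 p1)].
have [hW hj] := apx_lim p1 hal one1 (ltW M0) ax.
have A_gd : posA (jlim w) -> good A0 (jlim w) e0.
  move=> _ s t x hs ht.
  have uh : ucv (fun k => hes A0 (w k) s t x) (hes A0 (jlim w) s t x).
    have jx := hj t x ht.
    exact: (cc_ucv (ccD (cc_sum (fun i => ccZ (s ord0 i) (cc_sum (fun l => ccZ (s ord0 l) (j_dd jx i l)))))
      (ccZ A0 (cc_sum (fun i => j_dd jx i i))))).
  have up := cc_ucv (jcc_heat (hj t x ht)); have [_ <- _ _] := hW t x ht.
  rewrite -mulNr; apply: ucv_le (ucvZ (- e0) up) uh _.
  (* With tau bounded, sqrt(tau - t) - sqrt(tau) >= -t / D; multiplied by the opening k + 1 of the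
     cone this exceeds |x|, so x rescaled around the bad point lies in the cone. *)
  pose D := 2 * Num.sqrt (B - t).
  have Bt : 0 < B - t by have : 0 < B by [rewrite powR_gt0]; sra1 ht.
  have D0 : 0 < D by rewrite mulr_gt0 // sqrtr_gt0.
  have n1 : 0 < - t / (B + 1) by rewrite divr_gt0 ?oppr_gt0 // ltr_wpDl // powR_ge0.
  have n2 : 0 < - t / D / (`|x| + 1) by rewrite !divr_gt0 ?oppr_gt0 // ltr_wpDl.
  apply: (ev2 _ (ev_inv n1) (ev_inv n2)) => k k1 k2.
  have N0 : 0 < k.+1%:R :> R by [].
  have sc0 : 0 < Num.sqrt (c k) by rewrite sqrtr_gt0.
  have cc : Num.sqrt (c k) ^+ 2 = c k by rewrite sqr_sqrtr // ltW.
  have tt : t < tau k by exact: lt_trans ht (tau0 k).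
  have [_ -> _ _] := hw k t x tt; rewrite hes_scale.
  have -> : jv (w k) t x = (b k)^-1 * jv U ((q k).1.1 + c k * t) ((q k).1.2 + Num.sqrt (c k) *: x) by rewrite /w /= cc.
  rewrite powRM ?invr_ge0 ?(ltW (b0 k)) //; last by apply: ltW; apply: Up; have := qn k; have : c k * t < 0 by [rewrite pmulr_rlt0]; sra1.
  have be : (b k)^-1 `^ p = (b k)^-1 * Num.sqrt (c k) ^+ 2.
    rewrite cc -powR_inv1 ?(ltW (b0 k)) // -powRrM /c -(powRDp (b0 k)); congr (_ `^ _); ring.
  rewrite be cc mulrCA; apply: ler_wpM2l; first by rewrite mulr_ge0 ?invr_ge0 // ltW.
  have [_ [qx qg]] := hq k; rewrite mulNr; apply: qg => //.
    have : - t * k.+1%:R > tau k.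
      apply: le_lt_trans (tauB k) _; rewrite -ltr_pdivrMl ?oppr_gt0 //.
      move: k1; rewrite -[X in _ < X]invrK ltf_pV2 ?posrE ?invr_gt0 // invf_div => k1.
      apply: lt_trans k1; rewrite mulrC ltr_pM2r ?invr_gt0 ?oppr_gt0 //; sra1.
    rewrite /tau ltr_pdivrMr // => h; rewrite mulrDl mul1r lerD2l [leRHS]mulrC ler_pdivlMr //.
    by move: h; set z := k.+1%:R; clear; lra.
  have E : - ((q k).1.1 + c k * t) = c k * (tau k - t) by rewrite /tau; field; exact: lt0r_neq0.
  have E' : - (q k).1.1 = c k * tau k by rewrite /tau; field; exact: lt0r_neq0.
  rewrite E; rewrite E' in qx; rewrite sqrtrM ?(ltW (c0 k)) //; rewrite sqrtrM ?(ltW (c0 k)) // in qx.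
  apply: le_normD; rewrite normrZ (gtr0_norm sc0).
  suff h : `|x| <= k.+1%:R * (Num.sqrt (tau k - t) - Num.sqrt (tau k)).
    have := ler_wpM2l (ltW sc0) h; move: qx; set z := k.+1%:R; sra1.
  have pt : 0 < tau k - t by have := tau0 k; sra1 ht.
  have s1 : 0 < Num.sqrt (tau k - t) by rewrite sqrtr_gt0.
  have dlt : - t / D <= Num.sqrt (tau k - t) - Num.sqrt (tau k).
    rewrite ler_pdivrMr //.
    have sB : Num.sqrt (tau k - t) <= Num.sqrt (B - t) by rewrite ler_sqrt ?lerD2r // ltW.
    have s2 : Num.sqrt (tau k) <= Num.sqrt (tau k - t) by rewrite ler_sqrt ?(ltW pt) //; sra1 ht.
    have q1 : Num.sqrt (tau k - t) ^+ 2 = tau k - t by rewrite sqr_sqrtr // ltW.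
    have q2 : Num.sqrt (tau k) ^+ 2 = tau k by rewrite sqr_sqrtr // ltW.
    rewrite [leLHS](_ : _ = (Num.sqrt (tau k - t) - Num.sqrt (tau k)) * (Num.sqrt (tau k - t) + Num.sqrt (tau k))); last first.
      by rewrite -subr_sqr q1 q2; ring.
    by apply: ler_wpM2l; [rewrite subr_ge0|rewrite /D; sra1 s2 sB].
  apply: (@le_trans _ _ (k.+1%:R * (- t / D))); last by apply: ler_wpM2l.
  move: k2; rewrite -[X in _ < X]invrK ltf_pV2 ?posrE ?invr_gt0 // invf_div => k2.
  rewrite -ler_pdivrMr ?divr_gt0 ?oppr_gt0 //; apply: le_trans (ltW k2).
  by apply: ler_wpM2r; [rewrite invr_ge0 divr_ge0 ?oppr_ge0 // ltW|rewrite lerDl].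
have Wc t x y : t < 0 -> jv (jlim w) t x = jv (jlim w) t y.
  move=> ht; have [z|hp] := A_pos p1 hal (ltW M0) hW; first by rewrite !z.
  exact: (good_const p1 hal (ltW M0) psub n0 hW hp (A_gd hp) x y ht).
have w1 : ev (fun k => jv (w k) 0 0 <= 1) by apply: evE => k; rewrite w00.
pose D := n%:R * n%:R + A0 * n%:R + 1.
have D0 : 0 < D by rewrite ltr_wpDl // addr_ge0 // mulr_ge0 // ltW.
have dp : 0 < e0 / D by rewrite divr_gt0.
have hdd : ev (fun k => forall i j, `|jdd (w k) i j 0 0 - 0| < e0 / D).
  apply: ev_fin => i; apply: ev_fin => j.
  have h := endgame p1 hal M0 ltr01 one1 ax (evE tau0) w1 Wc.
  exact: (h i j _ dp).
have [k h] := ev_ex hdd; have [[_ s1 hbad] _] := hq k.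
have h' i j : `|jdd (w k) i j 0 0| <= e0 / D by have := ltW (h i j); rewrite subr0.
have := hes_bnd n0 (ltW A00) s1 h'; rewrite hes_scale mulr0 scaler0 !addr0 sqr_sqrtr ?(ltW (c0 k)) //.
have : hes A0 U (q k).2 (q k).1.1 (q k).1.2 * ((b k)^-1 * c k) < - e0.
  have pc : 0 < (b k)^-1 * c k by rewrite mulr_gt0 // invr_gt0.
  have := hbad; rewrite -(ltr_pM2r pc) => hh; apply: lt_le_trans hh _; rewrite mulNr lerN2.
  rewrite -powR_inv1 ?(ltW (b0 k)) // /c -!mulrA -!(powRDp (b0 k)) (_ : p + (-1 + (1 - p)) = 0) ?powRr0 ?mulr1 //; ring.
rewrite mulrC ler_norml => h1 /andP[h2 _].
have : (n%:R * n%:R + A0 * n%:R) * (e0 / D) <= e0.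
  rewrite mulrA ler_pdivrMr // mulrC ler_wpM2l ?(ltW e00) // /D; sra1.
sra1 h1 h2.
Qed.

(** Translation in space moves any point to the axis of the cones, so [no_bad0] yields [good]
    everywhere. *)
Lemma liouville U : clA U -> forall t x y, t < 0 -> jv U t x = jv U t y.
Proof.
move=> hU t x y ht; have [z|Up] := A_pos p1 hal (ltW M0) hU; first by rewrite !z.
apply: (good_const p1 hal (ltW M0) psub n0 hU Up) => // s t' x' hs ht'.
have T (s1 : R) (z : V) : 0 + 1 ^+ 2 * s1 = s1 /\ x' + 1 *: z = x' + z by rewrite add0r expr1n mul1r scale1r.
have hU' : clA (jscale 1 1 0 x' U).
  move=> s1 z hs1; have h := hU _ (x' + z) hs1; have [E1 E2] := T s1 z.
  have [C1 C2 C3 C4] := h; split; first by apply: C12_scale => //; rewrite E1 E2.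
  - by rewrite heat_scale E1 E2 expr1n !mul1r C2 /= E1 E2 mul1r.
  - by rewrite /= E1 E2 mul1r.
  - by rewrite /= E1 E2 mul1r.
have Up' : posA (jscale 1 1 0 x' U).
  by move=> s1 z hs1; have [E1 E2] := T s1 z; rewrite /= E1 E2 mul1r; exact: Up.
have := no_bad0 hU' Up' hs ht'; rewrite hes_scale /= expr1n !mul1r add0r scaler0 addr0.
by [].
Qed.

End PointPicking.

(** * Consequences of the hypotheses on f *)

Section Nonlinearity.
Context {R : realType}.
Variables (f : R -> R) (p C : R).
Hypotheses (p1 : 1 < p) (f_ge0 : forall s, 0 <= s -> 0 <= f s) (f_C1 : C1_nneg f)
  (f_as : s `^ (- p) * f s @[s --> +oo] --> (1 : R)) (C0 : 0 < C)
  (f_der : forall s, 0 <= s -> `|derive_nneg f s| <= C * (1 + s `^ (p - 1))).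
Implicit Types s r e d h B : R.

Lemma nneg_inc s e : 0 <= s -> 0 < e -> exists2 d, 0 < d & forall h, `|h| < d -> 0 <= s + h ->
  `|f (s + h) - f s - derive_nneg f s * h| <= e * `|h|.
Proof.
move=> s0 e0; have : diff_quotient_nneg f s h @[h --> within [set h | 0 <= s + h] 0^'] --> derive_nneg f s by exact: f_C1.1 s0.
move=> /cvgrPdist_lt /(_ e e0) /nbhs_ballP[d /= d0 hd]; exists d => // h hh sh.
have [->|hn] := eqVneq h 0; first by rewrite addr0 subrr mulr0 subrr normr0 mulr0.
have := hd h; rewrite /ball /= sub0r normrN => /(_ hh hn sh); rewrite /diff_quotient_nneg => /ltW k.
have -> : f (s + h) - f s - derive_nneg f s * h = - h * (derive_nneg f s - h^-1 * (f (s + h) - f s)) by field.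
by rewrite normrM normrN mulrC ler_wpM2r.
Qed.

Lemma nneg_der s : 0 < s -> is_derive s 1 f (derive_nneg f s).
Proof.
move=> s0; apply/derP => e e0; have [d d0 hd] := nneg_inc (ltW s0) e0.
exists (Num.min d s); first by rewrite lt_min d0.
by move=> h; rewrite lt_min => /andP[h1 h2]; apply: hd => //; move: h2; rewrite ltr_norml => /andP[? _]; lra.
Qed.

(** The mean value theorem applies on (0, B]. At 0 only a one-sided derivative is available; the
    estimate on [h, r] is therefore combined with f(h) -> f(0), which this derivative provides. *)
Lemma nneg_lip B r s : 0 <= r <= B -> 0 <= s <= B -> `|f r - f s| <= C * (1 + B `^ (p - 1)) * `|r - s|.
Proof.
wlog rs : r s / s <= r.
  by move=> H hr hs; have /orP[h|h] := le_total s r; [exact: H|rewrite distrC (distrC r); exact: H].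
move=> /andP[r0 rB] /andP[s0 sB]; set K := C * _.
have K0 : 0 <= K by rewrite mulr_ge0 ?addr_ge0 ?powR_ge0 // ltW.
rewrite (@ger0_norm _ (r - s)) ?subr_ge0 //.
have key z : 0 < z -> z <= r -> `|f r - f z| <= K * (r - z).
  move=> z0 zr; apply: (@itv_lip R f (derive_nneg f)) => // y /andP[y1 y2].
    by apply: nneg_der; exact: lt_le_trans y1.
  have y0 := ltW (lt_le_trans z0 y1).
  apply: le_trans (f_der y0) _; apply: ler_wpM2l; first exact: ltW.
  by rewrite lerD2l; apply: powR_le => //; [exact: le_trans y2 rB|rewrite ltW // subr_gt0].
have [s00|sn] := eqVneq s 0; last by apply: key => //; rewrite lt_neqAle eq_sym sn.
rewrite s00 subr0; have [->|rn] := eqVneq r 0; first by rewrite subrr normr0 mulr0.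
have r1 : 0 < r by rewrite lt_neqAle eq_sym rn.
apply/ler_addgt0Pr => e e0; have [d d0 hd] := nneg_inc (lexx 0) (@ltr01 R).
pose D := `|derive_nneg f 0| + 1; have D0 : 0 < D by rewrite ltr_wpDl.
pose h := Num.min (Num.min (d / 2) r) (e / D).
have h0 : 0 < h by rewrite !lt_min r1 divr_gt0 //= divr_gt0.
have [hd2 hr he] : [/\ h <= d / 2, h <= r & h <= e / D] by rewrite !ge_min !lexx !orbT.
have nh : `|h| = h by rewrite gtr0_norm.
have := hd h; rewrite nh add0r mul1r => hh.
have {}hh : `|f h - f 0 - derive_nneg f 0 * h| <= h by apply: hh; [lra|exact: ltW].
have := key h h0 hr => k1.
have k2 : `|f h - f 0| <= e.
  have -> : f h - f 0 = f h - f 0 - derive_nneg f 0 * h + derive_nneg f 0 * h by ring.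
  apply: le_normD; rewrite normrM nh.
  apply: (@le_trans _ _ (h * D)); first by rewrite /D mulrDr mulr1 (mulrC h); lra.
  by rewrite -ler_pdivlMr.
have -> : f r - f 0 = f r - f h + (f h - f 0) by ring.
apply: le_normD; apply: lerD => //; apply: le_trans k1 _.
by apply: ler_wpM2l => //; lra.
Qed.

(** For large s the asymptotics give the relative error d; on the remaining bounded interval both
    functions are bounded and K absorbs them. *)
Lemma f_near d : 0 < d -> exists2 K, 0 <= K & forall s, 0 <= s -> `|f s - s `^ p| <= d * s `^ p + K.
Proof.
move=> d0; move: f_as => /cvgrPdist_lt /(_ d d0) [s0 [_ hs0]].
pose m := Num.max 1 s0; have m1 : 1 <= m by rewrite le_max lexx.
have ms : s0 <= m by rewrite le_max lexx orbT.
have pp := ltW (lt_trans (@ltr01 R) p1).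
pose B := m + 1; have B0 : 0 <= B by rewrite /B; lra.
have k0 : 0 <= C * (1 + B `^ (p - 1)) by exact: mulr_ge0 (ltW C0) (addr_ge0 ler01 (powR_ge0 _ _)).
have k1 : 0 <= C * (1 + B `^ (p - 1)) * B by exact: mulr_ge0.
exists (f 0 + C * (1 + B `^ (p - 1)) * B + B `^ p) => [|s sp]; first by rewrite !addr_ge0 ?f_ge0 ?powR_ge0.
have K0 : 0 <= f 0 + C * (1 + B `^ (p - 1)) * B + B `^ p by rewrite !addr_ge0 ?f_ge0 ?powR_ge0.
have ds : 0 <= d * s `^ p by rewrite mulr_ge0 ?powR_ge0 // ltW.
have [sB|Bs] := lerP s B.
  have sB' : 0 <= s <= B by rewrite sp.
  have zB : 0 <= (0 : R) <= B by rewrite lexx.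
  have := nneg_lip sB' zB; rewrite subr0 (ger0_norm sp) => k2.
  have k3 : C * (1 + B `^ (p - 1)) * s <= C * (1 + B `^ (p - 1)) * B.
    exact: ler_wpM2l.
  have k4 : s `^ p <= B `^ p by exact: powR_le.
  have k5 := powR_ge0 s p; have k6 := f_ge0 sp; have k7 := f_ge0 (lexx 0).
  move: k2; rewrite ler_norml => /andP[k2 k8].
  rewrite ler_norml; apply/andP; split; lra.
have s00 : 0 < s by rewrite /B in Bs; lra.
have sm : s0 < s by rewrite /B in Bs; lra.
have sP : 0 < s `^ p by exact: powR_gt0.
have := hs0 s sm; rewrite /= powRN => k.
have -> : f s - s `^ p = - s `^ p * (1 - (s `^ p)^-1 * f s) by field; exact: lt0r_neq0.
rewrite normrM normrN (gtr0_norm sP) mulrC.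
apply: (@le_trans _ _ (d * s `^ p)); first by apply: ler_wpM2r; exact: ltW.
by rewrite lerDl.
Qed.

End Nonlinearity.

(** * The given solution as a jet *)

Section Solution.
Context {R : realType} {n : nat}.
Local Notation V := 'rV[R]_n.

(** Otherwise points of K with non-members of D ever closer to them would accumulate at a point of
    the closure of K, which is interior to D. *)
Lemma compact_dist (K D : set V) : compact (closure K) -> closure K `<=` D -> open D ->
  exists2 d : R, 0 < d & forall x y, K x -> `|y - x| <= d -> D y.
Proof.
move=> cK KD oD; apply: contrapT => hn.
have hk (k : nat) : exists q : V * V, [/\ K q.1, `|q.2 - q.1| <= k.+1%:R^-1 :> R & ~ D q.2].
  apply: contrapT => h; apply: hn; exists k.+1%:R^-1; first by rewrite invr_gt0.
  by move=> x y hx hy; apply: contrapT => hD; apply: h; exists (x, y).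
have [q hq] := choice hk.
have [B hB] : exists B : R, forall x, closure K x -> `|x| <= B.
  by have [M [_ hM]] := compact_bounded cK; exists (M + 1) => x hx; apply: hM => //; rewrite ltrDl.
have [|l hl] := @ucvV_ex R n (fun k => (q k).1) B.
  by apply: evE => k; apply: hB; apply: subset_closure; have [] := hq k.
have lK : closure K l.
  move=> N /nbhs_ballP[e /= e0 he]; have [k h] := ev_ex (hl e e0).
  exists (q k).1; split; first by have [] := hq k.
  by apply: he; rewrite -ball_normE /= distrC.
have /nbhs_ballP[e /= e0 he] : nbhs l D by apply: open_nbhs_nbhs; split => //; exact: KD.
have e2 : 0 < e / 2 by lra.
have [k [h1 h2]] := ev_ex (evI (hl _ e2) (ev_inv e2)).
have [_ h3 h4] := hq k; apply: h4; apply: he; rewrite -ball_normE /= distrC.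
have -> : (q k).2 - l = (q k).2 - (q k).1 + ((q k).1 - l) by rewrite addrA subrK.
by apply: lt_normD; move: h1 h2 h3; set z := k.+1%:R^-1; lra.
Qed.

Lemma compact_bnd (K : set V) : compact (closure K) -> exists2 B : R, 0 <= B & forall x, K x -> `|x| <= B.
Proof.
move=> cK; have [M [_ hM]] := compact_bounded cK; exists (`|M| + 1) => [|x hx]; first by rewrite addr_ge0.
by apply: (hM (`|M| + 1)); [rewrite ltr_pwDr // ler_norm|exact: subset_closure].
Qed.

Definition sol_jet (u : R -> V -> R) : @jf R n := Jf u (time_derivative u) (fun i t => partial i (u t))
  (fun i l t => partial l (partial i (u t))).

Lemma derivable_pd v (F : V -> R) x : derivable F x v -> pd v F x ('D_v F x).
Proof.
move=> /cvgrPdist_lt h; apply/derP => e e0; have /nbhs_ballP[d /= d0 hd] := h e e0.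
exists d => // s hs; have [->|sn] := eqVneq s 0; first by rewrite !addr0 subrr mulr0 subrr normr0 mulr0.
have := hd s; rewrite /ball /= sub0r normrN => /(_ hs sn) /ltW k.
rewrite add0r scale0r addr0.
have -> : F (x + s *: v) - F x - 'D_v F x * s = - s * ('D_v F x - s^-1 *: (F (s *: v + x) - F x)).
  by rewrite [s *: v + x]addrC /GRing.scale /=; field.
by rewrite normrM normrN mulrC ler_wpM2r.
Qed.

Lemma cyl_jc (T : R) (Om : set V) F t x : continuous_on_cylinder T Om F -> 0 < t < T -> Om x -> jc F t x.
Proof.
move=> hF ht hx e e0.
have /hF /cvgrPdist_lt /(_ e e0) /nbhs_ballP[d /= d0 hd] : (`]0, T[ `*` Om) (t, x) by split => //=; rewrite in_itv.
exists d => // s y hs hy; rewrite distrC; apply: (hd (s, y)).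
by split; rewrite /= -ball_normE /= distrC.
Qed.

Lemma sol_C12 (T : R) (Om : set V) u t x : C12_on_cylinder T Om u -> 0 < t < T -> Om x -> C12 (sol_jet u) t x.
Proof.
move=> [h1 h2 h3 h4 h5] ht hx; have [d1 d2 d3] := h1 t x ht hx; split.
- by rewrite /sol_jet /= /time_derivative derive1E; exact: derivableP d1.
- by move=> i; exact: derivable_pd (d2 i).
- by move=> i l; exact: derivable_pd (d3 i l).
- exact: cyl_jc h2 ht hx.
- exact: cyl_jc h3 ht hx.
- by move=> i; exact: cyl_jc (h4 i) ht hx.
- by move=> i l; exact: cyl_jc (h5 i l) ht hx.
Qed.

(** Subcriticality without division and uniform in the dimension, in the form that makes the
    coefficient in [pohozaev] positive. *)
Lemma sobolev_sub (p : R) : 1 < p -> (p%:E < sobolev_exponent R n)%E -> n%:R * (p - 1) < 2 * (p + 1).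
Proof.
rewrite /sobolev_exponent => p1; case: ifP => [n2 _|/negbT]; last first.
  rewrite -ltnNge => n2; rewrite lte_fin => h.
  have m0 : 0 < (n - 2)%:R :> R by rewrite ltr0n subn_gt0.
  by move: h; rewrite ltr_pdivlMr // natrB ?(ltnW n2) // natrD; lra.
have : n%:R <= 2 :> R by rewrite ler_nat.
have : 0 < p - 1 by rewrite subr_gt0.
nra.
Qed.

End Solution.

(** * Rescaling at the bad points *)

Section Blowup.
Context {R : realType} {n : nat}.
Local Notation V := 'rV[R]_n.
Variables (p al T g Lv c0 cm d1 Mu C : R) (f : R -> R) (pot : V -> R) (u : R -> V -> R) (Om D : set V).
Hypotheses (p1 : 1 < p) (hal : al * (p - 1) = 1) (T0 : 0 < T) (hg : 0 < g <= 1) (Lv0 : 0 <= Lv) (c00 : 0 < c0)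
  (d10 : 0 < d1) (Mu0 : 0 < Mu) (C0 : 0 < C) (f_ge0 : forall s, 0 <= s -> 0 <= f s)
  (f_lip : forall B r s, 0 <= r <= B -> 0 <= s <= B -> `|f r - f s| <= C * (1 + B `^ (p - 1)) * `|r - s|)
  (f_nr : forall d, 0 < d -> exists2 K, 0 <= K & forall s, 0 <= s -> `|f s - s `^ p| <= d * s `^ p + K)
  (DO : D `<=` Om) (pot_h : forall x y, D x -> D y -> `|pot x - pot y| <= Lv * `|x - y| `^ g)
  (u_sol : classical_solution T Om pot f u) (u0 : forall t x, 0 < t < T -> Om x -> 0 <= u t x)
  (u_I : forall t x, T / 4 < t < T -> D x -> u t x <= Mu * (T - t) `^ (- al)).
Variables (ts mu : nat -> R) (xs : nat -> V).
Hypotheses (hts : forall k, T / 2 <= ts k < T) (xD : forall k y, `|y - xs k| <= d1 -> D y /\ c0 <= pot y <= cm)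
  (mu1 : forall k, 1 <= mu k) (mu_u : forall k, u (ts k) (xs k) <= mu k) (mu_oo : forall B, ev (fun k => B < mu k)).
Implicit Types (t r s e B d : R) (x y : V) (k : nat).

Let vk k := pot (xs k).
(** The square of the space scale normalises both the amplitude mu and the potential, so that the
    rescaled source tends to r^p. [tau] is the rescaled time left until T. [L] is the rescaled room
    available: from T/2 down to T/4, where the type I bound starts, and the radius d1 within D. *)
Let c k := mu k `^ (1 - p) / vk k.
Let l k := Num.sqrt (c k).
Let tau k := (T - ts k) / c k.
Let L k := Num.min (T / (4 * c k)) (d1 / l k).
Let F k r := mu k `^ (- p) * f (mu k * r).
Let G k x r := pot (xs k + l k *: x) / vk k * F k r.
Let w k := jscale (mu k)^-1 (l k) (ts k) (xs k) (sol_jet u).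

Let xD0 k : D (xs k) /\ c0 <= vk k <= cm.
Proof. by apply: (@xD k (xs k)); rewrite subrr normr0 ltW. Qed.
Let vk0 k : 0 < vk k.
Proof. by have [_ /andP[h _]] := xD0 k; exact: lt_le_trans h. Qed.
Let cm0 : 0 < cm.
Proof. by have [_ /andP[h1 h2]] := xD0 0%N; apply: lt_le_trans c00 (le_trans h1 h2). Qed.
Let mu0 k : 0 < mu k.
Proof. exact: lt_le_trans ltr01 (mu1 k). Qed.
Let ck0 k : 0 < c k.
Proof. by rewrite divr_gt0 // powR_gt0. Qed.
Let lk0 k : 0 < l k.
Proof. by rewrite sqrtr_gt0. Qed.
Let l2 k : l k ^+ 2 = c k.
Proof. by rewrite sqr_sqrtr // ltW. Qed.
Let tau0 k : 0 < tau k.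
Proof. by rewrite divr_gt0 // subr_gt0; case/andP: (hts k). Qed.

Let mu_p k q : 0 <= q -> mu k `^ (- q) <= 1.
Proof. by move=> q0; rewrite powRN invf_le1 ?powR_gt0 // powR_ge1. Qed.

Let mu_p0 e : 0 < e -> ev (fun k => mu k `^ (1 - p) < e).
Proof.
move=> e0; apply: evS (mu_oo (e^-1 `^ al)) => k h.
have e1 : 0 < e^-1 by rewrite invr_gt0.
have : (e^-1 `^ al) `^ (p - 1) < mu k `^ (p - 1).
  by apply: gt0_ltr_powR => //; rewrite ?subr_gt0 // nnegrE ?powR_ge0 // ltW.
rewrite -powRrM hal powRr1 ?(ltW e1) // => h2; rewrite -opprB powRN -[e]invrK ltf_pV2 // posrE ?powR_gt0 //.
Qed.

Let l_0 e : 0 < e -> ev (fun k => l k < e).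
Proof.
move=> e0; have h0 : 0 < e ^+ 2 * c0 by rewrite mulr_gt0 // exprn_gt0.
apply: evS (mu_p0 h0) => k h; rewrite -(@ltr_pXn2r _ 2) ?nnegrE ?(ltW e0) ?(ltW (lk0 k)) // l2 ltr_pdivrMr //.
apply: lt_le_trans h _; rewrite ler_wpM2l ?sqr_ge0 //; by have [_ /andP[]] := xD0 k.
Qed.

Let c_0 e : 0 < e -> ev (fun k => c k < e).
Proof.
move=> e0; apply: (ev2 _ (l_0 (@ltr01 R)) (l_0 e0)) => k h1 h2.
by rewrite -l2 expr2; apply: le_lt_trans h2; rewrite ler_piMl // ltW.
Qed.

Let L_oo B : ev (fun k => B < L k).
Proof.
have e1 : 0 < T / (4 * (`|B| + 1)) by rewrite divr_gt0 // mulr_gt0.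
have e2 : 0 < d1 / (`|B| + 1) by rewrite divr_gt0.
apply: (ev2 _ (c_0 e1) (l_0 e2)) => k h1 h2; apply: (@le_lt_trans _ _ `|B|); first exact: ler_norm.
apply: (@lt_le_trans _ _ (`|B| + 1)); first by rewrite ltrDl.
rewrite /L le_min; apply/andP; split; rewrite ler_pdivlMr ?(mulr_gt0 (ltr0Sn R 3) (ck0 k)) //; last by move: h2; rewrite ltr_pdivlMr // mulrC => /ltW.
by move: h1; rewrite ltr_pdivlMr ?mulr_gt0 // => /ltW; lra.
Qed.

Let L_x k x : `|x| < L k -> D (xs k + l k *: x) /\ c0 <= pot (xs k + l k *: x) <= cm.
Proof.
rewrite /L lt_min => /andP[_ h]; apply: (@xD k); rewrite addrCK normrZ (gtr0_norm (lk0 k)) mulrC -ler_pdivlMr //; exact: ltW.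
Qed.

(** The growth condition on f' is invariant under the rescaling, up to the factor mu^(1 - p) <= 1 on
    its constant term. *)
Let F_lip k B r s : 0 <= r <= B -> 0 <= s <= B -> `|F k r - F k s| <= C * (1 + B `^ (p - 1)) * `|r - s|.
Proof.
move=> /andP[r0 rB] /andP[s0 sB]; rewrite /F -mulrBr normrM (gtr0_norm (powR_gt0 _ (mu0 k))).
have B0 := le_trans r0 rB.
have h1 : 0 <= mu k * r <= mu k * B by rewrite mulr_ge0 ?(ltW (mu0 k)) // ler_pM2l.
have h2 : 0 <= mu k * s <= mu k * B by rewrite mulr_ge0 ?(ltW (mu0 k)) // ler_pM2l.
apply: le_trans (ler_wpM2l (powR_ge0 _ _) (f_lip h1 h2)) _.
rewrite -mulrBr normrM (gtr0_norm (mu0 k)) powRM ?(ltW (mu0 k)) //.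
have E1 : mu k `^ (- p) * mu k = mu k `^ (1 - p).
  by rewrite -[X in _ * X]powRr1 ?(ltW (mu0 k)) // -(powRDp (mu0 k)) addrC.
have E2 : mu k `^ (1 - p) * mu k `^ (p - 1) = 1.
  by rewrite -(powRDp (mu0 k)) (_ : 1 - p + (p - 1) = 0) ?powRr0 //; ring.
have -> : mu k `^ (- p) * (C * (1 + mu k `^ (p - 1) * B `^ (p - 1)) * (mu k * `|r - s|)) =
    C * ((mu k `^ (- p) * mu k) + (mu k `^ (- p) * mu k) * mu k `^ (p - 1) * B `^ (p - 1)) * `|r - s| by ring.
rewrite E1 E2 mul1r; apply: ler_wpM2r => //; apply: ler_wpM2l; first exact: ltW.
by rewrite lerD2r -opprB; apply: mu_p; rewrite ltW // subr_gt0.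
Qed.

Let mu_pp k r : 0 <= r -> mu k `^ (- p) * (mu k * r) `^ p = r `^ p.
Proof.
move=> r0; rewrite powRM ?(ltW (mu0 k)) // mulrA -(powRDp (mu0 k)) addNr powRr0 mul1r //.
Qed.

Let F_nr d K : (forall s, 0 <= s -> `|f s - s `^ p| <= d * s `^ p + K) ->
  forall k r, 0 <= r -> `|F k r - r `^ p| <= d * r `^ p + K * mu k `^ (- p).
Proof.
move=> h k r r0; rewrite -(mu_pp k r0) /F -mulrBr normrM (gtr0_norm (powR_gt0 _ (mu0 k))) mulrCA [K * _]mulrC -mulrDr.
by apply: ler_wpM2l; [exact: powR_ge0|apply: h; rewrite mulr_ge0 // ltW].
Qed.

Let F_gr : exists2 K, 0 < K & forall k r, 0 <= r -> 0 <= F k r <= K * (r `^ p + 1).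
Proof.
have [K K0 hK] := f_nr (@ltr01 R); exists (2 + K) => [|k r r0]; first by rewrite ltr_wpDr.
have m0 := ltW (mu0 k); have rp := powR_ge0 r p.
apply/andP; split; first by rewrite mulr_ge0 ?powR_ge0 // f_ge0 // mulr_ge0.
have := F_nr hK k r0; have pp : 0 <= p := ltW (lt_trans ltr01 p1); have := mu_p k pp => h1.
have := ler_wpM2l K0 h1; have := mulr_ge0 K0 rp; rewrite ler_norml => h2 h3 /andP[_ h4].
by move: h2 h3 h4; rewrite mul1r; lra.
Qed.

(** The factor cm^al in the type I constant comes from normalising the potential by its value at the
    centre. *)
Let w_at k t x : - L k < t < tau k -> `|x| < L k ->
  [/\ C12 (w k) t x, heat (w k) t x = G k x (jv (w k) t x), 0 <= jv (w k) t x &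
      jv (w k) t x <= Mu * cm `^ al * (tau k - t) `^ (- al)].
Proof.
move=> /andP[t1 t2] hx; have [Dy /andP[py1 py2]] := L_x hx; have Oy := DO Dy.
have /andP[h1 h2] := hts k.
have s1 : T / 4 < ts k + l k ^+ 2 * t.
  have : - (T / (4 * c k)) < t by apply: le_lt_trans t1; rewrite lerN2 /L ge_min lexx.
  rewrite l2 -(ltr_pM2l (ck0 k)) mulrN (_ : c k * _ = T / 4); last by field; exact: lt0r_neq0.
  by have := h1; lra.
have s2 : ts k + l k ^+ 2 * t < T.
  by move: t2; rewrite l2 ltr_pdivlMr // mulrC ltrBrDl.
set s := ts k + _ in s1 s2 *; set y := xs k + _ in Dy py1 py2 Oy.
have s01 : 0 < s < T by rewrite s2 andbT; apply: lt_trans s1; rewrite divr_gt0.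
have [uC ueq] := u_sol; have us := u0 s01 Oy.
have wv : jv (w k) t x = (mu k)^-1 * u s y by [].
have hy : heat (sol_jet u) s y = pot y * f (u s y).
  rewrite /heat /= ueq // /laplacian addrAC subrr add0r //.
split.
- exact: (@C12_scale R n (mu k)^-1 (l k) (ts k) (xs k) (sol_jet u) t x (lk0 k) (sol_C12 uC s01 Oy)).
- rewrite heat_scale -/s -/y hy wv /G -/y /F mulVKf ?lt0r_neq0 // l2.
  have E : (mu k)^-1 * mu k `^ (1 - p) = mu k `^ (- p).
    by rewrite -powR_inv1 ?(ltW (mu0 k)) // -(powRDp (mu0 k)); congr (_ `^ _); ring.
  by rewrite /c -E; ring.
- by rewrite wv mulr_ge0 // invr_ge0 ltW.
rewrite wv ler_pdivrMl //; have sT : T / 4 < s < T by rewrite s1.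
apply: le_trans (u_I sT Dy) _.
have -> : T - s = c k * (tau k - t) by rewrite /s /tau l2; field; exact: lt0r_neq0.
have tt : 0 <= tau k - t by rewrite subr_ge0 ltW.
rewrite powRM ?(ltW (ck0 k)) // /c powRM ?powR_ge0 ?invr_ge0 ?(ltW (vk0 k)) //.
rewrite -powRrM (_ : (1 - p) * - al = 1) ?powRr1 ?(ltW (mu0 k)) //; last by have := hal; rewrite mulrBr mulr1; lra.
have -> : (vk k)^-1 `^ (- al) = vk k `^ al.
  by rewrite -powR_inv1 ?(ltW (vk0 k)) // -powRrM mulN1r opprK.
rewrite -!mulrA mulrCA; apply: ler_wpM2l; first exact: ltW.
apply: ler_wpM2l; first exact: ltW.
apply: ler_wpM2r; first exact: powR_ge0.
by apply: powR_le; [exact: ltW|have [_ /andP[]] := xD0 k|exact: ltW (al_gt0 p1 hal)].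
Qed.

Let w_apx : exists2 C1, 0 < C1 & apx p al g C1 (Mu * cm `^ al) w G tau L.
Proof.
have [K K0 hK] := F_gr; have pp : 0 <= p := ltW (lt_trans ltr01 p1).
have cc : 0 < cm / c0 by rewrite divr_gt0.
have [g0 g1] := andP hg.
have vle k b : 0 <= b -> b / vk k <= b / c0.
  by move=> b0; apply: ler_wpM2l => //; rewrite lef_pV2 ?posrE //; have [_ /andP[]] := xD0 k.
have bB B x : `|x| <= B -> `|x| <= `|B| by move=> h; apply: le_trans h (ler_norm B).
exists (cm / c0 * K); first by rewrite mulr_gt0.
split.
- exact: L_oo.
- by apply: evE => k; exact: ltW.
- by apply: evE => k t x; exact: w_at.
- move=> B0; pose B := `|B0|; have Bp := powR_ge0 B p; have Bq := powR_ge0 B (p - 1).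
  have K1 : 0 <= Lv / c0 * (K * (B `^ p + 1)) by rewrite mulr_ge0 ?divr_ge0 ?mulr_ge0 ?addr_ge0 // ltW.
  have K2 : 0 <= cm / c0 * (C * (1 + B `^ (p - 1))) := mulr_ge0 (ltW cc) (mulr_ge0 (ltW C0) (addr_ge0 ler01 Bq)).
  exists (Lv / c0 * (K * (B `^ p + 1)) + cm / c0 * (C * (1 + B `^ (p - 1)))); first exact: addr_ge0.
  apply: (ev2 _ (L_oo B) (l_0 (@ltr01 R))) => k k1 k2 x x' r r' /bB hx /bB hx' /andP[r0 rB] /andP[r'0 r'B].
  have rb : 0 <= r <= B by rewrite r0; exact: le_trans rB (ler_norm _).
  have rb' : 0 <= r' <= B by rewrite r'0; exact: le_trans r'B (ler_norm _).
  have [Dx _] := L_x (le_lt_trans hx k1); have [Dx' /andP[v1 v2]] := L_x (le_lt_trans hx' k1).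
  have -> : G k x r - G k x' r' = (pot (xs k + l k *: x) - pot (xs k + l k *: x')) / vk k * F k r +
      pot (xs k + l k *: x') / vk k * (F k r - F k r') by rewrite /G; ring.
  have a1 : `|(pot (xs k + l k *: x) - pot (xs k + l k *: x')) / vk k * F k r| <= Lv / c0 * (K * (B `^ p + 1)) * `|x - x'| `^ g.
    have /andP[Fr0 Fr1] := hK k r r0.
    rewrite normrM normrM normfV (gtr0_norm (vk0 k)) (ger0_norm Fr0) [leRHS]mulrAC; apply: ler_pM => //.
    - by rewrite divr_ge0 // ltW.
    - apply: le_trans (vle k _ (normr_ge0 _)) _; rewrite mulrAC ler_pM2r ?invr_gt0 //.
      apply: le_trans (pot_h Dx Dx') _; apply: ler_wpM2l => //; apply: powR_le; [by []| |exact: ltW].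
      by rewrite opprD addrACA subrr add0r -scalerBr normrZ (gtr0_norm (lk0 k)) ler_piMl // ltW.
    apply: le_trans Fr1 _; apply: ler_wpM2l; first exact: ltW.
    by rewrite lerD2r; apply: powR_le => //; case/andP: rb.
  have a2 : `|pot (xs k + l k *: x') / vk k * (F k r - F k r')| <= cm / c0 * (C * (1 + B `^ (p - 1))) * `|r - r'|.
    have v0 : 0 <= pot (xs k + l k *: x') by apply: le_trans v1; exact: ltW.
    rewrite normrM -mulrA; apply: ler_pM => //; last exact: F_lip.
    rewrite ger0_norm ?divr_ge0 ?(ltW (vk0 k)) //; apply: le_trans (vle k _ v0) _.
    by rewrite ler_pM2r ?invr_gt0.
  apply: le_normD; rewrite [leRHS]mulrDl; apply: lerD.
    by apply: le_trans a1 _; apply: ler_wpM2l => //; rewrite lerDl.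
  by apply: le_trans a2 _; apply: ler_wpM2l => //; rewrite lerDr powR_ge0.
- move=> B0 e e0; pose B := `|B0|; have B00 : 0 <= B := normr_ge0 B0; have Bp := powR_ge0 B p.
  have e3 : 0 < e / 3 / (B `^ p + 1) by rewrite !divr_gt0 // ltr_wpDl.
  have [Kd Kd0 hKd] := f_nr e3.
  have q0 : 0 < (Lv / c0 * (K * (B `^ p + 1)) + 1) by rewrite ltr_wpDl // mulr_ge0 ?divr_ge0 ?mulr_ge0 ?addr_ge0 // ltW.
  (* For l < d the Hoelder oscillation of the potential over |x| <= B contributes at most e/3. *)
  pose d := (e / 3 / (Lv / c0 * (K * (B `^ p + 1)) + 1)) `^ g^-1 / (B + 1).
  have d0 : 0 < d by rewrite divr_gt0 ?ltr_wpDl // powR_gt0 // !divr_gt0.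
  have e4 : 0 < e / 3 / (Kd + 1) by rewrite !divr_gt0 // ltr_wpDl.
  apply: (ev2 _ (evI (L_oo B) (l_0 d0)) (mu_p0 e4)) => k [k1 k2] k3 x r /bB hx /andP[r0 rB].
  have rb : r <= B by exact: le_trans rB (ler_norm _).
  have [Dx _] := L_x (le_lt_trans hx k1); have [Dx0 _] := xD0 k.
  have /andP[Fr0 Fr1] := hK k r r0.
  have rp : r `^ p <= B `^ p by apply: powR_le.
  have -> : G k x r - r `^ p = (pot (xs k + l k *: x) - vk k) / vk k * F k r + (F k r - r `^ p).
    by rewrite /G; field; exact: lt0r_neq0.
  have a1 : `|(pot (xs k + l k *: x) - vk k) / vk k * F k r| <= e / 3.
    rewrite normrM normrM normfV (gtr0_norm (vk0 k)) (ger0_norm Fr0).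
    apply: (@le_trans _ _ (Lv * (e / 3 / (Lv / c0 * (K * (B `^ p + 1)) + 1)) / c0 * (K * (B `^ p + 1)))).
      apply: ler_pM => //; first by rewrite divr_ge0 // ltW.
        apply: le_trans (vle k _ (normr_ge0 _)) _; rewrite ler_pM2r ?invr_gt0 //.
        apply: le_trans (pot_h Dx Dx0) _; apply: ler_wpM2l => //.
        rewrite addrCK normrZ (gtr0_norm (lk0 k)).
        have -> : e / 3 / (Lv / c0 * (K * (B `^ p + 1)) + 1) = ((e / 3 / (Lv / c0 * (K * (B `^ p + 1)) + 1)) `^ g^-1) `^ g.
          by rewrite -powRrM mulVf ?lt0r_neq0 // powRr1 // ltW // !divr_gt0.
        apply: powR_le; [by rewrite mulr_ge0 // ltW| |exact: ltW].
        apply: (@le_trans _ _ (d * (B + 1))); last by rewrite divfK // lt0r_neq0 // ltr_wpDl.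
        apply: ler_pM => //; [exact: ltW|exact: ltW|by apply: (le_trans hx); rewrite lerDl].
      apply: le_trans Fr1 _; apply: ler_wpM2l; first exact: ltW.
      by rewrite lerD2r.
    set Q := Lv / c0 * _ in q0 *; have Q0 : Q / (Q + 1) <= 1 by rewrite ler_pdivrMr // mul1r lerDl.
    have -> : Lv * (e / 3 / (Q + 1)) / c0 * (K * (B `^ p + 1)) = e / 3 * (Q / (Q + 1)) by rewrite {2}/Q; ring.
    by rewrite ler_piMr // divr_ge0 // ltW.
  have a2 := F_nr hKd k r0.
  have a3 : e / 3 / (B `^ p + 1) * r `^ p <= e / 3.
    rewrite -mulrA ler_piMr ?divr_ge0 ?(ltW e0) // mulrC ler_pdivrMr ?ltr_wpDl // mul1r; apply: (le_trans rp); by rewrite lerDl.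
  have a4 : Kd * mu k `^ (- p) < e / 3.
    apply: (@le_lt_trans _ _ (Kd * mu k `^ (1 - p))); first by apply: ler_wpM2l => //; apply: ler_powR => //; rewrite lerDr.
    apply: (@le_lt_trans _ _ ((Kd + 1) * mu k `^ (1 - p))); first by apply: ler_wpM2r; [exact: powR_ge0|rewrite lerDl].
    by rewrite mulrC -ltr_pdivlMr // ltr_wpDl.
  by apply: lt_normD; move: a1 a2 a3 a4; lra.
apply: evE => k x r hx r0; have /andP[Fr0 Fr1] := hK k r r0.
have [_ /andP[v1 v2]] := L_x hx; have v0 : 0 <= pot (xs k + l k *: x) by apply: le_trans v1; exact: ltW.
apply/andP; split; first by rewrite mulr_ge0 // divr_ge0 // ltW.
rewrite /G -[leRHS]mulrA; apply: ler_pM => //; first by rewrite divr_ge0 // ltW.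
by apply: le_trans (vle k _ v0) _; rewrite ler_pM2r ?invr_gt0.
Qed.

Hypotheses (n0 : (0 < n)%N) (psub : n%:R * (p - 1) < 2 * (p + 1)).

(** [liouville] and [endgame] apply to the rescalings, whose value u / mu at the origin is at most
    1. Scaling back produces mu^p times the potential, which is at most cm. *)
Lemma blowup_flat e : 0 < e -> ev (fun k => `|laplacian (u (ts k)) (xs k)| < e * mu k `^ p).
Proof.
move=> e0; have [C1 C10 ax] := w_apx.
have M0 : 0 < Mu * cm `^ al by rewrite mulr_gt0 // powR_gt0.
have [hW _] := apx_lim p1 hal hg (ltW M0) ax.
have Wc t x y : t < 0 -> jv (jlim w) t x = jv (jlim w) t y by exact: (liouville p1 hal M0 psub n0 hW).
have w1 : ev (fun k => jv (w k) 0 0 <= 1).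
  by apply: evE => k; rewrite /w /= mulr0 scaler0 !addr0 ler_pdivrMl // mulr1.
have ec : 0 < e / cm by rewrite divr_gt0.
have S0 : ucv (fun k => \sum_i jdd (w k) i i 0 0) (\sum_(i < n) 0).
  by apply: ucv_sum => i; exact: (endgame p1 hal M0 C10 hg ax (evE tau0) w1 Wc).
rewrite big1 // in S0; apply: evS (S0 _ ec) => k; rewrite subr0.
have -> : \sum_i jdd (w k) i i 0 0 = (mu k)^-1 * c k * laplacian (u (ts k)) (xs k).
  by rewrite /w /= mulr0 scaler0 !addr0 -mulr_sumr l2.
have mp : 0 < mu k `^ p by rewrite powR_gt0.
have -> : (mu k)^-1 * c k = (mu k `^ p * vk k)^-1.
  rewrite invfM /c mulrA -powRN; congr (_ / _).
  by rewrite -powR_inv1 ?(ltW (mu0 k)) // -(powRDp (mu0 k)); congr (_ `^ _); ring.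
have mv : 0 < mu k `^ p * vk k by rewrite mulr_gt0.
rewrite normrM normfV (gtr0_norm mv) ltr_pdivrMl // => h; apply: lt_le_trans h _.
have -> : mu k `^ p * vk k * (e / cm) = e * mu k `^ p * (vk k / cm) by ring.
rewrite ler_piMr ?mulr_ge0 ?(ltW e0) ?(ltW mp) // ler_pdivrMr // mul1r; by have [_ /andP[]] := xD0 k.
Qed.

End Blowup.

Theorem theorem1p2 (R : realType) (n : nat) (n_gt0 : (0 < n)%N)
  (Omega : set 'rV[R]_n) (domain_Omega : domain Omega)
  (T : R) (T_gt0 : 0 < T)
  (p : R) (p_gt1 : 1 < p) (p_subcritical : (p%:E < sobolev_exponent R n)%E)
  (alpha : R) (alphaE : alpha = 1 / (p - 1))
  (f : R -> R) (f_ge0 : forall s, 0 <= s -> 0 <= f s) (f_C1 : C1_nneg f)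
  (f_asymptotic : s `^ (- p) * f s @[s --> +oo] --> (1 : R))
  (f'_growth : exists C : R, 0 < C /\
     forall s, 0 <= s -> `|derive_nneg f s| <= C * (1 + s `^ (p - 1)))
  (V : 'rV[R]_n -> R) (V_ge0 : forall x, closure Omega x -> 0 <= V x)
  (V_hoelder : hoelder_continuous_on (closure Omega) V)
  (omega D : set 'rV[R]_n) (open_omega : open omega) (open_D : open D)
  (omega_D : compactly_included omega D)
  (D_Omega : compactly_included D Omega)
  (V_lower : exists c0 : R, 0 < c0 /\ forall x, D x -> c0 <= V x)
  (u : R -> 'rV[R]_n -> R)
  (u_ge0 : forall t x, 0 < t < T -> Omega x -> 0 <= u t x)
  (u_solution : classical_solution T Omega V f u)
  (u_typeI : exists M : R, 0 < M /\
     forall t x, T / 4 < t < T -> D x -> u t x <= M * (T - t) `^ (- alpha)) :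
  forall epsilon : R, 0 < epsilon ->
    exists C_epsilon : R, 0 < C_epsilon /\
      forall t x, T / 2 <= t < T -> omega x ->
        `|time_derivative u t x - V x * f (u t x)|
          <= epsilon * u t x `^ p + C_epsilon.
Proof.
move=> eps eps0; apply: contrapT => hn.
have pm : 0 < p - 1 by rewrite subr_gt0.
have pp : 0 < p := lt_trans ltr01 p_gt1.
have hal : alpha * (p - 1) = 1 by rewrite alphaE; field; exact: lt0r_neq0.
have [C [C0 hC]] := f'_growth; have [M [M0 hM]] := u_typeI; have [c0 [c00 hc0]] := V_lower.
have [g [Lv [g0 g1 Lv0 hV]]] := V_hoelder; have hg : 0 < g <= 1 by rewrite g0.
have DO : D `<=` Omega by move=> x Dx; apply: D_Omega.2; exact: subset_closure.
have hVD x y : D x -> D y -> `|V x - V y| <= Lv * `|x - y| `^ g.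
  by move=> /DO Dx /DO Dy; apply: hV; exact: subset_closure.
have [d1 d10 hd1] := compact_dist omega_D.1 omega_D.2 open_D.
have [Bw Bw0 hBw] := compact_bnd omega_D.1.
(* Each candidate 1, 2, 3, ... for the constant fails at some point. *)
have hk (k : nat) : exists q : R * 'rV[R]_n, [/\ T / 2 <= q.1 < T, omega q.2 &
    eps * u q.1 q.2 `^ p + k.+1%:R < `|time_derivative u q.1 q.2 - V q.2 * f (u q.1 q.2)|].
  apply: contrapT => h; apply: hn; exists k.+1%:R; split => // t x ht hx.
  by rewrite leNgt; apply/negP => hlt; apply: h; exists (t, x).
have [q hq] := choice hk.
(* The second entry of the maximum forces mu to infinity even where u stays bounded, and it keeps
   mu^p <= u^p + k + 1. *)
pose ts k := (q k).1; pose xs k := (q k).2; pose mu k := Num.max (u (ts k) (xs k)) (k.+1%:R `^ p^-1).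
(* Upper bound for V on the d1-neighbourhood of omega, from the Hoelder condition and the
   boundedness of omega. *)
pose cm := V (xs 0%N) + Lv * (d1 + 2 * Bw) `^ g.
have om k : omega (xs k) by have [] := hq k.
have hts k : T / 2 <= ts k < T by have [] := hq k.
have xD k y : `|y - xs k| <= d1 -> D y /\ c0 <= V y <= cm.
  move=> hy; have Dy := hd1 _ _ (om k) hy; split => //; rewrite hc0 //= /cm.
  have Dx : D (xs 0%N) by apply: (hd1 _ _ (om 0%N)); rewrite subrr normr0 ltW.
  have := hVD _ _ Dy Dx => h1; have : `|y - xs 0%N| <= d1 + 2 * Bw.
    have -> : y - xs 0%N = y - xs k + (xs k - xs 0%N) by rewrite addrA subrK.
    apply: le_normD; apply: lerD => //; apply: le_normB.
    by have := hBw _ (om k); have := hBw _ (om 0%N); lra.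
  move=> /(@powR_le R _ _ g (normr_ge0 _)) /(_ (ltW g0)) /(ler_wpM2l Lv0) h2.
  by have := le_trans h1 h2; rewrite ler_norml => /andP[_ h3]; rewrite -lerBlDl.
have k1 (k : nat) : 1 <= k.+1%:R :> R by rewrite ler1n.
have mu1 k : 1 <= mu k by rewrite le_max powR_ge1 ?orbT // invr_ge0 ltW.
have mu_u k : u (ts k) (xs k) <= mu k by rewrite le_max lexx.
have mu_oo B : ev (fun k => B < mu k).
  apply: evS (ev_ge (Num.truncn (`|B| `^ p)).+1) => k hk'.
  apply: (@le_lt_trans _ _ `|B|); first exact: ler_norm.
  rewrite lt_max; apply/orP; right.
  have -> : `|B| = (`|B| `^ p) `^ p^-1 by rewrite -powRrM mulfV ?powRr1 // lt0r_neq0.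
  apply: gt0_ltr_powR; rewrite ?invr_gt0 ?nnegrE ?powR_ge0 //.
  by apply: lt_le_trans (truncnS_gt _) _; rewrite ler_nat; exact: leqW.
have f_lip := nneg_lip p_gt1 f_C1 C0 hC; have f_nr := f_near p_gt1 f_ge0 f_C1 f_asymptotic C0 hC.
have psub := sobolev_sub p_gt1 p_subcritical.
(* This factor is at most eps in front of u^p and at most 1 in front of k + 1, so both parts of the
   bound for mu^p fit. *)
have m0 : 0 < Num.min eps 1 by rewrite lt_min eps0 ltr01.
have [k] := ev_ex (blowup_flat p_gt1 hal T_gt0 hg Lv0 c00 d10 M0 C0 f_ge0 f_lip f_nr DO hVD u_solution u_ge0 hM
  hts xD mu1 mu_u mu_oo n_gt0 psub m0).
have [/andP[t1 t2] _ hv] := hq k; rewrite -/(ts k) -/(xs k) in t1 t2 hv.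
have Ox : Omega (xs k) by apply: DO; apply: (hd1 _ _ (om k)); rewrite subrr normr0 ltW.
have ht : 0 < ts k < T by rewrite t2 andbT; apply: lt_le_trans t1; rewrite divr_gt0.
(* By the equation, the quantity to be estimated is the Laplacian of u. *)
rewrite u_solution.2 // addrK in hv; move=> h; have := lt_trans hv h.
have up := powR_ge0 (u (ts k) (xs k)) p.
have mp : mu k `^ p <= u (ts k) (xs k) `^ p + k.+1%:R.
  rewrite /mu; have /orP[h1|h1] := le_total (u (ts k) (xs k)) (k.+1%:R `^ p^-1).
    by rewrite (max_idPr h1) -powRrM mulVf ?lt0r_neq0 // powRr1 // lerDr.
  by rewrite (max_idPl h1) lerDl.
apply/negP; rewrite -leNgt; apply: le_trans (ler_wpM2l (ltW m0) mp) _; rewrite mulrDr; apply: lerD.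
  by apply: ler_wpM2r => //; rewrite ge_min lexx.
by rewrite ler_piMl // ge_min lexx orbT.
Qed.
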